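(* Assume the following. (A1) There exists $C>0$ such that $|\phi(\mu)|\le C(1+\|\mu\|_2^2)$ for all $\mu\in\mathcal P_2(\mathbb R^d)$. (A2) $\phi\in C^1(\mathcal P_2(\mathbb R^d);\mathbb R)$; there exists a modulus of continuity $\varpi$ such that $|\partial_x\delta_\mu\phi(\mu',x)-\partial_x\delta_\mu\phi(\mu,x)|\le\varpi(\mathcal W_2(\mu',\mu))$ for all $\mu,\mu'\in\mathcal P_2(\mathbb R^d)$, $x\in\mathbb R^d$; and for every $\mu\in\mathcal P_2(\mathbb R^d)$ there exists a modulus of continuity $\varpi_\mu$ such that $|\partial_x\delta_\mu\phi(\mu,x')-\partial_x\delta_\mu\phi(\mu,x)|\le\varpi_\mu(|x'-x|)$ for all $x,x'\in\mathbb R^d$. (B) $b=(b^0,b^1)\in C^{1,1}_b(\mathbb R^d\times\mathcal P_2(\mathbb R^d);\mathbb R^d\times\mathbb R^{d\times m})$. Then, for each $\mu_0\in\mathcal P_2(\mathbb R^d)$, the function $[0,\infty)\ni r\mapsto\Phi(\mu_0,r)$ is differentiable at $r=0$ and, for an arbitrary $\xi\in L^2(\mathcal F_0;\mathbb R^d)$ with law $\mu_0$, $$\frac{\partial\Phi}{\partial r}(\mu_0,0)=\Big\|\big(D_\xi X_T^\xi\big)^*\,\partial_x\delta_\mu\phi\big(\mu_T,X_T^\xi\big)\Big\|_{L^2}.$$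
   Context: **Probabilistic setting.** $T>0$; $(\Omega,\mathcal F,\mathsf P)$ is a complete probability space carrying an $m$-dimensional Brownian motion $B=(B_t)_{t\in[0,T]}$ and a sub-$\sigma$-algebra $\mathcal F_0$ that is independent of $B$, contains all $\mathsf P$-null sets, and is atomless (so every law on a Euclidean space is the law of some $\mathcal F_0$-measurable random variable). $\mathbb F=(\mathcal F_t)_{t\in[0,T]}$ is the filtration $\mathcal F_t=\mathcal F_0\vee\sigma(B_s:s\le t)$, which satisfies the usual conditions. $\mathsf P_X$ is the law of $X$. $L^2(\mathcal F_t;\mathbb R^d)$ is the space of square-integrable $\mathcal F_t$-measurable $\mathbb R^d$-valued random variables with norm $\|X\|_{L^2}=(\mathsf E|X|^2)^{1/2}$. $\mathcal S^2([0,T];\mathbb R^d)$ is the space of continuous $\mathbb F$-adapted processes $Y$ with $\|Y\|_{\mathcal S^2}^2:=\mathsf E[\sup_{t\in[0,T]}|Y_t|^2]<\infty$. **Wasserstein space.** $\mathcal P_2(\mathbb R^d)$ is the set of Borel probability measures on $\mathbb R^d$ with $\|\mu\|_2:=(\int|x|^2\mu(dx))^{1/2}<\infty$, with the $2$-Wasserstein distance $\mathcal W_2$, and $B_r^2(\mu):=\{\mu'\in\mathcal P_2(\mathbb R^d):\mathcal W_2(\mu',\mu)\le r\}$. A modulus of continuity is a nondecreasing function $\varpi:[0,\infty)\to[0,\infty)$ with $\lim_{s\downarrow0}\varpi(s)=0$. **Derivatives on $\mathcal P_2$.** $\phi:\mathcal P_2(\mathbb R^d)\to\mathbb R$ has a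 linear functional derivative if there is a map $\delta_\mu\phi:\mathcal P_2(\mathbb R^d)\times\mathbb R^d\to\mathbb R$, continuous for the product topology, with at most quadratic growth in $x$ locally uniformly in $\mu$, such that $\phi(\mu')-\phi(\mu)=\int_0^1\int_{\mathbb R^d}\delta_\mu\phi(\mu+\lambda(\mu'-\mu),x)\,(\mu'-\mu)(dx)\,d\lambda$ for all $\mu,\mu'\in\mathcal P_2(\mathbb R^d)$. $\phi\in C^1(\mathcal P_2(\mathbb R^d);\mathbb R)$ ($L$-differentiable) means in addition that $x\mapsto\delta_\mu\phi(\mu,x)$ is differentiable for every $\mu$ and that $(\mu,x)\mapsto\partial_x\delta_\mu\phi(\mu,x)\in\mathbb R^d$ is continuous with at most quadratic growth in $x$, locally uniformly in $\mu$; $\partial_x\delta_\mu\phi$ is the $L$-derivative. The same notions are used componentwise for vector- or matrix-valued maps. $C^{1,1}_b(\mathbb R^d\times\mathcal P_2(\mathbb R^d);E)$, for $E$ a Euclidean space, is the set of $f:\mathbb R^d\times\mathcal P_2(\mathbb R^d)\to E$ such that $f(\cdot,\mu)$ is $C^1$ for every $\mu$ with Jacobian $\partial_xf(x,\mu)$; $f(x,\cdot)$ is $L$-differentiable for every $x$ with $L$-derivative $\partial_{\tilde x}\delta_\mu f(x,\mu,\tilde x)$; and both $\partial_xf$ and $\partial_{\tilde x}\delta_\mu f$ are bounded and Lipschitz in all their arguments (with $\mathcal W_2$ on $\mathcal P_2(\mathbb R^d)$). **McKean–Vlasov SDE.** For $\xi\in L^2(\mathcal F_0;\mathbb R^d)$,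 $X^\xi\in\mathcal S^2([0,T];\mathbb R^d)$ is the unique solution of $$X_t^\xi=\xi+\int_0^tb^0(X_s^\xi,\mathsf P_{X_s^\xi})\,ds+\int_0^tb^1(X_s^\xi,\mathsf P_{X_s^\xi})\,dB_s,\quad t\in[0,T].$$ The law of $X^\xi$ depends on $\xi$ only through $\mathsf P_\xi$. If $\mathsf P_\xi=\mu_0$ write $\mu_t:=\mathsf P_{X_t^\xi}$; likewise, for $\mu_0'\in\mathcal P_2(\mathbb R^d)$, $\mu_t':=\mathsf P_{X_t^{\xi'}}$ for any $\xi'\in L^2(\mathcal F_0;\mathbb R^d)$ with law $\mu_0'$. **Gradient process.** Under (B), the map $\xi\mapsto X_t^\xi$ from $L^2(\mathcal F_0;\mathbb R^d)$ to $L^2(\mathcal F_t;\mathbb R^d)$ is Gateaux differentiable; $D_\xi X_t^\xi$ denotes its Gateaux derivative at $\xi$, a bounded linear operator from $L^2(\mathcal F_0;\mathbb R^d)$ to $L^2(\mathcal F_t;\mathbb R^d)$, and $(D_\xi X_t^\xi)^*$ its Hilbert-space adjoint, a bounded linear operator from $L^2(\mathcal F_t;\mathbb R^d)$ to $L^2(\mathcal F_0;\mathbb R^d)$. **DRO value.** For $\phi:\mathcal P_2(\mathbb R^d)\to\mathbb R$, $$\Phi(\mu_0,r):=\sup_{\mu_0'\in B_r^2(\mu_0)}\phi(\mu_T'),\qquad\mu_0\in\mathcal P_2(\mathbb R^d),\ r\ge0.$$ Since $\Phi(\mu_0,\cdot)$ is defined on $[0,\infty)$, differentiability at $0$ is one-sided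 (from the right). *)

(* Defs.v *)
From HB Require Import structures.
From mathcomp Require Import all_boot all_order all_algebra.
From mathcomp Require Import all_classical all_reals all_analysis.
From mathcomp Require Import measurable_realfun.

Set Implicit Arguments.
Unset Strict Implicit.
Unset Printing Implicit Defensive.

Import Order.TTheory GRing.Theory Num.Theory.
Import numFieldNormedType.Exports.

Local Open Scope classical_set_scope.
Local Open Scope ring_scope.

(* Borel sigma-algebra on matrix spaces, in particular on row vectors. *)
Section matrix_measurable.
Context {R : realType} {p q : nat}.
Let borel : set (set 'M[R]_(p, q)) := <<s open >>.

Let borel0 : borel set0.
Proof. exact: sigma_algebra0. Qed.

Let borelC A : borel A -> borel (~` A).
Proof. exact: sigma_algebraC. Qed.

Let borel_bigcup (A : (set 'M[R]_(p, q))^nat) :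
  (forall i, borel (A i)) -> borel (\bigcup_i A i).
Proof. exact: sigma_algebra_bigcup. Qed.

HB.instance Definition _ := @isMeasurable.Build default_measure_display
  'M[R]_(p, q) borel borel0 borelC borel_bigcup.

End matrix_measurable.

Section euclidean.
Context {R : realType}.

(* The norm `|x| of the library is the max norm, equivalent to enorm: it is used
   only through the topology and differentiability it induces. *)
Definition enorm p q (x : 'M[R]_(p, q)) : R :=
  Num.sqrt (\sum_i \sum_j x i j ^+ 2).

Definition edot d (x y : 'rV[R]_d) : R := \sum_j x 0 j * y 0 j.

Definition is_gradient d (f : 'rV[R]_d -> R) (x g : 'rV[R]_d) : Prop :=
  is_diff x f (edot g).

Definition modulus (w : R -> R) : Prop :=
  [/\ forall s, 0 <= s -> 0 <= w s,
      forall s t, 0 <= s -> s <= t -> w s <= w t &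
      w s @[s --> 0^'+] --> 0].

(* The limit is taken in the extended reals; as l is finite, it forces f to be
   finite on a right neighbourhood of x. *)
Definition right_derivative (f : R -> \bar R) (x l : R) : Prop :=
  f x \is a fin_num /\
  ((f (x + h)%R - f x) * (h^-1)%:E)%E @[h --> 0^'+] --> l%:E.

End euclidean.

Section L2.
Context {R : realType} {disp} {Om : measurableType disp} (P : probability Om R).

Definition norm2 p q (X : Om -> 'M[R]_(p, q)) : \bar R :=
  Lnorm P 2%:E (fun w => (enorm (X w))%:E).

Definition measurable_wrt {disp'} {V : measurableType disp'}
    (G : set (set Om)) (X : Om -> V) : Prop :=
  forall A, measurable A -> G (X @^-1` A).

Definition L2 (G : set (set Om)) p q (X : Om -> 'M[R]_(p, q)) : Prop :=
  measurable_wrt G X /\ (norm2 X < +oo)%E.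

Definition indep (G H : set (set Om)) : Prop :=
  forall A B, G A -> H B -> P (A `&` B) = (P A * P B)%E.

(* An operator between L2 spaces is represented by its action on random
   variables; linearity holds almost surely, and with boundedness it forces
   almost surely equal arguments to have almost surely equal images. *)
Definition bounded_operator (G H : set (set Om)) d
    (D : (Om -> 'rV[R]_d) -> (Om -> 'rV[R]_d)) : Prop :=
  [/\ forall X, L2 G X -> L2 H (D X),
      forall (a : R) X Y, L2 G X -> L2 G Y ->
        {ae P, forall w,
          D (fun w => a *: X w + Y w) w = a *: D X w + D Y w} &
      exists C : R, forall X, L2 G X -> (norm2 (D X) <= C%:E * norm2 X)%E].

Definition gateaux_derivative (G H : set (set Om)) d
    (F : (Om -> 'rV[R]_d) -> (Om -> 'rV[R]_d)) (xi : Om -> 'rV[R]_d)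
    (D : (Om -> 'rV[R]_d) -> (Om -> 'rV[R]_d)) : Prop :=
  bounded_operator G H D /\
  forall eta, L2 G eta ->
    norm2 (fun w =>
      h^-1 *: (F (fun w => xi w + h *: eta w) w - F xi w) - D eta w)
    @[h --> 0^'] --> 0%E.

(* Dadj : L2(H) -> L2(G) is the Hilbert adjoint of D : L2(G) -> L2(H). *)
Definition adjoint (G H : set (set Om)) d
    (D Dadj : (Om -> 'rV[R]_d) -> (Om -> 'rV[R]_d)) : Prop :=
  bounded_operator H G Dadj /\
  forall X Y, L2 G X -> L2 H Y ->
    \int[P]_w edot (D X w) (Y w) = \int[P]_w edot (X w) (Dadj Y w).

End L2.

Lemma continuous_enorm (R : realType) p q : continuous (@enorm R p q).
Proof.
move=> x; rewrite /enorm.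
apply: (@continuous_comp _ _ _ (fun y : 'M[R]_(p, q) => \sum_i \sum_j y i j ^+ 2)
  Num.sqrt); last exact: sqrt_continuous.
apply: continuous_big => [|i _]; first exact: add_continuous.
apply: continuous_big => [|j _ y]; first exact: add_continuous.
apply: (@continuous_comp _ _ _ (fun M : 'M[R]_(p, q) => M i j)
  (fun u : R => u ^+ 2)); first exact: coord_continuous.
exact: exprn_continuous.
Qed.

Lemma measurable_enorm (R : realType) p q :
  measurable_fun setT (@enorm R p q).
Proof.
apply: (measurability _ (RGenOInfty.measurableE R)) => _ [_ [x ->] <-].
rewrite setTI; apply: sub_sigma_algebra.
by apply: open_comp => [z _|]; [exact: continuous_enorm|exact: interval_open].
Qed.

Lemma norm2_lty (R : realType) disp (Om : measurableType disp)
    (P : probability Om R) p q (X : Om -> 'M[R]_(p, q)) :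
  (norm2 P X < +oo)%E <->
  (\int[P]_w (`|(enorm (X w))%:E| `^ 2) < +oo)%E.
Proof.
rewrite /norm2 unlock; split; last exact: poweR_lty.
by apply: lty_poweRy; rewrite invr_neq0.
Qed.

Lemma measurable_enorm_sq (R : realType) p q :
  measurable_fun setT (fun x : 'M[R]_(p, q) => (`|(enorm x)%:E| `^ 2)%E).
Proof.
apply: (measurableT_comp (measurable_poweR _)).
apply: measurableT_comp => //; apply/measurable_EFinP; exact: measurable_enorm.
Qed.

(* P_2(R^d): Borel probability measures with finite second moment. *)
Record P2 (R : realType) (d : nat) := MkP2 {
  P2_prob :> probability 'rV[R]_d R ;
  P2_finite : (norm2 P2_prob id < +oo)%E }.

Section wasserstein.
Context {R : realType} {d : nat}.
Implicit Types mu nu : P2 R d.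

Definition P2_norm mu : R := fine (norm2 mu id).

Definition coupling mu nu
    (pi : probability ('rV[R]_d * 'rV[R]_d)%type R) : Prop :=
  forall A, measurable A ->
    pi (A `*` setT) = mu A /\ pi (setT `*` A) = nu A.

(* fine is harmless: the product coupling has finite cost. *)
Definition W2 mu nu : R :=
  fine (ereal_inf [set norm2 pi (fun z => z.1 - z.2) | pi in coupling mu nu]).

Definition W2_nbhs mu : set_system (P2 R d) :=
  filter_from [set r : R | 0 < r] (fun r => [set nu | W2 nu mu < r]).

Definition W2_ball mu (r : R) : set (P2 R d) := [set nu | W2 nu mu <= r].

Lemma dirac_P2 : (norm2 (\d_(0%R : 'rV[R]_d) : probability _ R) id < +oo)%E.
Proof.
apply/norm2_lty; rewrite integral_dirac//; last exact: measurable_enorm_sq.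
by rewrite diracT mul1e poweR_lty// ltry.
Qed.

Definition clamp (l : R) : R := Num.max 0 (Num.min l 1).

Lemma clamp_ge0 l : 0 <= clamp l.
Proof. by rewrite /clamp le_max lexx. Qed.

Lemma clamp_le1 l : 0 <= 1 - clamp l.
Proof. by rewrite subr_ge0 /clamp ge_max ler01 ge_min lexx orbT. Qed.

Definition mix0 (l : R) mu nu : set 'rV[R]_d -> \bar R :=
  measure_add (mscale (NngNum (clamp_le1 l)) mu)
              (mscale (NngNum (clamp_ge0 l)) nu).

HB.instance Definition _ l mu nu := Measure.on (mix0 l mu nu).

Lemma mix0_setT l mu nu : mix0 l mu nu setT = 1%E.
Proof.
have mscaleT (r : {nonneg R}) (n : P2 R d) : mscale r n setT = r%:num%:E.
  by rewrite -[RHS]mule1; congr (_ * _)%E; exact: probability_setT.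
rewrite /mix0 measure_addE [X in (X + _)%E]mscaleT [X in (_ + X)%E]mscaleT.
by rewrite -EFinD/= subrK.
Qed.

HB.instance Definition _ l mu nu :=
  Measure_isProbability.Build _ _ _ (mix0 l mu nu) (mix0_setT l mu nu).

Lemma mix0_P2 l mu nu : (norm2 (mix0 l mu nu : probability _ R) id < +oo)%E.
Proof.
apply/norm2_lty; rewrite ge0_integral_measure_add//; last 2 first.
- by move=> x _; exact: poweR_ge0.
- exact: measurable_enorm_sq.
have fin (r : {nonneg R}) (n : P2 R d) :
    (\int[mscale r n]_x (`|(enorm x)%:E| `^ 2) < +oo)%E.
  rewrite ge0_integral_mscale//; last 2 first.
  - exact: measurable_enorm_sq.
  - by move=> x _; exact: poweR_ge0.
  by rewrite lte_mul_pinfty//; apply/norm2_lty; exact: P2_finite.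
exact: lte_add_pinfty (fin _ mu) (fin _ nu).
Qed.

(* mu + l (nu - mu) for l in [0, 1]; l is clamped only to make mix total. *)
Definition mix l mu nu : P2 R d := MkP2 (mix0_P2 l mu nu).

End wasserstein.

Section law.
Context {R : realType} {disp} {Om : measurableType disp} (P : probability Om R).
Context {d : nat}.

Lemma distribution_P2 (X : {mfun Om >-> 'rV[R]_d}) :
  (norm2 P X < +oo)%E ->
  (norm2 (distribution P X : probability _ R) id < +oo)%E.
Proof.
move=> /norm2_lty XP; apply/norm2_lty; rewrite ge0_integral_distribution//.
  exact: measurable_enorm_sq.
by move=> y; exact: poweR_ge0.
Qed.

(* Total function; the default value for X not in L2 is never relevant. *)
Definition law (X : Om -> 'rV[R]_d) : P2 R d :=
  match pselect (measurable_fun setT X /\ (norm2 P X < +oo)%E) with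
  | left (conj mX fX) =>
      @MkP2 R d _ (@distribution_P2 (mfun_Sub (mem_set mX)) fX)
  | right _ => MkP2 dirac_P2
  end.

End law.

Section derivatives.
Context {R : realType} {d : nat}.

Definition P2_continuous {V : topologicalType}
    (f : P2 R d -> 'rV[R]_d -> V) : Prop :=
  forall mu x,
    f y.1 y.2 @[y --> filter_prod (W2_nbhs mu) (nbhs x)] --> f mu x.

Definition quadratic_growth (f : P2 R d -> 'rV[R]_d -> R) : Prop :=
  forall mu, exists C : R, \forall nu \near W2_nbhs mu,
    forall x, `|f nu x| <= C * (1 + enorm x ^+ 2).

Definition linear_derivative (phi : P2 R d -> R)
    (dphi : P2 R d -> 'rV[R]_d -> R) : Prop :=
  [/\ P2_continuous dphi, quadratic_growth dphi &
      forall mu nu, phi nu - phi mu =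
        \int[lebesgue_measure]_(l in `[0, 1])
          (\int[nu]_x dphi (mix l mu nu) x -
           \int[mu]_x dphi (mix l mu nu) x)].

(* gphi is the L-derivative, the x-gradient of the linear derivative dphi. *)
Definition L_derivative (phi : P2 R d -> R)
    (gphi : P2 R d -> 'rV[R]_d -> 'rV[R]_d) : Prop :=
  exists dphi : P2 R d -> 'rV[R]_d -> R,
    [/\ linear_derivative phi dphi,
        forall mu x, is_gradient (dphi mu) x (gphi mu x),
        P2_continuous gphi &
        quadratic_growth (fun mu x => enorm (gphi mu x))].

Definition C11b_scalar (f : 'rV[R]_d -> P2 R d -> R) : Prop :=
  exists (fx : 'rV[R]_d -> P2 R d -> 'rV[R]_d)
         (fm : 'rV[R]_d -> P2 R d -> 'rV[R]_d -> 'rV[R]_d),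
    [/\ forall mu x, is_gradient (f ^~ mu) x (fx x mu),
        forall mu, continuous (fx ^~ mu),
        forall x, L_derivative (f x) (fm x),
        exists C : R, forall x mu y,
          enorm (fx x mu) <= C /\ enorm (fm x mu y) <= C &
        exists L : R, forall x x' mu mu' y y',
          enorm (fx x' mu' - fx x mu) <= L * (enorm (x' - x) + W2 mu' mu) /\
          enorm (fm x' mu' y' - fm x mu y) <=
            L * (enorm (x' - x) + W2 mu' mu + enorm (y' - y))].

Definition C11b p q (f : 'rV[R]_d -> P2 R d -> 'M[R]_(p, q)) : Prop :=
  forall i j, C11b_scalar (fun x mu => f x mu i j).

End derivatives.

Section stochastic.
Context {R : realType} {disp} {Om : measurableType disp} (P : probability Om R).
Context (T : R) {m : nat} (F0 : set (set Om)) (B : R -> Om -> 'rV[R]_m).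

Definition sigma_of {disp'} {V : measurableType disp'}
    (D : set R) (Y : R -> Om -> V) : set (set Om) :=
  <<s \bigcup_(s in D) preimage_set_system setT (Y s) measurable >>.

Definition filtration (t : R) : set (set Om) :=
  <<s F0 `|` sigma_of `[0, t] B >>.

Record brownian_motion : Prop := {
  bm_measurable : forall t, 0 <= t <= T -> measurable_fun setT (B t) ;
  bm_zero : {ae P, forall w, B 0 w = 0} ;
  bm_continuous : {ae P, forall w, {within `[0, T], continuous (B ^~ w)}} ;
  (* B t - B s has law N(0, (t - s) I), independent of (B u) for u <= s *)
  bm_gaussian : forall s t, 0 <= s -> s < t -> t <= T ->
    forall A : 'I_m -> set R, (forall j, measurable (A j)) ->
      P (\bigcap_(j in [set: 'I_m]) [set w | A j ((B t w - B s w) 0 j)]) =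
      \big[*%E/1%E]_(j < m) normal_prob 0 (Num.sqrt (t - s)) (A j) ;
  bm_indep : forall s t, 0 <= s -> s < t -> t <= T ->
    indep P (sigma_of `[0, s] B)
      (preimage_set_system setT (fun w => B t w - B s w) measurable) }.

Record initial_sigma_algebra : Prop := {
  F0_sigma : sigma_algebra setT F0 ;
  F0_measurable : F0 `<=` measurable ;
  F0_null : P.-negligible `<=` F0 ;
  F0_indep : indep P F0 (sigma_of `[0, T] B) ;
  F0_atomless : forall A, F0 A -> (0 < P A)%E ->
    exists A', [/\ F0 A', A' `<=` A & (0 < P A' < P A)%E] }.

Definition S2 d (Y : R -> Om -> 'rV[R]_d) : Prop :=
  [/\ forall t, 0 <= t <= T -> measurable_wrt (filtration t) (Y t),
      forall w, {within `[0, T], continuous (Y ^~ w)} &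
      (\int[P]_w ereal_sup [set ((enorm (Y t w)) ^+ 2)%:E | t in `[0%R, T]]
        < +oo)%E].

(* The elementary process equal to sp_val k on ]sp_time k, sp_time k.+1]
   for k < sp_size. *)
Record simple_process := SimpleProcess {
  sp_size : nat ;
  sp_time : nat -> R ;
  sp_val : nat -> Om -> R }.

Definition simple_on (t : R) (Z : simple_process) : Prop :=
  [/\ 0 <= sp_time Z 0, sp_time Z (sp_size Z) <= t &
      forall k, (k < sp_size Z)%N ->
        [/\ sp_time Z k <= sp_time Z k.+1,
            measurable_wrt (filtration (sp_time Z k)) (sp_val Z k) &
            exists C, forall w, `|sp_val Z k w| <= C]].

Definition simple_fun (Z : simple_process) (s : R) (w : Om) : R :=
  \sum_(k < sp_size Z)
    sp_val Z k w * \1_(`]sp_time Z k, sp_time Z k.+1]) s.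

Definition simple_integral (j : 'I_m) (Z : simple_process) (w : Om) : R :=
  \sum_(k < sp_size Z)
    sp_val Z k w * (B (sp_time Z k.+1) w 0 j - B (sp_time Z k) w 0 j).

(* I is a version of the Ito integral of H over [0, t] against the j-th
   component of B, i.e., the L2(P)-limit of the integrals of simple processes
   converging to H in L2(ds x P). *)
Definition ito_integral (j : 'I_m) (t : R) (H : R -> Om -> R) (I : Om -> R) :
    Prop :=
  [/\ measurable_fun (`[0, t] `*` setT) (fun z => H z.1 z.2),
      measurable_fun setT I &
      exists Z : nat -> simple_process,
        [/\ forall n, simple_on t (Z n),
            (\int[P]_w \int[lebesgue_measure]_(s in `[0%R, t])
              ((simple_fun (Z n) s w - H s w) ^+ 2)%:E)%E
              @[n --> \oo] --> 0%E &
            (\int[P]_w ((simple_integral j (Z n) w - I w) ^+ 2)%:E)%E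
              @[n --> \oo] --> 0%E]].

Definition mckean_vlasov d (b0 : 'rV[R]_d -> P2 R d -> 'rV[R]_d)
    (b1 : 'rV[R]_d -> P2 R d -> 'M[R]_(d, m))
    (xi : Om -> 'rV[R]_d) (X : R -> Om -> 'rV[R]_d) : Prop :=
  S2 X /\
  forall t, 0 <= t <= T -> exists I : Om -> 'M[R]_(d, m),
    (forall i j, ito_integral j t
      (fun s w => b1 (X s w) (law P (X s)) i j) (fun w => I w i j)) /\
    {ae P, forall w, forall i, X t w 0 i =
      xi w 0 i
      + \int[lebesgue_measure]_(s in `[0, t]) b0 (X s w) (law P (X s)) 0 i
      + \sum_j I w i j}.

(* X xi is meant to be the solution started from xi; mu0' determines the law of
   X xi T whatever the choice of xi with law mu0'. *)
Definition DRO d (X : (Om -> 'rV[R]_d) -> R -> Om -> 'rV[R]_d)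
    (phi : P2 R d -> R) (mu0 : P2 R d) (r : R) : \bar R :=
  ereal_sup [set y | exists mu0', W2_ball mu0 r mu0' /\
    exists xi, [/\ L2 P F0 xi, law P xi = mu0' & y = (phi (law P (X xi T)))%:E]].

End stochastic.

(* Main.v *)
Require Import Defs.
From HB Require Import structures.
From mathcomp Require Import all_boot all_order all_algebra.
From mathcomp Require Import all_classical all_reals all_analysis.
From mathcomp Require Import measurable_realfun.
From mathcomp Require Import ring lra.
Set Implicit Arguments.
Unset Strict Implicit.
Unset Printing Implicit Defensive.
Import Order.TTheory GRing.Theory Num.Theory.
Import numFieldNormedType.Exports.
Local Open Scope classical_set_scope.
Local Open Scope ring_scope.

(** Write [V xi] for [phi] of the law of [X xi T], and [G] for the L-derivative of [phi] along that terminal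
    value. By the chain rule for laws, [V (xi + eta) - V xi] is [E (G . (X (xi + eta) T - X xi T))] up to
    [o(|eta|)], uniformly in the direction of [eta]: [X] is Lipschitz in its initial value. That quantity is
    moreover homogeneous in [eta] under scaling by [0 <= t <= 1] up to [o(t |eta|)]: for the Euler scheme the
    defect of homogeneity is [O(t |eta|^2)] in L1 (it is not small in L2, hence a truncation of [G]), with
    constants independent of the step, and the scheme converges to [X] in L2. Hence
    [sup {V (xi + eta) - V xi | |eta| <= r} / r] is Cauchy as [r -> 0] and has a limit [l]. If [X] has a
    Gateaux derivative [D] at [xi], the same two estimates give
    [V (xi + eta) - V xi = E (eta . D^* G) + o(|eta|)], so that [l] is the norm of [D^* G].

    It remains to compare the ball of radius [r] in L2 with the Wasserstein ball. Since [V] only depends on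
    the law of the initial value, and [F0] has no atoms, every near-optimal coupling is realized, up to a
    dyadic discretization, by a pair whose second component is the given [xi]; the discretization costs
    nothing in the limit. *)

(** * Expectation *)

Section expectation.
Context {R : realType} {disp} {Om : measurableType disp} (P : probability Om R).
Implicit Types f g : Om -> R.

(** The derivative in [r] is asserted before any Gateaux derivative of [X] is at hand, so the limit
    cannot be read off a linearized equation; asymptotic homogeneity alone has to produce it.
    Homogeneity is tested on the scheme because there each noise term is an adapted factor times an
    independent Gaussian increment: second and fourth moments factorize, and a discrete Gronwall
    inequality closes the estimates. The Ito integral enters once, to show that the scheme
    converges. The obstacle is integrability. The quadratic remainder of the coefficients contains
    [|X (xi + eta) - X xi|^2], whose square need not be integrable when [eta] is only
    square-integrable. All moments are therefore weighted by [wt], an [F0]-measurable function of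
    [eta] that makes the fourth moments finite; a Cauchy-Schwarz step leads back to L1. The scheme
    also replaces uniqueness in law: [X] is just some choice of solutions, but the law of the scheme
    visibly depends on the law of its initial value only. The even moments of the standard normal
    law enter as the constants [gauss2] and [gauss4]. *)

Definition intg f := P.-integrable setT (EFin \o f).
Definition Ex f : R := \int[P]_w f w.

Lemma intg_meas f : intg f -> measurable_fun setT f.
Proof. by move=> /measurable_int /measurable_EFinP. Qed.

Lemma intgD f g : intg f -> intg g -> intg (fun w => f w + g w).
Proof. by move=> fi gi; exact: (integrableD measurableT fi gi). Qed.

Lemma intgZ a f : intg f -> intg (fun w => a * f w).
Proof. by move=> fi; exact: (integrableZl measurableT a fi). Qed.

Lemma intgN f : intg f -> intg (fun w => - f w).
Proof. by move=> /(intgZ (-1)); under eq_fun do rewrite mulN1r. Qed.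

Lemma intgB f g : intg f -> intg g -> intg (fun w => f w - g w).
Proof. by move=> ? /intgN; exact: intgD. Qed.

Lemma intg_cst a : intg (fun=> a).
Proof. by apply: finite_measure_integrable_cst. Qed.

Lemma intg_sum (I : Type) (s : seq I) (F : I -> Om -> R) :
  (forall i, intg (F i)) -> intg (fun w => \sum_(i <- s) F i w).
Proof.
move=> iF; elim: s => [|i s IH].
  by under eq_fun do rewrite big_nil; exact: intg_cst.
by under eq_fun do rewrite big_cons; exact: intgD.
Qed.

Lemma intg_abs f : intg f -> intg (fun w => `|f w|).
Proof. by move=> ?; exact: integrable_norm. Qed.

Lemma intg_le f g : measurable_fun setT f -> (forall w, `|f w| <= g w) ->
  intg g -> intg f.
Proof.
move=> mf fg; apply: le_integrable => //; first exact/measurable_EFinP.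
by move=> w _ /=; rewrite lee_fin (le_trans (fg w))// ler_norm.
Qed.

Lemma ExD f g : intg f -> intg g -> Ex (fun w => f w + g w) = Ex f + Ex g.
Proof. by move=> ? ?; exact: RintegralD. Qed.

Lemma ExB f g : intg f -> intg g -> Ex (fun w => f w - g w) = Ex f - Ex g.
Proof. by move=> ? ?; exact: RintegralB. Qed.

Lemma ExZ a f : intg f -> Ex (fun w => a * f w) = a * Ex f.
Proof. by move=> ?; exact: RintegralZl. Qed.

Lemma Ex_cst a : Ex (fun=> a) = a.
Proof.
rewrite /Ex Rintegral_cst// [X in fine X](_ : _ = 1%E) ?mulr1//.
exact: probability_setT.
Qed.

Lemma Ex_sum (I : Type) (s : seq I) (F : I -> Om -> R) :
  (forall i, intg (F i)) -> Ex (fun w => \sum_(i <- s) F i w) = \sum_(i <- s) Ex (F i).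
Proof.
move=> iF; elim: s => [|i s IH].
  by under eq_fun do rewrite big_nil; rewrite Ex_cst big_nil.
under eq_fun do rewrite big_cons; rewrite ExD// ?IH ?big_cons//.
exact: intg_sum.
Qed.

Lemma Ex_le f g : intg f -> intg g -> (forall w, f w <= g w) -> Ex f <= Ex g.
Proof. by move=> ? ? fg; apply: le_Rintegral. Qed.

Lemma Ex_ge0 f : (forall w, 0 <= f w) -> 0 <= Ex f.
Proof. by move=> f0; apply: Rintegral_ge0. Qed.

Lemma Ex_abs f : intg f -> `|Ex f| <= Ex (fun w => `|f w|).
Proof. by move=> ?; exact: le_normr_Rintegral. Qed.

Lemma Ex_absle f g : intg f -> intg g -> (forall w, `|f w| <= g w) -> `|Ex f| <= Ex g.
Proof.
move=> fi gi fg; rewrite (le_trans (Ex_abs fi))// Ex_le//; exact: intg_abs.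
Qed.

Lemma intgE f : intg f -> (\int[P]_w (f w)%:E)%E = (Ex f)%:E.
Proof. by move=> fi; rewrite /Ex /Rintegral fineK//; exact: integrable_fin_num. Qed.

Lemma intg_ae f g : measurable_fun setT f -> measurable_fun setT g ->
  {ae P, forall w, f w = g w} -> intg f -> intg g /\ Ex g = Ex f.
Proof.
move=> mf mg fg fi.
have gf : (\int[P]_w (g w)%:E = \int[P]_w (f w)%:E)%E.
  apply: ae_eq_integral => //; [exact/measurable_EFinP|exact/measurable_EFinP|].
  by apply: filterS fg => w /= -> _.
split; last by rewrite /Ex /Rintegral gf.
apply/integrableP; split; first exact/measurable_EFinP.
have -> : (\int[P]_w `|(EFin \o g) w| = \int[P]_w `|(EFin \o f) w|)%E.
  apply: ae_eq_integral => //.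
  - by apply: measurableT_comp => //; exact/measurable_EFinP.
  - by apply: measurableT_comp => //; exact/measurable_EFinP.
  - by apply: filterS fg => w /= -> _.
by case/integrableP: fi.
Qed.

Lemma intg_pos f : measurable_fun setT f -> (forall w, 0 <= f w) ->
  intg f <-> (\int[P]_w (f w)%:E < +oo)%E.
Proof.
move=> mf f0; split=> [/integrableP[_]|] fi.
  by under eq_integral do rewrite -(ger0_norm (f0 _)).
apply/integrableP; split; first exact/measurable_EFinP.
by under eq_integral do rewrite /= ger0_norm//.
Qed.

Definition sqi f := measurable_fun setT f /\ intg (fun w => f w ^+ 2).

Lemma sqiM f g : sqi f -> sqi g -> intg (fun w => f w * g w).
Proof.
move=> [mf f2] [mg g2]; apply: (intg_le _ _ (intgD f2 g2)).
  exact: measurable_funM.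
move=> w; rewrite normrM -(real_normK (num_real (f w))) -(real_normK (num_real (g w))).
by have := sqr_ge0 (`|f w| - `|g w|); have := sqr_ge0 (`|f w| + `|g w|); nra.
Qed.

Lemma sqi_cst a : sqi (fun=> a).
Proof. by split; [exact: measurable_cst|exact: intg_cst]. Qed.

Lemma sqi_intg f : sqi f -> intg f.
Proof. by move=> /sqiM/(_ (sqi_cst 1)); under eq_fun do rewrite mulr1. Qed.

Lemma sqiD f g : sqi f -> sqi g -> sqi (fun w => f w + g w).
Proof.
move=> sf sg; have fg := sqiM sf sg; move: sf sg => [mf f2] [mg g2].
split; first exact: measurable_funD.
under eq_fun do rewrite sqrrD -mulr_natl.
by apply: intgD => //; apply: intgD => //; exact: intgZ.
Qed.

Lemma sqiZ a f : sqi f -> sqi (fun w => a * f w).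
Proof.
move=> [mf f2]; split; first by apply: measurable_funM => //; exact: measurable_cst.
by under eq_fun do rewrite exprMn; exact: intgZ.
Qed.

Lemma sqiB f g : sqi f -> sqi g -> sqi (fun w => f w - g w).
Proof. by move=> sf /(sqiZ (-1)); under eq_fun do rewrite mulN1r; exact: sqiD. Qed.

Lemma sqi_le f g : measurable_fun setT f -> (forall w, `|f w| <= g w) -> sqi g -> sqi f.
Proof.
move=> mf fg [mg g2]; split=> //; apply: (intg_le _ _ g2).
  exact: measurable_funX.
move=> w; rewrite normrX lerXn2r// nnegrE ?normr_ge0//.
exact: le_trans (fg w).
Qed.

(** The quadratic [t |-> Ex P ((t f + g)^2)] is nonnegative; evaluating it at its minimizer
    [- b / a] gives the bound. *)
Lemma CauchySchwarz f g : sqi f -> sqi g ->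
  `|Ex (fun w => f w * g w)| <= Num.sqrt (Ex (fun w => f w ^+ 2)) * Num.sqrt (Ex (fun w => g w ^+ 2)).
Proof.
move=> sf sg; have fg := sqiM sf sg.
have key t : 0 <= t ^+ 2 * Ex (fun w => f w ^+ 2) + 2 * t * Ex (fun w => f w * g w) + Ex (fun w => g w ^+ 2).
  have i1 := intgZ (t ^+ 2) sf.2; have i2 := intgZ (2 * t) fg.
  rewrite -(ExZ _ sf.2) -(ExZ _ fg) -(ExD i1 i2) -(ExD (intgD i1 i2) sg.2).
  apply: Ex_ge0 => w; rewrite (_ : _ + _ = (t * f w + g w) ^+ 2) ?sqr_ge0//; ring.
move: key; set a := Ex (fun w => f w ^+ 2); set b := Ex (fun w => f w * g w).
set c := Ex (fun w => g w ^+ 2) => key.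
have a0 : 0 <= a by apply: Ex_ge0 => w; exact: sqr_ge0.
have c0 : 0 <= c by apply: Ex_ge0 => w; exact: sqr_ge0.
rewrite -sqrtrM// -sqrtr_sqr ler_sqrt ?mulr_ge0//.
have [a_eq0|a_neq0] := eqVneq a 0.
  have [->|b0] := eqVneq b 0; first by rewrite expr0n/= mulr_ge0.
  (* With [a = 0] the quadratic is affine in [t], and at this [t] it would equal [-1]. *)
  have := key (- (c + 1) / (2 * b)); rewrite a_eq0 mulr0 add0r.
  have -> : 2 * (- (c + 1) / (2 * b)) * b = - (c + 1) by field.
  by lra.
have apos : 0 < a by rewrite lt_def a_neq0.
have := key (- b / a).
have -> : (- b / a) ^+ 2 * a + 2 * (- b / a) * b + c = (a * c - b ^+ 2) / a by field.
by rewrite pmulr_lge0 ?invr_gt0// subr_ge0.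
Qed.

Lemma Ex_abs_sqrt f : sqi f -> Ex (fun w => `|f w|) <= Num.sqrt (Ex (fun w => f w ^+ 2)).
Proof.
move=> sf; have sf' : sqi (fun w => `|f w|).
  split; first by apply: measurableT_comp => //; exact: sf.1.
  by under eq_fun do rewrite real_normK ?num_real//; exact: sf.2.
have := CauchySchwarz sf' (sqi_cst 1).
under [X in `|Ex X|]eq_fun do rewrite mulr1.
under [X in Num.sqrt (Ex X) * _]eq_fun do rewrite real_normK ?num_real//.
rewrite expr1n Ex_cst sqrtr1 mulr1; apply: le_trans; exact: ler_norm.
Qed.

End expectation.

(** * Euclidean norm and sub-sigma-algebras *)

Section rows.
Context {R : realType}.

Lemma enorm_ge0 p q (x : 'M[R]_(p, q)) : 0 <= enorm x.
Proof. exact: sqrtr_ge0. Qed.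

Lemma enorm_sqr d (x : 'rV[R]_d) : enorm x ^+ 2 = \sum_j x 0 j ^+ 2.
Proof.
rewrite /enorm sqr_sqrtr; first by rewrite big_ord1.
by apply: sumr_ge0 => i _; apply: sumr_ge0 => j _; exact: sqr_ge0.
Qed.

Lemma edot_sqr d (x : 'rV[R]_d) : edot x x = enorm x ^+ 2.
Proof. by rewrite enorm_sqr; apply: eq_bigr => j _; rewrite expr2. Qed.

Lemma edotC d (x y : 'rV[R]_d) : edot x y = edot y x.
Proof. by apply: eq_bigr => j _; rewrite mulrC. Qed.

Lemma edotDr d (x y z : 'rV[R]_d) : edot x (y + z) = edot x y + edot x z.
Proof. by rewrite -big_split; apply: eq_bigr => j _; rewrite mxE mulrDr. Qed.

Lemma edotZr d a (x y : 'rV[R]_d) : edot x (a *: y) = a * edot x y.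
Proof. by rewrite mulr_sumr; apply: eq_bigr => j _; rewrite mxE mulrCA. Qed.

Lemma edotDl d (x y z : 'rV[R]_d) : edot (y + z) x = edot y x + edot z x.
Proof. by rewrite !(edotC _ x) edotDr. Qed.

Lemma edotZl d a (x y : 'rV[R]_d) : edot (a *: y) x = a * edot y x.
Proof. by rewrite !(edotC _ x) edotZr. Qed.

Lemma edotNr d (x y : 'rV[R]_d) : edot x (- y) = - edot x y.
Proof. by rewrite -scaleN1r edotZr mulN1r. Qed.

Lemma edotBr d (x y z : 'rV[R]_d) : edot x (y - z) = edot x y - edot x z.
Proof. by rewrite edotDr edotNr. Qed.

Lemma edotBl d (x y z : 'rV[R]_d) : edot (y - z) x = edot y x - edot z x.
Proof. by rewrite !(edotC _ x) edotBr. Qed.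

(** The discriminant argument of [CauchySchwarz], for a finite sum. *)
Lemma edot_le d (x y : 'rV[R]_d) : `|edot x y| <= enorm x * enorm y.
Proof.
have key t : 0 <= t ^+ 2 * enorm x ^+ 2 + 2 * t * edot x y + enorm y ^+ 2.
  rewrite -!edot_sqr (_ : _ + _ = edot (t *: x + y) (t *: x + y)).
    by rewrite edot_sqr sqr_ge0.
  by rewrite !(edotDr, edotDl, edotZr, edotZl) (edotC y x); ring.
rewrite -(@ler_pXn2r _ 2) ?nnegrE ?mulr_ge0 ?enorm_ge0// real_normK ?num_real//.
rewrite exprMn; move: key; set a := enorm x ^+ 2; set c := enorm y ^+ 2.
set b := edot x y => key.
have a0 : 0 <= a by exact: sqr_ge0.
have c0 : 0 <= c by exact: sqr_ge0.
have [a_eq0|a_neq0] := eqVneq a 0.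
  have [->|b0] := eqVneq b 0; first by rewrite expr0n/= mulr_ge0.
  have := key (- (c + 1) / (2 * b)); rewrite a_eq0 mulr0 add0r.
  have -> : 2 * (- (c + 1) / (2 * b)) * b = - (c + 1) by field.
  by lra.
have apos : 0 < a by rewrite lt_def a_neq0.
have := key (- b / a).
have -> : (- b / a) ^+ 2 * a + 2 * (- b / a) * b + c = (a * c - b ^+ 2) / a by field.
by rewrite pmulr_lge0 ?invr_gt0// subr_ge0.
Qed.

Lemma enormD d (x y : 'rV[R]_d) : enorm (x + y) <= enorm x + enorm y.
Proof.
rewrite -(@ler_pXn2r _ 2) ?nnegrE ?addr_ge0 ?enorm_ge0// -edot_sqr.
rewrite !(edotDr, edotDl) (edotC y x) !edot_sqr.
have := le_trans (ler_norm _) (edot_le x y); nra.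
Qed.

Lemma enormZ d a (x : 'rV[R]_d) : enorm (a *: x) = `|a| * enorm x.
Proof.
apply/eqP; rewrite -(@eqrXn2 _ 2) ?mulr_ge0 ?enorm_ge0//.
rewrite exprMn -!edot_sqr edotZr edotZl real_normK ?num_real//.
by apply/eqP; ring.
Qed.

Lemma enormN d (x : 'rV[R]_d) : enorm (- x) = enorm x.
Proof. by rewrite -scaleN1r enormZ normrN1 mul1r. Qed.

Lemma enormBC d (x y : 'rV[R]_d) : enorm (x - y) = enorm (y - x).
Proof. by rewrite -enormN opprB. Qed.

Lemma enorm0 d : enorm (0 : 'rV[R]_d) = 0.
Proof. by rewrite -(scale0r 0) enormZ normr0 mul0r. Qed.

Lemma coord_le_enorm d (x : 'rV[R]_d) j : `|x 0 j| <= enorm x.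
Proof.
rewrite -(@ler_pXn2r _ 2) ?nnegrE ?enorm_ge0// real_normK ?num_real// enorm_sqr.
rewrite (bigD1 j)//= lerDl; apply: sumr_ge0 => i _; exact: sqr_ge0.
Qed.

Lemma enorm_le_sum d (x : 'rV[R]_d) : enorm x <= \sum_j `|x 0 j|.
Proof.
rewrite -(@ler_pXn2r _ 2) ?nnegrE ?enorm_ge0//; last by apply: sumr_ge0.
rewrite enorm_sqr expr2 mulr_suml ler_sum// => i _.
rewrite -real_normK ?num_real// expr2 ler_wpM2l//.
by rewrite (bigD1 i)//= lerDl sumr_ge0.
Qed.

Lemma enorm_le_const d (x : 'rV[R]_d) e : (forall j, `|x 0 j| <= e) -> enorm x <= d%:R * e.
Proof.
move=> xe; apply: (le_trans (enorm_le_sum x)).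
rewrite (le_trans (ler_sum _ (fun j _ => xe j)))//.
by rewrite sumr_const card_ord mulr_natl.
Qed.

Lemma ball_row d (x y : 'rV[R]_d) e : 0 < e ->
  ball x e y <-> forall j, `|x 0 j - y 0 j| < e.
Proof.
move=> e0; split=> [[_ xy] j|xy]; first exact: xy.
by split=> // i j; rewrite (ord1 i); exact: xy.
Qed.

Lemma ball_sub_enorm d (x y : 'rV[R]_d) e : ball x e y -> enorm (y - x) <= d%:R * e.
Proof.
move=> [e0 xy]; apply: enorm_le_const => j; rewrite !mxE distrC ltW//.
exact: (xy 0 j).
Qed.

Lemma enorm_sub_ball d (x y : 'rV[R]_d) e : 0 < e -> enorm (y - x) < e -> ball x e y.
Proof.
move=> e0 xy; apply/ball_row => // j; rewrite distrC.
by have := coord_le_enorm (y - x) j; rewrite !mxE => /le_lt_trans; exact.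
Qed.

(** Bridge between the Euclidean norm, used in all estimates, and the topology of row vectors, which
    comes from the max norm. *)
Lemma cvg_enorm d (T : Type) (F : set_system T) {FF : Filter F} (f : T -> 'rV[R]_d) (x : 'rV[R]_d) :
  f @ F --> x <-> forall e : R, 0 < e -> \forall t \near F, enorm (f t - x) <= e.
Proof.
split=> [fx e e0|fx].
  have e0' : 0 < e / (d%:R + 1) by rewrite divr_gt0// ltr_wpDl.
  have /cvg_ballP/(_ _ e0') := fx; apply: filterS => t /ball_sub_enorm /le_trans; apply.
  rewrite mulrCA ger_pMr// ler_pdivrMr ?ltr_wpDl// mul1r lerDl//.
apply/cvg_ballP => e e0; have := fx _ (divr_gt0 e0 (ltr0n R 2)).
apply: filterS => t ht; apply: enorm_sub_ball => //; apply: le_lt_trans ht _; lra.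
Qed.

Lemma measurable_cts d (f : 'rV[R]_d -> R) :
  continuous f -> measurable_fun setT f.
Proof.
move=> cf; apply: (measurability _ (RGenOInfty.measurableE R)) => _ [_ [x ->] <-].
rewrite setTI; apply: sub_sigma_algebra.
by apply: open_comp => [z _|]; [exact: cf|exact: interval_open].
Qed.

Lemma measurable_coord d (j : 'I_d) : measurable_fun setT (fun x : 'rV[R]_d => x 0 j).
Proof. by apply: measurable_cts; exact: coord_continuous. Qed.

(** An open set is a countable union of max-norm balls with rational centre and radius
    [1 / (n + 1)], and the preimage of such a ball is a finite intersection of coordinate events. *)
Lemma measurable_row d disp (Om : measurableType disp) (X : Om -> 'rV[R]_d) :
  (forall j, measurable_fun setT (fun w => X w 0 j)) -> measurable_fun setT X.
Proof.
move=> mX.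
have genE : measurable = <<s (@open 'rV[R]_d) >> by [].
apply: (measurability _ genE) => _ [U oU <-]; rewrite setTI.
pose F (z : 'rV[rat]_d * nat) : set Om :=
  if pselect (ball (map_mx ratr z.1 : 'rV[R]_d) (z.2.+1%:R^-1 : R) `<=` U) then
    \bigcap_(j in [set: 'I_d]) (fun w => X w 0 j) @^-1` [set t | `|ratr (z.1 0 j) - t| < z.2.+1%:R^-1]
  else set0.
have -> : X @^-1` U = \bigcup_z F z.
  apply/seteqP; split=> [w /= Uw|w [z _]].
    have /nbhs_ballP[e /= e0 eU] := open_nbhs_nbhs (conj oU Uw).
    have [n ne] : exists n, (n.+1%:R^-1 : R) < e / 2.
      have /ltr_add_invr[n] : 0 < e / 2 by rewrite divr_gt0.
      by rewrite add0r => ?; exists n.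
    have n0 : 0 < (n.+1%:R^-1 : R) by rewrite invr_gt0.
    have hq j : exists q : rat, `|ratr q - X w 0 j| < n.+1%:R^-1.
      have /rat_in_itvoo[q] : X w 0 j - n.+1%:R^-1 < X w 0 j + n.+1%:R^-1.
        by rewrite ltrD2l gtrN.
      by rewrite in_itv/= => qX; exists q; rewrite ltr_distl.
    have {}hq := choice hq; case: hq => q hq.
    exists (\row_j q j, n) => //; rewrite /F; case: pselect => /= [_ j _ /=|].
      by rewrite mxE; exact: hq.
    case=> y qy; apply: eU; apply/ball_row => // j.
    move/ball_row : qy => /(_ n0 j); rewrite !mxE => qy.
    have := hq j; have := ler_distD (ratr (q j)) (X w 0 j) (y 0 j).
    rewrite (distrC (X w 0 j) (ratr _)); move: n.+1%:R^-1 ne qy => a ? ? ? ?; lra.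
  rewrite /F; case: pselect => // zU h; apply: (zU); apply/ball_row => [|j].
    by rewrite invr_gt0.
  by rewrite mxE; exact: h.
apply: countable_bigcupT_measurable => [|z]; first exact: countableP.
rewrite /F; case: pselect => [zU|zU]; last exact: measurable0.
apply: fin_bigcap_measurable => [|j _]; first exact: finite_finset.
rewrite -[_ @^-1` _]setTI; apply: mX => //.
rewrite (_ : [set t | _] = ball (ratr (z.1 0 j) : R) z.2.+1%:R^-1) //.
exact: measurable_ball.
Qed.

End rows.

Section sub_sigma.
Context {R : realType} {disp} {Om : measurableType disp} (G : set (set Om)).
Hypothesis sG : sigma_algebra setT G.

(** Recasts measurability with respect to [G] as measurability on the type that carries [G] as its
    sigma-algebra, so that the usual closure properties become available. *)
Lemma mwP disp' (V : measurableType disp') (X : Om -> V) :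
  measurable_wrt G X <-> measurable_fun setT (X : g_sigma_algebraType G -> V).
Proof.
split=> [mX _ A mA|mX A mA].
  by rewrite setTI; apply: sub_sigma_algebra; exact: mX.
by have := mX measurableT A mA; rewrite setTI measurable_g_measurableTypeE.
Qed.

Lemma mw_comp disp1 (V : measurableType disp1) disp2 (W : measurableType disp2)
  (f : V -> W) (X : Om -> V) : measurable_fun setT f -> measurable_wrt G X ->
  measurable_wrt G (fun w => f (X w)).
Proof. by move=> mf /mwP mX; apply/mwP; exact: measurableT_comp. Qed.

Lemma mw_cst disp1 (V : measurableType disp1) (a : V) : measurable_wrt G (fun=> a).
Proof. by apply/mwP; exact: measurable_cst. Qed.

Implicit Types u v : Om -> R.

Lemma mwD u v : measurable_wrt G u -> measurable_wrt G v -> measurable_wrt G (fun w => u w + v w).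
Proof. by move=> /mwP ? /mwP ?; apply/mwP; exact: measurable_funD. Qed.

Lemma mwM u v : measurable_wrt G u -> measurable_wrt G v -> measurable_wrt G (fun w => u w * v w).
Proof. by move=> /mwP ? /mwP ?; apply/mwP; exact: measurable_funM. Qed.

Lemma mwZ a u : measurable_wrt G u -> measurable_wrt G (fun w => a * u w).
Proof. by apply: mwM; exact: mw_cst. Qed.

Lemma mwB u v : measurable_wrt G u -> measurable_wrt G v -> measurable_wrt G (fun w => u w - v w).
Proof. by move=> /mwP ? /mwP ?; apply/mwP; exact: measurable_funB. Qed.

Lemma mwX u n : measurable_wrt G u -> measurable_wrt G (fun w => u w ^+ n).
Proof. by move=> /mwP ?; apply/mwP; exact: measurable_funX. Qed.

Lemma mw_sum (I : Type) (s : seq I) (F : I -> Om -> R) :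
  (forall i, measurable_wrt G (F i)) -> measurable_wrt G (fun w => \sum_(i <- s) F i w).
Proof. by move=> mF; apply/mwP; apply: measurable_sum => i; apply/mwP. Qed.

Lemma mw_row d (X : Om -> 'rV[R]_d) :
  (forall j, measurable_wrt G (fun w => X w 0 j)) <-> measurable_wrt G X.
Proof.
split=> [mX|mX j]; first by apply/mwP; apply: measurable_row => j; exact/mwP.
exact: (mw_comp (measurable_coord j)).
Qed.

Lemma mw_sub (H : set (set Om)) disp' (V : measurableType disp') (X : Om -> V) :
  G `<=` H -> measurable_wrt G X -> measurable_wrt H X.
Proof. by move=> GH mX A mA; apply: GH; exact: mX. Qed.

Lemma mw_meas disp' (V : measurableType disp') (X : Om -> V) :
  G `<=` measurable -> measurable_wrt G X -> measurable_fun setT X.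
Proof. by move=> Gm mX _ A mA; rewrite setTI; apply: Gm; exact: mX. Qed.

End sub_sigma.

Section rows_measurable.
Context {R : realType} {disp} {Om : measurableType disp}.

Lemma measurable_rowB d (X Y : Om -> 'rV[R]_d) : measurable_fun setT X ->
  measurable_fun setT Y -> measurable_fun setT (fun w => X w - Y w).
Proof.
move=> mX mY; apply: measurable_row => j; under eq_fun do rewrite !mxE.
by apply: measurable_funB; exact: (measurableT_comp (measurable_coord j)).
Qed.

Lemma measurable_edot d (X Y : Om -> 'rV[R]_d) : measurable_fun setT X ->
  measurable_fun setT Y -> measurable_fun setT (fun w => edot (X w) (Y w)).
Proof.
move=> mX mY; apply: measurable_sum => j.
by apply: measurable_funM; exact: (measurableT_comp (measurable_coord j)).
Qed.

Lemma measurable_enormf d (X : Om -> 'rV[R]_d) : measurable_fun setT X ->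
  measurable_fun setT (fun w => enorm (X w)).
Proof. by move=> mX; exact: (measurableT_comp (@measurable_enorm _ _ _)). Qed.

End rows_measurable.

(** * Image measures and independence *)

Section push.
Context {R : realType} {disp} {Om : measurableType disp} (P : probability Om R).

Definition pushP {disp'} {V : measurableType disp'} (X : Om -> V)
  (mX : measurable_fun setT X) : probability V R := distribution P (mfun_Sub (mem_set mX)).

Context {disp'} {V : measurableType disp'} (X : Om -> V) (mX : measurable_fun setT X).

Lemma pushPE A : pushP mX A = P (X @^-1` A).
Proof. by []. Qed.

Lemma pushP_ge0 (f : V -> \bar R) : measurable_fun setT f -> (forall y, (0 <= f y)%E) ->
  (\int[pushP mX]_y f y = \int[P]_w f (X w))%E.
Proof. by move=> mf f0; rewrite ge0_integral_distribution. Qed.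

Lemma pushP_intg (f : V -> R) : measurable_fun setT f ->
  intg (pushP mX) f <-> intg P (fun w => f (X w)).
Proof.
move=> mf; have mfX : measurable_fun setT (fun w => f (X w)) by exact: measurableT_comp.
split=> /integrableP[_ fi]; apply/integrableP; split; try exact/measurable_EFinP.
  rewrite pushP_ge0// in fi; do 2 apply: measurableT_comp => //.
rewrite pushP_ge0//; do 2 apply: measurableT_comp => //.
Qed.

Lemma pushP_Ex (f : V -> R) : measurable_fun setT f -> intg P (fun w => f (X w)) ->
  Ex (pushP mX) f = Ex P (fun w => f (X w)).
Proof.
move=> mf fi; rewrite /Ex /Rintegral /pushP integral_distribution//.
exact/measurable_EFinP.
Qed.

End push.

Section independence.
Context {R : realType} {disp} {Om : measurableType disp} (P : probability Om R).

(** The product measure is the only one with the prescribed values on rectangles. *)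
Lemma indep_pair {d1 d2} {V1 : measurableType d1} {V2 : measurableType d2}
    (X : Om -> V1) (Y : Om -> V2) (mX : measurable_fun setT X) (mY : measurable_fun setT Y)
    (mXY : measurable_fun setT (fun w => (X w, Y w))) :
  (forall A B, measurable A -> measurable B ->
    P (X @^-1` A `&` Y @^-1` B) = (P (X @^-1` A) * P (Y @^-1` B))%E) ->
  forall C, measurable C -> (pushP P mX \x pushP P mY)%E C = pushP P mXY C.
Proof. by move=> XY; apply: product_measure_unique => A B mA mB; exact: XY. Qed.

(** The law of the pair is a product measure. Tonelli gives the integrability of the product, then
    Fubini factorizes its integral. *)
Lemma indep_Ex (u v : Om -> R) :
  (forall A B, measurable A -> measurable B ->
    P (u @^-1` A `&` v @^-1` B) = (P (u @^-1` A) * P (v @^-1` B))%E) ->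
  intg P u -> intg P v ->
  intg P (fun w => u w * v w) /\ Ex P (fun w => u w * v w) = Ex P u * Ex P v.
Proof.
move=> uv ui vi; have mu := intg_meas ui; have mv := intg_meas vi.
have muv := measurable_fun_pair mu mv.
pose Pu := pushP P mu; pose Pv := pushP P mv.
have iu : intg Pu id by apply/pushP_intg.
have iv : intg Pv id by apply/pushP_intg.
have PE C : measurable C -> pushP P muv C = (Pu \x Pv)%E C.
  by move=> mC; rewrite -(indep_pair mu mv muv uv).
pose g (z : R * R) : R := z.1 * z.2.
have mf : measurable_fun setT g.
  by apply: measurable_funM; [exact: measurable_fst|exact: measurable_snd].
have fi : (Pu \x Pv)%E.-integrable setT (EFin \o g).
  apply/integrable12ltyP; first exact/measurable_EFinP.
  have -> : (\int[Pu]_x \int[Pv]_y `|(EFin \o g) (x, y)| =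
      \int[Pu]_x (`|x|%:E * (Ex Pv (fun y => `|y|))%:E))%E.
    apply: eq_integral => x _ /=; rewrite -intgE; last exact: intg_abs.
    rewrite -ge0_integralZl//; last by do 2 apply: measurableT_comp => //.
    by apply: eq_integral => y _; rewrite normrM.
  rewrite ge0_integralZr//; last 2 first.
  - by do 2 apply: measurableT_comp => //.
  - by rewrite lee_fin; apply: Ex_ge0.
  by rewrite intgE ?ltry//; exact: intg_abs.
have fi' : intg (pushP P muv) g.
  apply/integrableP; split; first exact/measurable_EFinP.
  rewrite (eq_measure_integral (Pu \x Pv)%E) => [|A mA _]; last exact: PE.
  by case/integrableP: fi.
have fi2 : intg P (fun w => u w * v w).
  exact: ((pushP_intg P muv mf).1 fi').
split=> //; rewrite -(pushP_Ex muv mf fi2) /Ex /Rintegral.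
rewrite (eq_measure_integral (Pu \x Pv)%E) => [|A mA _]; last exact: PE.
rewrite -(integral12_prod_meas1 fi) /fubini_F /=.
have -> : (\int[Pu]_x \int[Pv]_y (x * y)%:E = \int[Pu]_x (Ex Pv id * x)%:E)%E.
  by apply: eq_integral => x _; rewrite intgE; [rewrite (ExZ x iv) mulrC|exact: (intgZ x iv)].
rewrite (intgE (intgZ (Ex Pv id) iu))/= (ExZ _ iu) mulrC.
by rewrite /Pu /Pv !pushP_Ex.
Qed.

(** Both sides are finite measures in [A], namely [P] restricted to [E] and [P] scaled by [P E], and
    they agree on a pi-system. *)
Lemma indep_generated (C : set (set Om)) (E : set Om) : C `<=` measurable -> setI_closed C ->
  C setT -> measurable E -> (forall A, C A -> P (A `&` E) = (P A * P E)%E) ->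
  forall A, <<s C >> A -> P (A `&` E) = (P A * P E)%E.
Proof.
move=> Cm CI CT mE CE A sA.
have p0 : 0 <= fine (P E) by rewrite fine_ge0.
have mE' B : mscale (NngNum p0) P B = (P B * P E)%E.
  by rewrite muleC -[in RHS](@fineK _ (P E)) ?fin_num_measure.
have H := @g_sigma_algebra_measure_unique _ R Om C Cm (fun=> setT) (fun=> CT) _
  (mrestr P mE) (mscale (NngNum p0) P) CI.
suff : mrestr P mE A = mscale (NngNum p0) P A by rewrite mE'.
apply: H => //.
- by apply/seteqP; split=> // w _; exists 0%N.
- by move=> B CB; exact: (etrans (CE _ CB) (esym (mE' B))).
- move=> _; change (P (setT `&` E) < +oo)%E.
  by rewrite setTI -ge0_fin_numE// fin_num_measure.
Qed.

End independence.

(** * Moments of the centred normal laws *)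

Section normal_moments.
Context {R : realType}.
Local Notation mu := (@lebesgue_measure R).

(** The change of variables is available for the Radon-Nikodym derivative of the law; it equals
    [normal_pdf] almost everywhere because both have the same integral over every measurable set. *)
Lemma normal_ge0_integral (s : R) (f : R -> R) : measurable_fun setT f -> (forall x, 0 <= f x) ->
  (\int[normal_prob 0 s]_x (f x)%:E = \int[mu]_x (f x * normal_pdf 0 s x)%:E)%E.
Proof.
move=> mf f0; pose N : probability _ R := normal_prob (0 : R) s.
have Nmu : N `<< mu by exact: normal_prob_dominates.
have f0' x : (0 <= (f x)%:E)%E by rewrite lee_fin.
have mf' : measurable_fun setT (EFin \o f) by exact/measurable_EFinP.
rewrite -(Radon_Nikodym_SigmaFinite.change_of_variables Nmu f0' measurableT mf').
have mg := measurable_int _ (Radon_Nikodym_SigmaFinite.f_integrable Nmu).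
have mp : measurable_fun setT (EFin \o normal_pdf (0 : R) s).
  by apply/measurable_EFinP; exact: measurable_normal_pdf.
apply: ae_eq_integral => //.
- by apply: emeasurable_funM => //; exact/measurable_EFinP.
- apply/measurable_EFinP/measurable_funM => //; exact: measurable_normal_pdf.
have : ae_eq mu setT (Radon_Nikodym_SigmaFinite.f N mu) (EFin \o normal_pdf (0 : R) s).
  apply: integral_ae_eq => //; first exact: Radon_Nikodym_SigmaFinite.f_integrable.
  by move=> E _ mE; rewrite -Radon_Nikodym_SigmaFinite.f_integral.
by apply: filterS => x /= h _; rewrite h// EFinM.
Qed.

Lemma normal_pdf_scale (s x : R) : 0 < s -> normal_pdf 0 s (s * x) * s = normal_pdf 0 1 x.
Proof.
move=> s0; rewrite !normal_pdfE ?gt_eqF// /normal_peak /normal_fun !subr0 expr1n mul1r.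
rewrite -mulrnAr sqrtrM ?sqr_ge0// sqrtr_sqr gtr0_norm// invfM.
have -> : - (s * x) ^+ 2 / (s ^+ 2 *+ 2) = - x ^+ 2 / (1 *+ 2).
  by field; rewrite gt_eqF.
have p0 : 0 < Num.sqrt (pi *+ 2 : R) by rewrite sqrtr_gt0 pmulrn_lgt0// pi_gt0.
move: (expR _) (Num.sqrt _) p0 => e p p0.
by field; rewrite !gt_eqF.
Qed.

Lemma normal_scale (s : R) (f : R -> R) : 0 < s -> continuous f -> (forall x, 0 <= f x) ->
  (\int[normal_prob 0 s]_x (f x)%:E = \int[normal_prob 0 1]_x (f (s * x)%R)%:E)%E.
Proof.
move=> s0 cf f0.
have csx : continuous (fun x : R => s * x) by move=> x; apply: cvgM; [exact: cvg_cst|exact: cvg_id].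
have cfs : continuous (fun x => f (s * x)).
  by move=> x; apply: (@continuous_comp _ _ _ (fun x => s * x) f); [exact: csx|exact: cf].
rewrite (normal_ge0_integral s (continuous_measurable_fun cf) f0).
rewrite (normal_ge0_integral 1 (continuous_measurable_fun cfs) (fun x => f0 (s * x))).
have F' : (fun x : R => s * x)^`()%classic = cst s.
  by apply/funext => x; rewrite derive1E derive_val; exact: mulr1.
rewrite (@increasing_ge0_integration_by_substitutionT R (fun x => s * x)) ?F'//.
- by apply: eq_integral => x _; rewrite mulrfctE /= -(normal_pdf_scale x s0) mulrA.
- by move=> x y xy; rewrite ltr_pM2l.
- by move=> x; exact: cvg_cst.
- exact: is_cvg_cst.
- exact: is_cvg_cst.
- rewrite (_ : (fun x => s * x) = (fun x => x * s)); last by apply/funext => x; rewrite mulrC.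
  by apply: gt0_cvgMlNy => //; exact: cvg_id.
- rewrite (_ : (fun x => s * x) = (fun x => x * s)); last by apply/funext => x; rewrite mulrC.
  by apply: gt0_cvgMly => //; exact: cvg_id.
- move=> x; apply: continuousM; first exact: cf.
  by apply: continuous_normal_pdf; rewrite gt_eqF.
- by move=> x; rewrite mulr_ge0// normal_pdf_ge0.
Qed.

Local Notation N s := (normal_prob (0 : R) s : probability _ R).

(** [exp y] is the square of [exp (y / 2) >= 1 + y / 2]. *)
Lemma expR_ge_sqr (y : R) : 0 <= y -> y ^+ 2 / 4 <= expR y.
Proof.
move=> y0; have := expR_ge1Dx (y / 2); have -> : expR y = expR (y / 2) ^+ 2.
  by rewrite -expRM_natl; congr expR; field.
by have := expR_gt0 (y / 2); nra.
Qed.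

(** Half of the Gaussian exponent absorbs the power: [x^4 exp (- x^2 / 4) <= 64]. The other half is,
    up to a factor, the density of variance [2], which explains [t] and [c]. *)
Lemma normal_intg4 : intg (N 1) (fun x => x ^+ 4).
Proof.
have mX : measurable_fun setT (fun x : R => x ^+ 4) by exact: measurable_funX.
apply/intg_pos => //; first by move=> x; rewrite exprn_even_ge0.
rewrite normal_ge0_integral//; last by move=> x; rewrite exprn_even_ge0.
set t : R := Num.sqrt 2.
have t2 : t ^+ 2 = 2 by rewrite sqr_sqrtr.
have t0 : t != 0 by rewrite sqrtr_eq0 -ltNge.
pose c := 64 * (normal_peak 1 / normal_peak t).
have c0 : 0 <= c by rewrite mulr_ge0// divr_ge0// normal_peak_ge0.
apply: (@le_lt_trans _ _ (\int[mu]_x (c%:E * (normal_pdf 0 t x)%:E))%E).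
  apply: ge0_le_integral => //.
  - by move=> x _; rewrite lee_fin mulr_ge0// ?normal_pdf_ge0// exprn_even_ge0.
  - apply/measurable_EFinP/measurable_funM => //; exact: measurable_normal_pdf.
  - by apply: measurable_funeM; apply/measurable_EFinP; exact: measurable_normal_pdf.
  move=> x _; rewrite -EFinM lee_fin !normal_pdfE ?oner_eq0// /normal_fun !subr0.
  rewrite t2 expr1n -(mulr_natr 2 2) (_ : - x ^+ 2 / (1 *+ 2) = - x ^+ 2 / (2 * 2) - x ^+ 2 / 4); last by field.
  have x4 : x ^+ 4 <= 64 * expR (x ^+ 2 / 4).
    have := expR_ge_sqr (divr_ge0 (sqr_ge0 x) (ler0n R 4)).
    rewrite expr_div_n -exprM; lra.
  have e1 : expR (x ^+ 2 / 4) * expR (- x ^+ 2 / (2 * 2) - x ^+ 2 / 4) = expR (- x ^+ 2 / (2 * 2)).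
    by rewrite -expRD; congr expR; field.
  have pt : normal_peak t != 0 by rewrite gt_eqF// normal_peak_gt0.
  rewrite /c (_ : _ * (normal_peak t * _) = normal_peak 1 * (64 * expR (- x ^+ 2 / (2 * 2)))); last by field.
  rewrite -e1 mulrCA ler_wpM2l ?normal_peak_ge0//.
  by rewrite mulrA ler_wpM2r ?expR_ge0.
rewrite ge0_integralZl//; last 2 first.
- by apply/measurable_EFinP; exact: measurable_normal_pdf.
- by move=> x _; rewrite lee_fin normal_pdf_ge0.
by rewrite integral_normal_pdf mule1 ltry.
Qed.

Lemma normal_scale_even (s : R) (n : nat) : 0 < s -> ~~ odd n -> intg (N 1) (fun x => x ^+ n) ->
  intg (N s) (fun x => x ^+ n) /\ Ex (N s) (fun x => x ^+ n) = s ^+ n * Ex (N 1) (fun x => x ^+ n).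
Proof.
move=> s0 no i1; have n0 (x : R) : 0 <= x ^+ n by rewrite exprn_even_ge0.
have E : (\int[N s]_x (x ^+ n)%:E = (s ^+ n * Ex (N 1) (fun x => x ^+ n))%:E)%E.
  rewrite (normal_scale s0 (@exprn_continuous _ n) n0).
  rewrite -(ExZ _ i1) -(intgE (intgZ _ i1)); apply: eq_integral => x _.
  by rewrite exprMn.
have mX : measurable_fun setT (fun x : R => x ^+ n) by exact: measurable_funX.
split; last exact: (congr1 fine E).
have sy : (\int[N s]_x (x ^+ n)%:E < +oo)%E by rewrite E ltry.
by apply: (iffRL (intg_pos _ _ _) sy).
Qed.

(** The density is even, so the positive and the negative part of the identity have the same
    integral. *)
Lemma normal_mean (s : R) : 0 < s -> Ex (N s) id = 0.
Proof.
move=> s0.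
pose h (x : R) := Num.max (- x) 0 * normal_pdf 0 s x.
pose g (x : R) := Num.max x 0 * normal_pdf 0 s x.
have cp : continuous (normal_pdf (0 : R) s) by apply: continuous_normal_pdf; rewrite gt_eqF.
have cm : continuous (fun x : R => Num.max (- x) 0).
  by move=> x; apply: (@continuous_max _ _ (fun x : R => - x) (fun=> 0)); [exact: opp_continuous|exact: cst_continuous].
have ch : continuous h by move=> x; exact: cvgM (cm x) (cp x).
have h0 x : 0 <= h x by rewrite mulr_ge0 ?normal_pdf_ge0// le_max lexx orbT.
have g0 x : 0 <= g x by rewrite mulr_ge0 ?normal_pdf_ge0// le_max lexx orbT.
rewrite /Ex /Rintegral integralE.
have -> : (\int[N s]_x ((fun x : R => x%:E)^\+ x) = \int[mu]_x (g x)%:E)%E.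
  rewrite -normal_ge0_integral.
  - by apply: eq_integral => x _; rewrite funeposE EFin_max.
  - by apply: measurable_maxr => //; exact: measurable_cst.
  - by move=> x; rewrite le_max lexx orbT.
have -> : (\int[N s]_x ((fun x : R => x%:E)^\- x) = \int[mu]_x (h x)%:E)%E.
  rewrite -normal_ge0_integral.
  - by apply: eq_integral => x _; rewrite funenegE EFin_max EFinN.
  - by apply: measurable_maxr => //; exact: measurable_cst.
  - by move=> x; rewrite le_max lexx orbT.
suff -> : (\int[mu]_x (h x)%:E = \int[mu]_x (g x)%:E)%E.
  (* An infinite common value would do no harm: [fine] of the resulting difference is [0] as
     well. *)
  have := leey (\int[mu]_x (g x)%:E)%E; rewrite le_eqVlt => /predU1P[-> //|gy].
  by rewrite subee// ge0_fin_numE// integral_ge0// => x _; rewrite lee_fin.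
(* [h] vanishes on the positive half-line. The bound is written [- 0] to match the substitution
   [x |-> - x]. *)
have -> : (\int[mu]_x (h x)%:E = \int[mu]_(x in `]-oo, (- 0)%R]) (h x)%:E)%E.
  rewrite [RHS]integral_mkcond; apply: eq_integral => x _; rewrite patchE.
  case: ifPn => //; rewrite notin_setE/= in_itv/= oppr0 => /negP; rewrite -ltNge => x0.
  by rewrite /h max_r ?mul0r// oppr_le0 ltW.
rewrite (@ge0_integration_by_substitutionNy R h 0 (continuous_subspaceT ch) (fun x _ => h0 x)).
rewrite [LHS]integral_mkcond; apply: eq_integral => x _; rewrite patchE /=.
case: ifPn => [_|].
  by rewrite /h /g opprK !normal_pdfE ?gt_eqF// /normal_fun !subr0 sqrrN.
rewrite notin_setE/= in_itv/= andbT => /negP; rewrite -ltNge => x0.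
by rewrite /g max_r ?mul0r// ltW.
Qed.

End normal_moments.

(** * Brownian increments *)

Lemma norm_le_sqr (R : realType) (x : R) : `|x| <= 1 + x ^+ 2.
Proof.
by rewrite ler_norml; apply/andP; split; have := sqr_ge0 (x - 1); have := sqr_ge0 (x + 1); nra.
Qed.

Section brownian.
Context {R : realType} {disp} {Om : measurableType disp} (P : probability Om R).
Context (T : R) {m : nat} (F0 : set (set Om)) (B : R -> Om -> 'rV[R]_m).
Hypothesis BM : brownian_motion P T B.
Hypothesis F0i : initial_sigma_algebra P T F0 B.
Local Notation Fi := (filtration F0 B).

Lemma filtration_sigma t : sigma_algebra setT (Fi t).
Proof. exact: smallest_sigma_algebra. Qed.

Lemma F0_sub_filtration t : F0 `<=` Fi t.
Proof. by move=> A FA; apply: sub_sigma_algebra; left. Qed.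

Lemma sigma_of_sigma (D : set R) : sigma_algebra setT (sigma_of D B).
Proof. exact: smallest_sigma_algebra. Qed.

Lemma sigma_of_sub (D E : set R) : D `<=` E -> sigma_of D B `<=` sigma_of E B.
Proof. by move=> DE; apply: sub_sigma_algebra2 => A [t Dt At]; exists t => //; exact: DE. Qed.

Lemma filtrationS s t : s <= t -> Fi s `<=` Fi t.
Proof.
move=> st; apply: sub_sigma_algebra2; apply: setUS; apply: sigma_of_sub => u /=.
by rewrite !in_itv/= => /andP[-> /le_trans]; exact.
Qed.

Lemma sigma_of_mw (D : set R) t : D t -> measurable_wrt (sigma_of D B) (B t).
Proof.
move=> Dt A mA; apply: sub_sigma_algebra; exists t => //; exists A => //.
by rewrite setTI.
Qed.

Lemma sigma_of_measurable t : t <= T -> sigma_of `[0, t] B `<=` measurable.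
Proof.
move=> tT; apply: smallest_sub; first exact: sigma_algebra_measurable.
move=> A [s]; rewrite /= in_itv/= => /andP[s0 st] [C mC <-].
by apply: (bm_measurable BM) => //; rewrite s0 (le_trans st).
Qed.

Lemma filtration_measurable t : t <= T -> Fi t `<=` measurable.
Proof.
move=> tT; apply: smallest_sub; first exact: sigma_algebra_measurable.
by move=> A [|]; [exact: (F0_measurable F0i)|exact: sigma_of_measurable].
Qed.

Lemma brownian_mw s t : 0 <= s <= t -> measurable_wrt (Fi t) (B s).
Proof.
move=> st A mA; apply: sub_sigma_algebra; right; exact: (@sigma_of_mw `[0, t] s).
Qed.

Let incr s t w := B t w - B s w.

Lemma incr_measurable s t : 0 <= s -> s <= t -> t <= T -> measurable_fun setT (incr s t).
Proof.
move=> s0 st tT; apply: measurable_rowB; apply: (bm_measurable BM); apply/andP; split=> //; lra.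
Qed.

(** [Fi s] is generated by the pi-system of intersections of an event of [F0] with a past event of
    [B]. On it the claim combines the independence of [F0] from the whole of [B], used twice, with
    that of the increment from the past of [B]. *)
Lemma incr_indep s t : 0 <= s -> s < t -> t <= T -> forall A D, Fi s A -> measurable D ->
  P (A `&` incr s t @^-1` D) = (P A * P (incr s t @^-1` D))%E.
Proof.
move=> s0 st tT A D FA mD; have sT : s <= T by rewrite (le_trans (ltW st)).
have mE : measurable (incr s t @^-1` D).
  by rewrite -[_ @^-1` _]setTI; apply: incr_measurable => //; exact: ltW.
have [F00 F0C F0U] := F0_sigma F0i.
have F0I : setI_closed F0.
  move=> X Y FX FY; have := @measurableI _ (g_sigma_algebraType F0) X Y.
  by rewrite /measurable/= !(sigma_algebra_id (F0_sigma F0i)); exact.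
have F0T : F0 setT by have := F0C _ F00; rewrite setD0.
have sI D' : setI_closed (sigma_of D' B).
  move=> X Y FX FY.
  exact: (@measurableI _ (g_sigma_algebraType (\bigcup_(s in D') preimage_set_system setT (B s) measurable)) X Y).
have sTT D' : sigma_of D' B setT.
  exact: (@measurableT _ (g_sigma_algebraType (\bigcup_(s in D') preimage_set_system setT (B s) measurable))).
have sET : sigma_of `[0, T] B (incr s t @^-1` D).
  apply: (iffLR (mw_row (sigma_of_sigma `[0, T]) (incr s t))) => // j.
  rewrite (_ : (fun w => _) = (fun w => B t w 0 j - B s w 0 j)); last first.
    by apply/funext => w; rewrite !mxE.
  apply: mwB; first exact: sigma_of_sigma.
    apply: (iffRL (mw_row (sigma_of_sigma `[0, T]) (B t))).
    by apply: sigma_of_mw; rewrite /= in_itv/= tT (le_trans s0) ?ltW.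
  apply: (iffRL (mw_row (sigma_of_sigma `[0, T]) (B s))).
  by apply: sigma_of_mw; rewrite /= in_itv/= s0.
pose C := [set X : set Om | exists A0 A1, [/\ F0 A0, sigma_of `[0, s] B A1 & X = A0 `&` A1]].
have {}FA : <<s C >> A.
  move: FA; apply: sub_sigma_algebra2 => X [FX|sX].
    by exists X, setT; rewrite setIT; split.
  by exists setT, X; rewrite setTI; split.
apply: (indep_generated (C := C)) => //.
- move=> _ [A0 [A1 [FA0 sA1 ->]]]; apply: measurableI; first exact: (F0_measurable F0i).
  exact: sigma_of_measurable sA1.
- move=> _ _ [A0 [A1 [FA0 sA1 ->]]] [A2 [A3 [FA2 sA3 ->]]].
  by exists (A0 `&` A2), (A1 `&` A3); rewrite setIACA; split; [exact: F0I|exact: sI|].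
- by exists setT, setT; rewrite setTI; split.
move=> _ [A0 [A1 [FA0 sA1 ->]]].
have s01 : sigma_of `[0, T] B A1.
  by apply: sigma_of_sub sA1 => u /=; rewrite !in_itv/= => /andP[-> /le_trans]; exact.
rewrite -setIA (F0_indep F0i) //; last exact: sI.
rewrite (F0_indep F0i FA0 s01) -muleA; congr (_ * _)%E.
apply: (bm_indep BM s0 st tT sA1); exists D => //; by rewrite setTI.
Qed.

(** A marginal of [bm_gaussian]: all coordinates but the [j]-th are left free. *)
Lemma incr_law s t (j : 'I_m) A : 0 <= s -> s < t -> t <= T -> measurable A ->
  P [set w | A (incr s t w 0 j)] = normal_prob 0 (Num.sqrt (t - s)) A.
Proof.
move=> s0 st tT mA.
have := bm_gaussian BM s0 st tT (A := fun i => if i == j then A else setT) _.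
have -> : \bigcap_(i in [set: 'I_m]) [set w | (if i == j then A else setT) ((B t w - B s w) 0 i)] =
   [set w | A (incr s t w 0 j)].
  apply/seteqP; split=> w /=; first by move=> /(_ j I) /=; rewrite eqxx.
  by move=> Aw i _ /=; case: eqVneq => [->|].
rewrite (bigD1 j)//= eqxx big1 => [|i /negbTE ->]; last exact: probability_setT.
by rewrite mule1; apply=> i; case: eqVneq.
Qed.

Let mincr s t j w := incr s t w 0 j.

Lemma mincr_measurable s t j : 0 <= s -> s <= t -> t <= T -> measurable_fun setT (mincr s t j).
Proof. by move=> *; exact: (measurableT_comp (measurable_coord j) (incr_measurable _ _ _)). Qed.

Lemma incr_Ex s t j (f : R -> R) : 0 <= s -> s < t -> t <= T -> measurable_fun setT f ->
  intg (normal_prob (0 : R) (Num.sqrt (t - s)) : probability _ R) f ->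
  intg P (fun w => f (mincr s t j w)) /\
  Ex P (fun w => f (mincr s t j w)) = Ex (normal_prob (0 : R) (Num.sqrt (t - s)) : probability _ R) f.
Proof.
move=> s0 st tT mf fi; have mi := mincr_measurable j s0 (ltW st) tT.
set N := (normal_prob (0 : R) _ : probability _ R) in fi *.
(* The normal law is carried by [measurableTypeR R]; its image under the identity and the law of the
   increment then live on the same type. *)
have mid : measurable_fun setT (id : measurableTypeR R -> R) by move=> _ A mA; rewrite setTI.
have PE A : measurable A -> pushP P mi A = pushP N mid A by move=> mA; exact: incr_law.
have gi : intg (pushP N mid) f by apply/pushP_intg.
have fi' : intg (pushP P mi) f.
  apply/integrableP; split; first exact/measurable_EFinP.
  rewrite (eq_measure_integral (pushP N mid)) => [|A mA _]; last exact: PE.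
  by case/integrableP: gi.
have fi2 := (pushP_intg P mi mf).1 fi'.
split=> //; rewrite -(pushP_Ex mi mf fi2) -(pushP_Ex mid mf fi) /Ex /Rintegral; congr fine.
by apply: eq_measure_integral => A mA _; exact: PE.
Qed.

(** Second and fourth moment of the standard normal law, left unevaluated: the estimates rest on the
    powers of [t - s] in front of them. *)
Definition gauss2 : R := Ex (normal_prob (0 : R) 1 : probability _ R) (fun x => x ^+ 2).
Definition gauss4 : R := Ex (normal_prob (0 : R) 1 : probability _ R) (fun x => x ^+ 4).

(** Scaling: the increment is distributed as [Num.sqrt (t - s)] times a standard normal variable.
    The case [s = t], outside the scope of [bm_gaussian], is a zero increment. *)
Lemma incr_moments s t j : 0 <= s -> s <= t -> t <= T ->
  [/\ sqi P (mincr s t j), intg P (fun w => mincr s t j w ^+ 4),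
      Ex P (mincr s t j) = 0, Ex P (fun w => mincr s t j w ^+ 2) = (t - s) * gauss2 &
      Ex P (fun w => mincr s t j w ^+ 4) = (t - s) ^+ 2 * gauss4].
Proof.
move=> s0; rewrite le_eqVlt => /predU1P[<- _|st tT].
  have E : mincr s s j = fun=> 0 by apply/funext => w; rewrite /mincr /incr subrr mxE.
  rewrite E !subrr !expr0n/= !mul0r !Ex_cst.
  by split=> //; [exact: sqi_cst|exact: intg_cst].
set h := Num.sqrt (t - s); have h0 : 0 < h by rewrite sqrtr_gt0 subr_gt0.
have h2 : h ^+ 2 = t - s by rewrite sqr_sqrtr// subr_ge0 ltW.
have mX n : measurable_fun setT (fun x : R => x ^+ n) by exact: measurable_funX.
have i2 : intg (normal_prob (0 : R) 1 : probability _ R) (fun x => x ^+ 2).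
  apply: (intg_le _ _ (intgD (intg_cst _ 1) normal_intg4)); first exact: (mX 2%N).
  move=> x; rewrite ger0_norm ?sqr_ge0// (_ : 4 = 2 * 2)%N// exprM.
  by have := sqr_ge0 (x ^+ 2 - 1); have := sqr_ge0 (x ^+ 2 + 1); nra.
have [j2 e2] := normal_scale_even (n:=2) h0 isT i2.
have [j4 e4] := normal_scale_even (n:=4) h0 isT normal_intg4.
have [k2 f2] := incr_Ex j s0 st tT (mX 2%N) j2.
have [k4 f4] := incr_Ex j s0 st tT (mX 4%N) j4.
have sq : sqi P (mincr s t j) by split=> //; apply: mincr_measurable => //; exact: ltW.
split=> //.
- have i1 : intg (normal_prob (0 : R) h : probability _ R) id.
    apply: (intg_le _ _ (intgD (intg_cst _ 1) j2)); first exact: measurable_id.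
    by move=> x; exact: norm_le_sqr.
  by rewrite (incr_Ex j s0 st tT (f := id) _ i1).2// normal_mean.
- by rewrite f2 e2 h2.
- by rewrite f4 e4 (exprM h 2 2) h2.
Qed.

Lemma incr_indep_Ex s t j u (f : R -> R) : 0 <= s -> s <= t -> t <= T -> measurable_wrt (Fi s) u ->
  intg P u -> measurable_fun setT f -> intg P (fun w => f (mincr s t j w)) ->
  intg P (fun w => u w * f (mincr s t j w)) /\
  Ex P (fun w => u w * f (mincr s t j w)) = Ex P u * Ex P (fun w => f (mincr s t j w)).
Proof.
move=> s0; rewrite le_eqVlt => /predU1P[<- _ mu ui mf fi|st tT mu ui mf fi].
  have E w : mincr s s j w = 0 by rewrite /mincr /incr subrr mxE.
  under eq_fun do rewrite E mulrC; under [in Ex P u * _]eq_fun do rewrite E.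
  by rewrite Ex_cst ExZ// mulrC; split=> //; exact: intgZ.
apply: indep_Ex => // A D mA mD.
have mj := @measurable_coord R m j.
have -> : (fun w => f (mincr s t j w)) @^-1` D = incr s t @^-1` ((fun x : 'rV[R]_m => f (x 0 j)) @^-1` D) by [].
apply: incr_indep => //; first exact: mu.
by rewrite -[_ @^-1` _]setTI; apply: (measurableT_comp mf mj).
Qed.

End brownian.

(** * Square-integrable random vectors *)

Section nonmeasurable_integral.
Context {R : realType}.
Local Notation mu := (@lebesgue_measure R).

(* The library's integral of a nonnegative function is a lower integral, hence
   monotone without any measurability assumption. *)
Lemma ge0_integral_mono {disp} {Om : measurableType disp} (nu : {measure set Om -> \bar R})
    (f g : Om -> \bar R) :
  (forall x, 0 <= f x)%E -> (forall x, f x <= g x)%E -> (\int[nu]_x f x <= \int[nu]_x g x)%E.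
Proof.
move=> f0 fg; have g0 x : (0 <= g x)%E by exact: le_trans (f0 x) (fg x).
rewrite !ge0_integralTE//; apply: ereal_sup_le => _ [h hf <-]; exists h => // x.
exact: le_trans (hf x) (fg x).
Qed.

(** Meant for the integral over [l] in [linear_derivative], whose integrand is not known to be
    measurable. The integrals of the positive and of the negative part are each enclosed by
    monotonicity of the lower integral, and the four bounds combine. *)
Lemma Rintegral01_bound (f : R -> R) (c e : R) : (forall l, 0 <= l <= 1 -> `|f l - c| <= e) ->
  `|\int[mu]_(l in `[0, 1]) f l - c| <= e.
Proof.
move=> fce.
have e0 : 0 <= e by apply: le_trans (fce 0 _); rewrite ?lexx ?ler01.
have mu1 : (mu `[0%R, 1%R]%classic = 1)%E by rewrite lebesgue_measure_itv/= lte01 sube0.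
have bnd (a : R) (g : R -> \bar R) : 0 <= a -> (forall l, (0 <= g l)%E) ->
    (forall l, 0 <= l <= 1 -> (g l <= a%:E)%E) -> (\int[mu]_(l in `[0%R, 1%R]) g l <= a%:E)%E.
  move=> a0 g0 ga; rewrite -[leRHS]mule1 -mu1 -integral_cst//.
  rewrite [leLHS]integral_mkcond [leRHS]integral_mkcond; apply: ge0_integral_mono => x; rewrite !patchE.
    by case: ifPn.
  by case: ifPn => //; rewrite inE/= in_itv/= => /ga.
have bnd' (a : R) (g : R -> \bar R) : 0 <= a -> (forall l, 0 <= l <= 1 -> (a%:E <= g l)%E) ->
    (a%:E <= \int[mu]_(l in `[0%R, 1%R]) g l)%E.
  move=> a0 ga; rewrite -[leLHS]mule1 -mu1 -integral_cst//.
  rewrite [leLHS]integral_mkcond [leRHS]integral_mkcond; apply: ge0_integral_mono => x; rewrite !patchE.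
    by case: ifPn.
  by case: ifPn => //; rewrite inE/= in_itv/= => /ga.
have f1 l : 0 <= l <= 1 -> c - e <= f l <= c + e.
  by move=> /fce; rewrite ler_norml => /andP[? ?]; apply/andP; split; lra.
rewrite /Rintegral integralE.
set I1 := (\int[mu]_(x in _) _)%E; set I2 := (\int[mu]_(x in _) _)%E.
have g1 l : (0 <= (EFin \o f)^\+ l)%E by exact: funepos_ge0.
have g2 l : (0 <= (EFin \o f)^\- l)%E by exact: funeneg_ge0.
have p10 : (0 <= I1)%E by apply: integral_ge0.
have p20 : (0 <= I2)%E by apply: integral_ge0.
have le1 : (I1 <= (Num.max 0 (c + e))%:E)%E.
  apply: bnd => //; first by rewrite le_max lexx.
  by move=> l /f1/andP[_ h]; rewrite funeposE /= ge_max !lee_fin !le_max lexx h orbT.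
have le2 : (I2 <= (Num.max 0 (e - c))%:E)%E.
  apply: bnd => //; first by rewrite le_max lexx.
  by move=> l /f1/andP[h _]; rewrite funenegE /= ge_max -?EFinN !lee_fin !le_max lexx (_ : - f l <= e - c) ?orbT//; lra.
have ge1 : ((Num.max 0 (c - e))%:E <= I1)%E.
  apply: bnd' => //; first by rewrite le_max lexx.
  move=> l /f1/andP[h _]; rewrite funeposE /= le_max !lee_fin !ge_max h lexx andbT /=.
  by case: (lerP 0 (f l)) => //= fl; lra.
have ge2 : ((Num.max 0 (- (c + e)))%:E <= I2)%E.
  apply: bnd' => //; first by rewrite le_max lexx.
  move=> l /f1/andP[_ h]; rewrite funenegE /= -?EFinN le_max !lee_fin !ge_max lexx /=.
  have hN : - (c + e) <= - f l by lra.
  by case: (lerP 0 (- f l)) => fl; rewrite ?hN //=; lra.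
move: p10 p20 le1 le2 ge1 ge2; case: I1 => // a1; case: I2 => // a2.
rewrite -EFinB /= !lee_fin => _ _; rewrite !le_max !ge_max => h1 h2 /andP[h3 h4] /andP[h5 h6].
rewrite ler_norml; apply/andP; split.
  by case/orP: h2 => h2; lra.
by case/orP: h1 => h1; lra.
Qed.

(** The one-dimensional mean value theorem along the segment [t |-> x + t v]. *)
Lemma gradient_MVT d (h : 'rV[R]_d -> R) (g : 'rV[R]_d -> 'rV[R]_d) (x v : 'rV[R]_d) :
  (forall y, is_gradient h y (g y)) ->
  exists2 c : R, 0 <= c <= 1 & h (x + v) - h x = edot (g (x + c *: v)) v.
Proof.
move=> hg; pose f (t : R) := h (x + t *: v).
have df (t : R) : is_derive t (1 : R) f (edot (g (x + t *: v)) v).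
  have dh := @ex_diff _ _ _ _ _ _ _ (hg (x + t *: v)).
  have E : (fun e : R => e^-1 *: ((f \o shift t) (e *: (1 : R)) - f t)) =
      (fun e : R => e^-1 *: ((h \o shift (x + t *: v)) (e *: v) - h (x + t *: v))).
    apply/funext => e; rewrite /f /=; congr (_ *: (h _ - _)).
    by rewrite [e *: 1]mulr1 scalerDl addrCA addrA.
  split; first by rewrite /derivable E; exact: diff_derivable.
  have := @diff_val _ _ _ _ _ _ _ (hg (x + t *: v)) => /(congr1 (fun k => k v)) <-.
  by rewrite -deriveE// /derive E.
have [|c cI fc] := @MVT_segment R f (fun t => edot (g (x + t *: v)) v) 0 1 ler01 (fun t _ => df t).
  apply: continuous_subspaceT => t; apply: differentiable_continuous.
  by apply/derivable1_diffP; case: (df t).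
exists c; first by move: cI; rewrite in_itv.
by move: fc; rewrite /f scale1r scale0r addr0 subr0 mulr1.
Qed.

End nonmeasurable_integral.

Section L2v.
Context {R : realType} {disp} {Om : measurableType disp} (P : probability Om R).

Definition nrm2 d (X : Om -> 'rV[R]_d) : R := Ex P (fun w => enorm (X w) ^+ 2).
Definition L2v d (X : Om -> 'rV[R]_d) : Prop :=
  measurable_fun setT X /\ intg P (fun w => enorm (X w) ^+ 2).
Definition nrm d (X : Om -> 'rV[R]_d) : R := Num.sqrt (nrm2 X).

Context {d : nat}.
Implicit Types X Y : Om -> 'rV[R]_d.

Lemma nrm2_ge0 X : 0 <= nrm2 X.
Proof. by apply: Ex_ge0 => w; exact: sqr_ge0. Qed.

Lemma nrm_ge0 X : 0 <= nrm X. Proof. exact: sqrtr_ge0. Qed.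

Lemma nrm_sqr X : nrm X ^+ 2 = nrm2 X.
Proof. by rewrite sqr_sqrtr// nrm2_ge0. Qed.

Lemma nrm_le X e : 0 <= e -> nrm2 X <= e ^+ 2 -> nrm X <= e.
Proof. by move=> e0 Xe; rewrite -(ger0_norm e0) -sqrtr_sqr ler_wsqrtr. Qed.

Let powE X w : (`|(enorm (X w))%:E| `^ 2 = (enorm (X w) ^+ 2)%:E)%E.
Proof. by rewrite abse_EFin poweR_EFin ger0_norm ?enorm_ge0// powR_mulrn ?enorm_ge0. Qed.

Lemma L2vP X : measurable_fun setT X -> (norm2 P X < +oo)%E <-> L2v X.
Proof.
move=> mX; have me : measurable_fun setT (fun w => enorm (X w) ^+ 2).
  by apply: measurable_funX; exact: measurable_enormf.
rewrite norm2_lty; under eq_integral do rewrite powE.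
split=> [h|[_ h]].
  by split=> //; apply/intg_pos => // w; exact: sqr_ge0.
by apply/intg_pos => // w; exact: sqr_ge0.
Qed.

Lemma norm2E X : L2v X -> norm2 P X = (nrm X)%:E.
Proof.
move=> [mX iX]; rewrite /norm2 unlock; under eq_integral do rewrite powE.
by rewrite (intgE iX) poweR_EFin powR12_sqrt ?nrm2_ge0.
Qed.

Lemma L2v_coord X : L2v X <-> forall j, sqi P (fun w => X w 0 j).
Proof.
split=> [[mX iX] j|sX].
  have mj := measurableT_comp (measurable_coord j) mX.
  split=> //; apply: (intg_le _ _ iX); first exact: measurable_funX.
  by move=> w; rewrite normrX lerXn2r ?nnegrE ?enorm_ge0 ?coord_le_enorm.
split; first by apply: measurable_row => j; exact: (sX j).1.
rewrite (_ : (fun w => _) = (fun w => \sum_j X w 0 j ^+ 2)); last by apply/funext => w; rewrite enorm_sqr.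
by apply: intg_sum => j; exact: (sX j).2.
Qed.

Lemma nrm2_sum X : L2v X -> nrm2 X = \sum_j Ex P (fun w => X w 0 j ^+ 2).
Proof.
move=> /L2v_coord sX; rewrite -Ex_sum; last by move=> j; exact: (sX j).2.
by rewrite /nrm2; congr Ex; apply/funext => w; rewrite enorm_sqr.
Qed.

Lemma L2v_sqi X : L2v X -> sqi P (fun w => enorm (X w)).
Proof. by move=> [mX iX]; split=> //; exact: measurable_enormf. Qed.

Lemma L2vD X Y : L2v X -> L2v Y -> L2v (fun w => X w + Y w).
Proof.
move=> /L2v_coord sX /L2v_coord sY; apply/L2v_coord => j.
rewrite (_ : (fun w => _) = (fun w => X w 0 j + Y w 0 j)); first exact: sqiD.
by apply/funext => w; rewrite mxE.
Qed.

Lemma L2vZ a X : L2v X -> L2v (fun w => a *: X w).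
Proof.
move=> /L2v_coord sX; apply/L2v_coord => j.
rewrite (_ : (fun w => _) = (fun w => a * X w 0 j)); first exact: sqiZ.
by apply/funext => w; rewrite mxE.
Qed.

Lemma L2vB X Y : L2v X -> L2v Y -> L2v (fun w => X w - Y w).
Proof.
move=> sX /(L2vZ (-1)) /(L2vD sX).
by under eq_fun do rewrite scaleN1r.
Qed.

Lemma L2v_le X (f : Om -> R) : measurable_fun setT X -> (forall w, enorm (X w) <= f w) ->
  sqi P f -> L2v X.
Proof.
move=> mX Xf [mf f2]; split=> //; apply: (intg_le _ _ f2).
  by apply: measurable_funX; exact: measurable_enormf.
move=> w; rewrite normrX lerXn2r ?nnegrE ?normr_ge0//.
  by rewrite (le_trans _ (Xf w))// enorm_ge0.
by rewrite ger0_norm ?enorm_ge0.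
Qed.

Lemma edot_intg X Y : L2v X -> L2v Y -> intg P (fun w => edot (X w) (Y w)).
Proof.
move=> sX sY; have h := sqiM (L2v_sqi sX) (L2v_sqi sY).
apply: (intg_le _ _ h); first by apply: measurable_edot; [exact: sX.1|exact: sY.1].
by move=> w; exact: edot_le.
Qed.

Lemma Ex_edot_le X Y : L2v X -> L2v Y -> `|Ex P (fun w => edot (X w) (Y w))| <= nrm X * nrm Y.
Proof.
move=> sX sY; apply: le_trans (CauchySchwarz (L2v_sqi sX) (L2v_sqi sY)).
rewrite [leRHS]ger0_norm; last by apply: Ex_ge0 => w; rewrite mulr_ge0 ?enorm_ge0.
apply: Ex_absle; [exact: edot_intg|exact: sqiM (L2v_sqi sX) (L2v_sqi sY)|].
by move=> w; exact: edot_le.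
Qed.

Lemma nrm2Z a X : L2v X -> nrm2 (fun w => a *: X w) = a ^+ 2 * nrm2 X.
Proof.
move=> [mX iX]; rewrite /nrm2 -ExZ//; congr Ex; apply/funext => w.
by rewrite enormZ exprMn real_normK ?num_real.
Qed.

Lemma nrmZ a X : L2v X -> nrm (fun w => a *: X w) = `|a| * nrm X.
Proof. by move=> sX; rewrite /nrm nrm2Z// sqrtrM ?sqr_ge0// sqrtr_sqr. Qed.

Lemma nrmD X Y : L2v X -> L2v Y -> nrm (fun w => X w + Y w) <= nrm X + nrm Y.
Proof.
move=> sX sY; apply: nrm_le; first by rewrite addr_ge0 ?nrm_ge0.
have e w : enorm (X w + Y w) ^+ 2 = enorm (X w) ^+ 2 + (2 * edot (X w) (Y w) + enorm (Y w) ^+ 2).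
  by rewrite -!edot_sqr !(edotDr, edotDl) (edotC (Y w)); ring.
have ixy := edot_intg sX sY; have ix := sX.2; have iy := sY.2.
rewrite /nrm2 (_ : (fun w => _) = (fun w => enorm (X w) ^+ 2 + (2 * edot (X w) (Y w) + enorm (Y w) ^+ 2))); last first.
  by apply/funext => w; exact: e.
rewrite (ExD ix (intgD (intgZ 2 ixy) iy)) (ExD (intgZ 2 ixy) iy) (ExZ 2 ixy).
rewrite sqrrD !nrm_sqr -addrA lerD2l lerD2r.
by have := le_trans (ler_norm _) (Ex_edot_le sX sY); nra.
Qed.

Lemma nrmBC X Y : nrm (fun w => X w - Y w) = nrm (fun w => Y w - X w).
Proof. by rewrite /nrm /nrm2; congr (Num.sqrt (Ex P _)); apply/funext => w; rewrite enormBC. Qed.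

Lemma nrm_triangle X Y Z : L2v X -> L2v Y -> L2v Z ->
  nrm (fun w => X w - Z w) <= nrm (fun w => X w - Y w) + nrm (fun w => Y w - Z w).
Proof.
move=> sX sY sZ; have -> : (fun w => X w - Z w) = (fun w => (X w - Y w) + (Y w - Z w)).
  by apply/funext => w; rewrite addrA subrK.
exact: nrmD (L2vB sX sY) (L2vB sY sZ).
Qed.

Lemma Ex_enorm_le X : L2v X -> Ex P (fun w => enorm (X w)) <= nrm X.
Proof.
move=> /L2v_sqi sX; have := Ex_abs_sqrt sX.
by rewrite (_ : (fun w => `|_|) = (fun w => enorm (X w)))//; apply/funext => w; rewrite ger0_norm ?enorm_ge0.
Qed.

Lemma L2v_cst (a : 'rV[R]_d) : L2v (fun=> a).
Proof. by apply/L2v_coord => j; exact: sqi_cst. Qed.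

Lemma L2_L2v (G : set (set Om)) X : G `<=` measurable -> L2 P G X <-> measurable_wrt G X /\ L2v X.
Proof.
move=> Gm; split=> -[mX]; have mX' := mw_meas Gm mX.
  by move=> /(L2vP mX').
by move=> /(L2vP mX').
Qed.

End L2v.

(** * Wasserstein distance *)

Section mixture.
Context {R : realType} {disp} {V : measurableType disp} (l : R) (p q : probability V R).

(** The construction of [mix0] on an arbitrary space: couplings, which live on a product, have to be
    mixed too. *)
Definition mixP : set V -> \bar R :=
  measure_add (mscale (NngNum (clamp_le1 l)) p) (mscale (NngNum (clamp_ge0 l)) q).

HB.instance Definition _ := Measure.on mixP.

Let mixP_setT : mixP setT = 1%E.
Proof.
have mscaleT (r : {nonneg R}) (n : probability V R) : mscale r n setT = r%:num%:E.
  by rewrite -[RHS]mule1; congr (_ * _)%E; exact: probability_setT.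
rewrite /mixP measure_addE [X in (X + _)%E]mscaleT [X in (_ + X)%E]mscaleT.
by rewrite -EFinD/= subrK.
Qed.

HB.instance Definition _ := Measure_isProbability.Build _ _ _ mixP mixP_setT.

Lemma mixPE A : mixP A = ((1 - clamp l)%:E * p A + (clamp l)%:E * q A)%E.
Proof. by rewrite /mixP measure_addE. Qed.

Lemma mixP_ge0_integral (f : V -> \bar R) : measurable_fun setT f -> (forall x, 0 <= f x)%E ->
  (\int[mixP]_x f x = (1 - clamp l)%:E * \int[p]_x f x + (clamp l)%:E * \int[q]_x f x)%E.
Proof.
by move=> mf f0; rewrite ge0_integral_measure_add//= !ge0_integral_mscale.
Qed.

End mixture.

Section law_lemmas.
Context {R : realType} {disp} {Om : measurableType disp} (P : probability Om R).
Context {d : nat}.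
Implicit Types X Y D : Om -> 'rV[R]_d.

Lemma law_push X (mX : measurable_fun setT X) : (norm2 P X < +oo)%E -> law P X = pushP P mX :> probability _ R.
Proof.
move=> fX; rewrite /law; case: pselect => [[mX' fX']|]; last by case.
by rewrite /= /pushP (Prop_irrelevance mX' mX).
Qed.

Lemma lawE X A : L2v P X -> law P X A = P (X @^-1` A).
Proof. by move=> sX; rewrite (law_push sX.1) // (iffRL (L2vP _ sX.1)). Qed.

Lemma law_intg X (f : 'rV[R]_d -> R) : L2v P X -> measurable_fun setT f ->
  intg P (fun w => f (X w)) -> Ex (law P X) f = Ex P (fun w => f (X w)).
Proof.
move=> sX mf fi; rewrite (law_push sX.1); last exact/(L2vP _ sX.1).
exact: pushP_Ex.
Qed.

Lemma law_ext X Y : L2v P X -> L2v P Y -> (forall A, measurable A -> P (X @^-1` A) = P (Y @^-1` A)) ->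
  forall A, measurable A -> law P X A = law P Y A.
Proof. by move=> sX sY XY A mA; rewrite !lawE// XY. Qed.

End law_lemmas.

Section wasserstein_lemmas.
Context {R : realType} {d : nat}.
Local Notation V := 'rV[R]_d.
Local Notation diff := (fun z : V * V => z.1 - z.2).

Lemma measurable_diff : measurable_fun setT (diff : V * V -> V).
Proof. by apply: measurable_rowB; [exact: measurable_fst|exact: measurable_snd]. Qed.

Lemma W2_ge0 (mu nu : P2 R d) : 0 <= W2 mu nu.
Proof.
rewrite fine_ge0//; apply: le_ereal_inf_tmp => _ [pi _ <-]; exact: Lnorm_ge0.
Qed.

Lemma W2_le (mu nu : P2 R d) (pi : probability (V * V)%type R) : coupling mu nu pi ->
  L2v pi diff -> W2 mu nu <= nrm pi diff.
Proof.
move=> cpi sd; rewrite /W2.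
have h0 : (0 <= ereal_inf [set norm2 pi diff | pi in coupling mu nu])%E.
  by apply: le_ereal_inf_tmp => _ [q _ <-]; exact: Lnorm_ge0.
have h1 : (ereal_inf [set norm2 pi diff | pi in coupling mu nu] <= (nrm pi diff)%:E)%E.
  by rewrite -norm2E//; apply: ereal_inf_lbound; exists pi.
by move: h0 h1; case: (ereal_inf _).
Qed.

(** The coupling [pi0] of finite cost makes the infimum finite, so that the [fine] in [W2] returns
    its actual value and near-minimizers exist. *)
Lemma W2_coupling (mu nu : P2 R d) (e : R) (pi0 : probability (V * V)%type R) : 0 < e ->
  coupling mu nu pi0 -> L2v pi0 diff ->
  exists pi : probability (V * V)%type R, [/\ coupling mu nu pi, L2v pi diff & nrm pi diff <= W2 mu nu + e].
Proof.
move=> e0 cpi sd; rewrite /W2; set S := [set norm2 _ _ | _ in _].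
have h0 : (0 <= ereal_inf S)%E.
  by apply: le_ereal_inf_tmp => _ [q _ <-]; exact: Lnorm_ge0.
have h1 : (ereal_inf S <= (nrm pi0 diff)%:E)%E.
  by rewrite -norm2E//; apply: ereal_inf_lbound; exists pi0.
have fS : ereal_inf S \is a fin_num by rewrite ge0_fin_numE// (le_lt_trans h1)// ltry.
have [_ [pi cp <-] lpi] := lb_ereal_inf_adherent e0 fS.
have sp : L2v pi diff.
  apply/(L2vP _ measurable_diff)/(lt_trans lpi).
  by rewrite -(fineK fS) -EFinD ltry.
exists pi; split=> //; rewrite -lee_fin -norm2E// EFinD fineK//; exact: ltW.
Qed.

Context {disp} {Om : measurableType disp} (P : probability Om R).
Implicit Types X Y D : Om -> 'rV[R]_d.

Lemma pair_coupling X Y (mXY : measurable_fun setT (fun w => (X w, Y w))) (mu nu : P2 R d) :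
  (forall A, measurable A -> mu A = P (X @^-1` A)) -> (forall A, measurable A -> nu A = P (Y @^-1` A)) ->
  coupling mu nu (pushP P mXY).
Proof.
move=> muE nuE A mA; rewrite (muE _ mA) (nuE _ mA).
by split; rewrite pushPE; congr (P _); apply/seteqP; split=> w //= -[].
Qed.

Lemma pair_L2v X Y (mXY : measurable_fun setT (fun w => (X w, Y w))) :
  L2v P X -> L2v P Y -> L2v (pushP P mXY) diff /\ nrm (pushP P mXY) diff = nrm P (fun w => X w - Y w).
Proof.
move=> sX sY; have sB := L2vB sX sY.
have mf : measurable_fun setT (fun z : V * V => enorm (z.1 - z.2) ^+ 2).
  by apply: measurable_funX; apply: measurable_enormf; exact: measurable_diff.
split; first by split; [exact: measurable_diff|apply/pushP_intg => //; exact: sB.2].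
by rewrite /nrm /nrm2 pushP_Ex//; exact: sB.2.
Qed.

Lemma W2_law_le X Y : L2v P X -> L2v P Y -> W2 (law P X) (law P Y) <= nrm P (fun w => X w - Y w).
Proof.
move=> sX sY; have mXY := measurable_fun_pair sX.1 sY.1.
have [sd <-] := pair_L2v mXY sX sY; apply: W2_le => //.
by apply: pair_coupling => A mA; exact: lawE.
Qed.

(** The diagonal coupling of [X] with itself and the coupling of [Y] with [X], mixed with weights
    [1 - l] and [l], couple the mixture with the law of [X] at squared cost [l] times that of
    [Y - X]. *)
Lemma W2_mix_le X Y l : L2v P X -> L2v P Y -> 0 <= l <= 1 ->
  W2 (mix l (law P X) (law P Y)) (law P X) <= nrm P (fun w => Y w - X w).
Proof.
move=> sX sY /andP[l0 l1]; have cl : clamp l = l by rewrite /clamp min_l// max_r.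
have mXX := measurable_fun_pair sX.1 sX.1; have mYX := measurable_fun_pair sY.1 sX.1.
pose pi : probability _ R := mixP l (pushP P mXX) (pushP P mYX).
have [s1 n1] := pair_L2v mXX sX sX; have [s2 n2] := pair_L2v mYX sY sX.
have mf : measurable_fun setT (fun z : V * V => enorm (z.1 - z.2) ^+ 2).
  by apply: measurable_funX; apply: measurable_enormf; exact: measurable_diff.
have E : (\int[pi]_z (enorm (z.1 - z.2) ^+ 2)%:E = (l * nrm2 P (fun w => Y w - X w))%:E)%E.
  rewrite mixP_ge0_integral; last 2 first.
  - exact/measurable_EFinP.
  - by move=> z; rewrite lee_fin sqr_ge0.
  rewrite (intgE s1.2) (intgE s2.2) -!EFinM -EFinD cl; congr EFin.
  rewrite -/(nrm2 _ diff) -/(nrm2 (pushP P mYX) diff) -!nrm_sqr n1 n2.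
  rewrite [X in nrm P X](_ : _ = fun=> 0); last by apply/funext => w; rewrite subrr.
  have -> : nrm P (fun=> 0 : 'rV[R]_d) = 0.
    by rewrite /nrm /nrm2 enorm0 expr0n/= Ex_cst sqrtr0.
  by rewrite expr0n mulr0 add0r.
have sp : L2v pi diff.
  split; first exact: measurable_diff.
  by apply/intg_pos => //; [move=> z; exact: sqr_ge0|rewrite E ltry].
apply: (@le_trans _ _ (nrm pi diff)).
  have piE B : pi B = ((1 - clamp l)%:E * pushP P mXX B + (clamp l)%:E * pushP P mYX B)%E.
    exact: mixPE.
  apply: W2_le => // A mA; rewrite !piE.
  have [-> ->] := pair_coupling mXX (fun A _ => lawE A sX) (fun A _ => lawE A sX) mA.
  have [-> ->] := pair_coupling mYX (fun A _ => lawE A sY) (fun A _ => lawE A sX) mA.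
  split; first by rewrite /mix /= /mix0 measure_addE.
  by rewrite -ge0_muleDl ?lee_fin ?clamp_le1 ?clamp_ge0// -EFinD subrK mul1e.
rewrite /nrm; apply: ler_wsqrtr.
have -> : nrm2 pi diff = l * nrm2 P (fun w => Y w - X w) by rewrite {1}/nrm2 /Ex /Rintegral E.
by rewrite ler_piMl ?nrm2_ge0.
Qed.

End wasserstein_lemmas.

Lemma W2_refl (R : realType) d (m : P2 R d) : W2 m m = 0.
Proof.
have mid := measurable_fun_pair (@measurable_id _ 'rV[R]_d setT) (@measurable_id _ 'rV[R]_d setT).
have sid : L2v m id by apply/L2vP; [exact: measurable_id|exact: P2_finite].
apply/eqP; rewrite eq_le W2_ge0 andbT.
have [sd nd] := pair_L2v mid sid sid.
apply: le_trans (W2_le (pair_coupling mid _ _) sd) _ => //.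
rewrite nd /nrm /nrm2 [X in Ex _ X](_ : _ = fun=> 0) ?Ex_cst ?sqrtr0//.
by apply/funext => w; rewrite subrr enorm0 expr0n.
Qed.

Lemma W2_nbhs_self (R : realType) d (m : P2 R d) (A : set (P2 R d)) : W2_nbhs m A -> A m.
Proof. by case=> e /= e0; apply; rewrite /= W2_refl. Qed.

(** * First-order expansion of functions of laws *)

Section expansion.
Context {R : realType} {disp} {Om : measurableType disp} (P : probability Om R) {d : nat}.
Local Notation V := 'rV[R]_d.
Implicit Types X D : Om -> V.

(** The defining integral over [l] reduces the increment of [f] to increments of the linear
    derivative at the mixtures, and the mean value theorem turns these into gradients. Hence [k]
    must control the gradient at every measure within [nrm P D] of the law of [X], where [W2_mix_le]
    puts the mixtures, and at every point of the segment. *)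
Lemma L_expand (f : P2 R d -> R) (g : P2 R d -> V -> V) X D (G : Om -> V) (k : Om -> R) :
  L_derivative f g -> L2v P X -> L2v P D -> intg P (fun w => edot (G w) (D w)) -> intg P k ->
  (forall m w t, 0 <= t <= 1 -> W2 m (law P X) <= nrm P D ->
    `|edot (g m (X w + t *: D w)) (D w) - edot (G w) (D w)| <= k w) ->
  `|f (law P (fun w => X w + D w)) - f (law P X) - Ex P (fun w => edot (G w) (D w))| <= Ex P k.
Proof.
move=> [df [[dfc dfq dfE] dfg _ _]] sX sD iG ik hk; set Y := fun w => X w + D w.
have sY : L2v P Y by exact: L2vD.
rewrite dfE; apply: Rintegral01_bound => l l01.
set m := mix l _ _; have mW : W2 m (law P X) <= nrm P D.
  apply: le_trans (W2_mix_le sX sY l01) _.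
  by rewrite (_ : (fun w => Y w - X w) = D)//; apply/funext => w; rewrite /Y addrC addKr.
have cd : continuous (df m).
  by move=> x; apply: differentiable_continuous; exact: (@ex_diff _ _ _ _ _ _ _ (dfg m x)).
have md := measurable_cts cd.
have [C /W2_nbhs_self qb] := dfq m.
have iX Z : L2v P Z -> intg P (fun w => df m (Z w)).
  move=> sZ; apply: (intg_le _ (fun w => qb (Z w)) (intgZ C (intgD (intg_cst P 1) sZ.2))).
  exact: (measurableT_comp md sZ.1).
have e1 : \int[law P Y]_x df m x = Ex P (fun w => df m (Y w)) by exact: (law_intg sY md (iX _ sY)).
have e2 : \int[law P X]_x df m x = Ex P (fun w => df m (X w)) by exact: (law_intg sX md (iX _ sX)).
have iB := intgB (iX _ sY) (iX _ sX).
rewrite e1 e2 -(ExB (iX _ sY) (iX _ sX)) -(ExB iB iG).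
apply: Ex_absle; [exact: intgB|by []|] => w.
have [t t01 ->] := gradient_MVT (X w) (D w) (dfg m).
exact: hk.
Qed.

(** Measures are functions on all sets, so agreeing on the measurable ones is weaker than equality
    in [P2]. It suffices here, since the integrand of the defining formula vanishes. *)
Lemma L_derivative_ext (f : P2 R d -> R) (g : P2 R d -> V -> V) (mu nu : P2 R d) :
  L_derivative f g -> (forall A, measurable A -> mu A = nu A) -> f mu = f nu.
Proof.
move=> [df [[_ _ dfE] _ _ _]] mn; apply/eqP; rewrite eq_sym -subr_eq0 dfE.
rewrite -normr_le0 -[X in `|X|]subr0; apply: Rintegral01_bound => l _.
have -> : \int[nu]_x df (mix l mu nu) x = \int[mu]_x df (mix l mu nu) x.
  by apply: (congr1 fine); apply: eq_measure_integral => A mA _; exact: (esym (mn _ mA)).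
by rewrite subrr subr0 normr0.
Qed.

End expansion.

(** * Smooth functions of laws *)

Section coefficients.
Context {R : realType} {disp} {Om : measurableType disp} (P : probability Om R) {d : nat}.
Local Notation V := 'rV[R]_d.
Implicit Types Y D : Om -> V.

Lemma near_enorm (x : V) (e : R) : 0 < e -> \forall y \near x, enorm (y - x) <= e.
Proof.
move=> e0; have de : 0 < e / (d%:R + 1) by rewrite divr_gt0// ltr_wpDl.
apply: filterS (nbhsx_ballx x _ de) => y /ball_sub_enorm /le_trans; apply.
by rewrite mulrCA ger_pMr// ler_pdivrMr ?ltr_wpDl// mul1r lerDl.
Qed.

Lemma measurable_ctsrow (h : V -> V) : continuous h -> measurable_fun setT h.
Proof.
move=> ch; apply: measurable_row => j; apply: measurable_cts => x.
apply: (@continuous_comp _ _ _ h (fun y : V => y 0 j)); first exact: ch.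
exact: coord_continuous.
Qed.

(** A lifted Lipschitz condition: laws are represented by random variables on [Om], and their
    distance by an L2 norm. *)
Definition lip_coef (f : V -> P2 R d -> R) (K : R) : Prop :=
  forall x x' Y Y', L2v P Y -> L2v P Y' ->
  `|f x' (law P Y') - f x (law P Y)| <= K * (enorm (x' - x) + nrm P (fun w => Y' w - Y w)).

(** Differentiability with a quadratic remainder, phrased without the derivative: the increment
    along [(u1, D1)] is compared with [t] times the one along [(u, D)]. The difference [D1 - t D]
    enters through its L1 norm only, as the L-derivative is bounded; this is what allows homogeneity
    to be propagated in L1. *)
Definition exp_coef (f : V -> P2 R d -> R) (K : R) : Prop :=
  forall (x u1 u : V) (t : R) Y D1 D, 0 <= t -> L2v P Y -> L2v P D1 -> L2v P D ->
  `|(f (x + u1) (law P (fun w => Y w + D1 w)) - f x (law P Y)) -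
    t * (f (x + u) (law P (fun w => Y w + D w)) - f x (law P Y))| <=
  K * (enorm (u1 - t *: u) + Ex P (fun w => enorm (D1 w - t *: D w)) +
       (enorm u1 ^+ 2 + nrm2 P D1) + t * (enorm u ^+ 2 + nrm2 P D)).

Lemma C11b_scalar_ext (f : V -> P2 R d -> R) (x : V) (mu nu : P2 R d) : C11b_scalar f -> (forall A, measurable A -> mu A = nu A) ->
  f x mu = f x nu.
Proof. by move=> [fx [fm [_ _ hm _ _]]]; exact: (L_derivative_ext (hm x)). Qed.

Lemma C11b_scalar_cts (f : V -> P2 R d -> R) mu : C11b_scalar f -> continuous (fun x : V => f x mu).
Proof.
move=> [fx [fm [hx _ _ _ _]]] x; apply: differentiable_continuous.
exact: (@ex_diff _ _ _ _ _ _ _ (hx mu x)).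
Qed.

Lemma nrm_addK Y D : nrm P (fun w => (Y w + D w) - Y w) = nrm P D.
Proof. by congr nrm; apply/funext => w; rewrite addrC addKr. Qed.

(** The coefficient is expanded around its linearization [lin] with an error quadratic in the
    increments. [lin] is linear in [(u, D)], so the two linearizations in [exp_coef] differ by [lin]
    at [(u1 - t u, D1 - t D)]. *)
Lemma C11b_scalar_coef (f : V -> P2 R d -> R) : C11b_scalar f -> exists K, [/\ 0 <= K, lip_coef f K & exp_coef f K].
Proof.
move=> [fx [fm [hx _ hm [C hC] [L0 hL0]]]].
have C0 : 0 <= C.
  by have [h _] := hC 0 (MkP2 (@dirac_P2 R d)) 0; apply: le_trans h; exact: enorm_ge0.
pose L := `|L0|; have L0' : 0 <= L by exact: normr_ge0.
have hLx x x' mu mu' : enorm (fx x' mu' - fx x mu) <= L * (enorm (x' - x) + W2 mu' mu).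
  have [h _] := hL0 x x' mu mu' 0 0; apply: (le_trans h).
  by rewrite ler_wpM2r ?ler_norm// addr_ge0 ?enorm_ge0 ?W2_ge0.
have hLm x mu mu' y y' : enorm (fm x mu' y' - fm x mu y) <= L * (W2 mu' mu + enorm (y' - y)).
  have [_ h] := hL0 x x mu mu' y y'; apply: (le_trans h); rewrite subrr enorm0 add0r.
  by rewrite ler_wpM2r ?ler_norm// addr_ge0 ?enorm_ge0 ?W2_ge0.
have mfm x mu : measurable_fun setT (fm x mu).
  apply: measurable_ctsrow => y; apply: (iffRL (@cvg_enorm _ _ _ _ (nbhs_filter y) _ _)) => e e0.
  have de : 0 < e / (L + 1) by rewrite divr_gt0// ltr_wpDl.
  apply: filterS (near_enorm y de) => y' hy'.
  apply: (le_trans (hLm x mu mu y y')); rewrite W2_refl add0r.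
  apply: (@le_trans _ _ (L * (e / (L + 1)))); first by rewrite ler_wpM2l.
  by rewrite mulrCA ger_pMr// ler_pdivrMr ?ltr_wpDl// mul1r lerDl.
pose lin x Y (u : V) D := edot (fx x (law P Y)) u + Ex P (fun w => edot (fm x (law P Y) (Y w)) (D w)).
have iG x Y D : L2v P Y -> L2v P D -> intg P (fun w => edot (fm x (law P Y) (Y w)) (D w)).
  move=> sY sD; apply: (intg_le _ _ (intgZ C (sqi_intg (L2v_sqi sD)))).
    by apply: measurable_edot; [exact: (measurableT_comp (mfm _ _) sY.1)|exact: sD.1].
  move=> w; apply: (le_trans (edot_le _ _)); rewrite ler_wpM2r ?enorm_ge0//.
  by have [] := hC x (law P Y) (Y w).
have lin_le x Y u D : L2v P Y -> L2v P D ->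
    `|lin x Y u D| <= C * (enorm u + Ex P (fun w => enorm (D w))).
  move=> sY sD; have iD := sqi_intg (L2v_sqi sD).
  apply: (le_trans (ler_normD _ _)); rewrite mulrDr lerD//.
    apply: (le_trans (edot_le _ _)); rewrite ler_wpM2r ?enorm_ge0//.
    by have [] := hC x (law P Y) 0.
  rewrite -(ExZ _ iD); apply: Ex_absle; [exact: iG|exact: intgZ|] => w.
  apply: (le_trans (edot_le _ _)); rewrite ler_wpM2r ?enorm_ge0//.
  by have [] := hC x (law P Y) (Y w).
have exp1 x u Y D : L2v P Y -> L2v P D ->
    `|f (x + u) (law P (fun w => Y w + D w)) - f x (law P Y) - lin x Y u D| <=
    4 * L * (enorm u ^+ 2 + nrm2 P D).
  move=> sY sD; set mu' := law P (fun w => Y w + D w); set mu := law P Y.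
  have iD := sqi_intg (L2v_sqi sD).
  have W' : W2 mu' mu <= nrm P D.
    by apply: le_trans (W2_law_le (L2vD sY sD) sY) _; rewrite nrm_addK.
  have h1 : `|f (x + u) mu' - f x mu' - edot (fx x mu) u| <= L * (enorm u + nrm P D) * enorm u.
    have [c /andP[c0 c1] ->] := gradient_MVT x u (hx mu').
    rewrite -edotBl; apply: (le_trans (edot_le _ _)); rewrite ler_wpM2r ?enorm_ge0//.
    apply: (le_trans (hLx _ _ _ _)); rewrite ler_wpM2l// lerD//.
    rewrite addrC addKr enormZ ger0_norm//; exact: (ler_piMl (enorm_ge0 _) c1).
  pose k w := L * (nrm P D * enorm (D w) + enorm (D w) ^+ 2).
  have ik : intg P k by apply: intgZ; apply: intgD; [exact: intgZ|exact: sD.2].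
  have h2 : `|f x mu' - f x mu - Ex P (fun w => edot (fm x mu (Y w)) (D w))| <= Ex P k.
    apply: (L_expand (hm x)) => //; first exact: iG.
    move=> m w t /andP[t0 t1] mW; rewrite -edotBl; apply: (le_trans (edot_le _ _)).
    rewrite /k expr2 -mulrDl mulrA ler_wpM2r ?enorm_ge0//.
    apply: (le_trans (hLm _ _ _ _ _)); rewrite ler_wpM2l// lerD//.
    rewrite addrC addKr enormZ ger0_norm//; exact: (ler_piMl (enorm_ge0 _) t1).
  have h3 : Ex P k <= L * (2 * nrm2 P D).
    rewrite (ExZ _ (intgD (intgZ (nrm P D) iD) sD.2)) (ExD (intgZ (nrm P D) iD) sD.2) (ExZ _ iD).
    rewrite ler_wpM2l// mulrDl mul1r lerD// -nrm_sqr expr2 ler_wpM2l ?nrm_ge0//.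
    exact: Ex_enorm_le.
  rewrite /lin (_ : _ - _ - _ = (f (x + u) mu' - f x mu' - edot (fx x mu) u) +
     (f x mu' - f x mu - Ex P (fun w => edot (fm x mu (Y w)) (D w)))); last by ring.
  apply: (le_trans (ler_normD _ _)); apply: (le_trans (lerD h1 (le_trans h2 h3))).
  rewrite -nrm_sqr; move: (nrm P D) (enorm u) => a c.
  rewrite -subr_ge0 (_ : _ - _ = L * (5 / 2 * c ^+ 2 + 3 / 2 * a ^+ 2 + (c - a) ^+ 2 / 2)); last by field.
  apply: mulr_ge0 => //; have := sqr_ge0 a; have := sqr_ge0 c; have := sqr_ge0 (c - a); lra.
exists (C + 4 * L); split; first by rewrite addr_ge0// mulr_ge0.
- move=> x x' Y Y' sY sY'; set D := fun w => Y' w - Y w.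
  have sD : L2v P D by exact: L2vB.
  have iD := sqi_intg (L2v_sqi sD).
  have YD : Y' = (fun w => Y w + D w) by apply/funext => w; rewrite /D addrC subrK.
  have h1 : `|f x' (law P Y') - f x (law P Y')| <= C * enorm (x' - x).
    have [c _] := gradient_MVT x (x' - x) (hx (law P Y')).
    rewrite (addrC x (x' - x)) subrK => ->; apply: (le_trans (edot_le _ _)); rewrite ler_wpM2r ?enorm_ge0//.
    by have [] := hC (x + c *: (x' - x)) (law P Y') 0.
  have h2 : `|f x (law P Y') - f x (law P Y)| <= C * nrm P D.
    have E0 : (fun w => edot (0 : V) (D w)) = fun=> 0.
      by apply/funext => w; rewrite -(scale0r 0) edotZl mul0r.
    (* With [0] in the place of the gradient, the error term of [L_expand] bounds the whole
       increment. *)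
    have := @L_expand _ _ _ P d _ _ Y D (fun=> 0) (fun w => C * enorm (D w)) (hm x) sY sD.
    rewrite -YD E0 Ex_cst subr0 (ExZ _ iD) => h; apply: (le_trans (h _ _ _)).
    + exact: intg_cst.
    + exact: intgZ.
    + move=> m w t _ _; rewrite -(scale0r 0) edotZl mul0r subr0.
      apply: (le_trans (edot_le _ _)); rewrite ler_wpM2r ?enorm_ge0//.
      by have [] := hC x m (Y w + t *: D w).
    by rewrite ler_wpM2l// Ex_enorm_le.
  rewrite (_ : _ - _ = (f x' (law P Y') - f x (law P Y')) + (f x (law P Y') - f x (law P Y))); last by ring.
  apply: (le_trans (ler_normD _ _)); apply: (le_trans (lerD h1 h2)).
  by rewrite -mulrDr ler_wpM2r ?addr_ge0 ?enorm_ge0 ?nrm_ge0// lerDl mulr_ge0.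
move=> x u1 u t Y D1 D t0 sY sD1 sD.
have e1 := exp1 x u1 Y D1 sY sD1; have e2 := exp1 x u Y D sY sD.
have sDD : L2v P (fun w => D1 w - t *: D w) by exact: L2vB sD1 (L2vZ t sD).
have linE : lin x Y u1 D1 - t * lin x Y u D = lin x Y (u1 - t *: u) (fun w => D1 w - t *: D w).
  rewrite /lin edotBr edotZr (_ : (fun w => edot _ (D1 w - _)) =
    (fun w => edot (fm x (law P Y) (Y w)) (D1 w) - t * edot (fm x (law P Y) (Y w)) (D w))).
    by rewrite (ExB (iG x _ _ sY sD1) (intgZ t (iG x _ _ sY sD))) (ExZ _ (iG x _ _ sY sD)); ring.
  by apply/funext => w; rewrite edotBr edotZr.
have e3 := lin_le x Y (u1 - t *: u) _ sY sDD; rewrite -linE in e3.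
move: e1 e2 e3; set a1 := f (x + u1) _ - _; set a := f (x + u) _ - _.
move: (lin x Y u1 D1) (lin x Y u D) => l1 l e1 e2 e3.
have -> : a1 - t * a = (a1 - l1) - t * (a - l) + (l1 - t * l) by ring.
apply: (le_trans (ler_normD _ _)); apply: (le_trans (lerD (ler_normB _ _) e3)).
rewrite normrM (ger0_norm t0).
have e4 : t * `|a - l| <= t * (4 * L * (enorm u ^+ 2 + nrm2 P D)) by rewrite ler_wpM2l.
apply: (le_trans (lerD (lerD e1 e4) (lexx _))).
set q1 := _ + nrm2 P D1; set q := _ + nrm2 P D; set p := enorm _ + Ex P _.
have q10 : 0 <= q1 by rewrite addr_ge0 ?sqr_ge0 ?nrm2_ge0.
have q0 : 0 <= q by rewrite addr_ge0 ?sqr_ge0 ?nrm2_ge0.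
have p0 : 0 <= p by rewrite addr_ge0 ?enorm_ge0// Ex_ge0// => w; exact: enorm_ge0.
rewrite -subr_ge0 (_ : _ - _ = C * (q1 + t * q) + 4 * L * p); last by ring.
have tq : 0 <= t * q by exact: mulr_ge0.
have L4 : 0 <= 4 * L by exact: mulr_ge0.
by apply: addr_ge0; apply: mulr_ge0 => //; exact: addr_ge0.
Qed.

(** The segment from [x] to [x'] is cut into pieces of length at most [s0], on each of which [g]
    moves by at most [e]; their number is affine in the distance. *)
Lemma modulus_linear_growth (g : V -> V) (w : R -> R) (e : R) : modulus w ->
  (forall x x', enorm (g x' - g x) <= w (enorm (x' - x))) -> 0 < e ->
  exists2 K, 0 <= K & forall x x', enorm (g x' - g x) <= e + K * enorm (x' - x).
Proof.
move=> [w0 wm wc] hg e0.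
have [s0 s00 ws0] : exists2 s, 0 < s & w s <= e.
  have /cvgrPdist_le/(_ _ e0) := wc; rewrite /at_right/= => -[r /= r0 hr].
  exists (r / 2); first by rewrite divr_gt0.
  have r2 : 0 < r / 2 by rewrite divr_gt0.
  have := hr (r / 2); rewrite /ball_ /= sub0r normrN gtr0_norm// => /(_ _ r2).
  by rewrite sub0r normrN ger0_norm ?w0 ?(ltW r2)//; apply; lra.
have step n : forall x x', enorm (x' - x) <= n.+1%:R * s0 -> enorm (g x' - g x) <= n.+1%:R * e.
  elim: n => [|n IH] x x'.
    by rewrite !mul1r => h; apply: (le_trans (hg _ _)); apply: le_trans ws0; rewrite wm ?enorm_ge0.
  move=> h; pose y := x' - n.+2%:R^-1 *: (x' - x).
  have n20 : (0 : R) < n.+2%:R by [].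
  have h1 : enorm (x' - y) <= s0.
    rewrite /y opprB addrC subrK enormZ ger0_norm ?invr_ge0//.
    by rewrite mulrC ler_pdivrMr// mulrC.
  have h2 : enorm (y - x) <= n.+1%:R * s0.
    have -> : y - x = (n.+1%:R / n.+2%:R) *: (x' - x).
      rewrite /y -addrA [- _ - x]addrC addrA -{1}(scale1r (x' - x)) -scalerBl; congr (_ *: _).
      have a0 : (0 : R) < n.+1%:R by [].
      rewrite -(natr1 n.+1); move: n.+1%:R a0 => a a0.
      by field; rewrite gt_eqF// ltr_wpDr.
    rewrite enormZ ger0_norm ?divr_ge0// mulrAC ler_pdivrMr//.
    by rewrite -mulrA ler_wpM2l// mulrC.
  have -> : g x' - g x = (g x' - g y) + (g y - g x) by rewrite addrA subrK.
  apply: (le_trans (enormD _ _)); rewrite -(natr1 n.+1) mulrDl mul1r addrC lerD ?IH//.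
  by apply: (le_trans (hg _ _)); apply: le_trans ws0; rewrite wm ?enorm_ge0.
exists (e / s0) => [|x x']; first by rewrite divr_ge0// ltW.
set a := enorm (x' - x); have a0 : 0 <= a / s0 by rewrite divr_ge0 ?enorm_ge0// ltW.
have /andP[t1 t2] := truncn_itv a0.
apply: (le_trans (step (Num.truncn (a / s0)) x x' _)).
  by rewrite -ler_pdivrMr//; exact: (ltW t2).
rewrite -natr1 mulrDl mul1r addrC lerD2l (_ : e / s0 * a = (a / s0) * e); last by ring.
by rewrite ler_wpM2r// ltW.
Qed.

(** Quadratic growth of the L-derivative would not place [g (X w)] in L2; the modulus yields affine
    growth, which does. *)
Lemma gphi_L2v (g : V -> V) (w : R -> R) X : modulus w -> continuous g ->
  (forall x x', enorm (g x' - g x) <= w (enorm (x' - x))) -> L2v P X -> L2v P (fun w => g (X w)).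
Proof.
move=> mw cg hg sX; have [K K0 hK] := modulus_linear_growth mw hg ltr01.
apply: (@L2v_le _ _ _ _ _ _ (fun w => enorm (g 0) + 1 + K * enorm (X w))).
- exact: (measurableT_comp (measurable_ctsrow cg) sX.1).
- move=> z; have := hK 0 (X z); rewrite subr0 => h.
  have := enormD (g (X z) - g 0) (g 0); rewrite subrK; lra.
- by apply: sqiD; [exact: sqi_cst|exact/sqiZ/L2v_sqi].
Qed.

Lemma modulus_cts (g : V -> V) (w : R -> R) : modulus w ->
  (forall x x', enorm (g x' - g x) <= w (enorm (x' - x))) -> continuous g.
Proof.
move=> mw hg x; apply: (iffRL (@cvg_enorm _ _ _ _ (nbhs_filter x) _ _)) => e e0.
have [K K0 hK] := modulus_linear_growth mw hg (divr_gt0 e0 (ltr0n R 2)).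
have de : 0 < e / 2 / (K + 1) by rewrite !divr_gt0// ltr_wpDl.
apply: filterS (near_enorm x de) => y hy.
apply: (le_trans (hK x y)).
have : K * enorm (y - x) <= K * (e / 2 / (K + 1)) by rewrite ler_wpM2l.
have : K * (e / 2 / (K + 1)) <= e / 2.
  by rewrite mulrCA ger_pMr ?divr_gt0// ler_pdivrMr ?ltr_wpDl// mul1r lerDl.
lra.
Qed.

(** Frechet differentiability of the lift [X |-> phi (law P X)] to L2. A merely continuous gradient
    suffices because its modulus in [x] can be traded for a small constant plus a linear term. *)
Lemma phi_frechet (phi : P2 R d -> R) (gphi : P2 R d -> V -> V) X : L_derivative phi gphi ->
  (exists2 w : R -> R, modulus w &
    forall mu mu' x, enorm (gphi mu' x - gphi mu x) <= w (W2 mu' mu)) ->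
  (forall mu, exists2 w : R -> R, modulus w &
    forall x x', enorm (gphi mu x' - gphi mu x) <= w (enorm (x' - x))) ->
  L2v P X -> forall e, 0 < e -> exists2 r, 0 < r & forall D, L2v P D -> nrm P D <= r ->
  `|phi (law P (fun w => X w + D w)) - phi (law P X) -
    Ex P (fun w => edot (gphi (law P X) (X w)) (D w))| <= e * nrm P D.
Proof.
move=> hphi [w1 [w10 w1m w1c] hw1] hw2 sX e e0.
have [w2 mw2 hw2'] := hw2 (law P X).
have e4 : 0 < e / 4 by rewrite divr_gt0.
have [K K0 hK] := modulus_linear_growth mw2 hw2' e4.
have [s0 s00 ws0] : exists2 s, 0 < s & w1 s <= e / 4.
  have /cvgrPdist_le/(_ _ e4) := w1c; rewrite /at_right/= => -[r /= r0 hr].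
  exists (r / 2); first by rewrite divr_gt0.
  have r2 : 0 < r / 2 by rewrite divr_gt0.
  have := hr (r / 2); rewrite /ball_ /= sub0r normrN gtr0_norm// => /(_ _ r2).
  by rewrite sub0r normrN ger0_norm ?w10 ?(ltW r2)//; apply; lra.
have sG := gphi_L2v mw2 (modulus_cts mw2 hw2') hw2' sX.
(* [s0] brings the modulus in the measure below [e / 4]; the other bound gives
   [K * nrm P D <= e / 4]. *)
exists (Num.min s0 (e / (4 * (K + 1)))).
  by rewrite lt_min s00 divr_gt0// mulr_gt0// ltr_wpDl.
move=> D sD; rewrite le_min => /andP[Ds0 De].
pose k w := (e / 2 + K * enorm (D w)) * enorm (D w).
have iD := sqi_intg (L2v_sqi sD).
have kE : k = fun w => e / 2 * enorm (D w) + K * enorm (D w) ^+ 2.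
  by apply/funext => w; rewrite /k; ring.
have ik : intg P k by rewrite kE; apply: intgD; [exact: intgZ|exact: (intgZ _ sD.2)].
apply: (@le_trans _ _ (Ex P k)).
  apply: (L_expand hphi sX sD (edot_intg sG sD) ik) => m w t /andP[t0 t1] mW.
  rewrite -edotBl; apply: (le_trans (edot_le _ _)); rewrite ler_wpM2r ?enorm_ge0//.
  have -> : gphi m (X w + t *: D w) - gphi (law P X) (X w) =
     (gphi m (X w + t *: D w) - gphi (law P X) (X w + t *: D w)) +
     (gphi (law P X) (X w + t *: D w) - gphi (law P X) (X w)) by rewrite addrA subrK.
  apply: (le_trans (enormD _ _)).
  have h1 := hw1 (law P X) m (X w + t *: D w).
  have h2 : w1 (W2 m (law P X)) <= w1 s0.
    by apply: w1m; [exact: W2_ge0|exact: le_trans mW Ds0].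
  have h3 := hK (X w) (X w + t *: D w).
  have h4 : enorm (X w + t *: D w - X w) <= enorm (D w).
    rewrite addrC addKr enormZ ger0_norm//; exact: (ler_piMl (enorm_ge0 _) t1).
  have := ler_wpM2l K0 h4; lra.
rewrite kE (ExD (intgZ (e / 2) iD) (intgZ K sD.2)) (ExZ _ iD) (ExZ _ sD.2).
have h1 : e / 2 * Ex P (fun w => enorm (D w)) <= e / 2 * nrm P D.
  by apply: ler_wpM2l; [lra|exact: Ex_enorm_le].
have h2 : K * nrm2 P D <= e / 4 * nrm P D.
  rewrite -nrm_sqr expr2 mulrA ler_wpM2r ?nrm_ge0//.
  apply: (@le_trans _ _ (K * (e / (4 * (K + 1))))); first by rewrite ler_wpM2l.
  have K1 : 0 < K + 1 by rewrite ltr_wpDl.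
  rewrite (_ : K * _ = e / 4 * (K / (K + 1))); last by field; rewrite gt_eqF.
  rewrite ger_pMr//.
  by rewrite ler_pdivrMr ?ltr_wpDl// mul1r lerDl.
have := nrm_ge0 P D; rewrite -/(nrm2 P D); nra.
Qed.

End coefficients.

(** * The Euler scheme *)

Lemma pow4_ge0 (R : realType) (x : R) : 0 <= x ^+ 4.
Proof. by rewrite exprn_even_ge0. Qed.

Ltac nonneg := repeat first [ assumption | exact: sqr_ge0 | exact: pow4_ge0 | exact: enorm_ge0
  | exact: ler0n | exact: nrm2_ge0 | exact: nrm_ge0 | by rewrite subr_ge0 | apply: addr_ge0 | apply: mulr_ge0
  | apply: divr_ge0 | apply: exprn_ge0 | by [] ].

Section power_means.
Context {R : realType}.

Lemma sum_sqr_le m (x : 'I_m -> R) : (\sum_j x j) ^+ 2 <= m%:R * \sum_j x j ^+ 2.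
Proof.
have := edot_le (const_mx 1 : 'rV[R]_m) (\row_j x j).
have -> : edot (const_mx 1 : 'rV[R]_m) (\row_j x j) = \sum_j x j.
  by apply: eq_bigr => j _; rewrite !mxE mul1r.
rewrite -(@ler_pXn2r _ 2) ?nnegrE ?mulr_ge0 ?enorm_ge0// real_normK ?num_real//.
rewrite exprMn.
have -> : enorm (const_mx 1 : 'rV[R]_m) ^+ 2 = m%:R.
  rewrite enorm_sqr; under eq_bigr do rewrite mxE expr1n.
  by rewrite sumr_const card_ord.
have -> // : enorm (\row_j x j) ^+ 2 = \sum_j x j ^+ 2.
by rewrite enorm_sqr; apply: eq_bigr => j _; rewrite mxE.
Qed.

Lemma sum_pow4_le m (x : 'I_m -> R) : (\sum_j x j) ^+ 4 <= m%:R ^+ 3 * \sum_j x j ^+ 4.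
Proof.
rewrite (exprM _ 2 2); apply: (@le_trans _ _ ((m%:R * \sum_j x j ^+ 2) ^+ 2)).
  by rewrite lerXn2r ?nnegrE ?sqr_ge0 ?sum_sqr_le// mulr_ge0// sumr_ge0// => j _; exact: sqr_ge0.
rewrite exprMn (exprSr m%:R 2) -mulrA ler_wpM2l ?sqr_ge0//.
apply: (le_trans (sum_sqr_le _)); rewrite (eq_bigr (fun j => x j ^+ 4))// => j _.
by rewrite -exprM.
Qed.

(** The factor is [1 + h] instead of the usual [2], hence it remains bounded after [n] steps with
    [n h <= T]. *)
Lemma drift_sqr_le (h u b : R) : 0 <= h -> (u + h * b) ^+ 2 <= (1 + h) * (u ^+ 2 + h * b ^+ 2).
Proof.
move=> h0; rewrite -subr_ge0.
have -> : (1 + h) * (u ^+ 2 + h * b ^+ 2) - (u + h * b) ^+ 2 = h * (u - b) ^+ 2 by ring.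
by rewrite mulr_ge0 ?sqr_ge0.
Qed.

Lemma drift_pow4_le (h u b : R) : 0 <= h -> (u + h * b) ^+ 4 <= (1 + h) ^+ 3 * (u ^+ 4 + h * b ^+ 4).
Proof.
move=> h0; rewrite (exprM _ 2 2).
apply: (@le_trans _ _ (((1 + h) * (u ^+ 2 + h * b ^+ 2)) ^+ 2)).
  rewrite lerXn2r ?nnegrE ?sqr_ge0 ?drift_sqr_le// mulr_ge0 ?addr_ge0 ?sqr_ge0//.
  by rewrite mulr_ge0 ?sqr_ge0.
rewrite exprMn (exprSr (1 + h) 2) -mulrA ler_wpM2l ?sqr_ge0//.
by apply: (le_trans (drift_sqr_le _ _ h0)); rewrite -!exprM.
Qed.

(** The term [4 a n^3] is absorbed by its even neighbours, whereas [a^3 n] is kept exactly: its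
    expectation will vanish. *)
Lemma add_pow4_le (a n : R) : (a + n) ^+ 4 <= a ^+ 4 + 4 * (a ^+ 3 * n) + 8 * (a ^+ 2 * n ^+ 2) + 3 * n ^+ 4.
Proof.
have H : a ^+ 4 + 4 * (a ^+ 3 * n) + 8 * (a ^+ 2 * n ^+ 2) + 3 * n ^+ 4 - (a + n) ^+ 4 =
  2 * (n * (a - n)) ^+ 2 by ring.
by rewrite -subr_ge0 H mulr_ge0 ?sqr_ge0.
Qed.

End power_means.

(** * Moments over one step of the scheme *)

Section one_step.
Context {R : realType} {disp} {Om : measurableType disp} (P : probability Om R).
Context (T : R) {m : nat} (F0 : set (set Om)) (B : R -> Om -> 'rV[R]_m).
Hypothesis T0 : 0 <= T.
Hypothesis BM : brownian_motion P T B.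
Hypothesis F0i : initial_sigma_algebra P T F0 B.
Local Notation Fi := (filtration F0 B).

Definition dB s t j w : R := (B t w - B s w) 0 j.

Lemma gauss2_ge0 : 0 <= gauss2 (R := R).
Proof. by apply: Ex_ge0 => x; exact: sqr_ge0. Qed.

Lemma gauss4_ge0 : 0 <= gauss4 (R := R).
Proof. by apply: Ex_ge0 => x; exact: pow4_ge0. Qed.

Lemma mul_dB s t j (g : Om -> R) : 0 <= s -> s <= t -> t <= T -> measurable_wrt (Fi s) g -> intg P g ->
  [/\ intg P (fun w => g w * dB s t j w) /\ Ex P (fun w => g w * dB s t j w) = 0,
      intg P (fun w => g w * dB s t j w ^+ 2) /\
        Ex P (fun w => g w * dB s t j w ^+ 2) = Ex P g * ((t - s) * gauss2) &
      intg P (fun w => g w * dB s t j w ^+ 4) /\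
        Ex P (fun w => g w * dB s t j w ^+ 4) = Ex P g * ((t - s) ^+ 2 * gauss4)].
Proof.
move=> s0 st tT mg ig; have [sq i4 e1 e2 e4] := incr_moments BM j s0 st tT.
have mX n : measurable_fun setT (fun x : R => x ^+ n) by exact: measurable_funX.
have [j1 f1] := incr_indep_Ex BM F0i s0 st tT mg ig (@measurable_id _ _ setT) (sqi_intg sq).
have [j2 f2] := incr_indep_Ex BM F0i s0 st tT mg ig (mX 2%N) sq.2.
have [j4 f4] := incr_indep_Ex BM F0i s0 st tT mg ig (mX 4%N) i4.
rewrite e2 in f2; rewrite e4 in f4; split; split=> //.
by apply: (etrans f1); rewrite e1 mulr0.
Qed.

(** One scalar Euler step from [u] with drift [b] and noise coefficients [sg], whose [p]-th powers
    are below [Q]; [w] is a weight known at time [s]. Growth factor and source term have the form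
    required by [gronwall]. *)
Definition step_bound (p : nat) (c : R) : Prop :=
  forall s h (u b w Q : Om -> R) (sg : 'I_m -> Om -> R), 0 <= s -> 0 <= h -> s + h <= T ->
  measurable_wrt (Fi s) u -> measurable_wrt (Fi s) b -> measurable_wrt (Fi s) w ->
  (forall j, measurable_wrt (Fi s) (sg j)) -> (forall z, 0 <= w z) ->
  (forall z, b z ^+ p <= Q z) -> (forall j z, sg j z ^+ p <= Q z) ->
  intg P (fun z => w z * u z ^+ p) -> intg P (fun z => w z * Q z) ->
  let v z := u z + h * b z + \sum_j sg j z * dB s (s + h) j z in
  intg P (fun z => w z * v z ^+ p) /\
  Ex P (fun z => w z * v z ^+ p) <=
    (1 + c * h) * Ex P (fun z => w z * u z ^+ p) + c * h * Ex P (fun z => w z * Q z).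

Let mwm s : s <= T -> forall f : Om -> R, measurable_wrt (Fi s) f -> measurable_fun setT f.
Proof. by move=> sT f; exact: (mw_meas (filtration_measurable BM F0i sT)). Qed.

Let dBm s t j : 0 <= s -> s <= t -> t <= T -> measurable_fun setT (dB s t j).
Proof. by move=> *; exact: (mincr_measurable BM). Qed.

(** Expanding the square, the term linear in the noise is centred given [Fi s], and the squared
    noise is of order [h]. *)
Lemma step_bound2 : step_bound 2 (1 + T + m%:R ^+ 2 * gauss2).
Proof.
move=> s h u b w Q sg s0 h0 shT mu mb mw0 msg w0 bQ sgQ iu iQ v.
have sT : s <= T by lra.
have sF := filtration_sigma F0 B s.
have ssh : s <= s + h by lra.
have mu' := mwm sT mu; have mb' := mwm sT mb; have mw' := mwm sT mw0.
have msg' j := mwm sT (msg j).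
have mdB j : measurable_fun setT (dB s (s + h) j) by exact: dBm.
have ib : intg P (fun z => w z * b z ^+ 2).
  apply: (intg_le _ _ iQ); first by apply: measurable_funM => //; exact: measurable_funX.
  by move=> z; rewrite ger0_norm ?(mulr_ge0 _ (sqr_ge0 _))// ler_wpM2l.
have isg j : intg P (fun z => w z * sg j z ^+ 2).
  apply: (intg_le _ _ iQ); first by apply: measurable_funM => //; exact: measurable_funX.
  by move=> z; rewrite ger0_norm ?(mulr_ge0 _ (sqr_ge0 _))// ler_wpM2l.
pose a z := u z + h * b z.
have ma : measurable_wrt (Fi s) a by apply: mwD => //; exact: mwZ.
have ia j : intg P (fun z => w z * (a z * sg j z)).
  apply: (intg_le _ _ (intgD (intgD iu (intgZ (h ^+ 2) ib)) (isg j))).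
    by do 2 apply: measurable_funM => //; exact: (mwm sT ma).
  move=> z; rewrite normrM ger0_norm// (_ : _ + _ = w z * (u z ^+ 2 + h ^+ 2 * b z ^+ 2 + sg j z ^+ 2)); last by ring.
  rewrite ler_wpM2l// ler_norml; apply/andP; split; rewrite -subr_ge0 /a.
    rewrite (_ : _ - _ = (u z + sg j z / 2) ^+ 2 + (h * b z + sg j z / 2) ^+ 2 + sg j z ^+ 2 / 2); last by field.
    nonneg.
  rewrite (_ : _ - _ = (u z - sg j z / 2) ^+ 2 + (h * b z - sg j z / 2) ^+ 2 + sg j z ^+ 2 / 2); last by field.
  nonneg.
have k1 j : _ := let: And3 x _ _ := mul_dB j s0 ssh shT (mwM sF mw0 (mwM sF ma (msg j))) (ia j) in x.
have k2 j : _ := let: And3 _ x _ := mul_dB j s0 ssh shT (mwM sF mw0 (mwX sF 2 (msg j))) (isg j) in x.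
pose f1 z := (1 + h) * (w z * u z ^+ 2 + h * (w z * b z ^+ 2)).
pose f2 z := \sum_j w z * (a z * sg j z) * dB s (s + h) j z.
pose f3 z := \sum_j w z * sg j z ^+ 2 * dB s (s + h) j z ^+ 2.
have i1 : intg P f1 by apply: intgZ; apply: intgD => //; exact: intgZ.
have i2 : intg P f2 by apply: intg_sum => j; exact: (k1 j).1.
have i3 : intg P f3 by apply: intg_sum => j; exact: (k2 j).1.
have iF := intgD i1 (intgD (intgZ 2 i2) (intgZ m%:R i3)).
have vle z : w z * v z ^+ 2 <= f1 z + (2 * f2 z + m%:R * f3 z).
  have -> : f2 z = w z * (a z * \sum_j sg j z * dB s (s + h) j z).
    by rewrite !mulr_sumr; apply: eq_bigr => j _; ring.
  have -> : f3 z = w z * \sum_j (sg j z * dB s (s + h) j z) ^+ 2.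
    by rewrite !mulr_sumr; apply: eq_bigr => j _; ring.
  have -> : f1 z + (2 * (w z * (a z * \sum_j sg j z * dB s (s + h) j z)) +
      m%:R * (w z * \sum_j (sg j z * dB s (s + h) j z) ^+ 2)) =
    w z * ((1 + h) * (u z ^+ 2 + h * b z ^+ 2) + 2 * (a z * \sum_j sg j z * dB s (s + h) j z) +
      m%:R * \sum_j (sg j z * dB s (s + h) j z) ^+ 2) by rewrite /f1; ring.
  rewrite ler_wpM2l//; have := sum_sqr_le (fun j => sg j z * dB s (s + h) j z).
  have := drift_sqr_le (u z) (b z) h0; rewrite /v /a; set N := \sum_j _; lra.
have mv : measurable_fun setT v.
  apply: measurable_funD; first exact: (mwm sT ma).
  by apply: measurable_sum => j; exact: measurable_funM.
have iv : intg P (fun z => w z * v z ^+ 2).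
  apply: (intg_le _ _ iF); first by apply: measurable_funM => //; exact: measurable_funX.
  by move=> z; rewrite ger0_norm ?(mulr_ge0 _ (sqr_ge0 _)).
split=> //; apply: (le_trans (Ex_le iv iF vle)).
rewrite (ExD i1 (intgD (intgZ 2 i2) (intgZ m%:R i3))) (ExD (intgZ 2 i2) (intgZ m%:R i3)) (ExZ _ i2) (ExZ _ i3).
rewrite (ExZ _ (intgD iu (intgZ h ib))) (ExD iu (intgZ h ib)) (ExZ _ ib).
rewrite (Ex_sum _ (fun j => (k1 j).1)) (Ex_sum _ (fun j => (k2 j).1)).
(* Each cross term is an adapted factor times a centred independent increment. *)
rewrite [X in 2 * X]big1 ?mulr0 ?add0r => [|j _]; last exact: (k1 j).2.
set U := Ex P (fun z => w z * u z ^+ 2); set q := Ex P (fun z => w z * Q z).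
have bq : Ex P (fun z => w z * b z ^+ 2) <= q by apply: Ex_le => // z; rewrite ler_wpM2l.
have sq j : Ex P (fun z => w z * sg j z ^+ 2) <= q by apply: Ex_le => // z; rewrite ler_wpM2l.
have g0 := gauss2_ge0.
have hs : s + h - s = h by rewrite addrC addKr.
have h3 : \sum_j Ex P (fun z => w z * sg j z ^+ 2 * dB s (s + h) j z ^+ 2) <= m%:R * (q * (h * gauss2)).
  apply: (@le_trans _ _ (\sum_(j < m) q * (h * gauss2))); last first.
    by rewrite sumr_const card_ord mulr_natl.
  by apply: ler_sum => j _; rewrite (k2 j).2 hs ler_wpM2r// mulr_ge0.
have U0 : 0 <= U by apply: Ex_ge0 => z; rewrite mulr_ge0 ?sqr_ge0.
have q0 : 0 <= q by apply: le_trans bq; apply: Ex_ge0 => z; rewrite mulr_ge0 ?sqr_ge0.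
have hT : h <= T by lra.
have h4 := ler_wpM2l (ler0n R m) h3.
have h5 : (1 + h) * (h * Ex P (fun z => w z * b z ^+ 2)) <= (1 + T) * (h * q).
  by apply: ler_pM; rewrite ?mulr_ge0 ?Ex_ge0 ?addr_ge0// ?lerD2l// ?ler_wpM2l// => z; rewrite mulr_ge0 ?sqr_ge0.
have h6 : 0 <= (T + m%:R ^+ 2 * gauss2) * h * U.
  nonneg.
move: h4 h5 h6; rewrite mulrDr; lra.
Qed.

(** [add_pow4_le] leaves one odd term, which is centred, and even ones of order at least [h]. The
    constant [c] comes from [(1 + h)^3 <= 1 + c h] for [h <= T]. The constant [G] collects the mixed
    term: [8 m] from the expansion, [m] summands, and [1 / 2] from Young's inequality. *)
Lemma step_bound4 : let c := 3 + 3 * T + T ^+ 2 in let G := 4 * m%:R ^+ 2 * gauss2 in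
  step_bound 4 (c + G + c * G * T + (1 + c * T) * (1 + G * T) + G + 3 * m%:R ^+ 4 * gauss4 * T).
Proof.
move=> c G s h u b w Q sg s0 h0 shT mu mb mw0 msg w0 bQ sgQ iu iQ v.
have sT : s <= T by lra.
have sF := filtration_sigma F0 B s.
have ssh : s <= s + h by lra.
have mu' := mwm sT mu; have mb' := mwm sT mb; have mw' := mwm sT mw0.
have msg' j := mwm sT (msg j).
have mdB j : measurable_fun setT (dB s (s + h) j) by exact: dBm.
have ib : intg P (fun z => w z * b z ^+ 4).
  apply: (intg_le _ _ iQ); first by apply: measurable_funM => //; exact: measurable_funX.
  by move=> z; rewrite ger0_norm ?(mulr_ge0 _ (pow4_ge0 _))// ler_wpM2l.
have isg j : intg P (fun z => w z * sg j z ^+ 4).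
  apply: (intg_le _ _ iQ); first by apply: measurable_funM => //; exact: measurable_funX.
  by move=> z; rewrite ger0_norm ?(mulr_ge0 _ (pow4_ge0 _))// ler_wpM2l.
pose a z := u z + h * b z.
have ma : measurable_wrt (Fi s) a by apply: mwD => //; exact: mwZ.
have ma' := mwm sT ma.
have ale z : w z * a z ^+ 4 <= (1 + h) ^+ 3 * (w z * u z ^+ 4 + h * (w z * b z ^+ 4)).
  rewrite (_ : _ * (_ + _) = w z * ((1 + h) ^+ 3 * (u z ^+ 4 + h * b z ^+ 4))); last by ring.
  by rewrite ler_wpM2l// drift_pow4_le.
have iub := intgD iu (intgZ h ib).
have ia : intg P (fun z => w z * a z ^+ 4).
  apply: (intg_le _ _ (intgZ ((1 + h) ^+ 3) iub)).
    by apply: measurable_funM => //; exact: measurable_funX.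
  by move=> z; rewrite ger0_norm ?(mulr_ge0 _ (pow4_ge0 _)).
have ia3 j : intg P (fun z => w z * (a z ^+ 3 * sg j z)).
  apply: (intg_le _ _ (intgD ia (isg j))).
    by do 2 apply: measurable_funM => //; exact: measurable_funX.
  move=> z; rewrite normrM ger0_norm// -mulrDr ler_wpM2l// ler_norml.
  apply/andP; split; rewrite -subr_ge0.
    rewrite (_ : _ - _ = (a z ^+ 2 / 2 + a z * sg j z) ^+ 2 + (a z * sg j z - 0) ^+ 2 * 0 + (3 / 4 * (a z ^+ 2 - 2 / 3 * sg j z ^+ 2) ^+ 2 + 2 / 3 * sg j z ^+ 4)); last by field.
    nonneg.
  rewrite (_ : _ - _ = (a z ^+ 2 / 2 - a z * sg j z) ^+ 2 + (3 / 4 * (a z ^+ 2 - 2 / 3 * sg j z ^+ 2) ^+ 2 + 2 / 3 * sg j z ^+ 4)); last by field.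
  nonneg.
have le2 z j : w z * (a z ^+ 2 * sg j z ^+ 2) <= 2^-1 * (w z * a z ^+ 4 + w z * sg j z ^+ 4).
  rewrite (_ : _ * (_ + _) = w z * (2^-1 * (a z ^+ 4 + sg j z ^+ 4))); last by ring.
  rewrite ler_wpM2l// -subr_ge0 (_ : _ - _ = 2^-1 * (a z ^+ 2 - sg j z ^+ 2) ^+ 2); last by field.
  by rewrite mulr_ge0 ?sqr_ge0.
have ia2 j : intg P (fun z => w z * (a z ^+ 2 * sg j z ^+ 2)).
  apply: (intg_le _ _ (intgZ (2^-1) (intgD ia (isg j)))).
    by do 2 apply: measurable_funM => //; exact: measurable_funX.
  by move=> z; rewrite ger0_norm ?(mulr_ge0 _ (mulr_ge0 (sqr_ge0 _) (sqr_ge0 _))).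
have k1 j : _ := let: And3 x _ _ := mul_dB j s0 ssh shT (mwM sF mw0 (mwM sF (mwX sF 3 ma) (msg j))) (ia3 j) in x.
have k2 j : _ := let: And3 _ x _ := mul_dB j s0 ssh shT (mwM sF mw0 (mwM sF (mwX sF 2 ma) (mwX sF 2 (msg j)))) (ia2 j) in x.
have k4 j : _ := let: And3 _ _ x := mul_dB j s0 ssh shT (mwM sF mw0 (mwX sF 4 (msg j))) (isg j) in x.
pose f2 z := \sum_j w z * (a z ^+ 3 * sg j z) * dB s (s + h) j z.
pose f3 z := \sum_j w z * (a z ^+ 2 * sg j z ^+ 2) * dB s (s + h) j z ^+ 2.
pose f4 z := \sum_j w z * sg j z ^+ 4 * dB s (s + h) j z ^+ 4.
have i2 : intg P f2 by apply: intg_sum => j; exact: (k1 j).1.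
have i3 : intg P f3 by apply: intg_sum => j; exact: (k2 j).1.
have i4 : intg P f4 by apply: intg_sum => j; exact: (k4 j).1.
have iF34 := intgD (intgZ (8 * m%:R) i3) (intgZ (3 * m%:R ^+ 3) i4).
have iF := intgD ia (intgD (intgZ 4 i2) iF34).
have vle z : w z * v z ^+ 4 <= w z * a z ^+ 4 + (4 * f2 z + (8 * m%:R * f3 z + 3 * m%:R ^+ 3 * f4 z)).
  have -> : f2 z = w z * (a z ^+ 3 * \sum_j sg j z * dB s (s + h) j z).
    by rewrite !mulr_sumr; apply: eq_bigr => j _; ring.
  have -> : f3 z = w z * (a z ^+ 2 * \sum_j (sg j z * dB s (s + h) j z) ^+ 2).
    by rewrite !mulr_sumr; apply: eq_bigr => j _; ring.
  have -> : f4 z = w z * \sum_j (sg j z * dB s (s + h) j z) ^+ 4.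
    by rewrite !mulr_sumr; apply: eq_bigr => j _; ring.
  have := sum_sqr_le (fun j => sg j z * dB s (s + h) j z).
  have := sum_pow4_le (fun j => sg j z * dB s (s + h) j z).
  rewrite /v -/(a z); set N := \sum_j _; set N4 := \sum_j _; set N2 := \sum_j _ => hN4 hN2.
  apply: (le_trans (ler_wpM2l (w0 z) (add_pow4_le (a z) N))).
  rewrite (_ : w z * a z ^+ 4 + _ = w z * (a z ^+ 4 + 4 * (a z ^+ 3 * N) +
    8 * (a z ^+ 2 * (m%:R * N2)) + 3 * (m%:R ^+ 3 * N4))); last by ring.
  have := ler_wpM2l (sqr_ge0 (a z)) hN2 => ?.
  by rewrite ler_wpM2l//; lra.
have mv : measurable_fun setT v.
  by apply: measurable_funD => //; apply: measurable_sum => j; exact: measurable_funM.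
have iv : intg P (fun z => w z * v z ^+ 4).
  apply: (intg_le _ _ iF); first by apply: measurable_funM => //; exact: measurable_funX.
  by move=> z; rewrite ger0_norm ?(mulr_ge0 _ (pow4_ge0 _)).
split=> //; apply: (le_trans (Ex_le iv iF vle)).
rewrite (ExD ia (intgD (intgZ 4 i2) iF34)) (ExD (intgZ 4 i2) iF34) (ExZ _ i2).
rewrite (ExD (intgZ (8 * m%:R) i3) (intgZ (3 * m%:R ^+ 3) i4)) (ExZ _ i3) (ExZ _ i4).
rewrite (Ex_sum _ (fun j => (k1 j).1)) (Ex_sum _ (fun j => (k2 j).1)) (Ex_sum _ (fun j => (k4 j).1)).
rewrite [X in 4 * X]big1 ?mulr0 ?add0r => [|j _]; last exact: (k1 j).2.
set U := Ex P (fun z => w z * u z ^+ 4); set q := Ex P (fun z => w z * Q z).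
set A := Ex P (fun z => w z * a z ^+ 4).
have bq : Ex P (fun z => w z * b z ^+ 4) <= q by apply: Ex_le => // z; rewrite ler_wpM2l.
have sq j : Ex P (fun z => w z * sg j z ^+ 4) <= q by apply: Ex_le => // z; rewrite ler_wpM2l.
have g20 := gauss2_ge0; have g40 := gauss4_ge0.
have U0 : 0 <= U by apply: Ex_ge0 => z; rewrite mulr_ge0 ?pow4_ge0.
have A0 : 0 <= A by apply: Ex_ge0 => z; rewrite mulr_ge0 ?pow4_ge0.
have q0 : 0 <= q by apply: le_trans bq; apply: Ex_ge0 => z; rewrite mulr_ge0 ?pow4_ge0.
have hT : h <= T by lra.
have hs : s + h - s = h by rewrite addrC addKr.
have h3 : \sum_j Ex P (fun z => w z * (a z ^+ 2 * sg j z ^+ 2) * dB s (s + h) j z ^+ 2) <=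
    m%:R * (2^-1 * (A + q) * (h * gauss2)).
  apply: (@le_trans _ _ (\sum_(j < m) 2^-1 * (A + q) * (h * gauss2))); last first.
    by rewrite sumr_const card_ord mulr_natl.
  apply: ler_sum => j _; rewrite (k2 j).2 hs ler_wpM2r ?mulr_ge0//.
  apply: (le_trans (Ex_le (ia2 j) (intgZ (2^-1) (intgD ia (isg j))) (le2 ^~ j))).
  by rewrite (ExZ _ (intgD ia (isg j))) (ExD ia (isg j)) ler_wpM2l// lerD2l.
have h4 : \sum_j Ex P (fun z => w z * sg j z ^+ 4 * dB s (s + h) j z ^+ 4) <=
    m%:R * (q * (h ^+ 2 * gauss4)).
  apply: (@le_trans _ _ (\sum_(j < m) q * (h ^+ 2 * gauss4))); last first.
    by rewrite sumr_const card_ord mulr_natl.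
  by apply: ler_sum => j _; rewrite (k4 j).2 hs ler_wpM2r// mulr_ge0 ?sqr_ge0.
have cA : A <= (1 + c * h) * (U + h * q).
  apply: (le_trans (Ex_le ia (intgZ ((1 + h) ^+ 3) iub) ale)).
  rewrite (ExZ _ iub) (ExD iu (intgZ h ib)) (ExZ _ ib).
  have hU : 0 <= U + h * Ex P (fun z => w z * b z ^+ 4).
    by rewrite addr_ge0// mulr_ge0// Ex_ge0// => z; rewrite mulr_ge0 ?pow4_ge0.
  apply: ler_pM => //; first by rewrite exprn_ge0// addr_ge0.
    rewrite -subr_ge0 /c (_ : _ - _ = h * (3 * (T - h) + (T - h) * (T + h))); last by ring.
    nonneg.
  by rewrite lerD2l ler_wpM2l.
have c0 : 0 <= c by rewrite /c; nonneg.
have G0 : 0 <= G by rewrite /G; nonneg.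
have m0 := ler0n R m.
have h3' : 8 * m%:R * (\sum_j Ex P (fun z => w z * (a z ^+ 2 * sg j z ^+ 2) * dB s (s + h) j z ^+ 2))
   <= G * h * (A + q).
  apply: (le_trans (ler_wpM2l _ h3)); first by rewrite mulr_ge0.
  by rewrite le_eqVlt; apply/orP; left; apply/eqP; rewrite /G; field.
have h4' : 3 * m%:R ^+ 3 * (\sum_j Ex P (fun z => w z * sg j z ^+ 4 * dB s (s + h) j z ^+ 4))
   <= 3 * m%:R ^+ 4 * gauss4 * T * h * q.
  apply: (le_trans (ler_wpM2l _ h4)); first by nonneg.
  rewrite (_ : _ * (m%:R * _) = (3 * m%:R ^+ 4 * gauss4 * h * q) * h); last by ring.
  rewrite [leRHS](_ : _ = (3 * m%:R ^+ 4 * gauss4 * h * q) * T); last by ring.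
  by rewrite ler_wpM2l//; nonneg.
apply: (le_trans (lerD (lexx _) (lerD h3' h4'))).
have hA : A * (1 + G * h) <= (1 + c * h) * (U + h * q) * (1 + G * h).
  by rewrite ler_wpM2r// addr_ge0// mulr_ge0.
set g := 3 * m%:R ^+ 4 * gauss4 * T in h4' *.
have g0 : 0 <= g by rewrite /g; nonneg.
rewrite -subr_ge0.
rewrite (_ : _ - _ = ((1 + c * h) * (U + h * q) * (1 + G * h) - A * (1 + G * h)) +
  (c * G * h * (T - h) * U + ((1 + c * T) * (1 + G * T) + G + g) * h * U
  + (c * (T - h) * (1 + G * T) + (1 + c * h) * G * (T - h)) * h * q
  + (c + G + c * G * T) * h * q)); last by ring.
have Th : 0 <= T - h by rewrite subr_ge0.
have chT : 0 <= c * T by rewrite mulr_ge0.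
have cch : 0 <= c * h by rewrite mulr_ge0.
have GT : 0 <= G * T by rewrite mulr_ge0.
nonneg.
Qed.

End one_step.

(** [(1 + c h)^n <= exp (c n h)]: the bound sees only the elapsed time [n h], not the number of
    steps. *)
Lemma gronwall (R : realType) (x : nat -> R) (c e h : R) n : 0 <= c -> 0 <= e -> 0 <= h ->
  (forall k, 0 <= x k) -> (forall k, (k < n)%N -> x k.+1 <= (1 + c * h) * x k + h * e) ->
  x n <= expR (c * (n%:R * h)) * (x 0%N + n%:R * h * e).
Proof.
move=> c0 e0 h0 x0; elim: n => [|n IH] hx; first by rewrite !mul0r mulr0 expR0 mul1r addr0.
have {}IH := IH (fun k kn => hx k (ltnW kn)).
have E1 : 1 + c * h <= expR (c * h) by exact: expR_ge1Dx.
have ch : 0 <= 1 + c * h by nonneg.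
have g1 : 1 <= expR (c * (n.+1%:R * h)).
  by rewrite -[leLHS]expR0 ler_expR; nonneg.
apply: (le_trans (hx n (ltnSn n))).
have nS : n.+1%:R * h = n%:R * h + h by rewrite -natr1 mulrDl mul1r.
have -> : expR (c * (n.+1%:R * h)) * (x 0%N + n.+1%:R * h * e) =
  expR (c * h) * (expR (c * (n%:R * h)) * (x 0%N + n%:R * h * e)) + expR (c * (n.+1%:R * h)) * (h * e).
  by rewrite nS (mulrDr c) expRD; ring.
have he : 0 <= h * e by exact: mulr_ge0.
apply: lerD; last by rewrite ler_peMl.
apply: (le_trans (ler_wpM2l ch IH)); rewrite ler_wpM2r//.
by apply: mulr_ge0; [exact: expR_ge0|nonneg].
Qed.

(** * The scheme and its stability in the initial value *)

Section euler.
Context {R : realType} {disp} {Om : measurableType disp} (P : probability Om R).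
Context (T : R) {m : nat} (F0 : set (set Om)) (B : R -> Om -> 'rV[R]_m) {d : nat}.
Hypothesis T0 : 0 <= T.
Hypothesis BM : brownian_motion P T B.
Hypothesis F0i : initial_sigma_algebra P T F0 B.
Local Notation Fi := (filtration F0 B).
Local Notation V := 'rV[R]_d.

(* The index None stands for the drift and Some j for the j-th noise. *)
Variable cf : 'I_d -> option 'I_m -> V -> P2 R d -> R.
Variable K : R.
Hypothesis K0 : 0 <= K.
Hypothesis hlip : forall i o, lip_coef P (cf i o) K.
Hypothesis hexp : forall i o, exp_coef P (cf i o) K.
Hypothesis hcts : forall i o mu, continuous (fun x => cf i o x mu).

(** One step with the coefficients [Z] already evaluated. In this form the step is linear in
    [(U, Z)], so differences of iterates again satisfy such a recursion. *)
Definition vstep (s h : R) (U : Om -> V) (Z : 'I_d -> option 'I_m -> Om -> R) (w : Om) : V :=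
  \row_i (U w 0 i + h * Z i None w + \sum_j Z i (Some j) w * dB B s (s + h) j w).

(** The measure argument is the exact law of the iterate; no particle system is involved. *)
Fixpoint eul (h : R) (xi : Om -> V) (k : nat) : Om -> V :=
  if k is k'.+1 then
    vstep (k'%:R * h) h (eul h xi k') (fun i o w => cf i o (eul h xi k' w) (law P (eul h xi k')))
  else xi.

Lemma vstep_bound p c (s h : R) (U : Om -> V) (Z : 'I_d -> option 'I_m -> Om -> R) (w Q : Om -> R) : step_bound P T F0 B p c -> 0 <= c ->
  0 <= s -> 0 <= h -> s + h <= T -> measurable_wrt (Fi s) U ->
  (forall i o, measurable_wrt (Fi s) (Z i o)) -> measurable_wrt (Fi s) w -> (forall z, 0 <= w z) ->
  (forall i o z, Z i o z ^+ p <= Q z) -> (forall i, intg P (fun z => w z * U z 0 i ^+ p)) ->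
  intg P (fun z => w z * Q z) ->
  (forall i, intg P (fun z => w z * vstep s h U Z z 0 i ^+ p)) /\
  \sum_i Ex P (fun z => w z * vstep s h U Z z 0 i ^+ p) <=
    (1 + c * h) * \sum_i Ex P (fun z => w z * U z 0 i ^+ p) + d%:R * c * h * Ex P (fun z => w z * Q z).
Proof.
move=> sb c0 s0 h0 sT mU mZ mw w0 ZQ iU iQ.
have mUi := iffRL (mw_row (filtration_sigma F0 B s) U) mU.
have H i := sb s h (fun z => U z 0 i) (Z i None) w Q (fun j => Z i (Some j)) s0 h0 sT
  (mUi i) (mZ i None) mw (fun j => mZ i (Some j)) w0 (ZQ i None) (fun j => ZQ i (Some j)) (iU i) iQ.
have E i : (fun z => w z * vstep s h U Z z 0 i ^+ p) =
   (fun z => w z * (U z 0 i + h * Z i None z + \sum_j Z i (Some j) z * dB B s (s + h) j z) ^+ p).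
  by apply/funext => z; rewrite mxE.
split=> [i|]; first by rewrite E; exact: (H i).1.
apply: (@le_trans _ _ (\sum_(i < d) ((1 + c * h) * Ex P (fun z => w z * U z 0 i ^+ p) + c * h * Ex P (fun z => w z * Q z)))).
  by apply: ler_sum => i _; rewrite E; exact: (H i).2.
by rewrite le_eqVlt; apply/orP; left; apply/eqP; rewrite big_split/= -mulr_sumr sumr_const card_ord -mulr_natl; ring.
Qed.

Lemma vstep_mw (s h : R) (U : Om -> V) (Z : 'I_d -> option 'I_m -> Om -> R) : 0 <= s -> 0 <= h -> measurable_wrt (Fi s) U ->
  (forall i o, measurable_wrt (Fi s) (Z i o)) -> measurable_wrt (Fi (s + h)) (vstep s h U Z).
Proof.
move=> s0 h0 mU mZ; have sF := filtration_sigma F0 B (s + h).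
have ssh : s <= s + h by rewrite lerDl.
have sub := @filtrationS _ _ _ _ F0 B _ _ ssh.
apply: (iffLR (mw_row sF _)) => i.
rewrite (_ : (fun w => _) = (fun z => U z 0 i + h * Z i None z + \sum_j Z i (Some j) z * dB B s (s + h) j z)); last first.
  by apply/funext => z; rewrite mxE.
apply: mwD => //; first apply: mwD => //.
- by apply: (iffRL (mw_row sF U)); exact: mw_sub mU.
- by apply: mwZ => //; exact: mw_sub (mZ _ _).
apply: mw_sum => // j; apply: mwM => //; first exact: mw_sub (mZ _ _).
rewrite (_ : dB _ _ _ _ = fun w => B (s + h) w 0 j - B s w 0 j); last first.
  by apply/funext => w; rewrite /dB !mxE.
apply: mwB => //.
  by apply: (iffRL (mw_row sF _)); apply: brownian_mw; rewrite lexx andbT addr_ge0.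
by apply: (iffRL (mw_row sF _)); apply: brownian_mw; rewrite s0.
Qed.

Lemma vstepB (s h : R) U1 Z1 U2 Z2 : (fun w => vstep s h U1 Z1 w - vstep s h U2 Z2 w) =
  vstep s h (fun w => U1 w - U2 w) (fun i o w => Z1 i o w - Z2 i o w).
Proof.
apply/funext => w; apply/rowP => i; rewrite !mxE.
under [X in _ = _ + X]eq_bigr do rewrite mulrBl.
by rewrite sumrB; ring.
Qed.

Lemma vstepZ (s h a : R) U Z : (fun w => a *: vstep s h U Z w) =
  vstep s h (fun w => a *: U w) (fun i o w => a * Z i o w).
Proof.
apply/funext => w; apply/rowP => i; rewrite !mxE.
under [X in _ = _ + X]eq_bigr do rewrite -mulrA.
by rewrite -mulr_sumr; ring.
Qed.

Let c2 := 1 + T + m%:R ^+ 2 * gauss2 (R := R).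
Let c20 : 0 <= c2.
Proof. by have := gauss2_ge0 (R := R) => ?; rewrite /c2; nonneg. Qed.
Let sb2 : step_bound P T F0 B 2 c2 := step_bound2 T0 BM F0i.

Let cG := 4 * m%:R ^+ 2 * gauss2 (R := R).
Let c4' := 3 + 3 * T + T ^+ 2.
Let c4 := c4' + cG + c4' * cG * T + (1 + c4' * T) * (1 + cG * T) + cG + 3 * m%:R ^+ 4 * gauss4 (R := R) * T.
Let c40 : 0 <= c4.
Proof.
have := gauss2_ge0 (R := R) => ?; have := gauss4_ge0 (R := R) => ?.
by rewrite /c4 /c4' /cG; nonneg.
Qed.
Let sb4 : step_bound P T F0 B 4 c4 := step_bound4 T0 BM F0i.

Let F_sub k (h : R) : k%:R * h <= T -> Fi (k%:R * h) `<=` measurable.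
Proof. by move=> kT; exact: (filtration_measurable BM F0i kT). Qed.

Let tS k (h : R) : k.+1%:R * h = k%:R * h + h.
Proof. by rewrite -natr1 mulrDl mul1r. Qed.

Lemma cf_mw (G : set (set Om)) i o mu (Y : Om -> V) : sigma_algebra setT G -> measurable_wrt G Y -> measurable_wrt G (fun w => cf i o (Y w) mu).
Proof. by move=> sG mY; exact: (mw_comp sG (measurable_cts (@hcts i o mu)) mY). Qed.

(** Square integrability propagates because the Lipschitz bound, taken relative to the origin and
    the law of the constant [0], gives affine growth of the coefficients. *)
Lemma eul_ok (h : R) (xi : Om -> V) k : 0 <= h -> k%:R * h <= T -> L2 P F0 xi ->
  measurable_wrt (Fi (k%:R * h)) (eul h xi k) /\ L2v P (eul h xi k).
Proof.
move=> h0 kT /(L2_L2v _ _ (F0_measurable F0i)) [mxi sxi].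
elim: k kT => [_|k IH kT] /=; first by split=> //; rewrite mul0r; exact: mw_sub (@F0_sub_filtration _ _ _ _ F0 B 0) mxi.
have kT' : k%:R * h <= T by rewrite tS in kT; lra.
have [mY sY] := IH kT'; set Y := eul h xi k in mY sY *.
have kh0 : 0 <= k%:R * h by nonneg.
have sF := filtration_sigma F0 B (k%:R * h).
have mZ i o : measurable_wrt (Fi (k%:R * h)) (fun w => cf i o (Y w) (law P Y)) by exact: cf_mw.
have mV := vstep_mw kh0 h0 mY mZ.
rewrite tS; split=> //; apply/L2v_coord => i.
pose c0 := \sum_i \sum_o `|cf i o 0 (law P (fun=> 0))|.
pose Q w := 2 * (c0 + K * nrm P Y) ^+ 2 + 2 * K ^+ 2 * enorm (Y w) ^+ 2.
have ZQ i' o w : cf i' o (Y w) (law P Y) ^+ 2 <= Q w.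
  have := hlip i' o 0 (Y w) (L2v_cst P 0) sY.
  rewrite subr0 (_ : (fun w => Y w - 0) = Y); last by apply/funext => z; rewrite subr0.
  have h1 : `|cf i' o 0 (law P (fun=> 0))| <= c0.
    rewrite /c0 (bigD1 i')//= (bigD1 o)//= -addrA lerDl addr_ge0// sumr_ge0// => *; exact: sumr_ge0.
  set a := cf i' o 0 _ in h1 *; set b := cf i' o (Y w) _ => h2.
  have hb : `|b| <= c0 + K * nrm P Y + K * enorm (Y w).
    have := ler_normD (b - a) a; rewrite subrK; move: h1 h2; lra.
  rewrite -real_normK ?num_real//.
  apply: (@le_trans _ _ ((c0 + K * nrm P Y + K * enorm (Y w)) ^+ 2)); first by rewrite lerXn2r ?nnegrE// (le_trans _ hb).
  rewrite -subr_ge0 /Q (_ : _ - _ = (c0 + K * nrm P Y - K * enorm (Y w)) ^+ 2) ?sqr_ge0//; ring.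
have iQ : intg P (fun z => 1 * Q z).
  under eq_fun do rewrite mul1r; apply: intgD; first exact: intg_cst.
  exact: (intgZ _ sY.2).
have iU i' : intg P (fun z => 1 * Y z 0 i' ^+ 2).
  by under eq_fun do rewrite mul1r; exact: ((iffLR (L2v_coord _ _) sY) i').2.
have shT : k%:R * h + h <= T by rewrite -tS.
have [iV _] := vstep_bound sb2 c20 kh0 h0 shT mY mZ (mw_cst sF (1 : R)) (fun=> ler01) ZQ iU iQ.
split; first by apply: (measurableT_comp (measurable_coord i)); apply: mw_meas mV; rewrite -tS; exact: F_sub.
by have := iV i; under eq_fun do rewrite mul1r.
Qed.

Section differences.
Variables (h : R) (xi xi' : Om -> V).
Hypotheses (h0 : 0 <= h) (lxi : L2 P F0 xi) (lxi' : L2 P F0 xi').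

Let D k w := eul h xi' k w - eul h xi k w.
Let Z k i o w := cf i o (eul h xi' k w) (law P (eul h xi' k)) - cf i o (eul h xi k w) (law P (eul h xi k)).

Let DS k : D k.+1 = vstep (k%:R * h) h (D k) (Z k).
Proof. by rewrite /D /= vstepB. Qed.

Let D_ok k : k%:R * h <= T -> measurable_wrt (Fi (k%:R * h)) (D k) /\ L2v P (D k).
Proof.
move=> kT; have [m1 s1] := eul_ok h0 kT lxi; have [m2 s2] := eul_ok h0 kT lxi'.
have sF := filtration_sigma F0 B (k%:R * h).
split; last exact: L2vB.
apply: (iffLR (mw_row sF _)) => j.
rewrite (_ : (fun w => _) = (fun w => eul h xi' k w 0 j - eul h xi k w 0 j)).
  by apply: mwB => //; apply: (iffRL (mw_row sF _)).
by apply/funext => w; rewrite /D !mxE.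
Qed.

Let Z_mw k i o : k%:R * h <= T -> measurable_wrt (Fi (k%:R * h)) (Z k i o).
Proof.
move=> kT; have [m1 s1] := eul_ok h0 kT lxi; have [m2 s2] := eul_ok h0 kT lxi'.
have sF := filtration_sigma F0 B (k%:R * h).
by apply: mwB => //; exact: cf_mw.
Qed.

Let Z_le k i o w : k%:R * h <= T -> `|Z k i o w| <= K * (enorm (D k w) + nrm P (D k)).
Proof.
move=> kT; have [_ s1] := eul_ok h0 kT lxi; have [_ s2] := eul_ok h0 kT lxi'.
exact: hlip.
Qed.

(** Depends on the horizon and on [K] but not on the step, so that [eul_lip] survives the passage to
    the limit. *)
Definition lipC : R := expR ((c2 + d%:R * c2 * (4 * K ^+ 2)) * T).

Lemma eul_lip k : k%:R * h <= T -> nrm2 P (D k) <= lipC * nrm2 P (D 0).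
Proof.
move=> kT; pose c := c2 + d%:R * c2 * (4 * K ^+ 2).
have c0 : 0 <= c by rewrite /c; nonneg.
have step j : (j < k)%N -> nrm2 P (D j.+1) <= (1 + c * h) * nrm2 P (D j) + h * 0.
  move=> jk; have jT : j.+1%:R * h <= T.
    by apply: le_trans kT; rewrite ler_wpM2r// ler_nat.
  have jT' : j%:R * h <= T by apply: le_trans jT; rewrite tS lerDl.
  have [mD sD] := D_ok jT'; have [_ sD'] := D_ok jT.
  have kh0 : 0 <= j%:R * h by nonneg.
  have sF := filtration_sigma F0 B (j%:R * h).
  pose Q w := 2 * K ^+ 2 * (enorm (D j w) ^+ 2 + nrm2 P (D j)).
  have ZQ i o w : Z j i o w ^+ 2 <= Q w.
    have hb := Z_le i o w jT'.
    rewrite -real_normK ?num_real//.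
    apply: (@le_trans _ _ ((K * (enorm (D j w) + nrm P (D j))) ^+ 2)).
      by rewrite lerXn2r ?nnegrE// (le_trans _ hb).
    rewrite -subr_ge0 /Q -nrm_sqr (_ : _ - _ = (K * (enorm (D j w) - nrm P (D j))) ^+ 2) ?sqr_ge0//; ring.
  have iQ' := intgZ (2 * K ^+ 2) (intgD sD.2 (intg_cst P (nrm2 P (D j)))).
  have iQ : intg P (fun z => 1 * Q z) by under eq_fun do rewrite mul1r.
  have iU i' : intg P (fun z => 1 * D j z 0 i' ^+ 2).
    by under eq_fun do rewrite mul1r; exact: ((iffLR (L2v_coord _ _) sD) i').2.
  have shT : j%:R * h + h <= T by rewrite -tS.
  have [_] := vstep_bound sb2 c20 kh0 h0 shT mD (fun i o => Z_mw i o jT') (mw_cst sF (1 : R)) (fun=> ler01) ZQ iU iQ.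
  rewrite -DS; have E f : (fun z => 1 * f z) = f :> (Om -> R) by apply/funext => z; rewrite mul1r.
  under eq_bigr do rewrite E; under [X in _ <= _ * X + _]eq_bigr do rewrite E.
  rewrite E -!nrm2_sum// => /le_trans; apply.
  rewrite (ExZ _ (intgD sD.2 (intg_cst P (nrm2 P (D j))))) (ExD sD.2 (intg_cst P _)) Ex_cst -/(nrm2 P (D j)).
  by rewrite le_eqVlt; apply/orP; left; apply/eqP; rewrite /c; ring.
have := gronwall c0 (lexx 0) h0 (fun k => nrm2_ge0 P (D k)) step.
rewrite mulr0 addr0 => /le_trans; apply; rewrite ler_wpM2r ?nrm2_ge0// ler_expR.
by rewrite ler_wpM2l.
Qed.

Variable w : Om -> R.
Hypotheses (mw : measurable_wrt F0 w) (w0 : forall z, 0 <= w z) (iw : intg P w).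
Hypothesis iw4 : intg P (fun z => w z * enorm (D 0 z) ^+ 4).

Definition q4C : R := expR ((c4 + d%:R * c4 * (8 * K ^+ 4) * d%:R) * T) *
  (1 + T * (d%:R * c4 * (8 * K ^+ 4) * lipC ^+ 2)).

Lemma sum_pow4_enorm (x : V) : \sum_j x 0 j ^+ 4 <= enorm x ^+ 4.
Proof.
rewrite [leRHS](exprM _ 2 2) enorm_sqr [leRHS]expr2 mulr_suml; apply: ler_sum => j _.
rewrite (exprM _ 2 2) expr2 ler_wpM2l ?sqr_ge0// (bigD1 j)//= lerDl.
by apply: sumr_ge0 => i _; exact: sqr_ge0.
Qed.

Lemma enorm_pow4_le (x : V) : enorm x ^+ 4 <= d%:R * \sum_j x 0 j ^+ 4.
Proof.
rewrite (exprM _ 2 2) enorm_sqr; apply: (le_trans (sum_sqr_le _)).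
by rewrite (eq_bigr (fun j => x 0 j ^+ 4))// => j _; rewrite -exprM.
Qed.

(** The difference enters the coefficients pointwise and through its L2 norm. The latter is
    deterministic and already bounded by [eul_lip]; it meets the weight only through the mean of
    [w], whence the second term on the right. *)
Lemma eul_pow4 k : k%:R * h <= T ->
  (forall i, intg P (fun z => w z * D k z 0 i ^+ 4)) /\
  \sum_i Ex P (fun z => w z * D k z 0 i ^+ 4) <=
    q4C * (Ex P (fun z => w z * enorm (D 0 z) ^+ 4) + nrm2 P (D 0) ^+ 2 * Ex P w).
Proof.
have mwm := mw_meas (F0_measurable F0i) mw.
pose e := d%:R * c4 * (8 * K ^+ 4) * ((lipC * nrm2 P (D 0)) ^+ 2 * Ex P w).
pose c := c4 + d%:R * c4 * (8 * K ^+ 4) * d%:R.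
have Ew0 : 0 <= Ex P w by exact: Ex_ge0.
have lip0 : 0 <= lipC by exact: expR_ge0.
have c0 : 0 <= c by rewrite /c; nonneg.
have e0 : 0 <= e by rewrite /e; nonneg.
pose q j := \sum_i Ex P (fun z => w z * D j z 0 i ^+ 4).
have q0 j : 0 <= q j by apply: sumr_ge0 => i _; apply: Ex_ge0 => z; exact: mulr_ge0 (w0 z) (pow4_ge0 _).
have step j : j.+1%:R * h <= T -> (forall i, intg P (fun z => w z * D j z 0 i ^+ 4)) ->
    (forall i, intg P (fun z => w z * D j.+1 z 0 i ^+ 4)) /\ q j.+1 <= (1 + c * h) * q j + h * e.
  move=> jT iU; have jT' : j%:R * h <= T by apply: le_trans jT; rewrite tS lerDl.
  have [mD sD] := D_ok jT'.
  have kh0 : 0 <= j%:R * h by nonneg.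
  have sF := filtration_sigma F0 B (j%:R * h).
  have mwF : measurable_wrt (Fi (j%:R * h)) w by exact: mw_sub (@F0_sub_filtration _ _ _ _ F0 B _) mw.
  pose Q z := 8 * K ^+ 4 * (d%:R * \sum_i D j z 0 i ^+ 4 + nrm2 P (D j) ^+ 2).
  have ZQ i o z : Z j i o z ^+ 4 <= Q z.
    have hb := Z_le i o z jT'.
    have -> : Z j i o z ^+ 4 = `|Z j i o z| ^+ 4.
      by rewrite (exprM _ 2 2) [RHS](exprM _ 2 2) real_normK ?num_real.
    apply: (@le_trans _ _ ((K * (enorm (D j z) + nrm P (D j))) ^+ 4)).
      by rewrite lerXn2r ?nnegrE// (le_trans _ hb).
    apply: (@le_trans _ _ (8 * K ^+ 4 * (enorm (D j z) ^+ 4 + nrm2 P (D j) ^+ 2))).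
      rewrite -nrm_sqr -(exprM _ 2 2) exprMn [leRHS](_ : _ = K ^+ 4 * (8 * (enorm (D j z) ^+ 4 + nrm P (D j) ^+ 4))); last by ring.
      rewrite ler_wpM2l ?pow4_ge0//; have := drift_pow4_le (enorm (D j z)) (nrm P (D j)) ler01.
      by rewrite !mul1r (_ : (1 + 1) ^+ 3 = 8 :> R)//; ring.
    rewrite ler_wpM2l//; first by nonneg.
    by rewrite lerD2r enorm_pow4_le.
  have D40 z : 0 <= \sum_i D j z 0 i ^+ 4 by apply: sumr_ge0 => i _; exact: pow4_ge0.
  have iS : intg P (fun z => \sum_i w z * D j z 0 i ^+ 4) by exact: intg_sum.
  have QE : (fun z => w z * Q z) = (fun z => 8 * K ^+ 4 * (d%:R * (\sum_i w z * D j z 0 i ^+ 4) + nrm2 P (D j) ^+ 2 * w z)).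
    by apply/funext => z; rewrite /Q -mulr_sumr; ring.
  have iQ' := intgD (intgZ d%:R iS) (intgZ (nrm2 P (D j) ^+ 2) iw).
  have iQ : intg P (fun z => w z * Q z) by rewrite QE; exact: intgZ.
  have shT : j%:R * h + h <= T by rewrite -tS.
  have [iV hV] := vstep_bound sb4 c40 kh0 h0 shT mD (fun i o => Z_mw i o jT') mwF w0 ZQ iU iQ.
  rewrite -DS in iV hV; split=> //; apply: (le_trans hV).
  rewrite QE (ExZ _ iQ') (ExD (intgZ d%:R iS) (intgZ _ iw)) (ExZ _ iS) (ExZ _ iw) Ex_sum// -/(q j).
  have h1 : nrm2 P (D j) ^+ 2 <= (lipC * nrm2 P (D 0)) ^+ 2.
    by rewrite lerXn2r ?nnegrE ?eul_lip//; nonneg.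
  have h2 := ler_wpM2r Ew0 h1.
  have h3 : d%:R * c4 * h * (8 * K ^+ 4) * (nrm2 P (D j) ^+ 2 * Ex P w) <=
    d%:R * c4 * h * (8 * K ^+ 4) * ((lipC * nrm2 P (D 0)) ^+ 2 * Ex P w).
    by apply: ler_wpM2l => //; nonneg.
  rewrite -subr_ge0; move: h3; rewrite -subr_ge0 => /le_trans; apply; rewrite le_eqVlt; apply/orP; left; apply/eqP.
  by rewrite /e /c; ring.
have iU0 i : intg P (fun z => w z * D 0 z 0 i ^+ 4).
  have d0 : 0%:R * h <= T by rewrite mul0r.
  have [mD sD] := D_ok d0; apply: (intg_le _ _ iw4).
    apply: measurable_funM => //; apply: measurable_funX.
    exact: (measurableT_comp (measurable_coord i) sD.1).
  move=> z; rewrite ger0_norm ?(mulr_ge0 (w0 z) (pow4_ge0 _))// ler_wpM2l//.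
  apply: le_trans (sum_pow4_enorm _); rewrite (bigD1 i)//= lerDl.
  by apply: sumr_ge0 => *; exact: pow4_ge0.
move=> kT.
have iU j : (j <= k)%N -> forall i, intg P (fun z => w z * D j z 0 i ^+ 4).
  elim: j => [//|j IH] jk; apply: (step j _ (IH (ltnW jk))).1.
  by apply: le_trans kT; rewrite ler_wpM2r// ler_nat.
split; first exact: iU.
have := @gronwall _ q c e h k c0 e0 h0 q0.
have /[swap]/[apply] : forall j, (j < k)%N -> q j.+1 <= (1 + c * h) * q j + h * e.
  move=> j jk; apply: (step j _ (iU j (ltnW jk))).2.
  by apply: le_trans kT; rewrite ler_wpM2r// ler_nat.
move=> /le_trans; apply.
set A := Ex P (fun z => w z * enorm (D 0 z) ^+ 4); set N := nrm2 P (D 0).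
have q0A : q 0%N <= A.
  rewrite /q -Ex_sum//; apply: Ex_le => //; first exact: intg_sum.
  by move=> z; rewrite -mulr_sumr ler_wpM2l// sum_pow4_enorm.
have A0 : 0 <= A by apply: Ex_ge0 => z; rewrite mulr_ge0 ?pow4_ge0.
have N0 : 0 <= N by exact: nrm2_ge0.
have khT : k%:R * h * e <= T * e by rewrite ler_wpM2r.
rewrite /q4C -[leRHS]mulrA; apply: ler_pM; first exact: expR_ge0.
- by apply: addr_ge0; [exact: q0|nonneg].
- by rewrite ler_expR ler_wpM2l.
apply: (le_trans (lerD q0A khT)).
have NE : 0 <= N ^+ 2 * Ex P w by nonneg.
set g := T * (d%:R * c4 * (8 * K ^+ 4) * lipC ^+ 2).
have g0 : 0 <= g by rewrite /g; nonneg.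
have -> : T * e = g * (N ^+ 2 * Ex P w) by rewrite /e /g -/N; ring.
by have := mulr_ge0 g0 A0; rewrite mulrDr !mulrDl !mul1r; lra.
Qed.

End differences.
End euler.

Lemma sqr6_le (R : realType) (a b c d e f : R) :
  (a + b + (c + d) + (e + f)) ^+ 2 <= 8 * (a ^+ 2 + b ^+ 2 + c ^+ 2 + d ^+ 2 + e ^+ 2 + f ^+ 2).
Proof.
have := sqr_ge0 (a - b); have := sqr_ge0 (c - d); have := sqr_ge0 (e - f).
have := sqr_ge0 ((a + b) - (c + d)); have := sqr_ge0 ((a + b) - (e + f)).
have := sqr_ge0 ((c + d) - (e + f)).
have := sqr_ge0 a; have := sqr_ge0 b; have := sqr_ge0 c; have := sqr_ge0 d; have := sqr_ge0 e; have := sqr_ge0 f.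
lra.
Qed.

(** The linear arithmetic of one step of [eul_hom]: [r] stands for the weighted square of the
    remainder, [S1] and [S2] for weighted fourth moments, [E] for the mean of the weight. *)
Lemma hom_arith (R : realType) (dd q L N e2 b1 b2 t2 t4 E r S1 S2 : R) :
  dd * S1 <= dd * (q * (2 * t4 * N)) -> t2 * dd * S2 <= t2 * dd * (q * (2 * N)) ->
  t2 * (b2 * E) <= t2 * (L * N) -> (2 * dd * q + L) * N * t4 <= (2 * dd * q + L) * N * t2 ->
  e2 * E <= 2 * r -> b1 * E <= L * t4 * N ->
  r + (dd * S1 + (t2 * dd * S2 + (e2 + b1 + t2 * b2) * E)) <= 3 * r + 2 * (2 * dd * q + L) * (t2 * N).
Proof. move=> *; lra. Qed.

(** * Asymptotic homogeneity of the scheme in the perturbation *)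

Section homogeneity.
Context {R : realType} {disp} {Om : measurableType disp} (P : probability Om R).
Context (T : R) {m : nat} (F0 : set (set Om)) (B : R -> Om -> 'rV[R]_m) {d : nat}.
Hypothesis T0 : 0 <= T.
Hypothesis BM : brownian_motion P T B.
Hypothesis F0i : initial_sigma_algebra P T F0 B.
Local Notation Fi := (filtration F0 B).
Local Notation V := 'rV[R]_d.
Variable cf : 'I_d -> option 'I_m -> V -> P2 R d -> R.
Variable K : R.
Hypothesis K0 : 0 <= K.
Hypothesis hlip : forall i o, lip_coef P (cf i o) K.
Hypothesis hexp : forall i o, exp_coef P (cf i o) K.
Hypothesis hcts : forall i o mu, continuous (fun x => cf i o x mu).
Local Notation eul := (eul P B cf).

Section weight.
Variable eta : Om -> V.
Hypotheses (leta : L2 P F0 eta) (N0 : 0 < nrm2 P eta).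
Let N := nrm2 P eta.
Let v z := enorm (eta z) ^+ 2 + N.

(* A weight depending on [eta] only replaces conditioning on [F0]: it makes the fourth moments finite for
   [eta] merely square-integrable. *)
Definition wt (z : Om) : R := (v z)^-1.

Let seta : L2v P eta.
Proof. by case: (iffLR (L2_L2v _ _ (F0_measurable F0i)) leta). Qed.

Let v0 z : 0 < v z. Proof. by rewrite /v ltr_wpDl ?sqr_ge0. Qed.

Lemma wt_ge0 z : 0 <= wt z. Proof. by rewrite /wt invr_ge0 ltW. Qed.

Lemma wt_mw : measurable_wrt F0 wt.
Proof.
have sF := F0_sigma F0i; have [meta _] := iffLR (L2_L2v _ _ (F0_measurable F0i)) leta.
rewrite (_ : wt = fun z => v z `^ (-1)); last by apply/funext => z; rewrite /wt powR_inv1// ltW.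
apply: (mw_comp sF (measurable_powR (-1))); apply: mwD => //; last exact: mw_cst.
by apply: mwX => //; apply: (mw_comp sF (@measurable_enorm _ _ _)).
Qed.

Lemma wt_le z : wt z <= N^-1.
Proof. by rewrite /wt lef_pV2 ?posrE// /v lerDr sqr_ge0. Qed.

Lemma wt_sqr_le z : wt z * enorm (eta z) ^+ 2 <= 1.
Proof. by rewrite /wt mulrC ler_pdivrMr// mul1r /v lerDl ltW. Qed.

Lemma wt_intg : intg P wt.
Proof.
apply: (intg_le _ _ (intg_cst P N^-1)); first exact: mw_meas (F0_measurable F0i) wt_mw.
by move=> z; rewrite ger0_norm ?wt_ge0 ?wt_le.
Qed.

Lemma wt_Ex : Ex P wt <= N^-1.
Proof. by rewrite -[leRHS](Ex_cst P); apply: Ex_le => [||z]; [exact: wt_intg|exact: intg_cst|exact: wt_le]. Qed.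

(** [wt z * enorm (eta z) ^+ 2 <= 1] trades two of the four powers for the weight. *)
Lemma wt_pow4 (t : R) : intg P (fun z => wt z * enorm (t *: eta z) ^+ 4) /\
  Ex P (fun z => wt z * enorm (t *: eta z) ^+ 4) <= t ^+ 4 * N.
Proof.
have i2 := intgZ (t ^+ 4) seta.2.
have h z : wt z * enorm (t *: eta z) ^+ 4 <= t ^+ 4 * enorm (eta z) ^+ 2.
  rewrite enormZ exprMn (_ : `|t| ^+ 4 = t ^+ 4); last first.
    by rewrite (exprM _ 2 2) [RHS](exprM _ 2 2) real_normK ?num_real.
  rewrite mulrCA ler_wpM2l ?pow4_ge0// (exprD _ 2 2) mulrA.
  by rewrite -[leRHS]mul1r ler_wpM2r ?sqr_ge0// wt_sqr_le.
have i4 : intg P (fun z => wt z * enorm (t *: eta z) ^+ 4).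
  apply: (intg_le _ _ i2).
    apply: measurable_funM; first exact: mw_meas (F0_measurable F0i) wt_mw.
    by apply: measurable_funX; apply: measurable_enormf; exact: (L2vZ t seta).1.
  by move=> z; rewrite ger0_norm ?(mulr_ge0 (wt_ge0 _) (pow4_ge0 _)).
by split=> //; rewrite -(ExZ _ seta.2); apply: Ex_le.
Qed.

(** Cauchy-Schwarz for the factors [sqrt wt * |X|] and [1 / sqrt wt]; the second has squared norm
    [E v = 2 N]. This is how weighted squares return to a plain L1 norm. *)
Lemma wt_CS (X : Om -> V) : L2v P X -> (forall i, intg P (fun z => wt z * X z 0 i ^+ 2)) ->
  Ex P (fun z => enorm (X z)) ^+ 2 <= (\sum_i Ex P (fun z => wt z * X z 0 i ^+ 2)) * (2 * N).
Proof.
move=> sX iX.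
have mwt : measurable_fun setT wt by exact: mw_meas (F0_measurable F0i) wt_mw.
have msq (f : Om -> R) : measurable_fun setT f -> measurable_fun setT (fun z => Num.sqrt (f z)).
  by apply: measurableT_comp; apply: continuous_measurable_fun; exact: sqrt_continuous.
have sE : (fun z => \sum_i wt z * X z 0 i ^+ 2) = (fun z => (Num.sqrt (wt z) * enorm (X z)) ^+ 2).
  by apply/funext => z; rewrite exprMn sqr_sqrtr ?wt_ge0// enorm_sqr mulr_sumr.
have vE : v = (fun z => Num.sqrt (v z) ^+ 2).
  by apply/funext => z; rewrite sqr_sqrtr// ltW.
have iv : intg P v by exact: (intgD seta.2 (intg_cst _ _)).
have s1 : sqi P (fun z => Num.sqrt (wt z) * enorm (X z)).
  split; first by apply: measurable_funM; [exact: msq|exact: measurable_enormf sX.1].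
  by rewrite -sE; exact: intg_sum.
have s2 : sqi P (fun z => Num.sqrt (v z)).
  by split; [exact: msq (intg_meas iv)|rewrite -vE].
have := CauchySchwarz s1 s2; rewrite -sE -vE Ex_sum//.
have -> : (fun z => Num.sqrt (wt z) * enorm (X z) * Num.sqrt (v z)) = (fun z => enorm (X z)).
  apply/funext => z; rewrite mulrAC -sqrtrM ?wt_ge0// /wt mulVf ?gt_eqF// sqrtr1 mul1r//.
rewrite (ExD seta.2 (intg_cst _ _)) Ex_cst -/(nrm2 P eta) -/N => h.
have e0 : 0 <= Ex P (fun z => enorm (X z)) by apply: Ex_ge0 => z; exact: enorm_ge0.
rewrite ger0_norm// -sqrtrM in h; last first.
  by apply: sumr_ge0 => i _; apply: Ex_ge0 => z; exact: mulr_ge0 (wt_ge0 _) (sqr_ge0 _).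
have r0 : 0 <= (\sum_i Ex P (fun z => wt z * X z 0 i ^+ 2)) * (N + N).
  apply: mulr_ge0; last by apply: addr_ge0; exact: ltW.
  by apply: sumr_ge0 => i _; apply: Ex_ge0 => z; exact: mulr_ge0 (wt_ge0 _) (sqr_ge0 _).
rewrite mulr2n mulrDl mul1r -(sqr_sqrtr r0) lerXn2r ?nnegrE ?sqrtr_ge0//.
Qed.

End weight.

Let c2 := 1 + T + m%:R ^+ 2 * gauss2 (R := R).
Let c20 : 0 <= c2.
Proof. by have := gauss2_ge0 (R := R) => ?; rewrite /c2; nonneg. Qed.
Let lC : R := @lipC R T m d K.
Let qC : R := @q4C R T m d K.
Let lC0 : 0 <= lC. Proof. exact: expR_ge0. Qed.
Let qC0 : 0 <= qC.
Proof.
have := gauss2_ge0 (R := R) => ?; have := gauss4_ge0 (R := R) => ?.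
by apply: mulr_ge0; [exact: expR_ge0|nonneg].
Qed.
Let A0 : R := 2 * d%:R * qC + lC ^+ 2.
Let c' : R := c2 + d%:R * c2 * (8 * K ^+ 2) * 3.
(** Of the form [2 x + 1], where [x] is the Gronwall constant for the weighted square: its square
    dominates the [2 x] produced by [wt_CS], and no square root has to be carried along. *)
Definition homC : R := 2 * (expR (c' * T) * (T * (16 * d%:R * c2 * K ^+ 2 * A0))) + 1.

Lemma homC_ge0 : 0 <= homC.
Proof.
rewrite /homC /A0; have := expR_ge0 (c' * T) => ?; nonneg.
Qed.

Lemma L2_addZ (xi eta : Om -> V) t : L2 P F0 xi -> L2 P F0 eta -> L2 P F0 (fun w => xi w + t *: eta w).
Proof.
have sF := F0_sigma F0i; have Fm := F0_measurable F0i.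
move=> /(L2_L2v _ _ Fm)[m1 s1] /(L2_L2v _ _ Fm)[m2 s2]; apply/(L2_L2v _ _ Fm); split; last exact: L2vD s1 (L2vZ t s2).
apply: (iffLR (mw_row sF _)) => j.
rewrite (_ : (fun w => _) = (fun w => xi w 0 j + t * eta w 0 j)); last by apply/funext => w; rewrite !mxE.
by apply: mwD => //; [|apply: mwZ => //]; apply: (iffRL (mw_row sF _)).
Qed.

(** The remainder [Rr = D1 - t D2] starts at [0] and solves a recursion whose source, by [exp_coef],
    is linear in [Rr] plus quadratic in [D1] and [D2]. With [eul_pow4] its weighted square is of
    order [t^2 N], and [wt_CS] turns this into [t N] in L1. The L1 norm [e] of [Rr], present in the
    source through the measure argument, is itself reduced to the weighted square by [wt_CS]. *)
Lemma eul_hom (xi eta : Om -> V) (t h : R) (k : nat) : L2 P F0 xi -> L2 P F0 eta -> 0 < nrm2 P eta ->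
  0 <= t <= 1 -> 0 <= h -> k%:R * h <= T ->
  Ex P (fun w => enorm ((eul h (fun w => xi w + t *: eta w) k w - eul h xi k w) -
     t *: (eul h (fun w => xi w + 1 *: eta w) k w - eul h xi k w))) <= homC * t * nrm2 P eta.
Proof.
move=> lxi leta N0 /andP[t0 t1] h0 kT.
have l1 := L2_addZ t lxi leta; have l2 := L2_addZ 1 lxi leta.
set xi1 := fun w => xi w + t *: eta w; set xi2 := fun w => xi w + 1 *: eta w.
set N := nrm2 P eta.
have seta : L2v P eta by case: (iffLR (L2_L2v _ _ (F0_measurable F0i)) leta).
pose w := wt eta.
have w0 z : 0 <= w z by exact: wt_ge0.
have mw : measurable_wrt F0 w by exact: wt_mw.
have iw : intg P w by exact: wt_intg.
have Ew : Ex P w <= N^-1 by exact: wt_Ex.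
have Ew0 : 0 <= Ex P w by exact: Ex_ge0.
pose D1 k w := eul h xi1 k w - eul h xi k w.
pose D2 k w := eul h xi2 k w - eul h xi k w.
pose Rr k w := D1 k w - t *: D2 k w.
pose ev x k i o w := cf i o (eul h x k w) (law P (eul h x k)).
pose Z k i o w := (ev xi1 k i o w - ev xi k i o w) - t * (ev xi2 k i o w - ev xi k i o w).
have tS j : j.+1%:R * h = j%:R * h + h by rewrite -natr1 mulrDl mul1r.
have RS j : Rr j.+1 = vstep B (j%:R * h) h (Rr j) (Z j).
  rewrite /Rr (_ : D1 j.+1 = vstep B (j%:R * h) h (D1 j) (fun i o w => ev xi1 j i o w - ev xi j i o w)); last first.
    by rewrite /D1 /= vstepB.
  rewrite (_ : D2 j.+1 = vstep B (j%:R * h) h (D2 j) (fun i o w => ev xi2 j i o w - ev xi j i o w)); last first.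
    by rewrite /D2 /= vstepB.
  rewrite (_ : (fun z => vstep B (j%:R * h) h (D1 j) _ z - _) = (fun z => vstep B (j%:R * h) h (D1 j)
     (fun i o w => ev xi1 j i o w - ev xi j i o w) z - vstep B (j%:R * h) h (fun w => t *: D2 j w)
     (fun i o w => t * (ev xi2 j i o w - ev xi j i o w)) z)); first by rewrite vstepB.
  by apply/funext => z; rewrite -[in RHS]vstepZ.
have d10 : D1 0 = (fun w => t *: eta w) by apply/funext => z; rewrite /D1 /= /xi1 addrC addKr.
have d20 : D2 0 = (fun w => 1 *: eta w) by apply/funext => z; rewrite /D2 /= /xi2 addrC addKr.
have [iw1 Ew1] := wt_pow4 leta N0 t; have [iw2 Ew2] := wt_pow4 leta N0 1.
have ok j : j%:R * h <= T -> [/\ measurable_wrt (Fi (j%:R * h)) (eul h xi j), measurable_wrt (Fi (j%:R * h)) (eul h xi1 j),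
   measurable_wrt (Fi (j%:R * h)) (eul h xi2 j) & [/\ L2v P (eul h xi j), L2v P (D1 j) & L2v P (D2 j)]].
  move=> jT; have [m3 s3] := eul_ok T0 BM F0i hlip hcts h0 jT lxi.
  have [m4 s4] := eul_ok T0 BM F0i hlip hcts h0 jT l1.
  have [m5 s5] := eul_ok T0 BM F0i hlip hcts h0 jT l2.
  by split=> //; split=> //; exact: L2vB.
have nD1 j : j%:R * h <= T -> nrm2 P (D1 j) <= lC * (t ^+ 2 * N).
  move=> jT; have := eul_lip T0 BM F0i hlip hcts h0 lxi l1 jT.
  by rewrite -/(D1 j) -/(D1 0) d10 nrm2Z.
have nD2 j : j%:R * h <= T -> nrm2 P (D2 j) <= lC * N.
  move=> jT; have := eul_lip T0 BM F0i hlip hcts h0 lxi l2 jT.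
  by rewrite -/(D2 j) -/(D2 0) d20 nrm2Z// expr1n mul1r.
have NV : N * N^-1 = 1 by rewrite mulfV// gt_eqF.
have iw1' : intg P (fun z => w z * enorm (D1 0 z) ^+ 4) by rewrite d10.
have iw2' : intg P (fun z => w z * enorm (D2 0 z) ^+ 4) by rewrite d20.
have sqE (y : R) : 0 <= y -> y ^+ 2 * Ex P w <= y ^+ 2 * N^-1 by move=> y0; rewrite ler_wpM2l ?sqr_ge0.
have q1 j : j%:R * h <= T -> (forall i, intg P (fun z => w z * D1 j z 0 i ^+ 4)) /\
    \sum_i Ex P (fun z => w z * D1 j z 0 i ^+ 4) <= qC * (2 * t ^+ 4 * N).
  move=> jT; have [i1 hq] := eul_pow4 T0 BM F0i hlip hcts h0 lxi l1 mw w0 iw iw1' jT.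
  split=> //; apply: (le_trans hq); rewrite ler_wpM2l// -/(D1 0) d10 nrm2Z//.
  rewrite (_ : 2 * t ^+ 4 * N = t ^+ 4 * N + t ^+ 4 * N); last by ring.
  apply: lerD.
    apply: (le_trans _ Ew1); rewrite le_eqVlt; apply/orP; left; apply/eqP.
    by congr Ex; apply/funext => z; have /(congr1 (fun f => f z)) <- := d10.
  apply: (le_trans (sqE _ (mulr_ge0 (sqr_ge0 t) (ltW N0)))).
  rewrite -/N (_ : (t ^+ 2 * N) ^+ 2 * N^-1 = t ^+ 4 * N * (N * N^-1)); last by ring.
  by rewrite NV mulr1.
have q2 j : j%:R * h <= T -> (forall i, intg P (fun z => w z * D2 j z 0 i ^+ 4)) /\
    \sum_i Ex P (fun z => w z * D2 j z 0 i ^+ 4) <= qC * (2 * N).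
  move=> jT; have [i1 hq] := eul_pow4 T0 BM F0i hlip hcts h0 lxi l2 mw w0 iw iw2' jT.
  split=> //; apply: (le_trans hq); rewrite ler_wpM2l// -/(D2 0) d20 nrm2Z// expr1n mul1r.
  rewrite expr1n mul1r in Ew2; rewrite mulr2n mulrDl mul1r; apply: lerD.
    apply: (le_trans _ Ew2); rewrite le_eqVlt; apply/orP; left; apply/eqP.
    by congr Ex; apply/funext => z; have /(congr1 (fun f => f z)) <- := d20.
  apply: (le_trans (sqE _ (ltW N0))).
  rewrite -/N (_ : N ^+ 2 * N^-1 = N * (N * N^-1)); last by ring.
  by rewrite NV mulr1.
have sqle (x y : R) : 0 <= x -> x <= y -> x ^+ 2 * Ex P w <= y ^+ 2 * N^-1.
  move=> x0 xy; apply: (le_trans (sqE _ x0)); apply: ler_wpM2r; first by rewrite invr_ge0 ltW.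
  by rewrite lerXn2r ?nnegrE ?(le_trans x0 xy).
have hA1 j : j%:R * h <= T -> nrm2 P (D1 j) ^+ 2 * Ex P w <= lC ^+ 2 * t ^+ 4 * N.
  move=> jT; apply: (le_trans (sqle _ _ (nrm2_ge0 _ _) (nD1 j jT))).
  rewrite (_ : (lC * (t ^+ 2 * N)) ^+ 2 * N^-1 = lC ^+ 2 * t ^+ 4 * N * (N * N^-1)); last by ring.
  by rewrite NV mulr1.
have hA2 j : j%:R * h <= T -> nrm2 P (D2 j) ^+ 2 * Ex P w <= lC ^+ 2 * N.
  move=> jT; apply: (le_trans (sqle _ _ (nrm2_ge0 _ _) (nD2 j jT))).
  rewrite (_ : (lC * N) ^+ 2 * N^-1 = lC ^+ 2 * N * (N * N^-1)); last by ring.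
  by rewrite NV mulr1.
pose rho j := \sum_i Ex P (fun z => w z * Rr j z 0 i ^+ 2).
pose e j := Ex P (fun z => enorm (Rr j z)).
have e0 j : 0 <= e j by apply: Ex_ge0 => z; exact: enorm_ge0.
have rho0 j : 0 <= rho j by apply: sumr_ge0 => i _; apply: Ex_ge0 => z; exact: mulr_ge0 (w0 z) (sqr_ge0 _).
have sR j : j%:R * h <= T -> L2v P (Rr j).
  by move=> jT; have [_ _ _ [_ s1 s2]] := ok j jT; exact: L2vB s1 (L2vZ t s2).
have eCS j : j%:R * h <= T -> (forall i, intg P (fun z => w z * Rr j z 0 i ^+ 2)) -> e j ^+ 2 <= rho j * (2 * N).
  by move=> jT iU; exact: (wt_CS leta N0 (sR j jT) iU).
have step j : j.+1%:R * h <= T -> (forall i, intg P (fun z => w z * Rr j z 0 i ^+ 2)) ->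
    (forall i, intg P (fun z => w z * Rr j.+1 z 0 i ^+ 2)) /\
    rho j.+1 <= (1 + c' * h) * rho j + h * (16 * d%:R * c2 * K ^+ 2 * A0 * (t ^+ 2 * N)).
  move=> jT iU; have jT' : j%:R * h <= T by apply: le_trans jT; rewrite tS lerDl.
  have [mY mY1 mY2 [sY sD1 sD2]] := ok j jT'; have sRj := sR j jT'.
  have sF := filtration_sigma F0 B (j%:R * h).
  have kh0 : 0 <= j%:R * h by nonneg.
  have shT : j%:R * h + h <= T by rewrite -tS.
  have mR : measurable_wrt (Fi (j%:R * h)) (Rr j).
    apply: (iffLR (mw_row sF _)) => i.
    rewrite (_ : (fun w => _) = (fun w => (eul h xi1 j w 0 i - eul h xi j w 0 i) - t * (eul h xi2 j w 0 i - eul h xi j w 0 i))).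
      by apply: mwB => //; [|apply: mwZ => //]; apply: mwB => //; apply: (iffRL (mw_row sF _)).
    by apply/funext => z; rewrite /Rr /D1 /D2 !mxE.
  have mZ i o : measurable_wrt (Fi (j%:R * h)) (Z j i o).
    by apply: mwB => //; [|apply: mwZ => //]; apply: mwB => //; exact: (cf_mw hcts).
  have mwF : measurable_wrt (Fi (j%:R * h)) w by exact: mw_sub (@F0_sub_filtration _ _ _ _ F0 B _) mw.
  set a1 := nrm2 P (D1 j); set a2 := nrm2 P (D2 j).
  have a10 : 0 <= a1 by exact: nrm2_ge0.
  have a20 : 0 <= a2 by exact: nrm2_ge0.
  pose Q z := 8 * K ^+ 2 * (\sum_i Rr j z 0 i ^+ 2 + e j ^+ 2 + d%:R * \sum_i D1 j z 0 i ^+ 4 + a1 ^+ 2 +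
     t ^+ 2 * (d%:R * \sum_i D2 j z 0 i ^+ 4) + t ^+ 2 * a2 ^+ 2).
  have ZQ i o z : Z j i o z ^+ 2 <= Q z.
    have := hexp i o (eul h xi j z) (D1 j z) (D2 j z) t0 sY sD1 sD2.
    rewrite (_ : (fun z => eul h xi j z + D1 j z) = eul h xi1 j); last first.
      by apply/funext => y; rewrite /D1 addrC subrK.
    rewrite (_ : (fun z => eul h xi j z + D2 j z) = eul h xi2 j); last first.
      by apply/funext => y; rewrite /D2 addrC subrK.
    rewrite (_ : eul h xi j z + D1 j z = eul h xi1 j z); last by rewrite /D1 addrC subrK.
    rewrite (_ : eul h xi j z + D2 j z = eul h xi2 j z); last by rewrite /D2 addrC subrK.
    rewrite -/(Rr j z) -/(e j) -/a1 -/a2 => hb.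
    pose S := K * (enorm (Rr j z) + e j + (enorm (D1 j z) ^+ 2 + a1) + t * (enorm (D2 j z) ^+ 2 + a2)).
    have {}hb : `|Z j i o z| <= S := hb.
    rewrite -real_normK ?num_real//.
    apply: (@le_trans _ _ (S ^+ 2)); first by rewrite lerXn2r ?nnegrE// (le_trans _ hb).
    rewrite /S exprMn (_ : t * (enorm (D2 j z) ^+ 2 + a2) = t * enorm (D2 j z) ^+ 2 + t * a2); last by ring.
    apply: (le_trans (ler_wpM2l (sqr_ge0 K) (sqr6_le _ _ _ _ _ _))).
    rewrite /Q [leLHS](_ : _ = 8 * K ^+ 2 * (enorm (Rr j z) ^+ 2 + e j ^+ 2 + enorm (D1 j z) ^+ 4 + a1 ^+ 2 +
      t ^+ 2 * enorm (D2 j z) ^+ 4 + t ^+ 2 * a2 ^+ 2)); last by ring.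
    rewrite ler_wpM2l ?mulr_ge0 ?sqr_ge0//; do 1!rewrite lerD2r.
    by apply: lerD; [rewrite lerD2r; apply: lerD; [rewrite enorm_sqr|exact: enorm_pow4_le]|rewrite ler_wpM2l ?sqr_ge0 ?enorm_pow4_le].
  have [i1 hq1] := q1 j jT'; have [i2 hq2] := q2 j jT'.
  have iS : intg P (fun z => \sum_i w z * Rr j z 0 i ^+ 2) by exact: intg_sum.
  have iS1 : intg P (fun z => \sum_i w z * D1 j z 0 i ^+ 4) by exact: intg_sum.
  have iS2 : intg P (fun z => \sum_i w z * D2 j z 0 i ^+ 4) by exact: intg_sum.
  pose cw := e j ^+ 2 + a1 ^+ 2 + t ^+ 2 * a2 ^+ 2.
  have QE : (fun z => w z * Q z) = (fun z => 8 * K ^+ 2 * (\sum_i w z * Rr j z 0 i ^+ 2 +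
      (d%:R * (\sum_i w z * D1 j z 0 i ^+ 4) + (t ^+ 2 * d%:R * (\sum_i w z * D2 j z 0 i ^+ 4) + cw * w z)))).
    by apply/funext => z; rewrite /Q /cw -!mulr_sumr; ring.
  have j3 := intgD (intgZ (t ^+ 2 * d%:R) iS2) (intgZ cw iw).
  have j2 := intgD (intgZ d%:R iS1) j3.
  have iQ : intg P (fun z => w z * Q z) by rewrite QE; exact: intgZ (intgD iS j2).
  have [iV hV] := vstep_bound (step_bound2 T0 BM F0i) c20 kh0 h0 shT mR mZ mwF w0 ZQ iU iQ.
  rewrite -RS in iV hV; split=> //; apply: (le_trans hV).
  rewrite QE (ExZ _ (intgD iS j2)) (ExD iS j2) (ExD (intgZ d%:R iS1) j3).
  rewrite (ExD (intgZ (t ^+ 2 * d%:R) iS2) (intgZ cw iw)) (ExZ _ iS1) (ExZ _ iS2) (ExZ _ iw) !Ex_sum// -/(rho j).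
  (* The mean of the weight is at most [1 / N], which cancels the factor [2 N] of [wt_CS] and closes
     the recursion in [rho]. *)
  have he : e j ^+ 2 * Ex P w <= 2 * rho j.
    apply: (le_trans (sqE _ (e0 j))).
    apply: (@le_trans _ _ (rho j * (2 * N) * N^-1)); first by rewrite ler_wpM2r ?invr_ge0 ?(ltW N0)// eCS.
    by rewrite -mulrA -mulrA NV mulr1 mulrC.
  have ha1 : a1 ^+ 2 * Ex P w <= lC ^+ 2 * t ^+ 4 * N := hA1 j jT'.
  have ha2 : a2 ^+ 2 * Ex P w <= lC ^+ 2 * N := hA2 j jT'.
  have t4 : t ^+ 4 <= t ^+ 2 by rewrite (exprD _ 2 2) ler_piMr ?sqr_ge0// expr_le1.
  have p1 : 0 <= t ^+ 2 * d%:R by nonneg.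
  have p2 : 0 <= (2 * d%:R * qC + lC ^+ 2) * N by apply: mulr_ge0 (ltW N0); nonneg.
  have p3 : 0 <= d%:R * c2 * h by nonneg.
  have p4 : 0 <= 8 * K ^+ 2 by nonneg.
  have h5 := ler_wpM2l p3 (ler_wpM2l p4 (hom_arith (ler_wpM2l (ler0n R d) hq1) (ler_wpM2l p1 hq2)
    (ler_wpM2l (sqr_ge0 t) ha2) (ler_wpM2l p2 t4) he ha1)).
  apply: (le_trans (lerD (lexx _) h5)); rewrite le_eqVlt; apply/orP; left; apply/eqP.
  by rewrite /c' /A0 /c2; move: (rho j) (t ^+ 2 * N) => r y; ring.
(* At time [0] the dependence on the perturbation is exactly homogeneous. *)
have r0 : rho 0%N = 0.
  rewrite /rho big1// => i _; rewrite (_ : (fun z => _) = fun=> 0) ?Ex_cst//.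
  by apply/funext => z; rewrite /Rr d10 d20 scale1r subrr mxE expr0n mulr0.
have iU j : (j <= k)%N -> forall i, intg P (fun z => w z * Rr j z 0 i ^+ 2).
  elim: j => [_ i|j IH jk].
    rewrite (_ : (fun z => _) = fun=> 0); first exact: intg_cst.
    by apply/funext => z; rewrite /Rr d10 d20 scale1r subrr mxE expr0n mulr0.
  apply: (step j _ (IH (ltnW jk))).1.
  by apply: le_trans kT; rewrite ler_wpM2r// ler_nat.
have c'0 : 0 <= c' by rewrite /c'; nonneg.
have A00 : 0 <= A0 by rewrite /A0; nonneg.
set C1 := 16 * d%:R * c2 * K ^+ 2 * A0.
have C10 : 0 <= C1 by rewrite /C1; nonneg.
have tN0 : 0 <= t ^+ 2 * N by apply: mulr_ge0 (sqr_ge0 _) (ltW N0).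
have := @gronwall _ rho c' (C1 * (t ^+ 2 * N)) h k c'0 (mulr_ge0 C10 tN0) h0 rho0.
have /[swap]/[apply] : forall j, (j < k)%N -> rho j.+1 <= (1 + c' * h) * rho j + h * (C1 * (t ^+ 2 * N)).
  move=> j jk; apply: (step j _ (iU j (ltnW jk))).2.
  by apply: le_trans kT; rewrite ler_wpM2r// ler_nat.
rewrite r0 add0r => hr.
set E1 := expR (c' * T).
have hr' : rho k <= E1 * (T * C1) * (t ^+ 2 * N).
  apply: (le_trans hr); rewrite [leRHS](_ : _ = E1 * (T * (C1 * (t ^+ 2 * N)))); last by ring.
  have Cy : 0 <= C1 * (t ^+ 2 * N) by exact: mulr_ge0.
  apply: ler_pM; first exact: expR_ge0.
  - by apply: mulr_ge0 => //; nonneg.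
  - by rewrite ler_expR ler_wpM2l.
  - by rewrite ler_wpM2r.
have := eCS k kT (iU k (leqnn k)); rewrite -/(e k) => he.
have X0 : 0 <= E1 * (T * C1) by apply: mulr_ge0 (expR_ge0 _) _; exact: mulr_ge0.
have N0' := ltW N0.
rewrite -(@ler_pXn2r _ 2) ?nnegrE ?e0//; last by apply: mulr_ge0 => //; apply: mulr_ge0 => //; exact: homC_ge0.
apply: (le_trans he); apply: (@le_trans _ _ (E1 * (T * C1) * (t ^+ 2 * N) * (2 * N))).
  by apply: ler_wpM2r => //; nonneg.
rewrite /homC -/E1 -/C1; move: (E1 * (T * C1)) X0 => x x0.
rewrite -subr_ge0 (_ : _ - _ = (t * N) ^+ 2 * (4 * x ^+ 2 + 2 * x + 1)); last by ring.
nonneg.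
Qed.

End homogeneity.

(** * Ito integrals of elementary processes *)

Section ito.
Context {R : realType} {disp} {Om : measurableType disp} (P : probability Om R).
Context (T : R) {m : nat} (F0 : set (set Om)) (B : R -> Om -> 'rV[R]_m).
Hypothesis BM : brownian_motion P T B.
Hypothesis F0i : initial_sigma_algebra P T F0 B.
Variable j : 'I_m.
Local Notation Fi := (filtration F0 B).
Local Notation mu := (@lebesgue_measure R).
Local Notation dBj s t := (dB B s t j).

(* The elementary integrand u on ]s, t]. *)
Record elem := Elem { es : R ; et : R ; eu : Om -> R }.

Definition elem_ok (tmax : R) (e : elem) : Prop :=
  [/\ 0 <= es e, es e <= et e, et e <= tmax, measurable_wrt (Fi (es e)) (eu e) & sqi P (eu e)].

Definition overlap (e f : elem) : R := Num.max 0 (Num.min (et e) (et f) - Num.max (es e) (es f)).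

Definition elem_int (e : elem) (w : Om) : R := eu e w * dBj (es e) (et e) w.

Let dB_split s r t w : dBj s t w = dBj s r w + dBj r t w.
Proof. by rewrite /dB !mxE; ring. Qed.

Let sF s := filtration_sigma F0 B s.

Lemma dB_mw s t r : 0 <= s -> s <= t -> t <= r -> measurable_wrt (Fi r) (dBj s t).
Proof.
move=> s0 st tr.
rewrite (_ : dBj s t = fun w => B t w 0 j - B s w 0 j); last by apply/funext => w; rewrite /dB !mxE.
apply: mwB => //; apply: (iffRL (mw_row (sF r) _)); apply: brownian_mw.
  by rewrite tr andbT (le_trans s0).
by rewrite s0 (le_trans st).
Qed.

Lemma elem_sqi e : elem_ok T e -> sqi P (elem_int e).
Proof.
move=> [s0 st tT mue sue].
have [[i1 _] [i2 _] _] := mul_dB BM F0i j s0 st tT (mwX (sF _) 2 mue) sue.2.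
split; last by rewrite /elem_int; under eq_fun do rewrite exprMn.
apply: measurable_funM; first exact: sue.1.
exact: mw_meas (filtration_measurable BM F0i tT) (dB_mw s0 st (lexx _)).
Qed.

Let disjoint_product e f : elem_ok T e -> elem_ok T f -> et e <= es f ->
  Ex P (fun w => elem_int e w * elem_int f w) = 0.
Proof.
move=> oe of_ ef; have se := elem_sqi oe; move: oe of_ => [s0 st tT mue sue] [s0' st' tT' muf suf].
have mg : measurable_wrt (Fi (es f)) (fun w => elem_int e w * eu f w).
  apply: mwM => //; apply: mwM => //; last exact: dB_mw.
  by apply: mw_sub mue; apply: filtrationS; rewrite (le_trans st).
have [[_ e1] _ _] := mul_dB BM F0i j s0' st' tT' mg (sqiM se suf).
by rewrite -[RHS]e1; congr Ex; apply/funext => w; rewrite /elem_int; ring.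
Qed.

Let same_start s t t' u v : 0 <= s -> s <= t -> t <= t' -> t' <= T ->
  measurable_wrt (Fi s) u -> measurable_wrt (Fi s) v -> sqi P u -> sqi P v ->
  Ex P (fun w => (u w * dBj s t w) * (v w * dBj s t' w)) = Ex P (fun w => u w * v w) * ((t - s) * gauss2).
Proof.
move=> s0 st tt' tT mu' mv su sv; have tT' := le_trans tt' tT.
have muv := mwM (sF s) mu' mv; have iuv := sqiM su sv.
have [[i1 _] [i2 e2] _] := mul_dB BM F0i j s0 st tT' muv iuv.
have mg : measurable_wrt (Fi t) (fun w => u w * v w * dBj s t w).
  apply: mwM => //; last exact: dB_mw.
  by apply: mw_sub muv; exact: filtrationS.
have [[i3 e3] _ _] := mul_dB BM F0i j (le_trans s0 st) tt' tT mg i1.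
rewrite -e2 -[RHS]addr0 -e3 -ExD//; congr Ex; apply/funext => w.
by rewrite (dB_split s t t'); ring.
Qed.

(** By symmetry [e] starts first. It is cut at the start of [f]: the first piece is over before [f]
    begins and is orthogonal to it, the second has the same start as [f]. *)
Lemma elem_product e f : elem_ok T e -> elem_ok T f ->
  Ex P (fun w => elem_int e w * elem_int f w) = Ex P (fun w => eu e w * eu f w) * (overlap e f * gauss2).
Proof.
wlog: e f / es e <= es f => [wl|sef oe of_].
  have [h oe of_|/ltW h oe of_] := leP (es e) (es f); first exact: wl.
  under eq_fun do rewrite mulrC; rewrite (wl f e)//; congr (Ex P _ * (_ * _)).
    by apply/funext => w; rewrite mulrC.
  by rewrite /overlap [Num.min (et e) _]minC [Num.max (es e) _]maxC.
have [h|/ltW h] := leP (et e) (es f).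
  have o0 : overlap e f = 0 by apply/max_idPl; rewrite (max_r sef) subr_le0 ge_min h.
  by rewrite (disjoint_product oe of_ h) o0 mul0r mulr0.
have [s0 st tT mue sue] := oe; have [s0' st' tT' muf suf] := of_.
pose e1 := Elem (es e) (es f) (eu e); pose e2 := Elem (es f) (et e) (eu e).
have o1 : elem_ok T e1 by split=> //=; exact: le_trans h tT.
have o2 : elem_ok T e2.
  by split=> //=; apply: mw_sub mue; exact: filtrationS.
rewrite (_ : (fun w => _) = (fun w => elem_int e1 w * elem_int f w + elem_int e2 w * elem_int f w)); last first.
  by apply/funext => w; rewrite /elem_int /= (dB_split (es e) (es f) (et e)); ring.
rewrite (ExD (sqiM (elem_sqi o1) (elem_sqi of_)) (sqiM (elem_sqi o2) (elem_sqi of_))).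
rewrite disjoint_product//= add0r /overlap (max_r sef).
have [tt|/ltW tt] := leP (et e) (et f).
  rewrite max_r ?subr_ge0//; by apply: same_start => //; case: o2.
rewrite max_r ?subr_ge0//.
under eq_fun do rewrite mulrC; under [in RHS]eq_fun do rewrite mulrC.
by apply: same_start => //; case: o2.
Qed.

Definition list_int (l : seq elem) (w : Om) : R := \sum_(e <- l) elem_int e w.
Definition list_fun (l : seq elem) (r : R) (w : Om) : R := \sum_(e <- l) eu e w * \1_(`]es e, et e]) r.

(** The integral over time of [list_fun l ^+ 2], computed along the path as a finite sum; the
    intervals of the list may overlap. *)
Definition energy (l : seq elem) (w : Om) : R :=
  \sum_(e <- l) \sum_(f <- l) eu e w * eu f w * overlap e f.

(** Membership is [List.In] because an [elem] contains a function and has no decidable equality. *)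
Lemma list_sum_intg (l : seq elem) (ok : elem -> Prop) (F : elem -> Om -> R) :
  (forall e, List.In e l -> ok e) -> (forall e, ok e -> intg P (F e)) ->
  intg P (fun w => \sum_(e <- l) F e w) /\ Ex P (fun w => \sum_(e <- l) F e w) = \sum_(e <- l) Ex P (F e).
Proof.
move=> + iF; elim: l => [|e l IH] hl.
  rewrite (_ : (fun w => _) = fun=> 0); last by apply/funext => w; rewrite big_nil.
  by rewrite Ex_cst big_nil; split=> //; exact: intg_cst.
have [i1 e1] := IH (fun f fl => hl f (or_intror fl)).
have i0 := iF e (hl e (or_introl erefl)).
rewrite (_ : (fun w => _) = fun w => F e w + \sum_(f <- l) F f w); last by apply/funext => w; rewrite big_cons.
by rewrite big_cons -e1 (ExD i0 i1); split=> //; exact: intgD.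
Qed.

Lemma eq_bigList (l : seq elem) (F G : elem -> R) : (forall e, List.In e l -> F e = G e) ->
  \sum_(e <- l) F e = \sum_(e <- l) G e.
Proof.
elim: l => [|e l IH] h; first by rewrite !big_nil.
by rewrite !big_cons h ?IH//; [move=> f fl; apply: h; right|left].
Qed.

(** Stated for arbitrary lists of intervals, so that the difference of two elementary integrands on
    unrelated partitions is just a concatenation and needs no common refinement. *)
Lemma ito_isometry (l : seq elem) : (forall e, List.In e l -> elem_ok T e) ->
  [/\ sqi P (list_int l), intg P (energy l) &
  Ex P (fun w => list_int l w ^+ 2) = gauss2 * Ex P (energy l)].
Proof.
move=> ok.
have E w : list_int l w ^+ 2 = \sum_(e <- l) \sum_(f <- l) elem_int e w * elem_int f w.
  by rewrite expr2 /list_int mulr_suml; apply: eq_bigr => e _; rewrite mulr_sumr.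
have H1 e : elem_ok T e -> _ := fun oe => list_sum_intg (F := fun f w => elem_int e w * elem_int f w) ok
   (fun f of_ => sqiM (elem_sqi oe) (elem_sqi of_)).
have [i2 e2] := list_sum_intg (F := fun e w => \sum_(f <- l) elem_int e w * elem_int f w) ok (fun e oe => (H1 e oe).1).
have sqe e : elem_ok T e -> sqi P (eu e) by case.
have H3' e : elem_ok T e -> intg P (fun w => \sum_(f <- l) eu e w * eu f w * overlap e f) /\
    Ex P (fun w => \sum_(f <- l) eu e w * eu f w * overlap e f) = \sum_(f <- l) Ex P (fun w => eu e w * eu f w) * overlap e f.
  move=> oe; have iF f : elem_ok T f -> intg P (fun w => eu e w * eu f w * overlap e f).
    by move=> of_; under eq_fun do rewrite mulrC; apply: intgZ; exact: sqiM (sqe _ oe) (sqe _ of_).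
  have [i ->] := list_sum_intg ok iF; split=> //; apply: eq_bigList => f /ok of_.
  by under eq_fun do rewrite mulrC; rewrite (ExZ _ (sqiM (sqe _ oe) (sqe _ of_))) mulrC.
have [i4 e4] := list_sum_intg ok (fun e oe => (H3' e oe).1).
have sI : sqi P (list_int l).
  have [i5 _] := list_sum_intg ok (fun e oe => sqi_intg (elem_sqi oe)).
  split; first exact: intg_meas i5.
  by rewrite (_ : (fun w => _) = (fun w => \sum_(e <- l) \sum_(f <- l) elem_int e w * elem_int f w))//; apply/funext => w; exact: E.
split=> //.
rewrite (_ : (fun w => _) = (fun w => \sum_(e <- l) \sum_(f <- l) elem_int e w * elem_int f w)); last first.
  by apply/funext => w; exact: E.
rewrite e2 /energy e4 mulr_sumr; apply: eq_bigList => e /ok oe.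
rewrite (H1 e oe).2 (H3' e oe).2 mulr_sumr; apply: eq_bigList => f /ok of_.
by rewrite elem_product//; ring.
Qed.

Lemma elem_cross_integral (t c : R) (e f : elem) : elem_ok t e -> elem_ok t f ->
  mu.-integrable `[0%R, t] (fun r => (c * (\1_(`]es e, et e]) r * \1_(`]es f, et f]) r))%:E) /\
  (\int[mu]_(r in `[0%R, t]) (c * (\1_(`]es e, et e]) r * \1_(`]es f, et f]) r))%:E)%E = (c * overlap e f)%:E.
Proof.
move=> [s0 st tT _ _] [s0' st' tT' _ _].
set a := Num.max (es e) (es f); set b := Num.min (et e) (et f).
have H (r : R) : \1_(`]es e, et e]) r * \1_(`]es f, et f]) r = \1_(`]a, b]) r :> R.
  rewrite -[LHS]/((\1_(`]es e, et e]) \* \1_(`]es f, et f])) r) -indicI; congr (\1_ _ r).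
  apply/seteqP; split=> z /=; rewrite !in_itv/= gt_max le_min.
    by move=> [/andP[-> ->] /andP[-> ->]].
  by move=> /andP[/andP[-> ->] /andP[-> ->]].
rewrite (_ : (fun r => _) = fun r => (c%:E * (\1_(`]a, b]) r)%:E)%E); last by apply/funext => r; rewrite H.
have mI : measurable (`]a, b] : set R) by exact: measurable_itv.
have mD : measurable (`[0%R, t] : set R) by exact: measurable_itv.
have i1 : mu.-integrable `[0%R, t] (fun r => (\1_(`]a, b]) r)%:E).
  exact: integrableS (integrable_indic_itv a b false false).
split; first exact: integrableZl.
rewrite integralZl// integral_indic// setIidl; last first.
  move=> z /=; rewrite !in_itv/= => /andP[az zb]; apply/andP; split.
    by rewrite ltW// (le_lt_trans s0)// (le_lt_trans _ az)// le_max lexx.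
  by rewrite (le_trans zb)// ge_min tT.
rewrite [RHS]EFinM; congr (_ * _)%E; apply: etrans (lebesgue_measure_itv _) _.
rewrite /= lte_fin /overlap -/a -/b.
case: ltP => h; first by rewrite max_r// subr_ge0 ltW.
by rewrite max_l// subr_le0.
Qed.

Lemma energyE (t : R) (l : seq elem) w : (forall e, List.In e l -> elem_ok t e) ->
  mu.-integrable `[0%R, t] (EFin \o (fun r => list_fun l r w ^+ 2)) /\
  (\int[mu]_(r in `[0%R, t]) ((list_fun l r w) ^+ 2)%:E)%E = (energy l w)%:E.
Proof.
have mD : measurable (`[0%R, t] : set R) by exact: measurable_itv.
have sumI (G : elem -> R -> R) (c : elem -> R) (k : seq elem) : (forall e, List.In e k ->
    mu.-integrable `[0%R, t] (EFin \o G e) /\ (\int[mu]_(r in `[0%R, t]) (G e r)%:E)%E = (c e)%:E) ->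
    mu.-integrable `[0%R, t] (EFin \o (fun r => \sum_(e <- k) G e r)) /\
    (\int[mu]_(r in `[0%R, t]) (\sum_(e <- k) G e r)%:E)%E = (\sum_(e <- k) c e)%:E.
  elim: k => [_|e k IH hk].
    rewrite (_ : EFin \o _ = fun=> 0%E); last by apply/funext => r /=; rewrite big_nil.
    by split; [exact: integrable0|rewrite big_nil integral0_eq// => r _; rewrite big_nil].
  have [i1 e1] := IH (fun f fl => hk f (or_intror fl)).
  have [i0 e0] := hk e (or_introl erefl).
  have E r : (\sum_(f <- e :: k) G f r)%:E = ((G e r)%:E + (\sum_(f <- k) G f r)%:E)%E by rewrite big_cons.
  rewrite (_ : EFin \o _ = ((EFin \o G e) \+ (EFin \o (fun r => (\sum_(f <- k) G f r)%R)))%E); last exact/funext/E.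
  split; first exact: integrableD.
  transitivity (\int[mu]_(r in `[0%R, t]) ((G e r)%:E + (\sum_(f <- k) G f r)%R%:E))%E.
    by apply: eq_integral => r _; exact: E.
  by rewrite (@integralD _ _ _ mu _ _ _ _ i0 i1) ?e0 ?e1 ?big_cons ?EFinD.
move=> ok.
pose F2 r := \sum_(e <- l) \sum_(f <- l) eu e w * eu f w * (\1_(`]es e, et e]) r * \1_(`]es f, et f]) r).
have EF : F2 = (fun r => list_fun l r w ^+ 2).
  apply/funext => r; rewrite expr2 /list_fun mulr_suml; apply: eq_bigr => e _.
  by rewrite mulr_sumr; apply: eq_bigr => f _; ring.
suff : mu.-integrable `[0%R, t] (EFin \o F2) /\ (\int[mu]_(r in `[0%R, t]) (F2 r)%:E)%E = (energy l w)%:E.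
  by rewrite EF.
exact: (sumI _ _ l (fun e he => sumI _ _ l (fun f hf => elem_cross_integral _ (ok e he) (ok f hf)))).
Qed.

End ito.

(** * Convergence of the Euler scheme *)

Section path_modulus.
Context {R : realType} {d : nat} (T : R).
Local Notation V := 'rV[R]_d.

Lemma within_enorm (f : R -> V) : {within `[0, T], continuous f} ->
  forall x e, 0 <= x <= T -> 0 < e ->
  exists2 r, 0 < r & forall y, 0 <= y <= T -> `|y - x| < r -> enorm (f y - f x) <= e.
Proof.
move=> /subspace_continuousP cf x e xT e0.
have xI : `[0, T]%classic x by rewrite /= in_itv.
have := cf x xI _ (near_enorm (f x) e0); rewrite /nbhs/= => /nbhs_ballP[r/= r0 hr].
exists r => // y yT yx; apply: (hr y) => //=; rewrite ?in_itv//.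
by rewrite /ball/= distrC.
Qed.

(** Compactness of [[0, T]]: a property that holds near every point at all small scales [a] holds on
    the whole interval at all small scales. *)
Lemma compact_near (K : R -> R -> Prop) : (forall x, 0 <= x <= T -> exists2 r, 0 < r &
    forall y a, 0 <= y <= T -> `|y - x| < r -> 0 < a < r -> K a y) ->
  exists2 r, 0 < r & forall y a, 0 <= y <= T -> 0 < a < r -> K a y.
Proof.
move=> H; have /compact_near_coveringP := @segment_compact R 0 T.
move=> /(_ R (0^'+) (fun a y => 0 <= y <= T -> K a y) _).
case=> [x xI|r /= r0 hr].
  have xT : 0 <= x <= T by move: xI; rewrite /= in_itv.
  have [r r0 hr] := H x xT.
  exists (ball x r, [set a | 0 < a < r]); first split=> /=.
  - exact: nbhsx_ballx.
  - by exists r => //= a; rewrite /ball/= sub0r normrN => ar a0; rewrite a0 (le_lt_trans (ler_norm a)).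
  by move=> [y a] [/= yx ar] yT; apply: hr => //; rewrite distrC.
exists r => // y a yT /andP[a0 ar]; apply: (hr a) => //=; rewrite ?in_itv//.
by rewrite /ball/= sub0r normrN gtr0_norm.
Qed.

Lemma path_bounded (f : R -> V) : {within `[0, T], continuous f} ->
  exists M, forall y, 0 <= y <= T -> enorm (f y) <= M.
Proof.
(* The scale is the inverse of the bound sought. *)
move=> cf; have [|r r0 hr] := @compact_near (fun a y => enorm (f y) <= a^-1).
  move=> x xT; have [r r0 hr] := within_enorm cf xT ltr01.
  pose s := (enorm (f x) + 1)^-1; have s0 : 0 < s by rewrite invr_gt0 ltr_wpDl ?enorm_ge0.
  exists (Num.min r s); first by rewrite lt_min r0.
  move=> y a yT; rewrite !lt_min => /andP[yr _] /andP[a0 /andP[_ as_]].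
  have h := hr y yT yr; have h2 := enormD (f y - f x) (f x).
  rewrite subrK in h2; apply: (@le_trans _ _ (enorm (f x) + 1)); first by lra.
  by rewrite -[leLHS]invrK lef_pV2 ?posrE// ltW.
exists (r / 2)^-1 => y yT; apply: hr => //; apply/andP; split; lra.
Qed.

Lemma path_heine (f : R -> V) e : {within `[0, T], continuous f} -> 0 < e ->
  exists2 r, 0 < r & forall x y, 0 <= x <= T -> 0 <= y <= T -> `|y - x| <= r -> enorm (f y - f x) <= e.
Proof.
move=> cf e0; have e20 : 0 < e / 2 by lra.
have [|r r0 hr] := @compact_near (fun a x => forall y, 0 <= y <= T -> `|y - x| <= a -> enorm (f y - f x) <= e).
  move=> x xT; have [r r0 hr] := within_enorm cf xT e20.
  exists (r / 2); first by lra.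
  move=> y a yT yx /andP[a0 ar] z zT zy.
  have h1 := hr y yT ltac:(lra); have h2 := hr z zT.
  have : `|z - x| < r by rewrite -(subrKA y) (le_lt_trans (ler_normD _ _))//; lra.
  move=> /h2 {}h2; rewrite -(subrKA (f x)) (le_trans (enormD _ _))//.
  by rewrite [X in _ + X]enormBC; lra.
exists (r / 2); first by lra.
by move=> x y xT yT xy; apply: (hr x (r / 2)) => //; apply/andP; split; lra.
Qed.

End path_modulus.

Section process_modulus.
Context {R : realType} {disp} {Om : measurableType disp} (P : probability Om R) {d : nat} (T : R).
Hypothesis T0 : 0 <= T.
Variable X : R -> Om -> 'rV[R]_d.
Hypothesis mX : forall t, 0 <= t <= T -> measurable_fun setT (X t).
Hypothesis cX : forall w, {within `[0, T], continuous (X ^~ w)}.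
Hypothesis sX : (\int[P]_w ereal_sup [set ((enorm (X t w)) ^+ 2)%:E | t in `[0%R, T]] < +oo)%E.

(** Only pairs of rational times are enumerated: the supremum over them is countable, hence
    measurable. *)
Let gap (h : R) (n : nat) (w : Om) : R :=
  if unpickle n is Some (p, q) then
    let a := ratr p in let b := ratr q in
    if [&& 0 <= a <= T, 0 <= b <= T & `|b - a| <= h] then enorm (X b w - X a w) else 0
  else 0.

(** The modulus of continuity of the path of [w] at scale [h]. *)
Definition path_mod (h : R) (w : Om) : R := sups (gap h ^~ w) 0.

Let gap_le h w c : 0 <= c -> (forall a b, 0 <= a <= T -> 0 <= b <= T -> `|b - a| <= h -> enorm (X b w - X a w) <= c) ->
  forall n, gap h n w <= c.
Proof.
move=> c0 H n; rewrite /gap; case: unpickle => [[p q]|//]; case: ifP => // /and3P[*]; exact: H.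
Qed.

Let gap_bnd w : exists2 M, 0 <= M & forall h n, gap h n w <= M.
Proof.
have [M hM] := path_bounded (@cX w); exists (2 * `|M|) => [|h]; first by rewrite mulr_ge0.
apply: gap_le => [|a b aT bT _]; first by rewrite mulr_ge0.
have := enormD (X b w) (- X a w); rewrite enormN => /le_trans; apply.
have := hM a aT; have := hM b bT; have := ler_norm M; lra.
Qed.

Let gap_ub h w : has_ubound (range (gap h ^~ w)).
Proof. by have [M _ hM] := gap_bnd w; exists M => _ [n _ <-]. Qed.

Let sdrop_range (u : nat -> R) : sdrop u 0 = range u.
Proof. by apply/seteqP; split=> _ [n _ <-]; exists n. Qed.

Lemma path_mod_le h w c : 0 <= c -> (forall a b, 0 <= a <= T -> 0 <= b <= T -> `|b - a| <= h -> enorm (X b w - X a w) <= c) ->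
  path_mod h w <= c.
Proof.
move=> c0 H; rewrite /path_mod /sups/= sdrop_range; apply: ge_sup; first by exists (gap h 0 w); exists 0%N.
by move=> _ [n _ <-]; exact: gap_le.
Qed.

Let le_path_mod h n w : gap h n w <= path_mod h w.
Proof. by rewrite /path_mod /sups/= sdrop_range; apply: ub_le_sup; [exact: gap_ub|exists n]. Qed.

Lemma path_mod_ge0 h w : 0 <= path_mod h w.
Proof.
by apply: le_trans (le_path_mod h 0 w); rewrite /gap; case: unpickle => [[p q]|//]; case: ifP => // _; exact: enorm_ge0.
Qed.

Lemma path_mod_measurable h : measurable_fun setT (path_mod h).
Proof.
apply: measurable_fun_sups => [w _|n]; first exact: gap_ub.
rewrite /gap; case: unpickle => [[p q]|//].
case: (boolP [&& 0 <= (ratr p : R) <= T, 0 <= (ratr q : R) <= T & `|(ratr q : R) - ratr p| <= h]) => // /and3P[pT qT _].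
by apply: measurable_enormf; apply: measurable_rowB; exact: mX.
Qed.

(** Extension from rational to real times by continuity of the path. The rationals are taken inside
    []a, b[], so that their distance stays below [h]. *)
Lemma path_modP h w a b : 0 <= a <= T -> 0 <= b <= T -> `|b - a| <= h ->
  enorm (X b w - X a w) <= path_mod h w.
Proof.
wlog: a b / a <= b => [wl aT bT ab|].
  have [h1|/ltW h1] := leP a b; first exact: wl.
  by rewrite enormBC; apply: wl => //; rewrite distrC.
rewrite le_eqVlt => /predU1P[-> _ _ _|ab aT bT abh]; first by rewrite subrr enorm0 path_mod_ge0.
apply/ler_addgt0Pr => e e0; have e20 : 0 < e / 2 by lra.
have [r1 r10 h1] := within_enorm (@cX w) aT e20.
have [r2 r20 h2] := within_enorm (@cX w) bT e20.
(* The midpoint separates the rational chosen near [a] from the one near [b] and keeps them in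
   order. *)
pose c := (a + b) / 2.
have [p] := rat_in_itvoo (ltac:(rewrite lt_min; apply/andP; split; rewrite /c; lra) : a < Num.min c (a + r1)).
rewrite in_itv/= lt_min => /andP[ap /andP[pc pr]].
have [q] := rat_in_itvoo (ltac:(rewrite gt_max; apply/andP; split; rewrite /c; lra) : Num.max c (b - r2) < b).
rewrite in_itv/= gt_max => /andP[/andP[cq qr] qb].
move: aT bT => /andP[a0 aT] /andP[b0 bT]; move: abh; rewrite gtr0_norm ?subr_gt0// => abh.
have pT : 0 <= (ratr p : R) <= T by apply/andP; split; rewrite /c in pc; lra.
have qT : 0 <= (ratr q : R) <= T by apply/andP; split; rewrite /c in cq; lra.
have {}h1 := h1 _ pT ltac:(rewrite gtr0_norm; lra).
have {}h2 := h2 _ qT ltac:(rewrite ltr0_norm; lra).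
have := le_path_mod h (pickle (p, q)) w; rewrite /gap pickleK pT qT/= ifT; last first.
  by move: pc cq; rewrite /c => pc cq; rewrite gtr0_norm; lra.
move=> h3.
have h5 : X b w - X a w = (X b w - X (ratr q) w) + (X (ratr q) w - X a w) by rewrite subrKA.
rewrite h5 (le_trans (enormD _ _))//; have h6 : X (ratr q) w - X a w = (X (ratr q) w - X (ratr p) w) + (X (ratr p) w - X a w) by rewrite subrKA.
have h4 := enormD (X (ratr q) w - X (ratr p) w) (X (ratr p) w - X a w).
by rewrite -h6 in h4; rewrite enormBC; lra.
Qed.

Lemma path_mod_mono h h' w : h <= h' -> path_mod h w <= path_mod h' w.
Proof.
move=> hh; apply: path_mod_le => [|a b aT bT ab]; first exact: path_mod_ge0.
by apply: path_modP => //; exact: le_trans hh.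
Qed.

(** Half of the modulus is at most the supremum of the norm along the path. The comparison with the
    supremum in [S2] goes through the monotonicity of the lower integral, as nothing is known about
    its measurability. *)
Lemma path_mod_sqi h : sqi P (path_mod h).
Proof.
rewrite (_ : path_mod h = fun w => 2 * (path_mod h w / 2)); last by apply/funext => w; rewrite mulrC divfK ?pnatr_eq0.
apply: sqiZ; have mm : measurable_fun setT (fun w => path_mod h w / 2).
  by apply: measurable_funM => //; exact: path_mod_measurable.
split=> //; have m2 : measurable_fun setT (fun w => (path_mod h w / 2) ^+ 2) by exact: measurable_funX.
apply/integrableP; split; first exact/measurable_EFinP.
apply: le_lt_trans sX; apply: ge0_integral_mono => w //=; rewrite ger0_norm ?sqr_ge0//.
set S := ereal_sup _.
have hS t : 0 <= t <= T -> ((enorm (X t w) ^+ 2)%:E <= S)%E.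
  by move=> tT; apply: ereal_sup_ubound; exists t => //=; rewrite in_itv.
have hS0 := hS 0 ltac:(by rewrite lexx).
case: S hS hS0 => [r hS hS0|_ _|_ //]; last by rewrite leey.
have r0 : 0 <= r by move: hS0; rewrite lee_fin; apply: le_trans; exact: sqr_ge0.
have hr t : 0 <= t <= T -> enorm (X t w) <= Num.sqrt r.
  move=> /hS; rewrite lee_fin => h1; rewrite -(ger0_norm (enorm_ge0 _)) -sqrtr_sqr ler_wsqrtr//.
have : path_mod h w <= 2 * Num.sqrt r.
  apply: path_mod_le => [|a b aT bT _]; first by rewrite mulr_ge0 ?sqrtr_ge0.
  have := enormD (X b w) (- X a w); rewrite enormN => /le_trans; apply.
  by have := hr a aT; have := hr b bT; lra.
move=> hD; have D0 := path_mod_ge0 h w; rewrite lee_fin -[leRHS](sqr_sqrtr r0) lerXn2r ?nnegrE ?sqrtr_ge0//; lra.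
Qed.

(** Each path is uniformly continuous, and the modulus at scale [T] dominates. *)
Lemma path_mod_cvg : Ex P (fun w => path_mod (T / n.+1%:R) w ^+ 2) @[n --> \oo] --> 0.
Proof.
pose f n w := ((path_mod (T / n.+1%:R) w) ^+ 2)%:E.
have hT n : T / n.+1%:R <= T by rewrite ler_pdivrMr// ler_peMr// ler1n.
have sq h := path_mod_sqi h.
have : (\int[P]_w f n w @[n --> \oo] --> \int[P]_w (cst 0 w))%E.
  apply: (@dominated_cvg _ _ _ P setT measurableT f (cst 0%E) (fun w => (path_mod T w ^+ 2)%:E)).
  - by move=> n; apply/measurable_EFinP; exact: intg_meas (sq _).2.
  - move=> w _; rewrite /f/=; apply/fine_cvgP; split; first exact: nearW.
    rewrite [X in X --> _](_ : _ = (fun n => path_mod (T / n.+1%:R) w ^+ 2) @ \oo)//.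
    rewrite -[X in _ --> X](expr0n R 2); apply: (@cvg_comp _ _ _ _ (fun x : R => x ^+ 2) _ (nbhs (0 : R))); last exact: exprn_continuous.
    apply/cvgrPdist_le => e e0; have [r r0 hr] := path_heine (@cX w) e0.
    have [N hN] : exists N : nat, T / N.+1%:R <= r.
      exists (Num.truncn (T / r)); rewrite ler_pdivrMr// mulrC -ler_pdivrMr//.
      have h0 : 0 <= T / r by rewrite divr_ge0// ltW.
      by have /andP[_ /ltW] := truncn_itv h0.
    exists N => // n /= Nn; rewrite sub0r normrN ger0_norm ?path_mod_ge0//.
    apply: path_mod_le => [|a b aT bT ab]; first exact: ltW.
    apply: hr => //; apply: (le_trans ab); apply: le_trans hN.
    by rewrite ler_wpM2l// lef_pV2 ?posrE ?ltr0Sn// ler_nat ltnS.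
  - by [].
  - exact: (sq T).2.
  - move=> n w _; rewrite /f abse_EFin lee_fin ger0_norm ?sqr_ge0// lerXn2r ?nnegrE ?path_mod_ge0//.
    exact: path_mod_mono.
rewrite integral0 => /fine_cvgP[_]; apply: cvg_trans.
by apply: near_eq_cvg; apply: nearW => n.
Qed.

End process_modulus.

(** [a] is only nonnegative, so its integral is a lower integral, for which additivity may fail.
    Additivity is applied to [q] and [f - q]; the positive part of [f - q] lies below [a]. *)
Lemma integral_le_add {R : realType} {disp} {T : measurableType disp} (mu : {measure set T -> \bar R})
    (D : set T) (f q : T -> R) (a : T -> \bar R) : measurable D ->
  mu.-integrable D (EFin \o f) -> mu.-integrable D (EFin \o q) -> (forall x, D x -> 0 <= a x)%E ->
  (forall x, D x -> (f x)%:E <= (q x)%:E + a x)%E ->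
  (\int[mu]_(x in D) (f x)%:E <= \int[mu]_(x in D) (q x)%:E + \int[mu]_(x in D) a x)%E.
Proof.
move=> mD fi qi a0 fqa.
have fqi : mu.-integrable D (EFin \o (fun x => f x - q x)) by exact: (integrableB mD fi qi).
have E : (\int[mu]_(x in D) (f x)%:E = \int[mu]_(x in D) (q x)%:E + \int[mu]_(x in D) (f x - q x)%:E)%E.
  rewrite -(@integralD _ _ _ mu _ mD _ _ qi fqi); apply: eq_integral => x _.
  by rewrite -EFinD subrKC.
rewrite E leeD2l//; apply: (@le_trans _ _ (\int[mu]_(x in D) (Num.max (f x - q x) 0)%:E)%E).
  have mm : measurable_fun D (fun x => f x - q x) by apply/measurable_EFinP; exact: measurable_int fqi.
  apply: le_integral => //.
    apply: (@le_integrable _ _ _ mu D mD _ (EFin \o (fun x => f x - q x))) => //.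
      by apply/measurable_EFinP; exact: measurable_maxr.
    by move=> x _ /=; rewrite lee_fin; case: (leP (f x - q x) 0); rewrite ?normr0 ?normr_ge0.
  by move=> x _ /=; rewrite lee_fin le_max lexx.
rewrite [leLHS]integral_mkcond [leRHS]integral_mkcond; apply: ge0_integral_mono => x; rewrite !patchE.
  by case: ifPn => //= _; rewrite lee_fin le_max lexx orbT.
case: ifPn => //; rewrite inE => Dx; have := fqa x Dx; have := a0 x Dx.
case: (a x) => [r||]//=; rewrite ?leey//.
by rewrite -EFinD !lee_fin ge_max => r0 h; rewrite r0 andbT; lra.
Qed.

(** * Step functions on a uniform time grid *)

Section cells.
Context {R : realType} (h : R).
Hypothesis h0 : 0 < h.
Local Notation mu := (@lebesgue_measure R).
Local Notation cell k := [set` `]k%:R * h, k.+1%:R * h]%R].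

Lemma cellP n r : 0 < r -> r <= n%:R * h -> exists2 k, (k < n)%N & cell k r.
Proof.
elim: n => [|n IH] r0 rn; first by rewrite mul0r in rn; lra.
have [h1|h1] := leP r (n%:R * h); last by exists n => //=; rewrite in_itv/= h1.
by have [k kn hk] := IH r0 h1; exists k => //; exact: ltnW.
Qed.

Lemma cell_indic k l r : cell k r -> (\1_(cell l) r : R) = (l == k)%:R.
Proof.
move=> /=; rewrite in_itv/= => /andP[k1 k2]; rewrite indicE; congr (nat_of_bool _)%:R.
case: eqVneq => [->|lk]; first by rewrite mem_set//= in_itv/= k1.
apply: memNset => /=; rewrite in_itv/= => /andP[l1 l2].
have : (l%:R * h < k.+1%:R * h) by exact: lt_le_trans k2.
have : (k%:R * h < l.+1%:R * h) by exact: lt_le_trans l2.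
rewrite !ltr_pM2r// !ltr_nat !ltnS => kl lk'.
by move: lk; rewrite eqn_leq kl lk'.
Qed.

Definition step_fun n (c : nat -> R) (r : R) : R := \sum_(0 <= k < n) c k * \1_(cell k) r.

Lemma step_funE n c k r : (k < n)%N -> cell k r -> step_fun n c r = c k.
Proof.
move=> kn hk; rewrite /step_fun big_mkord (bigD1 (Ordinal kn))//= (cell_indic _ hk) eqxx mulr1 big1 ?addr0//.
move=> i /negP ik; rewrite (cell_indic _ hk) (_ : (i == k :> nat) = false) ?mulr0//.
by apply/negP => /eqP e; apply: ik; apply/eqP/val_inj.
Qed.

Lemma step_fun0 n c : step_fun n c 0 = 0.
Proof.
rewrite /step_fun big1// => k _; rewrite indicE memNset ?mulr0//= in_itv/= => /andP[k0 _].
by move: k0; rewrite ltNge mulr_ge0// ltW.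
Qed.

Lemma step_fun_int (D : set (measurableTypeR R)) n c : measurable D -> (forall k, (k < n)%N -> cell k `<=` D) ->
  mu.-integrable D (EFin \o step_fun n c) /\
  (\int[mu]_(r in D) (step_fun n c r)%:E)%E = (\sum_(0 <= k < n) c k * h)%:E.
Proof.
move=> mD; rewrite /step_fun; elim: n => [_|n IH cD].
  rewrite (_ : EFin \o _ = fun=> 0%E); last by apply/funext => r /=; rewrite big_nil.
  by split; [exact: integrable0|rewrite big_nil integral0_eq// => r _; rewrite big_nil].
have [i1 e1] := IH (fun k kn => cD k (ltnW kn)).
have mc : measurable (cell n : set (measurableTypeR R)) by exact: measurable_itv.
have i0' : mu.-integrable D (EFin \o \1_(cell n)).
  apply: integrableS (integrable_indic_itv _ _ false false) => //.
have i0 : mu.-integrable D (fun r => (c n)%:E * (\1_(cell n) r)%:E)%E by exact: (integrableZl mD _ i0').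
have E r : (\sum_(0 <= k < n.+1) c k * \1_(cell k) r)%:E =
    ((\sum_(0 <= k < n) c k * \1_(cell k) r)%R%:E + (c n)%:E * (\1_(cell n) r)%:E)%E.
  by rewrite big_nat_recr//= EFinD EFinM.
rewrite (_ : EFin \o _ = (fun r => (\sum_(0 <= k < n) c k * \1_(cell k) r)%R%:E + (c n)%:E * (\1_(cell n) r)%:E)%E); last exact/funext/E.
split; first exact: (integrableD mD i1 i0).
transitivity (\int[mu]_(r in D) ((\sum_(0 <= k < n) c k * \1_(cell k) r)%R%:E + (c n)%:E * (\1_(cell n) r)%:E))%E.
  by apply: eq_integral => r _; exact: E.
rewrite (@integralD _ _ _ mu _ mD _ _ i1 i0) e1 (@integralZl _ _ _ mu _ mD _ i0') integral_indic//.
rewrite setIidl; last exact: cD.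
rewrite [X in (_ * X)%E](_ : _ = h%:E); first by rewrite big_nat_recr//= EFinD EFinM.
apply: etrans (lebesgue_measure_itv _) _; rewrite /= lte_fin ltr_pM2r// ltr_nat ltnSn -EFinB -natr1.
by congr EFin; ring.
Qed.

Lemma step_approx n (f : R -> R) (c q : nat -> R) : mu.-integrable `[0%R, n%:R * h] (EFin \o f) ->
  (forall k r, (k < n)%N -> cell k r -> `|f r - c k| <= q k) ->
  `|\int[mu]_(r in `[0%R, n%:R * h]) f r - \sum_(0 <= k < n) c k * h| <= \sum_(0 <= k < n) q k * h.
Proof.
move=> fi' hq; set D : set R := [set` `]0%R, n%:R * h]%R].
have mD : measurable (D : set (measurableTypeR R)) by exact: measurable_itv.
have sD : D `<=` `[0%R, n%:R * h] by apply: subset_itvr; rewrite bnd_simp.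
have fi : mu.-integrable D (EFin \o f) by apply: integrableS fi' => //; exact: measurable_itv.
(* The cells are open on the left and do not cover [0]; that point is removed from the domain of
   integration. *)
rewrite -(Rintegral_itv_obnd_cbnd fi).
have cD k : (k < n)%N -> cell k `<=` D.
  move=> kn r /=; rewrite !in_itv/= => /andP[r1 r2]; apply/andP; split.
    by apply: le_lt_trans r1; rewrite mulr_ge0// ltW.
  by apply: (le_trans r2); rewrite ler_pM2r// ler_nat.
have [ci ce] := step_fun_int c mD cD; have [qi qe] := step_fun_int q mD cD.
have -> : \sum_(0 <= k < n) c k * h = \int[mu]_(r in D) step_fun n c r by rewrite /Rintegral ce.
have -> : \sum_(0 <= k < n) q k * h = \int[mu]_(r in D) step_fun n q r by rewrite /Rintegral qe.
rewrite -(RintegralB mD fi ci).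
have di : mu.-integrable D (EFin \o (fun r => f r - step_fun n c r)) by exact: (integrableB mD fi ci).
apply: (le_trans (le_normr_Rintegral mD di)); apply: le_Rintegral => //; first exact: (integrable_norm di).
move=> r Dr; have [r0 rn] : 0 < r /\ r <= n%:R * h by move: Dr; rewrite /D/= in_itv/= => /andP.
have [k kn hk] := cellP r0 rn.
by rewrite !(step_funE _ kn hk); exact: hq.
Qed.

End cells.

Lemma In_map_iota (A : Type) (f : nat -> A) n e : List.In e [seq f k | k <- iota 0 n] ->
  exists2 k, (k < n)%N & e = f k.
Proof.
suff H s : List.In e [seq f k | k <- iota s n] -> exists2 k, (k < s + n)%N & e = f k by move=> /H.
elim: n s => [//|n IH] s /= [<-|/IH[k kn ->]]; first by exists s => //; rewrite addnS ltnS leq_addr.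
by exists k => //; rewrite addnS -addSn.
Qed.

Lemma ereal_cvg0_near (R : realType) (I : Type) (F : set_system I) (FF : Filter F) (u : I -> \bar R) (e : R) :
  u @ F --> 0%E -> 0 < e -> \forall i \near F, (u i <= e%:E)%E.
Proof.
move=> /fine_cvgP[fu cu] e0; move/cvgrPdist_le: cu => /(_ e e0).
apply: filterS2 fu => i fi; rewrite sub0r normrN /= => h.
by rewrite -(fineK fi) lee_fin; exact: le_trans (ler_norm _) h.
Qed.

Lemma ereal_cvg0_small (R : realType) (u : nat -> \bar R) (e : R) : u @ \oo --> 0%E -> 0 < e ->
  \forall n \near \oo, (u n <= e%:E)%E.
Proof. exact: ereal_cvg0_near. Qed.

(** * Comparison of Ito integrals with Euler sums *)

Section ito_approx.
Context {R : realType} {disp} {Om : measurableType disp} (P : probability Om R).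
Context (T : R) {m : nat} (F0 : set (set Om)) (B : R -> Om -> 'rV[R]_m).
Hypothesis BM : brownian_motion P T B.
Hypothesis F0i : initial_sigma_algebra P T F0 B.
Variable j : 'I_m.
Local Notation Fi := (filtration F0 B).
Local Notation mu := (@lebesgue_measure R).
Local Notation elem := (@elem R _ Om).
Local Notation ok := (elem_ok P F0 B).

Let sum_iota n (F : nat -> R) : \sum_(k <- iota 0 n) F k = \sum_(0 <= k < n) F k.
Proof. by rewrite /index_iota subn0. Qed.

Definition simple_list (Z : simple_process) : seq elem :=
  [seq Elem (sp_time Z k) (sp_time Z k.+1) (sp_val Z k) | k <- iota 0 (sp_size Z)].

Lemma simple_list_int Z : simple_integral B j Z = list_int B j (simple_list Z).
Proof.
apply/funext => w; rewrite /simple_integral /list_int big_map sum_iota big_mkord.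
by apply: eq_bigr => k _; rewrite /elem_int /dB !mxE.
Qed.

Lemma simple_list_fun Z r w : simple_fun Z r w = list_fun (simple_list Z) r w.
Proof. by rewrite /simple_fun /list_fun big_map sum_iota big_mkord. Qed.

Lemma simple_list_ok t Z : t <= T -> simple_on F0 B t Z -> forall e, List.In e (simple_list Z) -> ok t e.
Proof.
move=> tT [z0 zt hZ] e /(@In_map_iota elem _ _ _)[k kn ->].
have up a b : (a <= b)%N -> (b <= sp_size Z)%N -> sp_time Z a <= sp_time Z b.
  elim: b => [|b IH]; first by rewrite leqn0 => /eqP->.
  rewrite leq_eqVlt => /predU1P[-> //|ab] bs; apply: le_trans (IH ab (ltnW bs)) _.
  by have [] := hZ b bs.
have [h1 h2 [C hC]] := hZ k kn.
have k0 : 0 <= sp_time Z k by apply: le_trans z0 (up _ _ (leq0n _) (ltnW kn)).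
have kt : sp_time Z k.+1 <= t by apply: le_trans (up _ _ kn (leqnn _)) zt.
split=> //=; apply: (@sqi_le _ _ _ _ _ (fun=> C)) => //; last exact: sqi_cst.
have kT : sp_time Z k <= T by apply: le_trans h1 (le_trans kt tT).
exact: mw_meas (filtration_measurable BM F0i kT) h2.
Qed.

Definition opp_elem (e : elem) : elem := Elem (es e) (et e) (fun w => - eu e w).

Lemma opp_ok t e : ok t e -> ok t (opp_elem e).
Proof.
move=> [s0 st tT mu' sq]; split=> //=.
  by rewrite (_ : (fun w => _) = fun w => -1 * eu e w); [by apply: mwZ => //; exact: filtration_sigma|apply/funext => w; rewrite mulN1r].
by rewrite (_ : (fun w => _) = fun w => -1 * eu e w); [exact: sqiZ|apply/funext => w; rewrite mulN1r].
Qed.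

Lemma opp_list_int l w : list_int B j (map opp_elem l) w = - list_int B j l w.
Proof. by rewrite /list_int big_map -sumrN; apply: eq_bigr => e _; rewrite /elem_int /= mulNr. Qed.

Lemma opp_list_fun l r w : list_fun (map opp_elem l) r w = - list_fun l r w.
Proof. by rewrite /list_fun big_map -sumrN; apply: eq_bigr => e _; rewrite /= mulNr. Qed.

Variable h : R.
Hypothesis h0 : 0 < h.
Local Notation cell k := [set` `]k%:R * h, k.+1%:R * h]%R].

Definition grid_list (u : nat -> Om -> R) n : seq elem := [seq Elem (k%:R * h) (k.+1%:R * h) (u k) | k <- iota 0 n].

Lemma grid_list_fun u n r w : list_fun (grid_list u n) r w = step_fun h n (fun k => u k w) r.
Proof. by rewrite /list_fun big_map sum_iota. Qed.

(** The isometry is available for elementary integrands only, so it is applied to the difference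
    between the simple processes that define [I] and the grid process. The energy of that difference
    is at most twice the sum of the grid error and of the distance from the simple processes to [H],
    which vanishes in the limit. The factor [4] is made of this [2] and of the [2] that splits
    [(I - J)^2]. *)
Lemma ito_euler n H I (u q : nat -> Om -> R) : n%:R * h <= T ->
  ito_integral P F0 B j (n%:R * h) H I ->
  (forall k, (k < n)%N -> measurable_wrt (Fi (k%:R * h)) (u k) /\ sqi P (u k)) ->
  (forall k, (k < n)%N -> intg P (q k)) ->
  (forall k r w, (k < n)%N -> cell k r -> (H r w - u k w) ^+ 2 <= q k w) ->
  let J w := \sum_(0 <= k < n) u k w * dB B (k%:R * h) (k.+1%:R * h) j w in
  sqi P (fun w => I w - J w) /\
  Ex P (fun w => (I w - J w) ^+ 2) <= 4 * gauss2 * \sum_(0 <= k < n) h * Ex P (q k).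
Proof.
move=> nT [_ mI [Z [Z1 Z2 Z3]]] hu iq hq J.
pose t := n%:R * h; pose G := grid_list u n.
have g0 := gauss2_ge0 (R := R).
have okG e : List.In e G -> ok t e.
  move=> /(@In_map_iota elem _ _ _)[k kn ->]; have [m1 s1] := hu k kn.
  by split=> //=; rewrite ?mulr_ge0 ?ler_wpM2r ?ler_nat// ltW.
have JE : J = list_int B j G.
  by apply/funext => w; rewrite /list_int big_map sum_iota.
pose S nu := simple_list (Z nu) ++ map opp_elem G.
have okS nu e : List.In e (S nu) -> ok t e.
  move=> /(@List.in_app_or _ _ _ _)[]; first exact: simple_list_ok.
  by move=> /List.in_map_iff[f [<- /okG]]; exact: opp_ok.
have SI nu w : list_int B j (S nu) w = simple_integral B j (Z nu) w - J w.
  by rewrite /S /list_int big_cat/= -!/(list_int _ _ _ _) opp_list_int JE simple_list_int.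
have SF nu r w : list_fun (S nu) r w = simple_fun (Z nu) r w - step_fun h n (fun k => u k w) r.
  by rewrite /S /list_fun big_cat/= -!/(list_fun _ _ _) opp_list_fun simple_list_fun grid_list_fun.
pose Q w := \sum_(0 <= k < n) q k w * h.
pose a nu := (\int[P]_w \int[mu]_(s in `[0%R, t]) ((simple_fun (Z nu) s w - H s w) ^+ 2)%:E)%E.
pose c nu := (\int[P]_w ((simple_integral B j (Z nu) w - I w) ^+ 2)%:E)%E.
have okT l : (forall e, List.In e l -> ok t e) -> forall e, List.In e l -> ok T e.
  by move=> okl e /okl[*]; split=> //; exact: le_trans nT.
have [iQ eQ] : intg P Q /\ Ex P Q = \sum_(0 <= k < n) h * Ex P (q k).
  suff Hp p : (p <= n)%N -> intg P (fun w => \sum_(0 <= k < p) q k w * h) /\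
    Ex P (fun w => \sum_(0 <= k < p) q k w * h) = \sum_(0 <= k < p) h * Ex P (q k) by exact: Hp.
  elim: p => [_|k IH kn].
    rewrite (_ : (fun w => _) = fun=> 0); last by apply/funext => w; rewrite big_nil.
    by rewrite big_nil Ex_cst; split=> //; exact: intg_cst.
  have [i1 e1] := IH (ltnW kn); have i2 := intgZ h (iq k kn).
  rewrite (_ : (fun w => _) = fun w => \sum_(0 <= i < k) q i w * h + h * q k w); last first.
    by apply/funext => w; rewrite big_nat_recr//= (mulrC h).
  by rewrite (ExD i1 i2) e1 (ExZ _ (iq k kn)) big_nat_recr//=; split=> //; exact: intgD.
have t0 : 0 <= t by rewrite mulr_ge0 // ltW.
have mD : measurable (`[0%R, t] : set (measurableTypeR R)) by exact: measurable_itv.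
have cD k : (k < n)%N -> cell k `<=` [set` `[0%R, t]%R].
  move=> kn r /=; rewrite !in_itv/= => /andP[r1 r2]; apply/andP; split.
    by apply: ltW; apply: le_lt_trans r1; rewrite mulr_ge0// ltW.
  by apply: (le_trans r2); rewrite ler_pM2r// ler_nat.
have fun0 l w : (forall e, List.In e l -> ok t e) -> list_fun l 0 w = 0.
  rewrite /list_fun; elim: l => [|e l IH] okl; first by rewrite big_nil.
  rewrite big_cons IH ?addr0; last by move=> f fl; apply: okl; right.
  have [s0 _ _ _ _] := okl e (or_introl erefl).
  by rewrite indicE memNset ?mulr0//= in_itv/= => /andP[]; rewrite ltNge s0.
pose A nu w := (\int[mu]_(s in `[0%R, t]) ((simple_fun (Z nu) s w - H s w) ^+ 2)%:E)%E.
have path nu w : ((energy (S nu) w / 2)%:E <= (Q w)%:E + A nu w)%E.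
  have [i1 e1] := energyE w (okS nu).
  have i1' := @integrableZr _ _ _ mu _ mD 2^-1 _ i1.
  have [i2 e2] := step_fun_int h0 (fun k => q k w) mD cD.
  have := @integral_le_add _ _ _ mu `[0%R, t] (fun r => list_fun (S nu) r w ^+ 2 / 2) (step_fun h n (fun k => q k w))
    (fun s => ((simple_fun (Z nu) s w - H s w) ^+ 2)%:E) mD i1' i2.
  have -> : (\int[mu]_(x in `[0%R, t]) (list_fun (S nu) x w ^+ 2 / 2)%:E = (energy (S nu) w / 2)%:E)%E.
    by under eq_integral do rewrite EFinM; rewrite (@integralZr _ _ _ mu _ mD _ i1) e1.
  rewrite e2; apply=> [r _|r /=]; first by rewrite lee_fin sqr_ge0.
  rewrite in_itv/= le_eqVlt => /andP[/predU1P[<- _|r0 rn]].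
    (* At [r = 0], outside all left-open intervals, both step functions vanish. *)
    rewrite (fun0 _ _ (okS nu)) step_fun0// expr0n/= mul0r add0e lee_fin; exact: sqr_ge0.
  have [k kn hk] := cellP r0 rn.
  rewrite SF !(step_funE _ _ kn hk)// lee_fin; have := hq k r w kn hk.
  set z := simple_fun _ _ _; have := sqr_ge0 (z - H r w - (H r w - u k w)); nra.
have main nu : ((Ex P (fun w => list_int B j (S nu) w ^+ 2))%:E <= (2 * gauss2)%:E * ((Ex P Q)%:E + a nu))%E.
  have [_ ie ->] := ito_isometry BM F0i j (okT _ (okS nu)).
  have A0 w : (0 <= A nu w)%E by apply: integral_ge0 => r _; rewrite lee_fin sqr_ge0.
  have ie2 : intg P (fun w => energy (S nu) w / 2) by under eq_fun do rewrite mulrC; exact: intgZ.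
  have := @integral_le_add _ _ _ P setT _ Q (A nu) measurableT ie2 iQ (fun w _ => A0 w) (fun w _ => path nu w).
  rewrite (intgE iQ) (intgE ie2) => hle.
  apply: (@le_trans _ _ ((2 * gauss2)%:E * (Ex P (fun w => energy (S nu) w / 2))%:E)%E).
    rewrite -EFinM lee_fin (_ : (fun w => _ / 2) = fun w => 2^-1 * energy (S nu) w); last by apply/funext => w; rewrite mulrC.
    by rewrite (ExZ _ ie) le_eqVlt; apply/orP; left; apply/eqP; field.
  by apply: lee_wpmul2l => //; rewrite lee_fin mulr_ge0.
have sS nu : sqi P (list_int B j (S nu)) by have [] := ito_isometry BM F0i j (okT _ (okS nu)).
have sJ : sqi P J by rewrite JE; have [] := ito_isometry BM F0i j (okT _ okG).
have sZ nu : sqi P (simple_integral B j (Z nu)).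
  rewrite (_ : simple_integral B j (Z nu) = fun w => list_int B j (S nu) w + J w); first exact: sqiD.
  by apply/funext => w; rewrite SI subrK.
have small e : 0 < e -> exists nu, (a nu <= e%:E)%E /\ (c nu <= e%:E)%E.
  move=> e0; have h1 := ereal_cvg0_small Z2 e0; have h2 := ereal_cvg0_small Z3 e0.
  by have [N _ hN] := filterI h1 h2; exists N; exact: hN (leqnn N).
(* [I] is only given as measurable; being at finite L2 distance from one elementary integral, it is
   square-integrable. *)
have sI : sqi P I.
  have [nu [_ hc]] := small 1 ltr01.
  have mm : measurable_fun setT (fun w => simple_integral B j (Z nu) w - I w).
    by apply: measurable_funB => //; exact: (sZ nu).1.
  have sd : sqi P (fun w => simple_integral B j (Z nu) w - I w).
    split=> //; apply/intg_pos; [exact: measurable_funX|by move=> w; exact: sqr_ge0|].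
    by apply: le_lt_trans hc _; exact: ltry.
  rewrite (_ : I = fun w => simple_integral B j (Z nu) w - (simple_integral B j (Z nu) w - I w)).
    exact: sqiB.
  by apply/funext => w; rewrite opprB addrC subrK.
have sIJ := sqiB sI sJ; split=> //; rewrite -eQ.
(* The approximation error [e'] appears twice for the integrals and [4 gauss2] times for the
   energies. *)
apply/ler_addgt0Pr => e e0; pose e' := e / (2 + 4 * gauss2 (R := R)).
have den0 : 0 < 2 + 4 * gauss2 (R := R) by lra.
have e'0 : 0 < e' by rewrite divr_gt0.
have [nu [ha hc]] := small _ e'0.
have sd := sqiB (sZ nu) sI.
have hc' : Ex P (fun w => (simple_integral B j (Z nu) w - I w) ^+ 2) <= e' by rewrite -lee_fin -(intgE sd.2).
have hm : Ex P (fun w => list_int B j (S nu) w ^+ 2) <= 2 * gauss2 * (Ex P Q + e').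
  rewrite -lee_fin; apply: le_trans (main nu) _; rewrite [leRHS]EFinM EFinD.
  by apply: lee_wpmul2l; [rewrite lee_fin mulr_ge0|rewrite leeD2l].
have i1 := intgZ 2 sd.2; have i2 := intgZ 2 (sS nu).2.
apply: (@le_trans _ _ (2 * Ex P (fun w => (simple_integral B j (Z nu) w - I w) ^+ 2) + 2 * Ex P (fun w => list_int B j (S nu) w ^+ 2))).
  rewrite -(ExZ 2 sd.2) -(ExZ 2 (sS nu).2) -(ExD i1 i2); apply: Ex_le => [||w].
  - exact: sIJ.2.
  - exact: intgD.
  rewrite SI; set z := simple_integral _ _ _ _.
  have := sqr_ge0 (z - I w + (z - J w)); nra.
have : (2 + 4 * gauss2 (R := R)) * e' = e by rewrite /e' mulrC divfK// gt_eqF.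
lra.
Qed.

End ito_approx.

Lemma Ex_le_ae (R : realType) disp (Om : measurableType disp) (P : probability Om R) (f g : Om -> R) :
  intg P f -> intg P g -> {ae P, forall w, f w <= g w} -> Ex P f <= Ex P g.
Proof.
move=> fi gi fg; have mm : measurable_fun setT (fun w => Num.max (f w) (g w)).
  by apply: measurable_maxr; [exact: intg_meas fi|exact: intg_meas gi].
have ae : {ae P, forall w, g w = Num.max (f w) (g w)} by apply: filterS fg => w fgw; rewrite max_r.
have [im <-] := intg_ae (intg_meas gi) mm ae gi.
by apply: Ex_le => // w; rewrite le_max lexx.
Qed.

(** * Strong error of the scheme *)

Section solution.
Context {R : realType} {disp} {Om : measurableType disp} (P : probability Om R).
Context (T : R) {m : nat} (F0 : set (set Om)) (B : R -> Om -> 'rV[R]_m) {d : nat}.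
Hypothesis T0 : 0 < T.
Hypothesis BM : brownian_motion P T B.
Hypothesis F0i : initial_sigma_algebra P T F0 B.
Local Notation Fi := (filtration F0 B).
Local Notation V := 'rV[R]_d.
Variables (b0 : V -> P2 R d -> V) (b1 : V -> P2 R d -> 'M[R]_(d, m)).

Definition coefs (i : 'I_d) (o : option 'I_m) (x : V) (mu : P2 R d) : R :=
  if o is Some j then b1 x mu i j else b0 x mu 0 i.

Variable K : R.
Hypothesis K0 : 0 <= K.
Hypothesis hlip : forall i o, lip_coef P (coefs i o) K.
Hypothesis hcts : forall i o mu, continuous (fun x => coefs i o x mu).

Variables (xi : Om -> V) (X : R -> Om -> V).
Hypothesis lxi : L2 P F0 xi.
Hypothesis sX : S2 P T F0 B X.

Let T0' : 0 <= T := ltW T0.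

Let mX t : 0 <= t <= T -> measurable_fun setT (X t).
Proof.
move=> tT; have [h _ _] := sX; apply: mw_meas (h t tT).
by apply: (filtration_measurable BM F0i); case/andP: tT.
Qed.

Let cX w : {within `[0, T], continuous (X ^~ w)}.
Proof. by have [_ h _] := sX. Qed.

Let iX : (\int[P]_w ereal_sup [set ((enorm (X t w)) ^+ 2)%:E | t in `[0%R, T]] < +oo)%E.
Proof. by have [_ _ h] := sX. Qed.

Lemma S2_L2v t : 0 <= t <= T -> L2v P (X t).
Proof.
move=> tT; split; first exact: mX.
have mm : measurable_fun setT (fun w => enorm (X t w) ^+ 2).
  by apply: measurable_funX; apply: measurable_enormf; exact: mX.
apply/intg_pos => // [w|]; first exact: sqr_ge0.
apply: le_lt_trans iX; apply: ge0_integral_mono => w; first by rewrite lee_fin sqr_ge0.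
by apply: ereal_sup_ubound; exists t => //=; rewrite in_itv.
Qed.

Let D h := path_mod T X h.
Let ED h := Ex P (fun w => D h w ^+ 2).

Let D_sqi h : sqi P (D h). Proof. exact: path_mod_sqi. Qed.
Let ED0 h : 0 <= ED h. Proof. by apply: Ex_ge0 => w; exact: sqr_ge0. Qed.

Let nrm_D h s t : 0 <= s <= T -> 0 <= t <= T -> `|t - s| <= h -> nrm P (fun w => X t w - X s w) <= Num.sqrt (ED h).
Proof.
move=> sT tT st; apply: nrm_le; first exact: sqrtr_ge0.
rewrite sqr_sqrtr//; apply: Ex_le => [||w].
- exact: (L2vB (S2_L2v tT) (S2_L2v sT)).2.
- exact: (D_sqi h).2.
by rewrite lerXn2r ?nnegrE ?enorm_ge0 ?path_mod_ge0//; exact: path_modP.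
Qed.

Lemma coef_sqi i o (Y : Om -> V) : L2v P Y -> sqi P (fun w => coefs i o (Y w) (law P Y)).
Proof.
move=> sY; apply: (@sqi_le _ _ _ _ _ (fun w => `|coefs i o 0 (law P (fun=> 0))| + K * nrm P Y + K * enorm (Y w))).
- exact: measurableT_comp (measurable_cts (hcts (mu := _))) sY.1.
- move=> w; have := hlip i o 0 (Y w) (L2v_cst P 0) sY.
  rewrite subr0 (_ : (fun w => Y w - 0) = Y); last by apply/funext => z; rewrite subr0.
  move=> hb; have := ler_normD (coefs i o (Y w) (law P Y) - coefs i o 0 (law P (fun=> 0))) (coefs i o 0 (law P (fun=> 0))).
  by rewrite subrK; lra.
by apply: sqiD; [exact: sqi_cst|exact: sqiZ (L2v_sqi sY)].
Qed.

(** Needed to integrate the coefficients in time along a path. The path is continuous, and so is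
    [s |-> X s] in L2, by [path_mod_cvg], which takes care of the measure argument. *)
Lemma coef_within_cts i o w : {within `[0, T], continuous (fun s => coefs i o (X s w) (law P (X s)))}.
Proof.
apply/subspace_continuousP => x; rewrite /= in_itv/= => xT.
apply/cvgrPdist_le => e e0; pose e' := e / (2 * (K + 1)).
have K1 : 0 < K + 1 by rewrite ltr_wpDl.
have e'0 : 0 < e' by rewrite divr_gt0// mulr_gt0.
have [r r0 hr] := within_enorm (@cX w) xT e'0.
have := path_mod_cvg T0' mX cX iX => /cvgrPdist_le /(_ (e' ^+ 2)).
have e'20 : 0 < e' ^+ 2 by rewrite exprn_gt0.
move=> /(_ e'20)[N _ /(_ N (leqnn N))]; rewrite /= sub0r normrN -/(ED _) ger0_norm// => hN.
have TN : 0 < T / N.+1%:R by rewrite divr_gt0.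
rewrite /prop_near1 /nbhs/=; exists (Num.min r (T / N.+1%:R)); first by rewrite /= lt_min r0.
move=> y; rewrite /ball/= lt_min => /andP[yr yN]; rewrite in_itv/= => yT.
apply: (le_trans (hlip i o _ _ (S2_L2v yT) (S2_L2v xT))).
have h1 : enorm (X x w - X y w) <= e' by rewrite enormBC; apply: hr => //; rewrite distrC.
have h2 : nrm P (fun w => X x w - X y w) <= e'.
  apply: (le_trans (nrm_D yT xT (ltW yN))).
  by rewrite -(ger0_norm (ltW e'0)) -sqrtr_sqr ler_wsqrtr.
apply: (@le_trans _ _ (K * (e' + e'))); first by rewrite ler_wpM2l// lerD.
have : (2 * (K + 1)) * e' = e by rewrite /e' mulrC divfK// gt_eqF// mulr_gt0.
by nra.
Qed.

Lemma coef_integrable i o w t : 0 <= t <= T ->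
  (@lebesgue_measure R).-integrable `[0%R, t] (EFin \o (fun s => coefs i o (X s w) (law P (X s)))).
Proof.
move=> /andP[t0 tT].
have sub : [set` `[0, t]%R] `<=` [set` `[0, T]%R].
  by move=> r /=; rewrite !in_itv/= => /andP[-> /le_trans]; exact.
have := continuous_subspaceW sub (@coef_within_cts i o w).
exact: (@continuous_compact_integrable _ _ _ (@segment_compact R 0 t)).
Qed.

(** [d] coordinates; [2 T] from the drift, by Cauchy-Schwarz in time; [8 m^2 gauss2] from the [m]
    noises, as [2 m] times [m] times the constant of [ito_euler]; [8 K^2] from the mean of [q]. *)
Let errC := d%:R * (2 * T + 8 * m%:R ^+ 2 * gauss2 (R := R)) * (8 * K ^+ 2).

Section fixed_step.
Variables (h : R) (n : nat).
Hypotheses (h0 : 0 < h) (nT : n%:R * h <= T).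
Hypothesis MV : mckean_vlasov P T F0 B b0 b1 xi X.

Local Notation Y k := (eul P B coefs h xi k).
Let e k w := X (k%:R * h) w - Y k w.

Let kT k : (k <= n)%N -> 0 <= k%:R * h <= T.
Proof.
move=> kn; apply/andP; split; first by rewrite mulr_ge0// ltW.
by apply: le_trans nT; rewrite ler_pM2r// ler_nat.
Qed.

Let Y_ok k : (k <= n)%N -> measurable_wrt (Fi (k%:R * h)) (Y k) /\ L2v P (Y k).
Proof. by move=> /kT/andP[_ k2]; exact: (eul_ok T0' BM F0i hlip hcts (ltW h0) k2 lxi). Qed.

Let e_ok k : (k <= n)%N -> L2v P (e k).
Proof. by move=> kn; apply: L2vB; [exact: S2_L2v (kT kn)|exact: (Y_ok kn).2]. Qed.

Let q1 k w := K * (D h w + enorm (e k w) + (Num.sqrt (ED h) + nrm P (e k))).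
Let q k w := 4 * K ^+ 2 * (D h w ^+ 2 + enorm (e k w) ^+ 2 + (ED h + nrm2 P (e k))).

Let q1_ge0 k w : 0 <= q1 k w.
Proof. by rewrite mulr_ge0// !addr_ge0 ?path_mod_ge0 ?enorm_ge0 ?sqrtr_ge0 ?nrm_ge0. Qed.

Let q1q k w : q1 k w ^+ 2 <= q k w.
Proof.
rewrite /q1 /q -nrm_sqr -{2}(sqr_sqrtr (ED0 h)) exprMn.
move: (D h w) (enorm (e k w)) (Num.sqrt (ED h)) (nrm P (e k)) => a b c f.
rewrite -[leRHS]mulrA [leRHS]mulrCA ler_wpM2l ?sqr_ge0//.
have := sqr_ge0 (a - b); have := sqr_ge0 (a - c); have := sqr_ge0 (a - f).
have := sqr_ge0 (b - c); have := sqr_ge0 (b - f); have := sqr_ge0 (c - f); nra.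
Qed.

Let q_intg k : (k <= n)%N -> intg P (q k) /\ Ex P (q k) = 8 * K ^+ 2 * (ED h + nrm2 P (e k)).
Proof.
move=> kn; have i1 := intgD (D_sqi h).2 (e_ok kn).2; have i2 := intg_cst P (ED h + nrm2 P (e k)).
have i3 := intgD i1 i2; split; first exact: (intgZ (4 * K ^+ 2) i3).
rewrite (ExZ _ i3) (ExD i1 i2) (ExD (D_sqi h).2 (e_ok kn).2) Ex_cst -/(ED h) -/(nrm2 P (e k)).
by ring.
Qed.

Let coef_close k i o r w : (k < n)%N -> k%:R * h < r <= k.+1%:R * h ->
  `|coefs i o (X r w) (law P (X r)) - coefs i o (Y k w) (law P (Y k))| <= q1 k w.
Proof.
move=> kn /andP[kr rk]; have kT' := kT (ltnW kn).
have rT : 0 <= r <= T.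
  by case/andP: (kT kn) => _ h2; case/andP: kT' => h1 _; rewrite (le_trans h1 (ltW kr)) (le_trans rk h2).
have rh : `|r - k%:R * h| <= h.
  by rewrite gtr0_norm ?subr_gt0//; move: rk; rewrite -natr1 mulrDl mul1r; lra.
have sY := (Y_ok (ltnW kn)).2; have sr := S2_L2v rT; have sk := S2_L2v kT'.
apply: (le_trans (hlip i o _ _ sY sr)); rewrite ler_wpM2l//; apply: lerD.
  rewrite -(subrKA (X (k%:R * h) w)) (le_trans (enormD _ _))// lerD2r.
  exact: path_modP.
by rewrite (le_trans (nrm_triangle sr sk sY))// lerD2r nrm_D.
Qed.

Let eul_sum k i w : Y k w 0 i = xi w 0 i + \sum_(0 <= l < k) coefs i None (Y l w) (law P (Y l)) * h +
  \sum_j \sum_(0 <= l < k) coefs i (Some j) (Y l w) (law P (Y l)) * dB B (l%:R * h) (l.+1%:R * h) j w.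
Proof.
elim: k => [|k IH].
  by rewrite big_nil addr0 big1 ?addr0// => j _; rewrite big_nil.
rewrite big_nat_recr//= mxE IH.
have E j : \sum_(0 <= l < k.+1) coefs i (Some j) (Y l w) (law P (Y l)) * dB B (l%:R * h) (l.+1%:R * h) j w =
   \sum_(0 <= l < k) coefs i (Some j) (Y l w) (law P (Y l)) * dB B (l%:R * h) (l.+1%:R * h) j w +
   coefs i (Some j) (Y k w) (law P (Y k)) * dB B (k%:R * h) (k.+1%:R * h) j w by rewrite big_nat_recr.
rewrite (eq_bigr _ (fun j _ => E j)).
rewrite big_split/= -natr1 mulrDl mul1r; ring.
Qed.

(** Solution and scheme are compared in integrated form: [step_approx] handles the drift path by
    path, [ito_euler] each noise. The error at earlier grid times remains on the right for
    Gronwall. *)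
Lemma euler_error k : (k <= n)%N -> nrm2 P (e k) <= errC * \sum_(0 <= l < k) h * (ED h + nrm2 P (e l)).
Proof.
move=> kn; set S := \sum_(0 <= l < k) _.
have g0 := gauss2_ge0 (R := R).
have ltn_le l : (l < k)%N -> (l < n)%N by move=> lk; exact: leq_trans kn.
have [_ /(_ _ (kT kn))[I [hI aeI]]] := MV.
rewrite (nrm2_sum (e_ok kn)).
suff H i : Ex P (fun w => e k w 0 i ^+ 2) <= (2 * T + 8 * m%:R ^+ 2 * gauss2 (R := R)) * (8 * K ^+ 2) * S.
  apply: (@le_trans _ _ (\sum_(i < d) (2 * T + 8 * m%:R ^+ 2 * gauss2 (R := R)) * (8 * K ^+ 2) * S)).
    by apply: ler_sum => i _; exact: H.
  rewrite sumr_const card_ord -mulr_natl le_eqVlt; apply/orP; left; apply/eqP; rewrite /errC; ring.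
pose J j w := \sum_(0 <= l < k) coefs i (Some j) (Y l w) (law P (Y l)) * dB B (l%:R * h) (l.+1%:R * h) j w.
have noise j : sqi P (fun w => I w i j - J j w) /\
    Ex P (fun w => (I w i j - J j w) ^+ 2) <= 4 * gauss2 * \sum_(0 <= l < k) h * Ex P (q l).
  apply: (ito_euler BM F0i h0 _ (hI i j)); first by case/andP: (kT kn).
  - move=> l lk; have ln := ltn_le _ lk; have [mY sY] := Y_ok (ltnW ln).
    split; first exact: cf_mw hcts _ _ _ _ _ (filtration_sigma _ _ _) mY.
    exact: coef_sqi.
  - by move=> l lk; exact: (q_intg (ltnW (ltn_le _ lk))).1.
  - move=> l r w lk; rewrite /= in_itv/= => hr; apply: le_trans (q1q l w).
    rewrite -[leLHS]real_normK ?num_real// lerXn2r ?nnegrE ?q1_ge0//.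
    exact: (coef_close i (Some j) w (ltn_le _ lk) hr).
have qS : \sum_(0 <= l < k) h * Ex P (q l) = 8 * K ^+ 2 * S.
  rewrite /S mulr_sumr; apply: eq_big_nat => l /andP[_ lk].
  by rewrite (q_intg (ltnW (ltn_le _ lk))).2; ring.
pose Rd w := \int[lebesgue_measure]_(s in `[0, k%:R * h]) b0 (X s w) (law P (X s)) 0 i -
  \sum_(0 <= l < k) coefs i None (Y l w) (law P (Y l)) * h.
have drift w : Rd w ^+ 2 <= T * \sum_(0 <= l < k) h * q l w.
  have hR : `|Rd w| <= \sum_(0 <= l < k) q1 l w * h.
    apply: (step_approx h0 (@coef_integrable i None w _ (kT kn))) => l r lk; rewrite /= in_itv/= => hr.
    exact: (coef_close i None w (ltn_le _ lk) hr).
  rewrite -real_normK ?num_real//; apply: (@le_trans _ _ ((\sum_(0 <= l < k) q1 l w * h) ^+ 2)).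
    rewrite lerXn2r ?nnegrE//; apply: le_trans hR; exact: normr_ge0.
  rewrite !big_mkord; apply: (le_trans (sum_sqr_le _)).
  apply: (@le_trans _ _ (k%:R * h * \sum_(l < k) h * q l w)); last first.
    by apply: ler_wpM2r; [apply: sumr_ge0 => l _; apply: mulr_ge0 (ltW h0) (le_trans (sqr_ge0 _) (q1q l w))|case/andP: (kT kn)].
  rewrite -mulrA ler_wpM2l// mulr_sumr; apply: ler_sum => l _.
  by rewrite exprMn mulrA -expr2 mulrC ler_wpM2l ?sqr_ge0.
have iq : intg P (fun w => \sum_(0 <= l < k) h * q l w) /\
    Ex P (fun w => \sum_(0 <= l < k) h * q l w) = \sum_(0 <= l < k) h * Ex P (q l).
  suff Hp p : (p <= k)%N -> intg P (fun w => \sum_(0 <= l < p) h * q l w) /\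
    Ex P (fun w => \sum_(0 <= l < p) h * q l w) = \sum_(0 <= l < p) h * Ex P (q l) by exact: Hp.
  elim: p => [_|p IH pk].
    rewrite (_ : (fun w => _) = fun=> 0); last by apply/funext => w; rewrite big_nil.
    by rewrite big_nil Ex_cst; split=> //; exact: intg_cst.
  have [i1 e1] := IH (ltnW pk); have iq := (q_intg (leq_trans (ltnW pk) kn)).1.
  have i2 := intgZ h iq.
  rewrite (_ : (fun w => _) = fun w => \sum_(0 <= l < p) h * q l w + h * q p w); last first.
    by apply/funext => w; rewrite big_nat_recr.
  by rewrite (ExD i1 i2) e1 (ExZ _ iq) big_nat_recr//=; split=> //; exact: intgD.
have iN := intg_sum (index_enum 'I_m) (fun j => (noise j).1.2).
have i1 := intgZ (2 * T) iq.1; have i2 := intgZ (2 * m%:R) iN.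
apply: (@le_trans _ _ (Ex P (fun w => 2 * T * \sum_(0 <= l < k) h * q l w + 2 * m%:R * \sum_j (I w i j - J j w) ^+ 2))).
  apply: Ex_le_ae; first exact: ((iffLR (L2v_coord _ _) (e_ok kn)) i).2.
    exact: intgD.
  apply: filterS aeI => w /(_ i) hX.
  have -> : e k w 0 i = Rd w + \sum_j (I w i j - J j w).
    by rewrite /e mxE mxE hX eul_sum /Rd /J sumrB; ring.
  have := sum_sqr_le (fun j => I w i j - J j w); have := drift w.
  move: (Rd w) (\sum_j (I w i j - J j w)) (\sum_(0 <= l < k) h * q l w) (\sum_j (I w i j - J j w) ^+ 2).
  move=> r s a b h1 h2; have := sqr_ge0 (r - s); nra.
rewrite (ExD i1 i2) (ExZ _ iq.1) iq.2 (ExZ _ iN) Ex_sum; last by move=> j; exact: (noise j).1.2.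
have : \sum_j Ex P (fun w => (I w i j - J j w) ^+ 2) <= m%:R * (4 * gauss2 * (8 * K ^+ 2 * S)).
  apply: (@le_trans _ _ (\sum_(j < m) (4 * gauss2 * (8 * K ^+ 2 * S)))).
    by apply: ler_sum => j _; rewrite -qS; exact: (noise j).2.
  by rewrite sumr_const card_ord -[leLHS]mulr_natl.
rewrite qS => hN; have m0 : 0 <= 2 * m%:R :> R by rewrite mulr_ge0.
have := ler_wpM2l m0 hN; rewrite -subr_ge0 => hh; rewrite -subr_ge0; apply: le_trans hh _.
rewrite le_eqVlt; apply/orP; left; apply/eqP; ring.
Qed.

(** Gronwall is applied to the right-hand side of [euler_error]: it dominates the error and, being a
    partial sum, satisfies a one-step recursion. *)
Lemma euler_error_final : nrm2 P (e n) <= expR (errC * T) * (T * (errC * ED h)).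
Proof.
have g0 := gauss2_ge0 (R := R).
have C0 : 0 <= errC by rewrite /errC; nonneg.
pose x k := errC * \sum_(0 <= l < k) h * (ED h + nrm2 P (e l)).
apply: (le_trans (euler_error (leqnn n))); rewrite -/(x n).
have x0 k : 0 <= x k.
  by apply: mulr_ge0 => //; apply: sumr_ge0 => l _; rewrite mulr_ge0 ?addr_ge0 ?nrm2_ge0// ltW.
have := @gronwall _ x errC (errC * ED h) h n C0 _ (ltW h0) x0.
have -> : x 0%N = 0 by rewrite /x big_nil mulr0.
rewrite add0r => H; apply: le_trans (H _ _) _.
- exact: mulr_ge0.
- move=> k kn; have ek : nrm2 P (e k) <= x k by exact: euler_error (ltnW kn).
  rewrite /x big_nat_recr//= mulrDr -/(x k).
  have : errC * h * nrm2 P (e k) <= errC * h * x k by rewrite ler_wpM2l// mulr_ge0// ltW.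
  lra.
- apply: ler_pM; first exact: expR_ge0.
  + by apply: mulr_ge0; [apply: mulr_ge0 => //; exact: ltW|exact: mulr_ge0].
  + by rewrite ler_expR ler_wpM2l.
  + by apply: ler_wpM2r => //; exact: mulr_ge0.
Qed.

End fixed_step.

Lemma euler_cvg : mckean_vlasov P T F0 B b0 b1 xi X ->
  nrm P (fun w => X T w - eul P B coefs (T / n.+1%:R) xi n.+1 w) @[n --> \oo] --> 0.
Proof.
move=> MV; apply/cvgrPdist_le => r r0.
pose M := expR (errC * T) * (T * errC).
have M0 : 0 <= M.
  by have := gauss2_ge0 (R := R) => g0; rewrite /M /errC; apply: mulr_ge0; [exact: expR_ge0|nonneg].
have r'0 : 0 < r ^+ 2 / (M + 1) by rewrite divr_gt0 ?exprn_gt0// ltr_wpDl.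
have := path_mod_cvg T0' mX cX iX => /cvgrPdist_le /(_ _ r'0).
apply: filterS => n; rewrite !sub0r !normrN -/(ED _) ger0_norm// => hn.
rewrite ger0_norm ?nrm_ge0//; apply: nrm_le; first exact: ltW.
have nN : n.+1%:R * (T / n.+1%:R) = T by rewrite mulrC divfK.
have h0 : 0 < T / n.+1%:R by rewrite divr_gt0.
have nT : n.+1%:R * (T / n.+1%:R) <= T by rewrite nN.
have := euler_error_final h0 nT MV; rewrite nN => /le_trans; apply.
rewrite [leLHS](_ : _ = M * ED (T / n.+1%:R)); last by rewrite /M; ring.
apply: (le_trans (ler_wpM2l M0 hn)); rewrite mulrCA ger_pMr ?exprn_gt0//.
by rewrite ler_pdivrMr ?ltr_wpDl// mul1r lerDl.
Qed.

End solution.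

(** * Invariance in law of the Euler scheme *)

Section pair_law.
Context {R : realType} {disp} {Om : measurableType disp} (P : probability Om R).
Context {d1 d2 d3} {U : measurableType d1} {V : measurableType d2} {W : measurableType d3}.

(** The law of [(Y, Z)] is the product of the two laws, hence the same for [Y']. *)
Lemma indep_image_law (Y Y' : Om -> U) (Z : Om -> V) (f : U -> V -> W) :
  measurable_fun setT Y -> measurable_fun setT Y' -> measurable_fun setT Z ->
  measurable_fun setT (fun z => f z.1 z.2) ->
  (forall A, measurable A -> P (Y @^-1` A) = P (Y' @^-1` A)) ->
  (forall A C, measurable A -> measurable C -> P (Y @^-1` A `&` Z @^-1` C) = (P (Y @^-1` A) * P (Z @^-1` C))%E) ->
  (forall A C, measurable A -> measurable C -> P (Y' @^-1` A `&` Z @^-1` C) = (P (Y' @^-1` A) * P (Z @^-1` C))%E) ->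
  forall A, measurable A -> P ((fun w => f (Y w) (Z w)) @^-1` A) = P ((fun w => f (Y' w) (Z w)) @^-1` A).
Proof.
move=> mY mY' mZ mf YY' iY iY' A mA.
have mYZ := measurable_fun_pair mY mZ; have mYZ' := measurable_fun_pair mY' mZ.
have mfA : measurable ((fun z => f z.1 z.2) @^-1` A) by rewrite -[_ @^-1` _]setTI; exact: mf.
have e1 := indep_pair mY mZ mYZ iY mfA.
have e2 : (pushP P mY \x pushP P mZ)%E ((fun z => f z.1 z.2) @^-1` A) = pushP P mYZ' ((fun z => f z.1 z.2) @^-1` A).
  apply: product_measure_unique => // C D mC mD.
  by rewrite -[RHS]/(P (Y @^-1` C) * P (Z @^-1` D))%E (YY' _ mC); exact: iY'.
exact: (etrans (esym e1) e2).
Qed.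

End pair_law.

Section euler_law.
Context {R : realType} {disp} {Om : measurableType disp} (P : probability Om R).
Context (T : R) {m : nat} (F0 : set (set Om)) (B : R -> Om -> 'rV[R]_m) {d : nat}.
Hypothesis T0 : 0 <= T.
Hypothesis BM : brownian_motion P T B.
Hypothesis F0i : initial_sigma_algebra P T F0 B.
Local Notation Fi := (filtration F0 B).
Local Notation V := 'rV[R]_d.
Variable cf : 'I_d -> option 'I_m -> V -> P2 R d -> R.
Variable K : R.
Hypothesis hlip : forall i o, lip_coef P (cf i o) K.
Hypothesis hcts : forall i o mu, continuous (fun x => cf i o x mu).
Hypothesis hext : forall i o x (mu nu : P2 R d), (forall A, measurable A -> mu A = nu A) -> cf i o x mu = cf i o x nu.

(** By induction, an iterate is a fixed function of its predecessor and of an independent increment.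
    The function involves the law of the predecessor, which [hext] identifies on both sides. *)
Lemma eul_law h xi xi' k : 0 < h -> k%:R * h <= T -> L2 P F0 xi -> L2 P F0 xi' ->
  (forall A, measurable A -> P (xi @^-1` A) = P (xi' @^-1` A)) ->
  forall A, measurable A -> P (eul P B cf h xi k @^-1` A) = P (eul P B cf h xi' k @^-1` A).
Proof.
move=> h0 kT lxi lxi' E; elim: k kT => [//|k IH] kT.
have tS : k.+1%:R * h = k%:R * h + h by rewrite -natr1 mulrDl mul1r.
have kT' : k%:R * h <= T by rewrite tS in kT; lra.
have {}IH := IH kT'.
have [mY sY] := eul_ok T0 BM F0i hlip hcts (ltW h0) kT' lxi.
have [mY' sY'] := eul_ok T0 BM F0i hlip hcts (ltW h0) kT' lxi'.
set Y := eul P B cf h xi k in IH mY sY *; set Y' := eul P B cf h xi' k in IH mY' sY' *.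
have k0 : 0 <= k%:R * h by rewrite mulr_ge0// ltW.
pose Z w := B (k%:R * h + h) w - B (k%:R * h) w.
pose f (y : V) (z : 'rV[R]_m) : V := \row_i (y 0 i + h * cf i None y (law P Y) + \sum_j cf i (Some j) y (law P Y) * z 0 j).
have E1 : eul P B cf h xi k.+1 = fun w => f (Y w) (Z w) by [].
have E2 : eul P B cf h xi' k.+1 = fun w => f (Y' w) (Z w).
  apply/funext => w; apply/rowP => i; rewrite !mxE.
  have e o : cf i o (Y' w) (law P Y') = cf i o (Y' w) (law P Y).
    by apply: hext => A mA; rewrite !lawE// IH.
  by rewrite e; congr (_ + _); apply: eq_bigr => j _; rewrite e.
have sh : k%:R * h < k%:R * h + h by rewrite ltrDl.
have shT : k%:R * h + h <= T by rewrite -tS.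
have mZ : measurable_fun setT Z by exact: (incr_measurable BM k0 (ltW sh) shT).
rewrite E1 E2; apply: indep_image_law => //; [exact: sY.1|exact: sY'.1| | |].
- apply: measurable_row => i.
  rewrite (_ : (fun w => _) = fun z : V * 'rV[R]_m => z.1 0 i + h * cf i None z.1 (law P Y) + \sum_j cf i (Some j) z.1 (law P Y) * z.2 0 j); last first.
    by apply/funext => z; rewrite mxE.
  have mc o : measurable_fun setT (fun z : V * 'rV[R]_m => cf i o z.1 (law P Y)).
    exact: (measurableT_comp (measurable_cts (@hcts i o _)) measurable_fst).
  apply: measurable_funD; first apply: measurable_funD.
  + exact: (measurableT_comp (measurable_coord i) measurable_fst).
  + by apply: measurable_funM.
  apply: measurable_sum => j; apply: measurable_funM => //.
  exact: (measurableT_comp (measurable_coord j) measurable_snd).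
- by move=> A C mA mC; apply: (incr_indep BM F0i k0 sh shT) => //; exact: mY.
- by move=> A C mA mC; apply: (incr_indep BM F0i k0 sh shT) => //; exact: mY'.
Qed.

End euler_law.

(** * Realization of laws on an atomless sigma-algebra *)

Section sigma_algebra_closure.
Context {T : Type} (F : set (set T)).
Hypothesis sF : sigma_algebra setT F.

Lemma sigma_setC A : F A -> F (~` A).
Proof. by have [_ h _] := sF => /h; rewrite setTD. Qed.

Lemma sigma_bigcup (A : nat -> set T) : (forall n, F (A n)) -> F (\bigcup_n A n).
Proof. by have [_ _] := sF; exact. Qed.

Lemma sigma_setU A C : F A -> F C -> F (A `|` C).
Proof.
have [h _ _] := sF; move=> FX FY; rewrite -bigcup2E; apply: sigma_bigcup => -[|[|n]]//.
Qed.

Lemma sigma_setI A C : F A -> F C -> F (A `&` C).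
Proof. by move=> FX FY; rewrite -[_ `&` _]setCK setCI; apply/sigma_setC/sigma_setU; exact: sigma_setC. Qed.

Lemma sigma_setD A C : F A -> F C -> F (A `\` C).
Proof. by move=> FX FY; rewrite setDE; apply: sigma_setI => //; exact: sigma_setC. Qed.

End sigma_algebra_closure.

Section atomless.
Context {R : realType} {disp} {Om : measurableType disp} (P : probability Om R).
Variable F : set (set Om).
Hypothesis sF : sigma_algebra setT F.
Let sigma_setU := sigma_setU sF.
Let sigma_setD := sigma_setD sF.
Let sigma_bigcup := sigma_bigcup sF.
Hypothesis FM : F `<=` measurable.
Hypothesis FA : forall A, F A -> (0 < P A)%E -> exists A', [/\ F A', A' `<=` A & (0 < P A' < P A)%E].

Let p (A : set Om) : R := fine (P A).

Let pE A : F A -> P A = (p A)%:E.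
Proof. by move=> FX; rewrite fineK// fin_num_measure//; exact: FM. Qed.

Let p0 A : 0 <= p A. Proof. by rewrite fine_ge0. Qed.

Let pU A C : F A -> F C -> A `&` C = set0 -> p (A `|` C) = p A + p C.
Proof.
move=> FX FY AC; apply: EFin_inj; rewrite -pE; last exact: sigma_setU.
by rewrite measureU//; [rewrite EFinD -!pE|exact: FM|exact: FM].
Qed.

Let pD A C : F A -> F C -> C `<=` A -> p (A `\` C) = p A - p C.
Proof.
move=> FX FY CA; rewrite -{2}(setDUK CA) pU//; [by rewrite addrC addKr|exact: sigma_setD|exact: setDIK].
Qed.

Let ple A C : F A -> F C -> A `<=` C -> p A <= p C.
Proof. by move=> FX FY AC; rewrite -lee_fin -!pE//; apply: le_measure => //; rewrite inE; exact: FM. Qed.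

(** Of a proper part and its complement, one carries at most half of the mass. *)
Let small n A : F A -> 0 < p A -> exists C, [/\ F C, C `<=` A, 0 < p C & p C <= p A / 2 ^+ n].
Proof.
move=> FX pA; elim: n => [|n [C [FC CA C0 Cn]]]; first by exists A; rewrite expr0 divr1; split.
have C0' : (0 < P C)%E by rewrite pE// lte_fin.
have [C' [FC' C'C]] := FA FC C0'; rewrite !pE// !lte_fin => /andP[C'0 C'1].
have h2 : p A / 2 ^+ n.+1 = p A / 2 ^+ n / 2 by rewrite exprSr invfM mulrA.
have [h|h] := leP (p C') (p C / 2).
  by exists C'; split=> //; [exact: subset_trans CA|rewrite h2; lra].
exists (C `\` C'); rewrite pD//; split; [exact: sigma_setD|by apply: subset_trans CA; exact: subDsetl|lra|rewrite h2; lra].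
Qed.

Section greedy.
Variables (A : set Om) (c : R).
Hypotheses (FX : F A) (c0 : 0 <= c) (cA : c <= p A).

Let ok C := [/\ F C, C `<=` A & p C <= c].

(** Greedy step: the part added has at least half of the largest mass that still fits below [c]. The
    admissibility of [C] is a premise inside the existential, so that [choice] gives a total
    successor function. *)
Let extend C : exists N, ok C -> [/\ ok N, C `<=` N &
  forall E, F E -> E `<=` A `\` C -> p C + p E <= c -> p E <= 2 * (p N - p C)].
Proof.
have [[FC CA Cc]|nok] := pselect (ok C); last by exists C.
pose S := [set p E | E in [set E | [/\ F E, E `<=` A `\` C & p C + p E <= c]]].
have [F00 _ _] := sF.
have S0 : S 0 by exists set0; rewrite /p ?measure0//; split; rewrite ?measure0 ?addr0.
have ubS : has_ubound S by exists c => _ [E [_ _ hE] <-]; have := p0 C; lra.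
have [sle|sgt] := leP (sup S) 0.
  exists C => _; split=> // E FE EA hE; rewrite subrr mulr0; apply: le_trans sle.
  by apply: ub_le_sup => //; exists E.
have hs : has_sup S by split=> //; exists 0.
have [_ [E [FE EA hE] <-] Egt] := sup_adherent (ltac:(lra) : 0 < sup S / 2) hs.
have dis : C `&` E = set0 by rewrite setIC; apply/disjoints_subset => x /EA[].
exists (C `|` E) => _; split.
- split; [exact: sigma_setU|by rewrite subUset; split=> // x /EA[]|by rewrite pU].
- exact: subsetUl.
move=> E' FE' E'A hE'; rewrite pU// addrC addKr.
have : p E' <= sup S by apply: ub_le_sup => //; exists E'.
lra.
Qed.

(** Sierpinski's intermediate value property. If the union of the greedy sets fell short of [c], a
    set [E] of positive mass would still fit beside it; each greedy step would then gain at least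
    half of the mass of [E], without end. *)
Lemma atomless_value : exists C, [/\ F C, C `<=` A & P C = c%:E].
Proof.
have [F00 _ _] := sF.
have [nx hnx] := choice extend.
pose Bn n := iter n nx set0.
have okB n : ok (Bn n).
  elim: n => [|n IH]; first by split=> //; rewrite /p /= measure0.
  by have [] := hnx _ IH.
pose Bu := \bigcup_n Bn n.
have FBu : F Bu by apply: sigma_bigcup => n; have [] := okB n.
have BuA : Bu `<=` A by move=> x [n _]; have [_ h _] := okB n; exact: h.
have mono n : Bn n `<=` Bn n.+1 by have [_ h _] := hnx _ (okB n).
have nd : nondecreasing_seq Bn by apply/nondecreasing_seqP => n; apply/subsetPset; exact: mono.
have cv : (fun n => p (Bn n)) @ \oo --> p Bu.
  have mB n : measurable (Bn n) by apply: FM; have [] := okB n.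
  have : (P \o Bn) @ \oo --> (p Bu)%:E by rewrite -(pE FBu); exact: nondecreasing_cvg_mu mB (FM FBu) nd.
  by move=> /fine_cvgP[].
have Buc : p Bu <= c.
  rewrite -(cvg_lim (@Rhausdorff R) cv); apply: limr_le; first by apply/cvg_ex; exists (p Bu).
  by apply: nearW => n; have [] := okB n.
have [Bc|cB] := leP c (p Bu); first by exists Bu; rewrite pE//; split=> //; congr EFin; apply/eqP; rewrite eq_le Buc.
have FD : F (A `\` Bu) by exact: sigma_setD.
have pDp : p (A `\` Bu) = p A - p Bu by exact: pD.
have [n hn] : exists n, p (A `\` Bu) / 2 ^+ n <= c - p Bu.
  have h : (fun n => p (A `\` Bu) * (2^-1) ^+ n) @ \oo --> p (A `\` Bu) * 0.
    by apply: cvgMl_tmp; apply: cvg_expr; rewrite ger0_norm ?invr_ge0// invf_lt1// ltr1n.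
  have cp : 0 < c - p Bu by lra.
  move: h => /cvgrPdist_le /(_ _ cp)[n _ /(_ n (leqnn n))]; rewrite /= mulr0 sub0r normrN exprVn => h.
  by exists n; apply: le_trans h; exact: ler_norm.
have [|E [FE EA E0 En]] := small n FD; first by rewrite pDp subr_gt0 (lt_le_trans cB).
have grow k : p E <= 2 * (p (Bn k.+1) - p (Bn k)).
  have [_ _ h] := hnx _ (okB k); apply: h => //.
    by move=> x /EA[Ax nB]; split=> // Bx; apply: nB; exists k.
  have : p (Bn k) <= p Bu by apply: ple => //; [by have [] := okB k|move=> x Bx; exists k].
  by lra.
have grow2 k : k%:R * p E <= 2 * p (Bn k).
  elim: k => [|k IH]; first by rewrite mul0r mulr_ge0.
  by have := grow k; rewrite -natr1 mulrDl mul1r; lra.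
have [k hk] : exists k : nat, 2 * c < k%:R * p E.
  have h0 : 0 <= 2 * c / p E by rewrite divr_ge0 ?mulr_ge0// ltW.
  exists (Num.truncn (2 * c / p E)).+1; rewrite -ltr_pdivrMr//.
  by have /andP[] := truncn_itv h0.
have := grow2 k; have [_ _] := okB k; lra.
Qed.

End greedy.

Lemma atomless_sequence (A : set Om) (c : nat -> R) : F A -> (forall n, 0 <= c n) ->
  (forall n, \sum_(i < n) c i <= p A) ->
  exists C : nat -> set Om, [/\ forall n, F (C n), forall n, C n `<=` A, forall n, P (C n) = (c n)%:E &
    forall i k, i != k -> C i `&` C k = set0].
Proof.
move=> FX c0 cA; have [F00 _ _] := sF.
have nxt (U : set Om) n : exists C, F U -> U `<=` A -> p U = \sum_(i < n) c i ->
    [/\ F C, C `<=` A `\` U & P C = (c n)%:E].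
  have [[FU UA pU']|h] := pselect [/\ F U, U `<=` A & p U = \sum_(i < n) c i]; last by exists set0 => *; case: h.
  have [|||C [? ? ?]] := @atomless_value (A `\` U) (c n); [exact: sigma_setD|exact: c0| |by exists C].
  by rewrite pD// pU'; have := cA n.+1; rewrite big_ord_recr/=; lra.
have [f0 hf0] := choice (fun Un : set Om * nat => nxt Un.1 Un.2).
pose f U n := f0 (U, n); have hf U n := hf0 (U, n).
pose fix U n := if n is n'.+1 then U n' `|` f (U n') n' else set0 : set Om.
have okU n : [/\ F (U n), U n `<=` A & p (U n) = \sum_(i < n) c i].
  elim: n => [|n [FU UA pUn]]; first by split=> //; rewrite big_ord0 /p/= measure0.
  have [FC CA PC] := hf _ _ FU UA pUn; split=> /=; first exact: sigma_setU.
    by rewrite subUset; split=> // x /CA[].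
  rewrite pU//; first by rewrite pUn big_ord_recr/=; congr (_ + _); rewrite /p PC.
  by rewrite setIC; apply/disjoints_subset => x /CA[].
have okf n : [/\ F (f (U n) n), f (U n) n `<=` A `\` U n & P (f (U n) n) = (c n)%:E].
  by have [FU UA pUn] := okU n; exact: hf.
have mono i k : (i <= k)%N -> U i `<=` U k.
  elim: k => [|k IH]; first by rewrite leqn0 => /eqP->.
  by rewrite leq_eqVlt => /predU1P[-> //|ik]; apply: subset_trans (IH ik) _; exact: subsetUl.
exists (fun n => f (U n) n); split=> [n|n|n|i k].
- by have [] := okf n.
- by have [_ h _] := okf n => x /h[].
- by have [] := okf n.
wlog ik : i k / (i < k)%N => [wl|_].
  by rewrite neq_ltn => /orP[ik|ki]; [apply: wl; rewrite ?neq_ltn ?ik|rewrite setIC; apply: wl; rewrite ?neq_ltn ?ki].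
rewrite -subset0 => x [xi xk]; have [_ h _] := okf k; have [_ nU] := h x xk.
by apply: nU; apply: (mono _ _ ik); right.
Qed.

End atomless.

(** * Transfer of joint laws of integer-valued variables *)

Section natural_laws.
Context {R : realType} {disp} {Om : measurableType disp} (P : probability Om R).
Context {disp'} {Om' : measurableType disp'} (Q : probability Om' R).

Definition nat_measurable {T : Type} (F : set (set T)) (a : T -> nat) : Prop := forall n, F (a @^-1` [set n]).

Lemma preimage_nat {T : Type} (a : T -> nat) (S : set nat) : a @^-1` S = \bigcup_(n in S) (a @^-1` [set n]).
Proof. by apply/seteqP; split=> [w Sw|w [n Sn /= wn]]; [exists (a w)|rewrite wn]. Qed.

Lemma nat_measurable_set {T : Type} (F : set (set T)) (a : T -> nat) (S : set nat) : sigma_algebra setT F ->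
  nat_measurable F a -> F (a @^-1` S).
Proof.
move=> sF mF; have [F00 _ _] := sF; rewrite preimage_nat bigcup_mkcond; apply: (sigma_bigcup sF) => n.
by case: ifP.
Qed.

(** An inequality on singletons is enough: summed over [S] and over its complement, it becomes an
    equality because both total masses are [1]. *)
Lemma nat_law_eq (c : Om -> nat) (c' : Om' -> nat) : nat_measurable measurable c -> nat_measurable measurable c' ->
  (forall n, (Q (c' @^-1` [set n]) <= P (c @^-1` [set n]))%E) -> forall S, P (c @^-1` S) = Q (c' @^-1` S).
Proof.
move=> mc mc' le S.
have tr (T : Type) (a : T -> nat) (D : set nat) : trivIset D (fun n => a @^-1` [set n]).
  by move=> i k _ _ [w [/= <- <-]].
have leS D : (Q (c' @^-1` D) <= P (c @^-1` D))%E.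
  rewrite !preimage_nat !measure_bigcup//; apply: lee_nneseries => // n _; exact: le.
have mS D : measurable (c @^-1` D) by apply: nat_measurable_set mc; exact: sigma_algebra_measurable.
have mS' D : measurable (c' @^-1` D) by apply: nat_measurable_set mc'; exact: sigma_algebra_measurable.
apply/eqP; rewrite eq_le leS andbT.
have := leS (~` S); rewrite -[(c' @^-1` _)]/(~` (c' @^-1` S)) -[(c @^-1` (~` _))]/(~` (c @^-1` S)).
rewrite (probability_setC Q (mS' S)) (probability_setC P (mS S)).
have fP := fin_num_measure P _ (mS S); have fQ := fin_num_measure Q _ (mS' S).
by rewrite -(fineK fP) -(fineK fQ) -!EFinB !lee_fin lerD2l lerN2.
Qed.

Variable F : set (set Om).
Hypothesis sF : sigma_algebra setT F.
Hypothesis FM : F `<=` measurable.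
Hypothesis FA : forall A, F A -> (0 < P A)%E -> exists A', [/\ F A', A' `<=` A & (0 < P A' < P A)%E].

(** Each event [a = k] is carved into disjoint parts of masses [Q (a' = k, b' = l)], and [b] is the
    index of the part. *)
Lemma nat_transfer (a : Om -> nat) (a' b' : Om' -> nat) : nat_measurable F a ->
  nat_measurable measurable a' -> nat_measurable measurable b' ->
  (forall k, P (a @^-1` [set k]) = Q (a' @^-1` [set k])) ->
  exists b : Om -> nat, nat_measurable F b /\
    forall S : set (nat * nat), P [set w | S (a w, b w)] = Q [set w | S (a' w, b' w)].
Proof.
move=> ma ma' mb' aa'.
pose E k l := a' @^-1` [set k] `&` b' @^-1` [set l].
have mE k l : measurable (E k l) by exact: measurableI.
pose c k l := fine (Q (E k l)).
have cE k l : Q (E k l) = (c k l)%:E by rewrite fineK// fin_num_measure.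
have csum k n : \sum_(i < n) c k i <= fine (P (a @^-1` [set k])).
  have : (\sum_(i < n) c k i)%:E = Q (a' @^-1` [set k] `&` b' @^-1` [set i | (i < n)%N]).
    elim: n => [|n IH].
      by rewrite big_ord0 (_ : _ `&` _ = set0) ?measure0//; apply/seteqP; split=> // w [].
    rewrite big_ord_recr/= EFinD IH -cE -measureU//.
    - congr (Q _); rewrite -setIUr; congr (_ `&` _); apply/seteqP; split=> w /=.
        by move=> [/ltnW//|->]; rewrite ltnS.
      by rewrite ltnS leq_eqVlt => /predU1P[->|]; [right|left].
    - by apply: measurableI => //; apply: nat_measurable_set mb'; exact: sigma_algebra_measurable.
    - by rewrite -subset0 => w [[_ /= h] [_ /= h2]]; rewrite h2 ltnn in h.
  rewrite aa' -lee_fin => ->; rewrite fineK ?fin_num_measure//; apply: le_measure; rewrite ?inE//.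
  by apply: measurableI => //; apply: nat_measurable_set mb'; exact: sigma_algebra_measurable.
have [C hC] := choice (fun k => atomless_sequence sF FM FA (ma k) (fun l => fine_ge0 (measure_ge0 Q (E k l))) (csum k)).
(* The value [0] is also the default outside all the parts, which is why the preimage of [0] is
   treated apart below. *)
pose b w := xget 0%N [set l | C (a w) l w].
have bE k l w : a w = k -> C k l w -> b w = l.
  move=> aw Cw; rewrite /b aw; case: xgetP => [l' _ /= Cl'|/(_ l)//].
  have [_ _ _ dis] := hC k; case: (eqVneq l' l) => // /dis h.
  by have : (C k l' `&` C k l) w by []; rewrite h.
have mb : nat_measurable F b.
  move=> l.
  have -> : b @^-1` [set l] = \bigcup_k (a @^-1` [set k] `&` (if l == 0%N then ~` \bigcup_(j in [set j | j != 0%N]) C k j else C k l)).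
    apply/seteqP; split=> [w /= bw|w [k _ [/= aw]]].
      exists (a w) => //; split=> //; move: bw; rewrite /b; case: xgetP => [l' _ /= Cl' <-|h <-].
        case: eqVneq => [l0|//] [j /= j0 Cj].
        have [_ _ _ dis] := hC (a w); have : (C (a w) j `&` C (a w) l') w by [].
        by rewrite dis// l0.
      by rewrite eqxx => -[j _]; exact: h.
    case: eqVneq => [->|_]; last by move=> /(bE _ _ _ aw).
    move=> nC; rewrite /b; case: xgetP => [l' _ /= Cl'|//].
    by apply/eqP; apply: contrapT => /negP l'0; apply: nC; exists l' => //; rewrite -aw.
  apply: (sigma_bigcup sF) => k; apply: (sigma_setI sF) => //.
  have [FC _ _ _] := hC k; case: ifP => _ //; apply: (sigma_setC sF).
  by rewrite bigcup_mkcond; apply: (sigma_bigcup sF) => n; case: ifP => // _; case: sF.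
exists b; split=> // S.
pose pc w := pickle (a w, b w); pose pc' w := pickle (a' w, b' w).
(* Pairs are encoded as integers to bring the joint law within reach of [nat_law_eq]. *)
have preS (T : Type) (x y : T -> nat) : [set w | S (x w, y w)] =
    (fun w => pickle (x w, y w)) @^-1` [set n | exists2 z, S z & n = pickle z].
  apply/seteqP; split=> w /=; first by exists (x w, y w).
  by move=> [z Sz /(pcan_inj pickleK) ->].
have mpc (T : Type) (G : set (set T)) (x y : T -> nat) : sigma_algebra setT G -> nat_measurable G x -> nat_measurable G y ->
    nat_measurable G (fun w => pickle (x w, y w)).
  move=> sG mx my n; have [[[k l] ->]|no] := pselect (exists z : nat * nat, n = pickle z).
    rewrite (_ : _ @^-1` _ = x @^-1` [set k] `&` y @^-1` [set l]); first exact: (sigma_setI sG).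
    by apply/seteqP; split=> w /=; [move=> /(pcan_inj pickleK)[]|case=> -> ->].
  rewrite (_ : _ @^-1` _ = set0); first by case: sG.
  by apply/seteqP; split=> // w /= h; case: no; exists (x w, y w).
rewrite !preS; apply: nat_law_eq.
- by move=> n; apply: FM; exact: mpc.
- by apply: mpc => //; exact: sigma_algebra_measurable.
move=> n; have [[[k l] ->]|no] := pselect (exists z : nat * nat, n = pickle z); last first.
  by rewrite [X in Q X](_ : _ = set0) ?measure0//; apply/seteqP; split=> // w /= h; case: no; exists (a' w, b' w).
rewrite [X in Q X](_ : _ = E k l); last first.
  by apply/seteqP; split=> w /=; [move=> /(pcan_inj pickleK)[]|case=> /= -> ->].
have [FC CA PC _] := hC k; rewrite cE -PC; apply: le_measure; rewrite ?inE.
- exact: FM.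
- by apply: FM; exact: mpc.
by move=> w Cw /=; have /= aw := CA l w Cw; rewrite aw (bE k l w aw Cw).
Qed.

End natural_laws.

Lemma ae_le_measure (R : realType) disp (Om : measurableType disp) (P : probability Om R) (A C : set Om) :
  measurable A -> measurable C -> {ae P, forall w, A w -> C w} -> (P A <= P C)%E.
Proof.
move=> mA mC [N [mN PN hN]]; rewrite -[leRHS]adde0 -PN.
apply: le_trans (measureU2 P mC mN); apply: le_measure; rewrite ?inE//; first exact: measurableU.
by move=> w Aw; have [Cw|nC] := pselect (C w); [left|right; apply: hN => /= h; exact: nC (h Aw)].
Qed.

(** * Equality of laws from discrete approximations *)

Section same_law.
Context {R : realType} {disp} {Om : measurableType disp} (P : probability Om R).
Context {disp'} {Om' : measurableType disp'} (Q : probability Om' R).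

Lemma same_law_Ex {d1} {U : measurableType d1} (X : Om -> U) (X' : Om' -> U) (f : U -> R) :
  measurable_fun setT X -> measurable_fun setT X' -> measurable_fun setT f ->
  (forall A, measurable A -> P (X @^-1` A) = Q (X' @^-1` A)) -> intg Q (fun w => f (X' w)) ->
  intg P (fun w => f (X w)) /\ Ex P (fun w => f (X w)) = Ex Q (fun w => f (X' w)).
Proof.
move=> mX mX' mf PE fi.
have fi' : intg (pushP Q mX') f by apply/pushP_intg.
have gi : intg (pushP P mX) f.
  apply/integrableP; split; first exact/measurable_EFinP.
  rewrite (eq_measure_integral (pushP Q mX')) => [|A mA _]; last exact: PE.
  by case/integrableP: fi'.
have fi2 := (pushP_intg P mX mf).1 gi.
split=> //; rewrite -(pushP_Ex mX mf fi2) -(pushP_Ex mX' mf fi) /Ex /Rintegral; congr fine.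
by apply: eq_measure_integral => A mA _; exact: PE.
Qed.

Context {d : nat}.
Local Notation V := 'rV[R]_d.
Let del n : R := 2^-1 ^+ n.
Let del0 n : 0 < del n. Proof. by rewrite exprn_gt0// invr_gt0. Qed.

(** If [Y] lies in [C], then [Yn n] lies in the neighbourhood of [C] of radius [2 * del n]; the law
    of [Yn' n] is the same, and [Y'] is then in the one of radius [4 * del n]. These neighbourhoods
    decrease to the closed set [C]. *)
Lemma closed_law_le (Y : Om -> V) (Yn : nat -> Om -> V) (Y' : Om' -> V) (Yn' : nat -> Om' -> V) (C : set V) :
  measurable_fun setT Y -> (forall n, measurable_fun setT (Yn n)) ->
  measurable_fun setT Y' -> (forall n, measurable_fun setT (Yn' n)) ->
  (forall n A, measurable A -> P (Yn n @^-1` A) = Q (Yn' n @^-1` A)) ->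
  {ae P, forall w, forall n j, `|Yn n w 0 j - Y w 0 j| <= del n} ->
  {ae Q, forall w, forall n j, `|Yn' n w 0 j - Y' w 0 j| <= del n} ->
  closed C -> (P (Y @^-1` C) <= Q (Y' @^-1` C))%E.
Proof.
move=> mY mYn mY' mYn' E cY cY' cC.
pose U c n : set V := \bigcup_(x in C) ball x (c * del n).
have oU c n : 0 < c -> measurable (U c n).
  move=> c0; apply: sub_sigma_algebra; apply: bigcup_open => x _; apply: ball_open.
have mpre (T1 : measurableType _) (Z : T1 -> V) A : measurable_fun setT Z -> measurable A -> measurable (Z @^-1` A).
  by move=> mZ mA; rewrite -[_ @^-1` _]setTI; exact: mZ.
have mC : measurable C by rewrite -[C]setCK; apply: measurableC; apply: sub_sigma_algebra; exact: closed_openC.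
have step n : (P (Y @^-1` C) <= Q (Y' @^-1` U 4%R n))%E.
  have m1 := oU 2%R n ltac:(lra); have m2 := oU 4%R n ltac:(lra).
  apply: (@le_trans _ _ (P (Yn n @^-1` U 2%R n))).
    apply: ae_le_measure; [|exact: mpre m1|]; first by rewrite -[_ @^-1` _]setTI; exact: mY.
    apply: filterS cY => w h Cw; exists (Y w) => //; apply/ball_row => [|j]; first by rewrite mulr_gt0.
    by have := h n j; rewrite distrC; have := del0 n; lra.
  rewrite E//; apply: ae_le_measure; [by rewrite -[_ @^-1` _]setTI; exact: mYn'|by rewrite -[_ @^-1` _]setTI; exact: mY'|].
  apply: filterS cY' => w h [x Cx /ball_row hx]; exists x => //; apply/ball_row => [|j]; first by rewrite mulr_gt0.
  have h1 := hx (ltac:(by rewrite mulr_gt0)) j; have h2 := h n j.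
  by have := ler_normD (x 0 j - Yn' n w 0 j) (Yn' n w 0 j - Y' w 0 j); rewrite subrKA; have := del0 n; lra.
have capE : \bigcap_n (Y' @^-1` U 4%R n) = Y' @^-1` C.
  apply/seteqP; split=> [w hw|w Cw n _]; last by exists (Y' w) => //; apply: ballxx; rewrite mulr_gt0.
  apply: cC => B /nbhs_ballP[e /= e0 he].
  have [n hn] : exists n, 4 * del n <= e.
    have h : (fun n => 4 * del n : R) @ \oo --> (4 * 0 : R).
      by apply: cvgMl_tmp; apply: cvg_expr; rewrite ger0_norm ?invr_ge0// invf_lt1// ltr1n.
    move: h => /cvgrPdist_le /(_ _ e0)[n _ /(_ n (leqnn n))]; rewrite /= mulr0 sub0r normrN => h.
    by exists n; apply: le_trans h; exact: ler_norm.
  have [x Cx xb] := hw n I; exists x; split=> //; apply: he; apply: le_ball hn _ _; exact: ball_sym.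
have mU n : measurable (Y' @^-1` U 4%R n).
  by rewrite -[_ @^-1` _]setTI; apply: mY' => //; apply: oU; lra.
have cv : (Q \o (fun n => Y' @^-1` U 4%R n)) @ \oo --> Q (Y' @^-1` C).
  rewrite -capE; apply: nonincreasing_cvg_mu => //.
  - by rewrite -ge0_fin_numE// fin_num_measure.
  - exact: bigcapT_measurable.
  - apply/nonincreasing_seqP => n; apply/subsetPset => w [x Cx xb]; exists x => //; apply: le_ball xb.
    by rewrite ler_pM2l// /del exprS ler_piMl ?exprn_ge0 ?invr_ge0// invf_le1// ler1n.
rewrite -(cvg_lim (@ereal_hausdorff R) cv); apply: lime_ge; first by apply/cvg_ex; eexists; exact: cv.
by apply: nearW => n; exact: step.
Qed.

End same_law.

Lemma closed_determine (R : realType) d (mu nu : probability 'rV[R]_d R) :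
  (forall C, closed C -> (mu C <= nu C)%E) -> (forall C, closed C -> (nu C <= mu C)%E) ->
  forall A, measurable A -> mu A = nu A.
Proof.
move=> h1 h2; apply: (@measure_unique _ R 'rV[R]_d open (fun=> setT)) => //.
- by move=> A C; exact: openI.
- by move=> _; exact: openT.
- by apply/seteqP; split=> // x _; exists 0%N.
- move=> A oA; have mA : measurable A by exact: sub_sigma_algebra.
  have e : mu (~` A) = nu (~` A) by apply/eqP; rewrite eq_le h1 ?h2//; exact: open_closedC.
  have f1 := fin_num_measure mu _ mA; have f2 := fin_num_measure nu _ mA.
  have e3 : fine (mu A) = fine (nu A).
    move: e; rewrite (probability_setC mu mA) (probability_setC nu mA).
    by rewrite -{1}(fineK f1) -{1}(fineK f2) -!EFinB => -[]; lra.
  by rewrite -[LHS](fineK f1) e3 fineK.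
- by move=> _; rewrite -ge0_fin_numE// fin_num_measure.
Qed.

(** * Dyadic cells *)

Section grid.
Context {R : realType} {d : nat}.
Local Notation V := 'rV[R]_d.

Definition grid_code (n : nat) (x : V) : nat := pickle (\row_i Num.floor (2 ^+ n * x 0 i) : 'rV[int]_d).

Definition grid_point (n k : nat) : V :=
  if unpickle k is Some r then \row_i (((r : 'rV[int]_d) 0 i)%:~R * 2^-1 ^+ n) else 0.

Lemma grid_pointE n x i : grid_point n (grid_code n x) 0 i = (Num.floor (2 ^+ n * x 0 i))%:~R * 2^-1 ^+ n.
Proof. by rewrite /grid_point /grid_code pickleK !mxE. Qed.

Let two n : 2 ^+ n * 2^-1 ^+ n = 1 :> R.
Proof. by rewrite -exprMn divff// expr1n. Qed.

Let half0 n : 0 < 2^-1 ^+ n :> R. Proof. by rewrite exprn_gt0// invr_gt0. Qed.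

Lemma grid_close n x i : `|grid_point n (grid_code n x) 0 i - x 0 i| <= 2^-1 ^+ n.
Proof.
rewrite grid_pointE; have /andP[h1 h2] := floor_itv (2 ^+ n * x 0 i); have h := half0 n; have e := two n.
set f := (Num.floor _)%:~R in h1 *; rewrite intrD -/f in h2.
have e2 : x 0 i = 2 ^+ n * x 0 i * 2^-1 ^+ n by rewrite mulrAC e mul1r.
rewrite {1}e2 -mulrBl normrM (gtr0_norm h) ger_pMl//.
rewrite ler_norml; apply/andP; split; lra.
Qed.

(** Nestedness of the dyadic cells, expressed through their lower corners at two consecutive levels,
    so that it can be transferred by a joint law of two codes. *)
Lemma grid_nested n x i : grid_point n (grid_code n x) 0 i <= grid_point n.+1 (grid_code n.+1 x) 0 i /\
  grid_point n.+1 (grid_code n.+1 x) 0 i + 2^-1 ^+ n.+1 <= grid_point n (grid_code n x) 0 i + 2^-1 ^+ n.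
Proof.
rewrite !grid_pointE; have /andP[h1 h2] := floor_itv (2 ^+ n * x 0 i); have h := half0 n.+1.
have e : 2 ^+ n.+1 * x 0 i = 2 * (2 ^+ n * x 0 i) by rewrite exprS mulrA.
have e2 : 2^-1 ^+ n = 2 * 2^-1 ^+ n.+1 :> R by rewrite exprS mulrA divff// mul1r.
set k := Num.floor (2 ^+ n * x 0 i) in h1 h2 *; set k' := Num.floor (2 ^+ n.+1 * x 0 i).
have l1 : 2 * k <= k' by rewrite floor_ge_int e intrM ler_pM2l.
have l2 : k' + 1 <= 2 * k + 2.
  have -> : 2 * k + 2 = 2 * (k + 1) by rewrite mulrDr mulr1.
  by rewrite lezD1 floor_lt_int e intrM ltr_pM2l.
have l1' : 2 * k%:~R <= k'%:~R :> R by rewrite -[2]/(2%:~R) -intrM ler_int.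
have l2' : k'%:~R + 1 <= 2 * k%:~R + 2 :> R by have := l2; rewrite -(ler_int R) !intrD intrM.
by rewrite e2; split; nra.
Qed.

Lemma grid_code_measurable n : nat_measurable measurable (grid_code n).
Proof.
move=> k; have [[r ->]|no] := pselect (exists r : 'rV[int]_d, k = pickle r); last first.
  by rewrite (_ : _ @^-1` _ = set0)//; apply/seteqP; split=> // x /= h; case: no; eexists; rewrite -h.
rewrite (_ : _ @^-1` _ = \bigcap_(i in [set: 'I_d]) ((fun x : V => 2 ^+ n * x 0 i) @^-1` [set` `[(r 0 i)%:~R, (r 0 i + 1)%:~R[%R])); last first.
  apply/seteqP; split=> [x /= /(pcan_inj pickleK) <- i _ /=|x hx /=].
    by rewrite !mxE in_itv/= floor_itv.
  congr pickle; apply/rowP => i; rewrite mxE; apply: floor_def.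
  by have := hx i I; rewrite /= in_itv.
apply: fin_bigcap_measurable => // i _.
have mf : measurable_fun setT (fun x : V => 2 ^+ n * x 0 i).
  by apply: measurable_funM => //; exact: measurable_coord.
by rewrite -[_ @^-1` _]setTI; apply: mf => //; exact: measurable_itv.
Qed.

Lemma grid_measurable n : measurable_fun setT (fun x => grid_point n (grid_code n x)).
Proof.
move=> _ A mA; rewrite setTI -[_ @^-1` _]/(grid_code n @^-1` (grid_point n @^-1` A)).
by apply: nat_measurable_set; [exact: sigma_algebra_measurable|exact: grid_code_measurable].
Qed.

End grid.

(** * Realization of laws and couplings *)

Section realization.
Context {R : realType} {disp} {Om : measurableType disp} (P : probability Om R) {d : nat}.
Local Notation V := 'rV[R]_d.
Variable F : set (set Om).
Hypothesis sF : sigma_algebra setT F.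
Hypothesis FM : F `<=` measurable.
Hypothesis FA : forall A, F A -> (0 < P A)%E -> exists A', [/\ F A', A' `<=` A & (0 < P A' < P A)%E].

Let point_mw n (b : Om -> nat) : nat_measurable F b -> measurable_wrt F (fun w => grid_point n (b w) : V).
Proof. by move=> mb A _; exact: (nat_measurable_set (grid_point n @^-1` A) sF mb). Qed.

Let pair_set (a b : Om -> nat) (S : set (nat * nat)) : nat_measurable F a -> nat_measurable F b -> F [set w | S (a w, b w)].
Proof.
move=> ma mb.
rewrite (_ : [set w | _] = \bigcup_k (a @^-1` [set k] `&` b @^-1` [set l | S (k, l)])).
  by apply: (sigma_bigcup sF) => k; apply: (sigma_setI sF) => //; exact: nat_measurable_set.
by apply/seteqP; split=> [w Sw|w [k _ [/= <-]]]; first by exists (a w).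
Qed.

(** The codes of the dyadic cells are realized one level at a time. Only the joint law of two
    consecutive levels is reproduced, which is enough: nestedness of consecutive cells makes the
    corners converge at rate [2^-n], and each level fixes an approximation of the law of the
    limit. *)
Lemma law_realized (mu : P2 R d) : exists xi : Om -> V,
  [/\ measurable_wrt F xi, L2v P xi & forall A, measurable A -> P (xi @^-1` A) = mu A].
Proof.
have mcode n := @grid_code_measurable R d n.
have F00 : F set0 by case: sF.
have [b0 [mb0 hb0]] : exists b : Om -> nat, nat_measurable F b /\
    forall k, P (b @^-1` [set k]) = mu (grid_code 0 @^-1` [set k]).
  have mc (T : Type) (G : set (set T)) : sigma_algebra setT G -> nat_measurable G (fun=> 0%N).
    move=> sG n; have [G0 GC _] := sG; case: n => [|n].
      rewrite (_ : _ @^-1` _ = setT); first by have := GC _ G0; rewrite setD0.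
      by apply/seteqP; split.
    by rewrite (_ : _ @^-1` _ = set0)//; apply/seteqP; split.
  have [|k|b [mb hb]] := @nat_transfer _ _ _ P _ _ mu F sF FM FA (fun=> 0%N) (fun=> 0%N) (grid_code 0) (mc _ _ sF) _ (mcode 0%N).
  - by apply: mc; exact: sigma_algebra_measurable.
  - have T0 (T : Type) : (fun _ : T => 0%N) @^-1` [set 0%N] = setT by apply/seteqP; split.
    have T1 (T : Type) l : (fun _ : T => 0%N) @^-1` [set l.+1] = set0 by apply/seteqP; split.
    case: k => [|k]; first by rewrite (T0 Om) (T0 V) (probability_setT P) (probability_setT mu).
    by rewrite (T1 Om) (T1 V) (measure0 P) (measure0 mu).
  - by exists b; split=> // k; have := hb [set z | z.2 = k].
have nxt (nb : nat * (Om -> nat)) : exists b' : Om -> nat, nat_measurable F nb.2 ->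
    (forall k, P (nb.2 @^-1` [set k]) = mu (grid_code nb.1 @^-1` [set k])) ->
    nat_measurable F b' /\ forall S : set (nat * nat), P [set w | S (nb.2 w, b' w)] = mu [set x | S (grid_code nb.1 x, grid_code nb.1.+1 x)].
  have [[m h]|no] := pselect (nat_measurable F nb.2 /\ forall k, P (nb.2 @^-1` [set k]) = mu (grid_code nb.1 @^-1` [set k])).
    by have [b' ?] := nat_transfer sF FM FA m (mcode nb.1) (mcode nb.1.+1) h; exists b'.
  by exists (fun=> 0%N) => m h; case: no.
have [f hf] := choice nxt.
pose fix b n : Om -> nat := if n is n'.+1 then f (n', b n') else b0.
have okb n : nat_measurable F (b n) /\ forall k, P (b n @^-1` [set k]) = mu (grid_code n @^-1` [set k]).
  elim: n => [//|n [m h]]; have [m' h'] := hf (n, b n) m h; split=> // k.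
  exact: (h' [set z | z.2 = k]).
have okS n S : P [set w | S (b n w, b n.+1 w)] = mu [set x | S (grid_code n x, grid_code n.+1 x)].
  by have [m h] := okb n; exact: (hf (n, b n) m h).2.
pose del n : R := 2^-1 ^+ n.
have del0 n : 0 < del n by rewrite exprn_gt0// invr_gt0.
pose good n (z : nat * nat) := forall i : 'I_d, (grid_point n z.1 : V) 0 i <= (grid_point n.+1 z.2 : V) 0 i /\
  (grid_point n.+1 z.2 : V) 0 i + del n.+1 <= (grid_point n z.1 : V) 0 i + del n.
pose Gn n := [set w | good n (b n w, b n.+1 w)].
have FGn n : F (Gn n) by apply: (pair_set (good n)); [exact: (okb n).1|exact: (okb n.+1).1].
pose G := ~` \bigcup_n ~` Gn n.
have FG : F G by apply: (sigma_setC sF); apply: (sigma_bigcup sF) => n; exact: (sigma_setC sF).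
have GE w : G w <-> forall n, Gn n w.
  by split=> [h n|h [n _]]; [apply: contrapT => nG; apply: h; exists n|apply; exact: h].
have aeG : {ae P, forall w, G w}.
  have : {ae P, forall w n, Gn n w}.
    apply/ae_foralln => n; have mG : measurable (Gn n) by exact: FM.
    have e : P (Gn n) = 1%E.
      rewrite /Gn (okS n (good n)) -(probability_setT mu); congr (mu _); apply/seteqP; split=> // x _ i.
      exact: grid_nested.
    exists (~` Gn n); split; [exact: measurableC| |by []].
    by apply: etrans (probability_setC P mG) _; rewrite e subee.
  by apply: filterS => w h; apply/GE.
(* Outside the almost sure event [G] of nested cells the approximations are [0], so that they
   converge for every [w]. *)
pose y n w i : R := (grid_point n (b n w) : V) 0 i * \1_G w.
have yup w i : {homo (fun n => y n w i) : n k / (n <= k)%N >-> n <= k}.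
  apply/nondecreasing_seqP => n; rewrite /y indicE; case: (boolP (w \in G)) => [|_]; last by rewrite !mulr0.
  by rewrite inE !mulr1 => /GE /(_ n i)[].
have ydn w i n k : (n <= k)%N -> y k w i <= y n w i + del n.
  suff h : (n <= k)%N -> y k w i + del k <= y n w i + del n.
    by move=> /h; have := del0 k; lra.
  elim: k => [|k IH]; first by rewrite leqn0 => /eqP->.
  rewrite leq_eqVlt => /predU1P[-> //|/IH]; apply: le_trans.
  rewrite /y indicE; case: (boolP (w \in G)) => [|_]; last first.
    by rewrite !mulr0 !add0r /del exprS ler_piMl ?exprn_ge0 ?invr_ge0// invf_le1// ler1n.
  by rewrite inE !mulr1 => /GE /(_ k i)[].
have yub w i : has_ubound (range (fun n => y n w i)) by exists (y 0%N w i + del 0%N) => _ [n _ <-]; exact: ydn.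
have ycv w i : (fun n => y n w i) @ \oo --> limn (fun n => y n w i).
  by apply/cvg_ex; eexists; exact: nondecreasing_cvgn.
pose xi w : V := \row_i limn (fun n => y n w i).
have close w n i : `|y n w i - xi w 0 i| <= del n.
  have h1 : y n w i <= limn (fun n => y n w i) by apply: nondecreasing_cvgn_le => //; apply/cvg_ex; eexists; exact: ycv.
  have h2 : limn (fun n => y n w i) <= y n w i + del n.
    apply: limr_le; first by apply/cvg_ex; eexists; exact: ycv.
    by exists n => // k /= nk; exact: ydn.
  by rewrite /xi mxE ler_norml; apply/andP; split; lra.
have mxi : measurable_wrt F xi.
  apply: (iffLR (mw_row sF _)) => i; apply/(mwP sF).
  rewrite (_ : (fun w => _) = fun w => limn (fun n => y n w i)); last by apply/funext => w; rewrite mxE.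
  apply: (@measurable_fun_cvg _ (g_sigma_algebraType F) R setT (fun n w => y n w i)) => [n|w _]; last exact: ycv.
  apply: measurable_funM; last by apply: measurable_indic; exact: sub_sigma_algebra.
  by apply/(mwP sF); apply: (iffRL (mw_row sF _)); exact: point_mw (okb n).1.
have mxi' := mw_meas FM mxi.
have mid : measurable_fun setT (id : V -> V) by exact: measurable_id.
have smu : L2v mu id by apply/L2vP => //; exact: P2_finite.
have mY n : measurable_fun setT (fun w => grid_point n (b n w) : V) by exact: mw_meas FM (point_mw n (okb n).1).
have mY' n := @grid_measurable R d n.
have same n A : measurable A -> P ((fun w => grid_point n (b n w) : V) @^-1` A) = mu ((fun x => grid_point n (grid_code n x)) @^-1` A).
  by move=> mA; exact: (okS n [set z | A (grid_point n z.1)]).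
have cl1 : {ae P, forall w, forall n j, `|(grid_point n (b n w) : V) 0 j - xi w 0 j| <= del n}.
  by apply: filterS aeG => w Gw n j; have := close w n j; rewrite /y indicE mem_set// mulr1.
have cl2 : {ae mu, forall x : V, forall n j, `|grid_point n (grid_code n x) 0 j - id x 0 j| <= del n}.
  by apply: nearW => x n j; exact: grid_close.
have PE A : measurable A -> P (xi @^-1` A) = mu A.
  move=> mA; apply: (@closed_determine R d (pushP P mxi') mu) => // C cC.
    exact: (closed_law_le mxi' mY mid mY' same cl1 cl2 cC).
  by apply: (closed_law_le mid mY' mxi' mY _ cl2 cl1 cC) => n D mD; rewrite same.
exists xi; split=> //; split=> //.
have mf : measurable_fun setT (fun x : V => enorm x ^+ 2) by apply: measurable_funX; exact: measurable_enorm.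
exact: (same_law_Ex mxi' mid mf PE smu.2).1.
Qed.

(** Here [xi] is prescribed. Only its code at level [n] is matched and its partner is discrete, so
    [nat_transfer] is applied just once. *)
Lemma coupling_realized (xi : Om -> V) (n : nat) {disp'} {Om' : measurableType disp'} (Q : probability Om' R) (x y : Om' -> V) :
  measurable_wrt F xi -> measurable_fun setT x -> measurable_fun setT y ->
  (forall A, measurable A -> P (xi @^-1` A) = Q (x @^-1` A)) ->
  let q (z : V) : V := grid_point n (grid_code n z) in
  exists xi' : Om -> V, measurable_wrt F xi' /\
    forall S : set (V * V), P [set w | S (q (xi w), xi' w)] = Q [set w | S (q (x w), q (y w))].
Proof.
move=> mxi mx my xx q.
have mcode := @grid_code_measurable R d n.
have mpre (z : Om' -> V) : measurable_fun setT z -> nat_measurable measurable (fun w => grid_code n (z w)).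
  by move=> mz k; rewrite -[_ @^-1` _]setTI -[_ @^-1` _]/(z @^-1` (grid_code n @^-1` [set k])); exact: mz.
have [|k|b [mb hb]] := nat_transfer (Q := Q) (a := fun w => grid_code n (xi w)) sF FM FA _ (mpre x mx) (mpre y my).
- by move=> k; exact: (mxi _ (mcode k)).
- exact: (xx _ (mcode k)).
exists (fun w => grid_point n (b w)); split; first exact: point_mw.
by move=> S; exact: (hb [set z | S (grid_point n z.1, grid_point n z.2)]).
Qed.

End realization.

(** * Directional slopes *)

Section slope.
Context {R : realType} {H : Type}.
Variables (ok : H -> Prop) (N : H -> R) (sc : R -> H -> H) (z : H).

(** [l] is the limit, as [r] tends to [0] from the right, of [sup {f x | N x <= r} / r], spelled out
    as an upper bound and a near-maximizer. *)
Definition slope (f : H -> R) (l : R) : Prop := forall e, 0 < e -> exists2 r0, 0 < r0 &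
  forall r, 0 < r <= r0 -> (forall x, ok x -> N x <= r -> f x <= (l + e) * r) /\
    exists x, [/\ ok x, N x <= r & (l - e) * r <= f x].

Hypotheses (ok_sc : forall t x, ok x -> ok (sc t x)) (N_sc : forall t x, 0 <= t -> ok x -> N (sc t x) = t * N x).
Hypothesis (sc_inv : forall t x, 0 < t -> sc t (sc t^-1 x) = x).
Hypotheses (okz : ok z) (Nz : N z = 0).
Variables (f p : H -> R) (C : R).
Hypothesis f_p : forall e, 0 < e -> exists2 r0, 0 < r0 & forall x, ok x -> N x <= r0 -> `|f x - p x| <= e * N x.
Hypothesis p_hom : forall e, 0 < e -> exists2 r0, 0 < r0 & forall x t, ok x -> N x <= r0 -> 0 <= t <= 1 ->
  `|p (sc t x) - t * p x| <= e * t * N x.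
Hypothesis p_bnd : forall x, ok x -> `|p x| <= C * N x.
Hypotheses (C0 : 0 <= C) (N0 : forall x, 0 <= N x).

Let f_hom e : 0 < e -> exists2 r0, 0 < r0 & forall x t, ok x -> N x <= r0 -> 0 <= t <= 1 ->
  `|f (sc t x) - t * f x| <= e * t * N x.
Proof.
move=> e0; have e3 : 0 < e / 3 by lra.
have [r1 r10 h1] := f_p e3; have [r2 r20 h2] := p_hom e3.
exists (Num.min r1 r2) => [|x t okx]; first by rewrite lt_min r10.
rewrite le_min => /andP[n1 n2] /[dup] t01 /andP[t0 t1].
have a1 := h1 x okx n1; have a2 := h2 x t okx n2 t01.
have n3 : N (sc t x) <= r1 by rewrite N_sc// (le_trans _ n1)// ler_piMl.
have a3 := h1 (sc t x) (ok_sc t okx) n3; rewrite N_sc// in a3.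
have a1' : `|t * (f x - p x)| <= t * (e / 3 * N x) by rewrite normrM (ger0_norm t0) ler_wpM2l.
have E : f (sc t x) - t * f x = (f (sc t x) - p (sc t x)) + (p (sc t x) - t * p x) - t * (f x - p x) by ring.
rewrite E; apply: (le_trans (ler_normB _ _)).
have := ler_normD (f (sc t x) - p (sc t x)) (p (sc t x) - t * p x).
move: (`|_ + _|) (`|t * _|) a1' (`|f (sc t x) - _|) a3 (`|p (sc t x) - _|) a2 => u1 u2 h u3 h' u4 h''; lra.
Qed.

(** Scaling carries the ball of radius [r'] onto that of radius [r] and, by homogeneity, multiplies
    [f] by [r / r'] up to [e r]. The quotients [g r] are therefore Cauchy at [0]. *)
Lemma slope_exists : exists l, slope f l.
Proof.
have [rb rb0 hb] := f_p ltr01.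
have fbnd x : ok x -> N x <= rb -> `|f x| <= (C + 1) * N x.
  move=> okx nx; have := hb x okx nx; have := p_bnd okx.
  have := ler_normD (f x - p x) (p x); rewrite subrK mul1r; lra.
pose S r := [set f x | x in [set x | ok x /\ N x <= r]].
have ubS r : r <= rb -> has_ubound (S r).
  move=> rr; exists ((C + 1) * r) => _ [x [okx nx] <-].
  have := fbnd x okx (le_trans nx rr); have := ler_norm (f x).
  have : (C + 1) * N x <= (C + 1) * r by rewrite ler_wpM2l// addr_ge0.
  lra.
have S0 r : 0 <= r -> S r !=set0 by move=> r0; exists (f z); exists z => //; split=> //; rewrite Nz.
pose g r := sup (S r) / r.
have gP r x : 0 < r -> r <= rb -> ok x -> N x <= r -> f x <= g r * r.
  move=> r0 rr okx nx; rewrite /g divfK ?gt_eqF//; apply: ub_le_sup; first exact: ubS.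
  by exists x.
have gE r c : 0 < r -> (forall x, ok x -> N x <= r -> f x <= c * r) -> g r <= c.
  move=> r0 h; rewrite ler_pdivrMr//; apply: ge_sup; first exact: S0 (ltW r0).
  by move=> _ [x [okx nx] <-]; exact: h.
have gclose e : 0 < e -> exists2 r0, 0 < r0 <= rb & forall r r', 0 < r -> r <= r' -> r' <= r0 ->
    g r <= g r' + e /\ g r' <= g r + e.
  move=> e0; have [r1 r10 h1] := f_hom e0.
  exists (Num.min r1 rb) => [|r r' r0 rr']; first by rewrite lt_min r10 rb0 ge_min lexx orbT.
  rewrite le_min => /andP[n1 nb]; have r'0 : 0 < r' by exact: lt_le_trans rr'.
  have rnb : r <= rb by exact: le_trans nb.
  pose t := r / r'; have t0 : 0 < t by rewrite divr_gt0.
  have t1 : t <= 1 by rewrite ler_pdivrMr// mul1r.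
  have tr : t * r' = r by rewrite divfK// gt_eqF.
  (* A point of the small ball is scaled up by [t^-1]; one of the large ball is scaled down by
     [t]. *)
  split; apply: gE => // x okx nx.
    pose y := sc t^-1 x; have oky : ok y by exact: ok_sc.
    have ny : N y <= r' by rewrite N_sc ?invr_ge0 ?(ltW t0)// mulrC ler_pdivrMr// mulrC tr.
    have := h1 y t oky (le_trans ny n1) (ltac:(by rewrite (ltW t0))); rewrite /y sc_inv// -/y => hh.
    have h2 := gP r' y r'0 nb oky ny.
    have h3 : t * f y <= t * (g r' * r') by rewrite ler_wpM2l// ltW.
    have h4 : e * t * N y <= e * t * r' by rewrite ler_wpM2l// mulr_ge0// ltW.
    have -> : (g r' + e) * r = t * (g r' * r') + e * t * r' by rewrite -[in LHS]tr; ring.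
    by have := ler_norm (f x - t * f y); lra.
  have nt : N (sc t x) <= r by rewrite N_sc ?(ltW t0)// -tr ler_wpM2l// ltW.
  have h2 := gP r (sc t x) r0 rnb (ok_sc t okx) nt.
  have := h1 x t okx (le_trans nx n1) (ltac:(by rewrite (ltW t0))); rewrite ler_norml => /andP[h3 _].
  have h4 : e * t * N x <= e * t * r' by rewrite ler_wpM2l// mulr_ge0// ltW.
  have : t * f x <= t * ((g r + e) * r').
    have -> : t * ((g r + e) * r') = g r * r + e * t * r' by rewrite mulrDl mulrDr mulrCA tr; ring.
    lra.
  by rewrite ler_pM2l.
have gclose2 e : 0 < e -> exists2 r0, 0 < r0 <= rb & forall r r', 0 < r <= r0 -> 0 < r' <= r0 -> g r <= g r' + e.
  move=> e0; have [r0 r00 h] := gclose e e0; exists r0 => // r r' /andP[a1 a2] /andP[c1 c2].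
  by have [rr|/ltW rr] := leP r r'; [have [] := h r r' a1 rr c2|have [] := h r' r c1 rr a2].
(* The eventual lower bounds of [g]: the supremum of [A] is the lower limit of [g] at [0], hence its
   limit. *)
pose A := [set x | exists2 r0, 0 < r0 & forall r, 0 < r <= r0 -> x <= g r].
have key e r0 : 0 < r0 -> 0 < e -> (forall r r', 0 < r <= r0 -> 0 < r' <= r0 -> g r <= g r' + e) -> forall r, 0 < r <= r0 ->
    g r - e <= sup A /\ sup A <= g r + e.
  move=> r00 e0 h r hr.
  have Ain : A (g r - e) by exists r0 => // r' hr'; have := h r r' hr hr'; lra.
  have Aub : ubound A (g r + e).
    move=> x [r1 r10 hx]; pose s := Num.min r1 r0; have s0 : 0 < s by rewrite lt_min r10.
    have hs : 0 < s <= r0 by rewrite s0 ge_min lexx orbT.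
    have := hx s (ltac:(by rewrite s0 ge_min lexx)); have := h s r hs hr; lra.
  split; first by apply: ub_le_sup => //; exists (g r + e).
  by apply: ge_sup => //; exists (g r - e).
exists (sup A) => e e0; have e2 : 0 < e / 2 by lra.
have [r0 /andP[r00 r0b] h] := gclose2 _ e2.
exists r0 => // r /[dup] hr /andP[a1 a2]; have [k1 k2] := key _ r0 r00 e2 h r hr.
split=> [x okx nx|].
  apply: le_trans (gP r x a1 (le_trans a2 r0b) okx nx) _; rewrite ler_pM2r//; lra.
have hs : has_sup (S r) by split; [exact: S0 (ltW a1)|exact: ubS (le_trans a2 r0b)].
have er : 0 < e / 2 * r by rewrite mulr_gt0.
have [_ [x [okx nx] <-] hx] := sup_adherent er hs; exists x; split=> //.
apply: ltW; apply: le_lt_trans hx.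
have -> : sup (S r) = g r * r by rewrite /g divfK// gt_eqF.
by rewrite -mulrBl ler_pM2r//; lra.
Qed.

End slope.

(** * Expansion of the terminal value *)

Lemma truncation_cvg (R : realType) disp (Om : measurableType disp) (P : probability Om R) (f : Om -> R) (e : R) :
  sqi P f -> 0 < e -> exists2 K, 0 <= K & sqi P (fun w => Num.max (f w - K) 0) /\
    Ex P (fun w => Num.max (f w - K) 0 ^+ 2) <= e.
Proof.
move=> sf e0; pose g n w := Num.max (f w - n%:R) 0.
have g0 n w : 0 <= g n w by rewrite le_max lexx orbT.
have gf n w : g n w <= `|f w|.
  by rewrite ge_max normr_ge0 andbT; have := ler_norm (f w); have : 0 <= n%:R :> R by []; lra.
have mg n : measurable_fun setT (g n).
  by apply: measurable_maxr => //; apply: measurable_funB => //; exact: sf.1.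
have sg n : sqi P (g n).
  apply: (@sqi_le _ _ _ _ _ (fun w => `|f w|)) => // [w|]; first by rewrite ger0_norm.
  by split; [exact: measurableT_comp sf.1|under eq_fun do rewrite real_normK ?num_real//; exact: sf.2].
have : (\int[P]_w ((g n w) ^+ 2)%:E @[n --> \oo] --> \int[P]_w (cst 0 w))%E.
  apply: (@dominated_cvg _ _ _ P setT measurableT (fun n w => ((g n w) ^+ 2)%:E) (cst 0%E) (fun w => (f w ^+ 2)%:E)).
  - by move=> n; apply/measurable_EFinP; exact: intg_meas (sg n).2.
  - move=> w _; apply: cvg_near_cst; exists (Num.truncn `|f w|).+1 => // n /= hn.
    have /andP[_ h] := truncn_itv (normr_ge0 (f w)).
    rewrite /g max_r ?expr0n// subr_le0 (le_trans (ler_norm _))// (le_trans (ltW h))// ler_nat//.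
  - by [].
  - exact: sf.2.
  - move=> n w _; rewrite abse_EFin lee_fin ger0_norm ?sqr_ge0// -[leRHS]real_normK ?num_real//.
    by rewrite lerXn2r ?nnegrE.
rewrite integral0 => /ereal_cvg0_small /(_ e0)[n _ /(_ n (leqnn n)) h].
exists n%:R => //; split; first exact: sg.
by rewrite -lee_fin -(intgE (sg n).2).
Qed.

Lemma dist_half (R : realType) (a b c e : R) : `|a - b| <= e / 2 -> `|b - c| <= e / 2 -> `|a - c| <= e.
Proof. by have := ler_normD (a - b) (b - c); rewrite subrKA; lra. Qed.

Lemma dist_one_le (R : realType) (t : R) : 0 <= t -> t <= 1 -> `|t - 1| <= 2.
Proof. by move=> t0 t1; rewrite ler_norml; apply/andP; split; lra. Qed.

Lemma half_bound (R : realType) (e C : R) : 0 <= C -> 0 < e -> e * (2 * C) <= e / 2 * (4 * C + 1).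
Proof. by move=> C0 e0; have := mulr_ge0 C0 (ltW e0); nra. Qed.

Lemma dist_linear (R : realType) (a b c N D e : R) : `|a - b - c| <= 1 * D -> `|c| <= N * D -> (N + 1) * D <= e ->
  `|a - b| <= e.
Proof. by have := ler_normD (a - b - c) c; rewrite subrK; lra. Qed.

Section flow.
Context {R : realType} {disp} {Om : measurableType disp} (P : probability Om R).
Context (T : R) {m : nat} (F0 : set (set Om)) (B : R -> Om -> 'rV[R]_m) {d : nat}.
Hypothesis T0 : 0 < T.
Hypothesis BM : brownian_motion P T B.
Hypothesis F0i : initial_sigma_algebra P T F0 B.
Local Notation V := 'rV[R]_d.
Variables (phi : P2 R d -> R) (gphi : P2 R d -> V -> V).
Variables (b0 : V -> P2 R d -> V) (b1 : V -> P2 R d -> 'M[R]_(d, m)).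
Variable X : (Om -> V) -> R -> Om -> V.
Hypothesis A2_C1 : L_derivative phi gphi.
Hypothesis A2_mu : exists2 w : R -> R, modulus w &
    forall mu mu' x, enorm (gphi mu' x - gphi mu x) <= w (W2 mu' mu).
Hypothesis A2_x : forall mu, exists2 w : R -> R, modulus w &
    forall x x', enorm (gphi mu x' - gphi mu x) <= w (enorm (x' - x)).
Hypotheses (B_b0 : C11b b0) (B_b1 : C11b b1).
Hypothesis X_solution : forall xi, L2 P F0 xi -> mckean_vlasov P T F0 B b0 b1 xi (X xi).

Local Notation cf := (coefs b0 b1).
Local Notation law := (law P).
Implicit Types xi eta : Om -> V.

Let T0' : 0 <= T := ltW T0.

Let cfC i o : C11b_scalar (cf i o).
Proof. by case: o => [j|]; [exact: B_b1|exact: B_b0]. Qed.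

Let hcts i o mu : continuous (fun x => cf i o x mu).
Proof. exact: C11b_scalar_cts (cfC i o). Qed.

Lemma coefs_bound : exists2 K, 0 <= K & (forall i o, lip_coef P (cf i o) K) /\ (forall i o, exp_coef P (cf i o) K).
Proof.
have [k hk] := choice (fun io : 'I_d * option 'I_m => C11b_scalar_coef P (cfC io.1 io.2)).
have k0 io : 0 <= k io by have [] := hk io.
exists (\sum_io k io); first exact: sumr_ge0.
have kle i o : k (i, o) <= \sum_io k io by rewrite (bigD1 (i, o))//= lerDl sumr_ge0.
split=> i o.
  have [_ h _] := hk (i, o); move=> x x' Y Y' sY sY'; apply: (le_trans (h x x' Y Y' sY sY')).
  by rewrite ler_wpM2r// addr_ge0 ?enorm_ge0 ?nrm_ge0.
have [_ _ h] := hk (i, o); move=> x u1 u t Y D1 D t0 sY sD1 sD.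
apply: (le_trans (h x u1 u t Y D1 D t0 sY sD1 sD)); rewrite ler_wpM2r//.
have E0 : 0 <= Ex P (fun w => enorm (D1 w - t *: D w)) by apply: Ex_ge0 => w; exact: enorm_ge0.
apply: addr_ge0; [apply: addr_ge0; [apply: addr_ge0|apply: addr_ge0]|apply: mulr_ge0 => //; apply: addr_ge0];
  by rewrite ?enorm_ge0 ?sqr_ge0 ?nrm2_ge0.
Qed.

Let eulT n xi := eul P B cf (T / n.+1%:R) xi n.+1.
Let hn0 n : 0 < T / n.+1%:R. Proof. by rewrite divr_gt0. Qed.
Let hnT n : n.+1%:R * (T / n.+1%:R) <= T. Proof. by rewrite mulrC divfK. Qed.

Let TT : 0 <= T <= T. Proof. by rewrite T0' lexx. Qed.

Let sXS xi : L2 P F0 xi -> S2 P T F0 B (X xi).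
Proof. by move=> /X_solution[]. Qed.

Lemma flow_L2v xi : L2 P F0 xi -> L2v P (X xi T).
Proof. by move=> lxi; exact: (S2_L2v BM F0i (sXS lxi) TT). Qed.

Lemma flow_mw xi : L2 P F0 xi -> measurable_wrt (filtration F0 B T) (X xi T).
Proof. by move=> /sXS[h _ _]; exact: h. Qed.

Let eul_L2v n xi : L2 P F0 xi -> L2v P (eulT n xi).
Proof.
have [K K0 [hlip _]] := coefs_bound.
by move=> lxi; exact: (eul_ok T0' BM F0i hlip hcts (ltW (hn0 n)) (hnT n) lxi).2.
Qed.

Let close xi e : L2 P F0 xi -> 0 < e -> \forall n \near \oo, nrm P (fun w => X xi T w - eulT n xi w) <= e.
Proof.
have [K K0 [hlip _]] := coefs_bound; move=> lxi e0.
have /cvgrPdist_le/(_ _ e0) := euler_cvg T0 BM F0i K0 hlip hcts lxi (sXS lxi) (X_solution lxi).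
by apply: filterS => n; rewrite sub0r normrN ger0_norm ?nrm_ge0.
Qed.

(** The limit of [eul_lip], whose constant is the same for every step size. *)
Lemma flow_lip : exists2 C, 0 <= C & forall xi xi', L2 P F0 xi -> L2 P F0 xi' ->
  nrm P (fun w => X xi' T w - X xi T w) <= C * nrm P (fun w => xi' w - xi w).
Proof.
have [K K0 [hlip _]] := coefs_bound.
pose L := lipC (m := m) (d := d) T K; have L0 : 0 <= L by exact: expR_ge0.
exists (Num.sqrt L) => [|xi xi' lxi lxi']; first exact: sqrtr_ge0.
apply/ler_addgt0Pr => e e0; have e2 : 0 < e / 2 by lra.
have [n _ /(_ n (leqnn n))[/= h1 h2]] := filterI (close lxi e2) (close lxi' e2).
have s1 := flow_L2v lxi; have s2 := flow_L2v lxi'; have s3 := eul_L2v n lxi; have s4 := eul_L2v n lxi'.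
have h3 : nrm P (fun w => eulT n xi' w - eulT n xi w) <= Num.sqrt L * nrm P (fun w => xi' w - xi w).
  apply: nrm_le; first by rewrite mulr_ge0 ?sqrtr_ge0 ?nrm_ge0.
  rewrite exprMn sqr_sqrtr// nrm_sqr.
  exact: (eul_lip T0' BM F0i hlip hcts (ltW (hn0 n)) lxi lxi' (hnT n)).
have h1' : nrm P (fun w => eulT n xi w - X xi T w) <= e / 2 by rewrite (nrmBC P (eulT n xi) (X xi T)).
apply: (le_trans (nrm_triangle s2 s4 s1)).
apply: (le_trans (lerD h2 (le_trans (nrm_triangle s4 s3 s1) (lerD h3 h1')))).
by rewrite addrCA -splitr.
Qed.

Let Fm := F0_measurable F0i.

Lemma phi_cts (Y : Om -> V) e : L2v P Y -> 0 < e -> exists2 r, 0 < r & forall Z, L2v P Z ->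
  nrm P (fun w => Z w - Y w) <= r -> `|phi (law Z) - phi (law Y)| <= e.
Proof.
move=> sY e0; have [r r0 hr] := phi_frechet A2_C1 A2_mu A2_x sY ltr01.
have [w mw hw] := A2_x (law Y); have sG := gphi_L2v mw (modulus_cts mw hw) hw sY.
pose N := nrm P (fun w => gphi (law Y) (Y w)); have N0 : 0 <= N by exact: nrm_ge0.
exists (Num.min r (e / (N + 1))) => [|Z sZ]; first by rewrite lt_min r0 divr_gt0// ltr_wpDl.
rewrite le_min => /andP[z1 z2]; have sD := L2vB sZ sY.
have := hr _ sD z1; rewrite (_ : (fun w => Y w + (Z w - Y w)) = Z); last by apply/funext => z; rewrite addrC subrK.
move=> h1; apply: dist_linear h1 (Ex_edot_le sG sD) _.
by rewrite mulrC -ler_pdivlMr// ltr_wpDl.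
Qed.

(** [X] is one choice of solutions, and uniqueness in law comes from the approximation: [eul_law]
    equates the laws of the two schemes, and [phi] of the law is continuous along L2 convergence. *)
Lemma flow_law xi xi' : L2 P F0 xi -> L2 P F0 xi' ->
  (forall A, measurable A -> P (xi @^-1` A) = P (xi' @^-1` A)) -> phi (law (X xi T)) = phi (law (X xi' T)).
Proof.
have [K K0 [hlip _]] := coefs_bound; move=> lxi lxi' E.
have hext i o x (mu nu : P2 R d) : (forall A, measurable A -> mu A = nu A) -> cf i o x mu = cf i o x nu.
  exact: C11b_scalar_ext (cfC i o).
have s1 := flow_L2v lxi; have s2 := flow_L2v lxi'.
suff h e : 0 < e -> `|phi (law (X xi T)) - phi (law (X xi' T))| <= e.
  apply/eqP; rewrite -subr_eq0 -normr_le0; apply/ler_addgt0Pr => e e0; rewrite add0r; exact: h.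
move=> e0; have e2 : 0 < e / 2 by lra.
have [r1 r10 h1] := phi_cts s1 e2; have [r2 r20 h2] := phi_cts s2 e2.
have [n _ /(_ n (leqnn n))[/= c1 c2]] := filterI (close lxi r10) (close lxi' r20).
rewrite (nrmBC P (X xi T) (eulT n xi)) in c1; rewrite (nrmBC P (X xi' T) (eulT n xi')) in c2.
have s3 := eul_L2v n lxi; have s4 := eul_L2v n lxi'.
have a1 := h1 _ s3 c1; have a2 := h2 _ s4 c2.
have EE : phi (law (eulT n xi)) = phi (law (eulT n xi')).
  apply: (L_derivative_ext A2_C1) => A mA; apply: law_ext => // D mD.
  exact: (eul_law T0' BM F0i hlip hcts hext (hn0 n) (hnT n) lxi lxi' E mD).
rewrite EE distrC in a1; exact: dist_half a1 a2.
Qed.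

Variable xi : Om -> V.
Hypothesis lxi : L2 P F0 xi.

Definition terminal_gradient w := gphi (law (X xi T)) (X xi T w).
Local Notation G := terminal_gradient.

Let incr eta w := X (fun w => xi w + eta w) T w - X xi T w.

Definition value_incr eta : R := phi (law (X (fun w => xi w + eta w) T)) - phi (law (X xi T)).
(** Linear in the increment of the flow, not in [eta]; [linear_incr_hom] supplies the homogeneity in
    [eta]. *)
Definition linear_incr eta : R := Ex P (fun w => edot (G w) (incr eta w)).

Lemma terminal_gradient_L2 : L2 P (filtration F0 B T) G.
Proof.
have [w mw hw] := A2_x (law (X xi T)).
apply/(L2_L2v _ _ (filtration_measurable BM F0i (lexx T))); split.
  apply: (mw_comp (filtration_sigma F0 B T)) (flow_mw lxi).
  exact: (measurable_ctsrow (modulus_cts mw hw)).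
exact: (gphi_L2v mw (modulus_cts mw hw) hw (flow_L2v lxi)).
Qed.

Let sG : L2v P G.
Proof. exact: ((iffLR (L2_L2v _ _ (filtration_measurable BM F0i (lexx T)))) terminal_gradient_L2).2. Qed.

Lemma L2_add eta : L2 P F0 eta -> L2 P F0 (fun w => xi w + eta w).
Proof.
move=> le; rewrite (_ : (fun w => _) = fun w => xi w + 1 *: eta w); first exact: (L2_addZ F0i 1 lxi le).
by apply/funext => w; rewrite scale1r.
Qed.

Lemma L2_scale t eta : L2 P F0 eta -> L2 P F0 (fun w => t *: eta w).
Proof.
move=> le; have l0 : L2 P F0 (fun=> 0 : V).
  by apply/(L2_L2v _ _ Fm); split; [exact: (mw_cst (F0_sigma F0i) (0 : V))|exact: L2v_cst].
rewrite (_ : (fun w => _) = fun w => 0 + t *: eta w); first exact: (L2_addZ F0i t l0 le).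
by apply/funext => w; rewrite add0r.
Qed.

Let L2F eta : L2 P F0 eta -> L2v P eta.
Proof. by move=> /(L2_L2v _ _ Fm)[]. Qed.

Let incr_L2v eta : L2 P F0 eta -> L2v P (incr eta).
Proof. by move=> le; apply: L2vB; apply: flow_L2v => //; exact: L2_add. Qed.

Let incr_lip : exists2 C, 0 <= C & forall eta, L2 P F0 eta -> nrm P (incr eta) <= C * nrm P eta.
Proof.
have [C C0 hC] := flow_lip; exists C => // eta le.
have := hC _ _ lxi (L2_add le); rewrite (_ : (fun w => xi w + eta w - xi w) = eta)//.
by apply/funext => w; rewrite addrC addKr.
Qed.

Lemma linear_incr_bound : exists2 C, 0 <= C & forall eta, L2 P F0 eta -> `|linear_incr eta| <= C * nrm P eta.
Proof.
have [C C0 hC] := incr_lip; exists (nrm P G * C) => [|eta le]; first by rewrite mulr_ge0 ?nrm_ge0.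
apply: le_trans (Ex_edot_le sG (incr_L2v le)) _; rewrite -mulrA ler_wpM2l ?nrm_ge0//; exact: hC.
Qed.

Lemma value_linear e : 0 < e -> exists2 r, 0 < r & forall eta, L2 P F0 eta -> nrm P eta <= r ->
  `|value_incr eta - linear_incr eta| <= e * nrm P eta.
Proof.
move=> e0; have [C C0 hC] := incr_lip; have C1 : 0 < C + 1 by rewrite ltr_wpDl.
have e1 : 0 < e / (C + 1) by rewrite divr_gt0.
have [r r0 hr] := phi_frechet A2_C1 A2_mu A2_x (flow_L2v lxi) e1.
exists (r / (C + 1)) => [|eta le nr]; first by rewrite divr_gt0.
have h := hC eta le; have sD := incr_L2v le; have N0 := nrm_ge0 P eta.
have CN : C * nrm P eta <= (C + 1) * nrm P eta by rewrite ler_wpM2r// lerDl.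
have hD : nrm P (incr eta) <= r.
  by apply: (le_trans h); apply: (le_trans CN); rewrite mulrC -ler_pdivlMr.
have := hr _ sD hD; rewrite (_ : (fun w => X xi T w + incr eta w) = X (fun w => xi w + eta w) T); last first.
  by apply/funext => w; rewrite /incr addrC subrK.
move=> /le_trans; apply; rewrite mulrAC -mulrA.
have : e / (C + 1) * nrm P (incr eta) <= e / (C + 1) * ((C + 1) * nrm P eta).
  by rewrite ler_wpM2l ?(ltW e1)// (le_trans h).
by rewrite !mulrA [_ * (C + 1)]divfK ?gt_eqF// mulrAC.
Qed.

Let remainder_L1 : exists2 C, 0 <= C & forall eta t, L2 P F0 eta -> 0 < nrm2 P eta -> 0 <= t <= 1 ->
  Ex P (fun w => enorm (incr (fun w => t *: eta w) w - t *: incr eta w)) <= C * t * nrm2 P eta.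
Proof.
have [K K0 [hlip hexp]] := coefs_bound.
pose L := homC (m := m) (d := d) T K.
have L0 : 0 <= L by exact: homC_ge0.
exists L => // eta t le N0 /[dup] t01 /andP[t0 t1].
have t2 := dist_one_le t0 t1.
have lt := L2_add (L2_scale t le); have l1 := L2_add le.
have si := L2vB (incr_L2v (L2_scale t le)) (L2vZ t (incr_L2v le)).
apply/ler_addgt0Pr => e e0; have e4 : 0 < e / 4 by lra.
have [n _ /(_ n (leqnn n))[/= [/= c1 c2] c3]] := filterI (filterI (close lxi e4) (close lt e4)) (close l1 e4).
have s1 := flow_L2v lxi; have s2 := flow_L2v lt; have s3 := flow_L2v l1.
have z1 := eul_L2v n lxi; have z2 := eul_L2v n lt; have z3 := eul_L2v n l1.
pose Rn w := (eulT n (fun w => xi w + t *: eta w) w - eulT n xi w) - t *: (eulT n (fun w => xi w + eta w) w - eulT n xi w).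
have hR : Ex P (fun w => enorm (Rn w)) <= L * t * nrm2 P eta.
  have e1 : (fun w => xi w + 1 *: eta w) = (fun w => xi w + eta w) by apply/funext => w; rewrite scale1r.
  have := eul_hom T0' BM F0i K0 hlip hexp hcts lxi le N0 t01 (ltW (hn0 n)) (hnT n).
  by rewrite e1.
have sR : L2v P Rn := L2vB (L2vB z2 z1) (L2vZ t (L2vB z3 z1)).
pose D1 w := X xi T w - eulT n xi w.
pose D2 w := X (fun w => xi w + t *: eta w) T w - eulT n (fun w => xi w + t *: eta w) w.
pose D3 w := X (fun w => xi w + eta w) T w - eulT n (fun w => xi w + eta w) w.
have d1 := L2v_sqi (L2vB s1 z1); have d2 := L2v_sqi (L2vB s2 z2); have d3 := L2v_sqi (L2vB s3 z3).
have i1 := sqi_intg d1; have i2 := sqi_intg d2; have i3 := sqi_intg d3; have iR := sqi_intg (L2v_sqi sR).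
have b1' : Ex P (fun w => enorm (D1 w)) <= e / 4 := le_trans (Ex_enorm_le (L2vB s1 z1)) c1.
have b2' : Ex P (fun w => enorm (D2 w)) <= e / 4 := le_trans (Ex_enorm_le (L2vB s2 z2)) c2.
have b3' : Ex P (fun w => enorm (D3 w)) <= e / 4 := le_trans (Ex_enorm_le (L2vB s3 z3)) c3.
apply: (@le_trans _ _ (Ex P (fun w => enorm (Rn w) + (enorm (D2 w) + (enorm (D3 w) + 2 * enorm (D1 w)))))).
  apply: Ex_le => [||w].
  - exact: sqi_intg (L2v_sqi si).
  - exact: intgD iR (intgD i2 (intgD i3 (intgZ 2 i1))).
  (* The error [D1] at [xi] appears with the factor [t - 1], bounded by [2]; with [e / 4] for each
     scheme error the total is [e]. *)
  rewrite (_ : incr _ w - t *: incr eta w = Rn w + (D2 w + (- (t *: D3 w) + (t - 1) *: D1 w))); last first.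
    rewrite /incr /Rn /D1 /D2 /D3 -/(eulT n _) !scalerBr scalerBl scale1r.
    by apply/rowP => i; rewrite !mxE; ring.
  have g3 : enorm (- (t *: D3 w)) <= enorm (D3 w).
    by rewrite enormN enormZ ger0_norm// ler_piMl ?enorm_ge0.
  have g1 : enorm ((t - 1) *: D1 w) <= 2 * enorm (D1 w).
    by rewrite enormZ ler_wpM2r ?enorm_ge0.
  apply: (le_trans (enormD _ _)); rewrite lerD2l (le_trans (enormD _ _))// lerD2l.
  by apply: (le_trans (enormD _ _)); exact: lerD.
rewrite (ExD iR (intgD i2 (intgD i3 (intgZ 2 i1)))) (ExD i2 (intgD i3 (intgZ 2 i1))) (ExD i3 (intgZ 2 i1)) (ExZ 2 i1).
apply: lerD; first exact: hR.
apply: (@le_trans _ _ (e / 4 + (e / 4 + 2 * (e / 4)))); last by rewrite le_eqVlt; apply/orP; left; apply/eqP; field.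
exact: (lerD b2' (lerD b3' (ler_wpM2l (ler0n R 2) b1'))).
Qed.

(** The defect [Z] is of order [t |eta|^2] in L1 but only [t |eta|] in L2. The bounded part of the
    gradient is paired with the first estimate, and its tail, small in L2, with the second. *)
Lemma linear_incr_hom e : 0 < e -> exists2 r, 0 < r & forall eta t, L2 P F0 eta -> nrm P eta <= r -> 0 <= t <= 1 ->
  `|linear_incr (fun w => t *: eta w) - t * linear_incr eta| <= e * t * nrm P eta.
Proof.
move=> e0; have [C C0 hC] := incr_lip; have [L L0 hL] := remainder_L1.
(* The L2 size of the tail of the gradient: [2 C] times [e1] is at most [e / 2]. *)
pose e1 := e / (4 * C + 1).
have den : 0 < 4 * C + 1 by rewrite ltr_wpDl// mulr_ge0.
have e10 : 0 < e1 by rewrite divr_gt0.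
have e12 : 0 < e1 ^+ 2 by rewrite exprn_gt0.
have [K K0 [sg hg]] := truncation_cvg (L2v_sqi sG) e12.
(* Gives [K * L * nrm P eta <= e / 2] for the bounded part. *)
pose r := e / (2 * (K * L + 1)).
have KL : 0 < K * L + 1 by rewrite ltr_wpDl// mulr_ge0.
have r0 : 0 < r by rewrite divr_gt0// mulr_gt0.
exists r => // eta t le nr /[dup] t01 /andP[t0 t1].
have N0 := nrm_ge0 P eta; have lt := L2_scale t le.
have sit := incr_L2v lt; have si := incr_L2v le.
pose Z w := incr (fun w => t *: eta w) w - t *: incr eta w.
have sZ : L2v P Z := L2vB sit (L2vZ t si).
have EZ : linear_incr (fun w => t *: eta w) - t * linear_incr eta = Ex P (fun w => edot (G w) (Z w)).
  have i1 := edot_intg sG sit; have i2 := edot_intg sG si.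
  rewrite /linear_incr -(ExZ _ i2) -(ExB i1 (intgZ t i2)); congr Ex; apply/funext => w.
  by rewrite /Z (edotBr (G w) (incr (fun w => t *: eta w) w) (t *: incr eta w)) edotZr.
have nZ : nrm P Z <= 2 * C * t * nrm P eta.
  rewrite (_ : Z = fun w => incr (fun w => t *: eta w) w + (- t) *: incr eta w); last first.
    by apply/funext => w; rewrite /Z scaleNr.
  apply: (le_trans (nrmD sit (L2vZ (- t) si))); rewrite (nrmZ _ si) normrN (ger0_norm t0).
  have := hC _ lt; rewrite (nrmZ t (L2F le)) (ger0_norm t0) => h1.
  have h2 := ler_wpM2l t0 (hC _ le).
  by apply: (le_trans (lerD h1 h2)); rewrite le_eqVlt; apply/orP; left; apply/eqP; ring.
(* The weight behind the L1 estimate divides by the squared norm of [eta], so the null perturbation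
   is treated apart. *)
rewrite EZ; have [N00|N00] := eqVneq (nrm P eta) 0.
  apply: (le_trans (Ex_edot_le sG sZ)); rewrite N00 !mulr0 in nZ *.
  by rewrite mulr_ge0_le0 ?nrm_ge0.
have N2 : 0 < nrm2 P eta by rewrite -nrm_sqr exprn_gt0// lt_neqAle eq_sym N00.
have hR := hL eta t le N2 t01; rewrite -/Z in hR.
pose g w := Num.max (enorm (G w) - K) 0.
have seZ := L2v_sqi sZ.
have igZ := sqiM sg seZ; have iZ := sqi_intg seZ.
apply: (@le_trans _ _ (Ex P (fun w => g w * enorm (Z w) + K * enorm (Z w)))).
  apply: (Ex_absle (edot_intg sG sZ) (intgD igZ (intgZ K iZ))) => w.
  rewrite (le_trans (edot_le _ _))// -mulrDl ler_wpM2r ?enorm_ge0// -lerBlDr.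
  by rewrite /g le_max lexx.
rewrite (ExD igZ (intgZ K iZ)) (ExZ K iZ).
have h1 : Ex P (fun w => g w * enorm (Z w)) <= e1 * nrm P Z.
  apply: (le_trans (ler_norm _)); apply: (le_trans (CauchySchwarz sg seZ)).
  by rewrite ler_wpM2r ?sqrtr_ge0// -(ger0_norm (ltW e10)) -sqrtr_sqr ler_wsqrtr.
have h2 := ler_wpM2l K0 hR; rewrite -nrm_sqr in h2.
apply: (le_trans (lerD (le_trans h1 (ler_wpM2l (ltW e10) nZ)) h2)).
have h3 : e1 * (2 * C) <= e / 2.
  by rewrite /e1 mulrAC ler_pdivrMr//; exact: (half_bound C0 e0).
have h4 : K * L * nrm P eta <= e / 2.
  apply: (@le_trans _ _ ((K * L + 1) * r)); last by rewrite /r invfM mulrCA !mulrA mulrAC mulfK ?gt_eqF.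
  by apply: ler_pM => //; [exact: mulr_ge0|rewrite lerDl].
have tN : 0 <= t * nrm P eta by exact: mulr_ge0.
have h5 := ler_wpM2r tN (lerD h3 h4); rewrite -splitr in h5.
rewrite -[leRHS]mulrA; apply: le_trans h5; rewrite le_eqVlt; apply/orP; left; apply/eqP; ring.
Qed.

End flow.

(** * The robust value *)

Section dro.
Context {R : realType} {disp} {Om : measurableType disp} (P : probability Om R).
Context (T : R) {m : nat} (F0 : set (set Om)) (B : R -> Om -> 'rV[R]_m) {d : nat}.
Hypothesis T0 : 0 < T.
Hypothesis BM : brownian_motion P T B.
Hypothesis F0i : initial_sigma_algebra P T F0 B.
Local Notation V := 'rV[R]_d.
Variables (phi : P2 R d -> R) (gphi : P2 R d -> V -> V).
Variables (b0 : V -> P2 R d -> V) (b1 : V -> P2 R d -> 'M[R]_(d, m)).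
Variable X : (Om -> V) -> R -> Om -> V.
Hypothesis A2_C1 : L_derivative phi gphi.
Hypothesis A2_mu : exists2 w : R -> R, modulus w &
    forall mu mu' x, enorm (gphi mu' x - gphi mu x) <= w (W2 mu' mu).
Hypothesis A2_x : forall mu, exists2 w : R -> R, modulus w &
    forall x x', enorm (gphi mu x' - gphi mu x) <= w (enorm (x' - x)).
Hypotheses (B_b0 : C11b b0) (B_b1 : C11b b1).
Hypothesis X_solution : forall xi, L2 P F0 xi -> mckean_vlasov P T F0 B b0 b1 xi (X xi).
Variables (mu0 : P2 R d) (xi : Om -> V).
Hypothesis lxi : L2 P F0 xi.
Hypothesis hxi : forall A, measurable A -> P (xi @^-1` A) = mu0 A.

Local Notation law := (law P).
Local Notation N := (fun eta : Om -> 'rV[R]_d => nrm P eta).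
Local Notation ok := (@L2 R disp Om P F0 1 d).
Let Fm := F0_measurable F0i.
Let sF := F0_sigma F0i.
Let val (eta : Om -> V) := phi (law (X eta T)).
Local Notation f := (value_incr P T phi X xi).

Let L2F eta : ok eta -> measurable_wrt F0 eta /\ L2v P eta.
Proof. by move=> /(L2_L2v _ _ Fm). Qed.

Let F2L eta : measurable_wrt F0 eta -> L2v P eta -> ok eta.
Proof. by move=> ? ?; apply/(L2_L2v _ _ Fm). Qed.

Lemma W2_add eta : ok eta -> W2 (law (fun w => xi w + eta w)) mu0 <= nrm P eta.
Proof.
move=> le; have sx := (L2F (L2_add F0i lxi le)).2; have sxi := (L2F lxi).2.
have mXY := measurable_fun_pair sx.1 sxi.1.
have [sd nd] := pair_L2v mXY sx sxi.
have cp : coupling (law (fun w => xi w + eta w)) mu0 (pushP P mXY).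
  by apply: pair_coupling => A mA; [exact: lawE|exact: esym (hxi mA)].
apply: (le_trans (W2_le cp sd)); rewrite nd (_ : (fun w => _) = eta)//.
by apply/funext => w; rewrite addrC addKr.
Qed.

Let q n (z : V) : V := grid_point n (grid_code n z).
Let del n : R := d%:R * 2^-1 ^+ n.

Let q_close n z : enorm (q n z - z) <= del n.
Proof.
apply: (le_trans (enorm_le_sum _)); rewrite /del mulr_natl -[d in leRHS]card_ord -sumr_const.
by apply: ler_sum => j _; rewrite mxE mxE; exact: grid_close.
Qed.

Let del0 n : 0 <= del n.
Proof. by rewrite mulr_ge0// exprn_ge0// invr_ge0. Qed.

Let del_small e : 0 < e -> exists n, del n <= e.
Proof.
move=> e0; have h : (fun n => d%:R * 2^-1 ^+ n : R) @ \oo --> (d%:R * 0 : R).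
  by apply: cvgMl_tmp; apply: cvg_expr; rewrite ger0_norm ?invr_ge0// invf_lt1// ltr1n.
move: h => /cvgrPdist_le /(_ _ e0)[n _ /(_ n (leqnn n))]; rewrite /= mulr0 sub0r normrN => h.
by exists n; apply: le_trans h; exact: ler_norm.
Qed.

Let mq n : measurable_fun setT (q n). Proof. exact: grid_measurable. Qed.

Let q_L2v {disp'} {Om' : measurableType disp'} (Q : probability Om' R) n (Y : Om' -> V) : L2v Q Y -> L2v Q (fun w => q n (Y w)).
Proof.
move=> sY; apply: (@L2v_le _ _ _ _ _ _ (fun w => enorm (Y w) + del n)).
- exact: measurableT_comp (@mq n) sY.1.
- by move=> w; have := enormD (q n (Y w) - Y w) (Y w); rewrite subrK => /le_trans; apply; rewrite addrC lerD2l.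
- by apply: sqiD; [exact: L2v_sqi|exact: sqi_cst].
Qed.

Let q_nrm n (Y : Om -> V) : L2v P Y -> nrm P (fun w => q n (Y w) - Y w) <= del n.
Proof.
move=> sY; apply: nrm_le => //; rewrite -[leRHS](Ex_cst P); apply: Ex_le.
- exact: (L2vB (q_L2v n sY) sY).2.
- exact: intg_cst.
- by move=> w; rewrite lerXn2r ?nnegrE ?enorm_ge0.
Qed.

Lemma val_cts eta e : ok eta -> 0 < e -> exists2 r, 0 < r & forall eta', ok eta' ->
  nrm P (fun w => eta' w - eta w) <= r -> `|val eta' - val eta| <= e.
Proof.
move=> le e0; have [C C0 hC] := flow_lip T0 BM F0i B_b0 B_b1 X_solution.
have se := flow_L2v T0 BM F0i X_solution le.
have [r r0 hr] := phi_cts A2_C1 A2_mu A2_x se e0.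
have C1 : 0 < C + 1 by rewrite ltr_wpDl.
exists (r / (C + 1)) => [|eta' le' h]; first by rewrite divr_gt0.
apply: (hr _ (flow_L2v T0 BM F0i X_solution le')); apply: (le_trans (hC _ _ le le')).
apply: (@le_trans _ _ ((C + 1) * (r / (C + 1)))); last by rewrite mulrC divfK// gt_eqF.
by apply: ler_pM => //; [exact: nrm_ge0|rewrite lerDl].
Qed.

(** A near-optimal coupling of the law of [xi1] with [mu0] is quantized and realized over the given
    [xi]. The partner [xi'] has the law of the quantized [xi1], so its value is close to that of
    [xi1]. An optimal coupling is not at hand, whence the radius [r' > r]. *)
Lemma ball_value_le xi1 r r' e : ok xi1 -> W2 (law xi1) mu0 <= r -> r < r' -> 0 < e ->
  exists eta, [/\ ok eta, nrm P eta <= r' & val xi1 <= val (fun w => xi w + eta w) + e].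
Proof.
move=> l1 W1 rr' e0; have [m1 s1] := L2F l1; have [mxi sxi] := L2F lxi.
(* One [c] for the near-optimality of the coupling, two for quantizing its components, one for the
   distance from [xi] to its quantization. *)
pose c := (r' - r) / 4; have c0 : 0 < c by rewrite divr_gt0// subr_gt0.
have mXY := measurable_fun_pair s1.1 sxi.1; have [sd0 _] := pair_L2v mXY s1 sxi.
have cp0 : coupling (law xi1) mu0 (pushP P mXY).
  by apply: pair_coupling => A mA; [exact: lawE|exact: esym (hxi mA)].
have [pi [cp sd npi]] := W2_coupling c0 cp0 sd0.
have [rv rv0 hrv] := val_cts l1 e0.
have m0 : 0 < Num.min c rv by rewrite lt_min c0.
have [n] := del_small m0; rewrite le_min => /andP[nc nrv].
have xx A : measurable A -> P (xi @^-1` A) = pi (@snd V V @^-1` A).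
  move=> mA; have [_ h] := cp A mA; rewrite hxi// -h; congr (pi _).
  by apply/seteqP; split=> z //= [].
have yy A : measurable A -> P (xi1 @^-1` A) = pi (@fst V V @^-1` A).
  move=> mA; have [h _] := cp A mA; rewrite -lawE// -h; congr (pi _).
  by apply/seteqP; split=> z //= [].
have [xi' [mxi' hS]] := coupling_realized sF Fm (F0_atomless F0i) n mxi measurable_snd measurable_fst xx.
have mxi'' := mw_meas Fm mxi'.
have mq1 : measurable_fun setT (fun w => q n (xi1 w)) by exact: measurableT_comp (@mq n) s1.1.
have mqx : measurable_fun setT (fun w => q n (xi w)) by exact: measurableT_comp (@mq n) sxi.1.
have same A : measurable A -> P (xi' @^-1` A) = P ((fun w => q n (xi1 w)) @^-1` A).
  move=> mA; have mA' : measurable (q n @^-1` A) by rewrite -[_ @^-1` _]setTI; exact: mq.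
  by rewrite -[RHS]/(P (xi1 @^-1` (q n @^-1` A))) (yy _ mA'); exact: (hS [set z | A z.2]).
have sq1 := q_L2v n s1; have sqx := q_L2v n sxi.
have mf : measurable_fun setT (fun x : V => enorm x ^+ 2) by apply: measurable_funX; exact: measurable_enorm.
have sxi' : L2v P xi' by split=> //; exact: (same_law_Ex mxi'' mq1 mf same sq1.2).1.
have lxi' := F2L mxi' sxi'.
have lq1 : ok (fun w => q n (xi1 w)) by apply: F2L => //; exact: (mw_comp sF (@mq n) m1).
have mfst : measurable_fun setT (@fst V V) by exact: measurable_fst.
have msnd : measurable_fun setT (@snd V V) by exact: measurable_snd.
have dE (z : V * V) : q n z.1 - q n z.2 = (z.1 - z.2) + ((q n z.1 - z.1) - (q n z.2 - z.2)).
  by rewrite -[in RHS]opprB; apply/rowP => i; rewrite !mxE; ring.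
have dle (z : V * V) : enorm (q n z.1 - q n z.2) <= enorm (z.1 - z.2) + 2 * del n.
  rewrite dE; apply: (le_trans (enormD _ _)); rewrite lerD2l; apply: (le_trans (enormD _ _)).
  by rewrite enormN mulr2n mulrDl mul1r; apply: lerD; exact: q_close.
have mdq : measurable_fun setT (fun z : V * V => q n z.1 - q n z.2).
  by apply: measurable_rowB; [exact: measurableT_comp (@mq n) mfst|exact: measurableT_comp (@mq n) msnd].
have sbd : sqi pi (fun z : V * V => enorm (z.1 - z.2) + 2 * del n).
  by apply: sqiD; [exact: L2v_sqi|exact: sqi_cst].
have sdq : L2v pi (fun z : V * V => q n z.1 - q n z.2) by exact: L2v_le mdq dle sbd.
have ndq : nrm pi (fun z : V * V => q n z.1 - q n z.2) <= nrm pi (fun z : V * V => z.1 - z.2) + 2 * del n.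
  have mr (p : V * V -> V) : measurable_fun setT p -> measurable_fun setT (fun z => q n (p z) - p z).
    by move=> mp; apply: measurable_rowB => //; exact: measurableT_comp (@mq n) mp.
  have brest (z : V * V) : enorm ((q n z.1 - z.1) - (q n z.2 - z.2)) <= 2 * del n.
    apply: (le_trans (enormD _ _)); rewrite enormN mulr2n mulrDl mul1r; apply: lerD; exact: q_close.
  have srest : L2v pi (fun z : V * V => (q n z.1 - z.1) - (q n z.2 - z.2)).
    apply: (L2v_le _ brest (sqi_cst pi _)); apply: measurable_rowB; exact: mr.
  have nrest : nrm pi (fun z : V * V => (q n z.1 - z.1) - (q n z.2 - z.2)) <= 2 * del n.
    have d2 : 0 <= 2 * del n by rewrite mulr_ge0.
    apply: nrm_le => //; rewrite -[leRHS](Ex_cst pi); apply: Ex_le.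
    - exact: srest.2.
    - exact: intg_cst.
    - by move=> z; rewrite lerXn2r ?nnegrE ?enorm_ge0.
  rewrite (_ : (fun z : V * V => q n z.1 - q n z.2) = fun z => (z.1 - z.2) + ((q n z.1 - z.1) - (q n z.2 - z.2))); last first.
    by apply/funext => z; exact: dE.
  by apply: (le_trans (nrmD sd srest)); rewrite lerD2l.
have npair : nrm P (fun w => xi' w - q n (xi w)) = nrm pi (fun z : V * V => q n z.1 - q n z.2).
  have mp : measurable_fun setT (fun w => (q n (xi w), xi' w)) by exact: measurable_fun_pair.
  have mp' : measurable_fun setT (fun z : V * V => (q n z.2, q n z.1)).
    by apply: measurable_fun_pair; [exact: measurableT_comp (@mq n) msnd|exact: measurableT_comp (@mq n) mfst].
  have mg : measurable_fun setT (fun z : V * V => enorm (z.2 - z.1) ^+ 2).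
    by apply: measurable_funX; apply: measurable_enormf; exact: measurable_rowB.
  by rewrite /nrm /nrm2 (same_law_Ex mp mp' mg (fun A _ => hS A) sdq.2).2.
pose eta w := xi' w - xi w.
have le : ok eta.
  rewrite (_ : eta = fun w => xi' w + (-1) *: xi w); first exact: (L2_addZ F0i (-1) lxi' lxi).
  by apply/funext => w; rewrite scaleN1r.
have xe : (fun w => xi w + eta w) = xi' by apply/funext => w; rewrite /eta addrC subrK.
exists eta; split=> //.
  apply: (le_trans (nrm_triangle sxi' sqx sxi)); rewrite npair.
  apply: (le_trans (lerD (le_trans ndq (lerD (le_trans npi (lerD W1 (lexx c))) (lexx _))) (q_nrm n sxi))).
  apply: (@le_trans _ _ (r + c + 2 * c + c)).
    by apply: lerD => //; apply: lerD => //; rewrite ler_wpM2l.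
  by rewrite /c le_eqVlt; apply/orP; left; apply/eqP; field.
rewrite xe; have -> : val xi' = val (fun w => q n (xi1 w)).
  exact: (flow_law T0 BM F0i A2_C1 A2_mu A2_x B_b0 B_b1 X_solution lxi' lq1 same).
have := hrv _ lq1 (le_trans (q_nrm n s1) nrv).
by rewrite ler_norml => /andP[+ _]; rewrite lerNl opprB lerBlDl.
Qed.

Let v := val xi.
Let DROf := DRO P T F0 X phi mu0.

Let dro_le r r' c : r < r' -> (forall eta, ok eta -> nrm P eta <= r' -> val (fun w => xi w + eta w) <= c) ->
  (DROf r <= c%:E)%E.
Proof.
move=> rr' h; apply: ge_ereal_sup => _ [mu1 [W1 [xi1 [l1 lmu ->]]]].
have W1' : W2 (law xi1) mu0 <= r by rewrite lmu.
rewrite lee_fin; apply/ler_addgt0Pr => e e0.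
have [eta [le ne hv]] := ball_value_le l1 W1' rr' e0.
by apply: (le_trans hv); rewrite lerD2r; exact: h.
Qed.

Let dro_ge r eta : ok eta -> nrm P eta <= r -> ((val (fun w => xi w + eta w))%:E <= DROf r)%E.
Proof.
move=> le nr; apply: ereal_sup_ubound; exists (law (fun w => xi w + eta w)).
split; first exact: le_trans (W2_add le) nr.
by exists (fun w => xi w + eta w); split=> //; exact: (L2_add F0i lxi le).
Qed.

Let l0 : ok (fun=> 0 : V).
Proof. by apply: F2L; [exact: (mw_cst sF (0 : V))|exact: L2v_cst]. Qed.

Let n0 : nrm P (fun=> 0 : V) = 0.
Proof. by rewrite /nrm /nrm2; under eq_fun do rewrite enorm0 expr0n/=; rewrite Ex_cst sqrtr0. Qed.

(** The value at a law at distance [0] from [mu0] is matched, up to [e], by perturbations of [xi] of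
    arbitrarily small norm, and continuity of [val] concludes. *)
Let dro0 : DROf 0 = v%:E.
Proof.
apply/eqP; rewrite eq_le; apply/andP; split; last first.
  have := dro_ge l0 (ltac:(by rewrite n0) : nrm P (fun=> 0 : V) <= 0).
  by rewrite (_ : (fun w => xi w + 0) = xi)//; apply/funext => w; rewrite addr0.
apply/lee_addgt0Pr => e e0; have [r r0 hr] := val_cts lxi e0.
rewrite -EFinD; apply: (dro_le r0) => eta le nr.
have := hr _ (L2_add F0i lxi le); rewrite (_ : (fun w => xi w + eta w - xi w) = eta); last first.
  by apply/funext => w; rewrite addrC addKr.
by move=> /(_ nr); rewrite ler_norml => /andP[_]; rewrite lerBlDl.
Qed.

Let dro_near l e : slope ok N f l -> 0 < e -> \forall h \near 0^'+, exists2 y, DROf h = y%:E & `|(y - v) * h^-1 - l| <= 2 * e.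
Proof.
move=> sl e0; have [r0 r00 hr] := sl e e0.
(* Leaves room for the enlarged radius [h'], at most [2 h]. *)
exists (r0 / 2) => /=; first by rewrite divr_gt0.
move=> h; rewrite /ball/= sub0r normrN => hh h0; rewrite gtr0_norm// in hh.
have l0' := normr_ge0 l.
(* Relative enlargement of the radius required by [ball_value_le]; its cost [(l + e) * k] is at most
   [e]. *)
pose k := e / (`|l| + 2 * e); have kden : 0 < `|l| + 2 * e by rewrite ltr_wpDl// mulr_gt0.
have k0 : 0 < k by rewrite divr_gt0.
have k1 : k <= 1 by rewrite ler_pdivrMr// mul1r; lra.
have kE : k * (`|l| + 2 * e) = e by rewrite divfK// gt_eqF.
pose h' := h * (1 + k).
have hh' : h < h' by rewrite ltr_pMr// ltrDl.
have h'r : 0 < h' <= r0.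
  rewrite (lt_trans h0 hh')/= (le_trans (_ : h' <= h * 2))//; last by lra.
  by rewrite ler_pM2l//; lra.
have hr' : 0 < h <= r0 by rewrite h0/=; lra.
have [up _] := hr h' h'r; have [_ [eta [le ne lo]]] := hr h hr'.
have fE x : f x = val (fun w => xi w + x w) - v by [].
have up2 : (DROf h <= (v + (l + 2 * e) * h)%:E)%E.
  apply: (dro_le hh') => x okx nx; have := up x okx nx; rewrite fE lerBlDl => /le_trans; apply.
  have hk : (l + e) * k <= e by rewrite -[leRHS]kE mulrC ler_pM2l//; have := ler_norm l; lra.
  have -> : (l + e) * h' = (l + e + (l + e) * k) * h by rewrite /h'; ring.
  by rewrite lerD2l ler_pM2r//; lra.
have lo2 : ((v + (l - e) * h)%:E <= DROf h)%E.
  apply: le_trans (dro_ge le ne); rewrite lee_fin; move: lo; rewrite fE; lra.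
move: up2 lo2; case: (DROf h) => [y||]//; rewrite !lee_fin => a1 a2.
exists y => //; rewrite ler_norml; apply/andP; split.
  by rewrite lerBrDl ler_pdivlMr//; have := mulr_gt0 e0 h0; nra.
by rewrite lerBlDl ler_pdivrMr//; lra.
Qed.

Lemma dro_derivative l : slope ok N f l -> right_derivative DROf 0 l.
Proof.
move=> sl; split; first by rewrite dro0.
rewrite dro0; apply/fine_cvgP; split.
  by apply: filterS (dro_near sl ltr01) => h [y hy _]; rewrite add0r hy.
apply/cvgrPdist_le => e e0; have e2 : 0 < e / 2 by rewrite divr_gt0.
apply: filterS (dro_near sl e2) => h [y hy]; rewrite /= add0r hy/= distrC.
by rewrite (_ : 2 * (e / 2) = e)//; field.
Qed.

Local Notation G := (terminal_gradient P T gphi X xi).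
Local Notation p := (linear_incr P T gphi X xi).

Lemma value_slope : exists l, slope ok N f l.
Proof.
have [C C0 hC] := linear_incr_bound T0 BM F0i A2_x B_b0 B_b1 X_solution lxi.
apply: (@slope_exists _ _ ok N (fun t eta w => t *: eta w) (fun=> 0) _ _ _ l0 n0 f p C).
- by move=> t x; exact: L2_scale F0i _ _.
- by move=> t x t0 /L2F[_ sx]; rewrite nrmZ// ger0_norm.
- by move=> t x t0; apply/funext => w; rewrite scalerA divff ?scale1r// gt_eqF.
- by move=> e e0; exact: (value_linear T0 BM F0i A2_C1 A2_mu A2_x B_b0 B_b1 X_solution lxi e0).
- by move=> e e0; exact: (linear_incr_hom T0 BM F0i A2_x B_b0 B_b1 X_solution lxi e0).
- exact: hC.
- exact: C0.
- by move=> x; exact: nrm_ge0.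
Qed.

(** A Gateaux derivative controls [p (t eta) / t] only as [t] tends to [0] for fixed [eta];
    homogeneity is uniform in [eta] and carries this back to [t = 1], as in a Frechet derivative.
    The slope of [eta |-> E (eta . Z)] is the norm of [Z] by Cauchy-Schwarz. *)
Lemma adjoint_slope (D Dadj : (Om -> V) -> (Om -> V)) :
  gateaux_derivative P F0 (filtration F0 B T) (fun eta => X eta T) xi D ->
  adjoint P F0 (filtration F0 B T) D Dadj ->
  L2v P (Dadj G) /\ slope ok N f (nrm P (Dadj G)).
Proof.
move=> [[bD _ _] hD] [[bA _ _] hA].
have lG := terminal_gradient_L2 T0 BM F0i A2_x X_solution lxi.
have FT := filtration_measurable BM F0i (lexx T).
have sG := (iffLR (L2_L2v _ _ FT) lG).2.
have lZ : ok (Dadj G) := bA _ lG; have [mZ sZ] := L2F lZ; set Z := Dadj G in lZ mZ sZ *.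
split=> //.
have pZ e : 0 < e -> exists2 r, 0 < r & forall eta, ok eta -> nrm P eta <= r ->
    `|p eta - Ex P (fun w => edot (eta w) (Z w))| <= e * nrm P eta.
  move=> e0; have [r r0 hr] := linear_incr_hom T0 BM F0i A2_x B_b0 B_b1 X_solution lxi e0.
  exists r => // eta le nr.
  have -> : Ex P (fun w => edot (eta w) (Z w)) = Ex P (fun w => edot (D eta w) (G w)) := esym (hA _ _ le lG).
  have sD := (iffLR (L2_L2v _ _ FT) (bD _ le)).2.
  apply/ler_addgt0Pr => k k0.
  have N0 := nrm_ge0 P G; have k1 : 0 < k / (nrm P G + 1) by rewrite divr_gt0// ltr_wpDl.
  have /nbhs_ballP[s /= s0 hs] : nbhs (0 : R) (fun t : R => t != 0 ->
      (norm2 P (fun w => t^-1 *: (X (fun w => xi w + t *: eta w) T w - X xi T w) - D eta w)%R <= (k / (nrm P G + 1))%:E)%E).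
    exact: (@ereal_cvg0_near R R (0^')%classic _ _ _ (hD _ le) k1).
  (* [t] may depend on [eta]: the homogeneity error, once divided by [t], no longer involves it. *)
  pose t := Num.min (s / 2) 1; have t0 : 0 < t by rewrite lt_min ltr01 andbT divr_gt0.
  have t1 : t <= 1 by rewrite ge_min lexx orbT.
  have ts : ball (0 : R) s t.
    by rewrite /ball/= sub0r normrN gtr0_norm// gt_min; apply/orP; left; lra.
  have tn0 : t != 0 by rewrite gt_eqF.
  have {hs} := hs t ts tn0 => /=.
  have lt := L2_scale F0i t le.
  have si : L2v P (fun w => X (fun w => xi w + t *: eta w) T w - X xi T w).
    by apply: L2vB; [exact: (flow_L2v T0 BM F0i X_solution (L2_add F0i lxi lt))|exact: (flow_L2v T0 BM F0i X_solution lxi)].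
  have sW := L2vB (L2vZ t^-1 si) sD.
  rewrite (norm2E sW) lee_fin => nW.
  have i1 := edot_intg sG si; have i2 := edot_intg sG sD.
  have E1 : t^-1 * p (fun w => t *: eta w) - Ex P (fun w => edot (D eta w) (G w)) =
      Ex P (fun w => edot (G w) (t^-1 *: (X (fun w => xi w + t *: eta w) T w - X xi T w) - D eta w)).
    rewrite (_ : (fun w => edot (D eta w) (G w)) = fun w => edot (G w) (D eta w)); last by apply/funext => w; exact: edotC.
    rewrite /linear_incr -(ExZ t^-1 i1) -(ExB (intgZ t^-1 i1) i2); congr Ex; apply/funext => w.
    by rewrite (edotBr (G w) (t^-1 *: _) (D eta w)) edotZr.
  have b1' : `|t^-1 * p (fun w => t *: eta w) - Ex P (fun w => edot (D eta w) (G w))| <= k.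
    rewrite E1; apply: (le_trans (Ex_edot_le sG sW)); apply: (le_trans (ler_wpM2l N0 nW)).
    by rewrite mulrCA ger_pMr// ler_pdivrMr ?ltr_wpDl// mul1r lerDl.
  have b2' : `|p eta - t^-1 * p (fun w => t *: eta w)| <= e * nrm P eta.
    have t01 : 0 <= t <= 1 by rewrite ltW.
    have := hr _ _ le nr t01; set a := p _; set c := p eta => hac.
    have -> : c - t^-1 * a = - (t^-1 * (a - t * c)) by rewrite mulrBr mulKf// opprB.
    rewrite normrN normrM gtr0_norm ?invr_gt0// mulrC ler_pdivrMr// mulrAC; move: hac; by rewrite mulrAC.
  have := ler_normD (p eta - t^-1 * p (fun w => t *: eta w)) (t^-1 * p (fun w => t *: eta w) - Ex P (fun w => edot (D eta w) (G w))).
  by rewrite subrKA => /le_trans; apply; exact: lerD.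
move=> e e0; have e2 : 0 < e / 2 by rewrite divr_gt0.
have [r1 r10 h1] := pZ _ e2.
have [r2 r20 h2] := value_linear T0 BM F0i A2_C1 A2_mu A2_x B_b0 B_b1 X_solution lxi e2.
have fZ eta : ok eta -> nrm P eta <= Num.min r1 r2 -> `|f eta - Ex P (fun w => edot (eta w) (Z w))| <= e * nrm P eta.
  move=> le; rewrite le_min => /andP[n1 n2].
  have := ler_normD (f eta - p eta) (p eta - Ex P (fun w => edot (eta w) (Z w))); rewrite subrKA => /le_trans; apply.
  by apply: (le_trans (lerD (h2 _ le n2) (h1 _ le n1))); rewrite -mulrDl -splitr.
exists (Num.min r1 r2) => [|r /andP[r0 rr]]; first by rewrite lt_min r10.
split=> [eta le nr|].
  have := fZ eta le (le_trans nr rr); rewrite ler_norml => /andP[_]; rewrite lerBlDl => /le_trans; apply.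
  have a1 := le_trans (ler_norm _) (Ex_edot_le (L2F le).2 sZ).
  rewrite mulrDl; apply: lerD; last by rewrite ler_pM2l.
  by apply: (le_trans a1); rewrite mulrC ler_wpM2l ?nrm_ge0.
(* With slope [0] there is no direction to follow, and the null perturbation is a near-maximizer. *)
have [Z0|Z0] := eqVneq (nrm P Z) 0.
  exists (fun=> 0); rewrite n0 Z0; split; [exact: l0|exact: ltW|].
  have m0 : nrm P (fun=> 0 : V) <= Num.min r1 r2 by rewrite n0 (le_trans (ltW r0)).
  have := fZ _ l0 m0; rewrite n0 mulr0 normr_le0 subr_eq0 => /eqP ->.
  have -> : (fun w => edot (0 : V) (Z w)) = fun=> 0.
    by apply/funext => w; rewrite -(scale0r (0 : V)) edotZl mul0r.
  by rewrite Ex_cst sub0r mulNr oppr_le0 mulr_ge0// ltW.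
have Zp : 0 < nrm P Z by rewrite lt_neqAle eq_sym Z0 nrm_ge0.
(* The multiple of [Z] of norm [r] gives equality in Cauchy-Schwarz. *)
pose c := r / nrm P Z; have c0 : 0 <= c by rewrite divr_ge0// ltW.
have lc : ok (fun w => c *: Z w) := L2_scale F0i c lZ.
have nc : nrm P (fun w => c *: Z w) = r by rewrite nrmZ// ger0_norm// divfK.
exists (fun w => c *: Z w); split=> //; first by rewrite nc.
have mc : nrm P (fun w => c *: Z w) <= Num.min r1 r2 by rewrite nc.
have := fZ _ lc mc; rewrite nc.
have -> : Ex P (fun w => edot (c *: Z w) (Z w)) = nrm P Z * r.
  rewrite (_ : (fun w => _) = fun w => c * enorm (Z w) ^+ 2); last first.
    by apply/funext => w; rewrite edotZl edot_sqr.
  by rewrite (ExZ c sZ.2) -/(nrm2 P Z) -nrm_sqr /c expr2 mulrA divfK// mulrC.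
by rewrite ler_norml => /andP[h _]; rewrite mulrBl; move: h; lra.
Qed.

End dro.

Theorem theorem3p8 (R : realType) (d m : nat) (T : R) (T_gt0 : 0 < T)
  (disp : measure_display) (Om : measurableType disp) (P : probability Om R)
  (P_complete : measure_is_complete P)
  (F0 : set (set Om)) (B : R -> Om -> 'rV[R]_m)
  (B_brownian : brownian_motion P T B)
  (F0_initial : initial_sigma_algebra P T F0 B)
  (phi : P2 R d -> R) (gphi : P2 R d -> 'rV[R]_d -> 'rV[R]_d)
  (b0 : 'rV[R]_d -> P2 R d -> 'rV[R]_d)
  (b1 : 'rV[R]_d -> P2 R d -> 'M[R]_(d, m))
  (X : (Om -> 'rV[R]_d) -> R -> Om -> 'rV[R]_d)
  (A1 : exists2 C : R, 0 < C &
    forall mu, `|phi mu| <= C * (1 + P2_norm mu ^+ 2))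
  (A2_C1 : L_derivative phi gphi)
  (A2_mu : exists2 w : R -> R, modulus w &
    forall mu mu' x, enorm (gphi mu' x - gphi mu x) <= w (W2 mu' mu))
  (A2_x : forall mu, exists2 w : R -> R, modulus w &
    forall x x', enorm (gphi mu x' - gphi mu x) <= w (enorm (x' - x)))
  (B_b0 : C11b b0) (B_b1 : C11b b1)
  (X_solution : forall xi, L2 P F0 xi ->
    mckean_vlasov P T F0 B b0 b1 xi (X xi)) :
  forall mu0 : P2 R d, exists l : R,
    right_derivative (DRO P T F0 X phi mu0) 0 l /\
    forall xi, L2 P F0 xi -> law P xi = mu0 ->
    forall D Dadj : (Om -> 'rV[R]_d) -> (Om -> 'rV[R]_d),
      gateaux_derivative P F0 (filtration F0 B T) (fun eta => X eta T) xi D ->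
      adjoint P F0 (filtration F0 B T) D Dadj ->
      l%:E = norm2 P (Dadj (fun w => gphi (law P (X xi T)) (X xi T w))).
Proof.
move=> mu0; have F0s := F0_sigma F0_initial; have F0m := F0_measurable F0_initial.
(* The derivative must exist before any [xi] is given, so a representative of [mu0] is constructed;
   its law agrees with [mu0] on measurable sets. *)
have [xi0 [mxi0 sxi0 hxi0]] := law_realized F0s F0m (F0_atomless F0_initial) mu0.
have lxi0 : L2 P F0 xi0 by apply/(L2_L2v _ _ F0m).
have [l sl] := value_slope T_gt0 B_brownian F0_initial A2_C1 A2_mu A2_x B_b0 B_b1 X_solution lxi0.
have dl := dro_derivative T_gt0 B_brownian F0_initial A2_C1 A2_mu A2_x B_b0 B_b1 X_solution lxi0 hxi0 sl.
exists l; split=> // xi lxi law_xi D Dadj hD hDadj.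
have hxi A : measurable A -> P (xi @^-1` A) = mu0 A.
  move=> mA; rewrite -law_xi lawE//.
  exact: ((iffLR (L2_L2v _ _ F0m)) lxi).2.
have [sZ slZ] := adjoint_slope T_gt0 B_brownian F0_initial A2_C1 A2_mu A2_x B_b0 B_b1 X_solution lxi hD hDadj.
have dZ := dro_derivative T_gt0 B_brownian F0_initial A2_C1 A2_mu A2_x B_b0 B_b1 X_solution lxi hxi slZ.
(* The robust value does not refer to the representative: the slopes computed from [xi0] and from
   [xi] are limits of the same quotient. *)
rewrite (norm2E sZ); exact: (cvg_unique (@ereal_hausdorff R) dl.2 dZ.2).
Qed.
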